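(* Suppose that the regularity conditions (R) of the context hold for all candidate coefficients $c_{m_1}$, $m_1\in\mathfrak M_1$, and $a_{m_2}$, $m_2\in\mathfrak M_2$, and let $m_1^\ast\in\mathfrak M_1^\ast$ and $m_2^\ast\in\mathfrak M_2^\ast$. Let $$\mathrm{GQBIC}_{1,n}^{(m_1)}:=-2\mathbb H_{1,n}^{(m_1)}(\hat\gamma_{m_1,n})+\frac{p_{\gamma_{m_1}}}h\log T_n,\qquad\mathrm{GQBIC}_{2,n}^{(m_2|m_1)}:=-2\mathbb H_{2,n}^{(m_2|m_1)}(\hat\alpha_{m_2,n})+p_{\alpha_{m_2}}\log T_n,$$ and $\{\hat m_{1,n}\}=\mathrm{argmin}_{1\le m_1\le M_1}\mathrm{GQBIC}_{1,n}^{(m_1)}$. 1. (i) Let $m_1\in\mathfrak M_1\setminus\{m_1^\ast\}$. If $\Theta_{\gamma_{m_1^\ast}}$ is nested in $\Theta_{\gamma_{m_1}}$, then $\lim_{n\to\infty}P(\mathrm{GQBIC}_{1,n}^{(m_1^\ast)}<\mathrm{GQBIC}_{1,n}^{(m_1)})=1$. (ii) If $m_1\in\{1,\dots,M_1\}\setminus\mathfrak M_1$, then $\lim_{n\to\infty}P(\mathrm{GQBIC}_{1,n}^{(m_1^\ast)}<\mathrm{GQBIC}_{1,n}^{(m_1)})=1$. 2. (i) Let $m_2\in\mathfrak M_2\setminus\{m_2^\ast\}$. If $\Theta_{\alpha_{m_2^\ast}}$ is nested in $\Theta_{\alpha_{m_2}}$, then $\lim_{n\to\infty}P(\mathrm{GQBIC}_{2,n}^{(m_2^\ast|\hat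 m_{1,n})}<\mathrm{GQBIC}_{2,n}^{(m_2|\hat m_{1,n})})=1$. (ii) If $m_2\in\{1,\dots,M_2\}\setminus\mathfrak M_2$, then $\lim_{n\to\infty}P(\mathrm{GQBIC}_{2,n}^{(m_2^\ast|\hat m_{1,n})}<\mathrm{GQBIC}_{2,n}^{(m_2|\hat m_{1,n})})=1$.
   Context: Model and data. $Z$ is an $r$-dimensional L\'evy process with L\'evy measure $\nu$, independent of $X_0$; the $d$-dimensional process $X$ solves $dX_t=A(X_t)dt+C(X_{t-})dZ_t$. We observe $\mathbf X_n=(X_{t_j})_{j=0}^n$, $t_j=jh$, $h=h_n>0$, with $T_n:=nh\to\infty$ and $nh^2\to0$. Candidate scale coefficients $c_{m_1}(x,\gamma_{m_1})$, $\gamma_{m_1}\in\Theta_{\gamma_{m_1}}\subset\mathbb R^{p_{\gamma_{m_1}}}$, $m_1=1,\dots,M_1$, and drift coefficients $a_{m_2}(x,\alpha_{m_2})$, $\alpha_{m_2}\in\Theta_{\alpha_{m_2}}\subset\mathbb R^{p_{\alpha_{m_2}}}$, $m_2=1,\dots,M_2$, are given, the parameter spaces being bounded convex domains. Notation. $S(x)=C(x)C(x)^\top$; $S_{m_1}(x,\gamma)=c_{m_1}(x,\gamma)c_{m_1}(x,\gamma)^\top$; $\Delta_jX=X_{t_j}-X_{t_{j-1}}$; subscript $j-1$ means evaluation at $x=X_{t_{j-1}}$; $|B|$ is the determinant of a square matrix; $B^{\otimes2}=BB^\top$; $M[u,v]=u^\top Mv$, $M[B]=\mathrm{trace}(MB^\top)$;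 $\lesssim$ is inequality up to a universal constant. $\nu_{sts't'}(4)=\int z_sz_tz_{s'}z_{t'}\nu(dz)$. Quasi-likelihoods and estimators. $$\mathbb H_{1,n}^{(m_1)}(\gamma)=-\frac12\sum_{j=1}^n\left(\log|2\pi hS_{m_1,j-1}(\gamma)|+\frac1hS_{m_1,j-1}^{-1}(\gamma)[(\Delta_jX)^{\otimes2}]\right),\quad\hat\gamma_{m_1,n}\in\mathrm{argmax}\,\mathbb H_{1,n}^{(m_1)},$$ $$\mathbb H_{2,n}^{(m_2|m_1)}(\alpha)=\sum_{j=1}^n\left(S_{m_1,j-1}^{-1}(\hat\gamma_{m_1,n})[\Delta_jX,a_{m_2,j-1}(\alpha)]-\frac h2S_{m_1,j-1}^{-1}(\hat\gamma_{m_1,n})[a_{m_2,j-1}(\alpha)^{\otimes2}]\right),\quad\hat\alpha_{m_2,n}\in\mathrm{argmax}\,\mathbb H_{2,n}^{(m_2|m_1)}.$$ Specification sets. $\mathfrak M_1=\{m_1:\exists\gamma_{m_1,0}\in\Theta_{\gamma_{m_1}},\ c_{m_1}(\cdot,\gamma_{m_1,0})=C(\cdot)\}$, $\mathfrak M_2=\{m_2:\exists\alpha_{m_2,0}\in\Theta_{\alpha_{m_2}},\ a_{m_2}(\cdot,\alpha_{m_2,0})=A(\cdot)\}$, with $0<\sharp\mathfrak M_1<M_1$ and $0<\sharp\mathfrak M_2<M_2$; $\mathfrak M_1^\ast=\mathrm{argmin}_{m_1\in\mathfrak M_1}\dim(\Theta_{\gamma_{m_1}})$, $\mathfrak M_2^\ast=\mathrm{argmin}_{m_2\in\mathfrak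 M_2}\dim(\Theta_{\alpha_{m_2}})$. Conditions (R): for all $m_1\in\mathfrak M_1$, $m_2\in\mathfrak M_2$, with $a=a_{m_2}$, $c=c_{m_1}$, $S=S_{m_1}$, $\gamma_0=\gamma_{m_1,0}$, $\alpha_0=\alpha_{m_2,0}$, $\Theta=\Theta_{\alpha_{m_2}}\times\Theta_{\gamma_{m_1}}$: (R1) $E[Z_1]=0$, $E[Z_1^{\otimes2}]=I_r$, $E[|Z_1|^q]<\infty$ for all $q>0$. (R2) Each component $f$ of $a$ and $c$ is globally Lipschitz in $x$ uniformly in $\theta\in\overline\Theta$, 2 times continuously differentiable in $x$ and 4 times in $\theta$ with all partial derivatives continuous over $\overline\Theta$ for each $x$, and $\max_{i\le2,j\le4}\sup_{\theta\in\overline\Theta}|\partial_\theta^j\partial_x^if(x,\theta)|\lesssim1+|x|^{K}$ for some $K\ge0$; and $\sup_\gamma\lambda_{\min}\{S(x,\gamma)\}^{-1}\lesssim1+|x|^{C_0}$ for some $C_0\ge0$ ($\lambda_{\min}$ is the minimum eigenvalue). (R3) There is a probability measure $\pi$ such that for every $q>0$ there is $\mathsf a>0$ with $\sup_{t\ge0}e^{\mathsf at}\sup_{|f|\le g}|\int f(y)P_t(x,dy)-\int f\,d\pi|\lesssim g(x)$, where $g(x)=1+|x|^q$, $P_t(x,dy)=P(X_t\in dy|X_0=x)$; and $\sup_tE[|X_t|^q]<\infty$ for all $q>0$. (R4) There are $\chi_\gamma,\chi_\alpha>0$ such that for all $\gamma,\alpha$: $-\frac12\int\{\mathrm{trace}(S(x,\gamma)^{-1}S(x,\gamma_0)-I_d)+\log\frac{|S(x,\gamma)|}{|S(x,\gamma_0)|}\}\pi(dx)\le-\chi_\gamma|\gamma-\gamma_0|^2$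 and $-\frac12\int S^{-1}(x,\gamma_0)[(a(x,\alpha)-a(x,\alpha_0))^{\otimes2}]\pi(dx)\le-\chi_\alpha|\alpha-\alpha_0|^2$. (R5) $E[\mathrm{trace}(\hat\Gamma_{\gamma_{m_1},n}^{-1}\hat W_{\gamma_{m_1},n})]\to\mathrm{trace}\{\Gamma_{\gamma_{m_1}}(\gamma_{m_1,0})^{-1}W_{\gamma_{m_1}}(\gamma_{m_1,0})\}$, where, with $\Psi^{(kl),(q)}=\partial_{\gamma_q}(S_{m_1}^{-1})^{(kl)}$, $c=c_{m_1}$, $\hat S_{j-1}=S_{m_1,j-1}(\hat\gamma_{m_1,n})$ and $\hat\chi_j=\Delta_jX-ha_{m_2,j-1}(\hat\alpha_{m_2,n})$, $\Gamma_{\gamma_{m_1}}^{(kl)}(\gamma_{m_1,0})=\frac12\int\mathrm{trace}[(S_{m_1}^{-1}\partial_{\gamma_k}S_{m_1})(S_{m_1}^{-1}\partial_{\gamma_l}S_{m_1})(x,\gamma_{m_1,0})]\pi(dx)$, $W_{\gamma_{m_1}}^{(qr)}(\gamma_{m_1,0})=\frac14\sum_{k,l,k',l',s,t,s',t'}\nu_{sts't'}(4)\int(\Psi^{(kl),(q)}\Psi^{(k'l'),(r)}c^{(ks)}c^{(lt)}c^{(k's')}c^{(l't')})(x,\gamma_{m_1,0})\pi(dx)$, $\hat\Gamma_{\gamma_{m_1},n}^{(kl)}=\frac1{2n}\sum_j\mathrm{trace}[(\hat S_{j-1}^{-1}\partial_{\gamma_k}\hat S_{j-1})(\hat S_{j-1}^{-1}\partial_{\gamma_l}\hat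 S_{j-1})]$, $\hat W_{\gamma_{m_1},n}^{(qr)}=\frac1{4T_n}\sum_j\{(\hat S_{j-1}^{-1}(\partial_{\gamma_q}\hat S_{j-1})\hat S_{j-1}^{-1})[\hat\chi_j^{\otimes2}]\}\{(\hat S_{j-1}^{-1}(\partial_{\gamma_r}\hat S_{j-1})\hat S_{j-1}^{-1})[\hat\chi_j^{\otimes2}]\}$. Limits (standing framework for all candidates, including misspecified ones). Put $\mathbb H_{1,0}^{(m_1)}(\gamma)=-\frac12\int\{\mathrm{trace}(S_{m_1}(x,\gamma)^{-1}S(x))+\log|S_{m_1}(x,\gamma)|\}\pi(dx)$, $\{\gamma_{m_1}^\ast\}=\mathrm{argmax}\,\mathbb H_{1,0}^{(m_1)}$, and $\mathbb H_{2,0}^{(m_2|m_1)}(\alpha)=-\frac12\int S_{m_1}^{-1}(x,\gamma_{m_1}^\ast)[(a_{m_2}(x,\alpha)-A(x))^{\otimes2}]\pi(dx)$, $\{\alpha_{m_2}^\ast\}=\mathrm{argmax}\,\mathbb H_{2,0}^{(m_2|m_1)}$. It is supposed that, uniformly in the parameter and in probability, $\frac1n\mathbb H_{1,n}^{(m_1)}(\gamma)+\frac d2\log(2\pi h)\to\mathbb H_{1,0}^{(m_1)}(\gamma)$ and $\frac1{T_n}\mathbb H_{2,n}^{(m_2|m_1)}(\alpha)-\frac12\int S_{m_1}^{-1}(x,\gamma_{m_1}^\ast)[A(x)^{\otimes2}]\pi(dx)\to\mathbb H_{2,0}^{(m_2|m_1)}(\alpha)$, and that $\mathfrak M_1=\mathrm{argmax}_{m_1}\mathbb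 H_{1,0}^{(m_1)}(\gamma_{m_1}^\ast)$, $\mathfrak M_2=\mathrm{argmax}_{m_2}\mathbb H_{2,0}^{(m_2|m_1)}(\alpha_{m_2}^\ast)$. For $m_1\in\mathfrak M_1$, $\gamma_{m_1}^\ast=\gamma_{m_1,0}$; for $m_2\in\mathfrak M_2$, $\alpha_{m_2}^\ast=\alpha_{m_2,0}$. Nestedness. $\Theta_{\gamma_i}$ is nested in $\Theta_{\gamma_j}$ if $p_{\gamma_i}<p_{\gamma_j}$ and there are $F_1\in\mathbb R^{p_{\gamma_j}\times p_{\gamma_i}}$ with $F_1^\top F_1=I_{p_{\gamma_i}}$ and a vector $\mathsf c_1\in\mathbb R^{p_{\gamma_j}}$ such that $\mathbb H_{1,n}^{(i)}(\gamma_i)=\mathbb H_{1,n}^{(j)}(F_1\gamma_i+\mathsf c_1)$ for all $\gamma_i\in\Theta_{\gamma_i}$. Similarly $\Theta_{\alpha_i}$ is nested in $\Theta_{\alpha_j}$ if $p_{\alpha_i}<p_{\alpha_j}$ and there are $F_2$ with $F_2^\top F_2=I_{p_{\alpha_i}}$ and $\mathsf c_2$ with $\mathbb H_{2,n}^{(i|m_1)}(\alpha_i)=\mathbb H_{2,n}^{(j|m_1)}(F_2\alpha_i+\mathsf c_2)$ for all $\alpha_i\in\Theta_{\alpha_i}$. *)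

(* Defs.v *)
From HB Require Import structures.
From mathcomp Require Import all_boot all_order all_algebra.
From mathcomp Require Import all_classical all_reals all_analysis.

Set Implicit Arguments.
Unset Strict Implicit.
Unset Printing Implicit Defensive.
Import Order.TTheory GRing.Theory Num.Theory.
Import numFieldNormedType.Exports.
Local Open Scope classical_set_scope.
Local Open Scope ring_scope.

(* The sigma-algebra on real matrices generated by the entries, that is, the
   Borel sigma-algebra of R^(m x n); column vectors are the case n = 1. *)
Section matrix_measurable.
Context (R : realType) (m n : nat).

Definition mx_display : measure_display.
Proof. exact: default_measure_display. Qed.

Definition mx_cylinders : set (set 'M[R]_(m, n)) :=
  [set A | exists i j (B : set R),
     measurable B /\ A = (fun M : 'M[R]_(m, n) => M i j) @^-1` B].

HB.instance Definition _ := @isMeasurable.Build mx_display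
  'M[R]_(m, n) <<s mx_cylinders >>
  (@sigma_algebra0 _ setT mx_cylinders) (@sigma_algebraC _ mx_cylinders)
  (@sigma_algebra_bigcup _ setT mx_cylinders).

End matrix_measurable.

Section generalities.
Context (R : realType).

Definition argmax d (V : porderType d) (T : Type) (D : set T) (f : T -> V)
  : set T := [set x | D x /\ forall y, D y -> (f y <= f x)%O].

Definition argmin d (V : porderType d) (T : Type) (D : set T) (f : T -> V)
  : set T := [set x | D x /\ forall y, D y -> (f x <= f y)%O].

(* Euclidean norm; the library norm on matrices is the maximum norm *)
Definition enorm n (x : 'cV[R]_n) : R := Num.sqrt (\sum_(i < n) x i 0 ^+ 2).

(* B^{(x)2}, M[u, v] and M[B] *)
Definition otimes2 n (u : 'cV[R]_n) : 'M[R]_n := u *m u^T.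
Definition bilin n (M : 'M[R]_n) (u v : 'cV[R]_n) : R := (u^T *m M *m v) 0 0.
Definition mxdot m n (M B : 'M[R]_(m, n)) : R := \tr (M *m B^T).

Definition gram d r (c : 'M[R]_(d, r)) : 'M[R]_d := c *m c^T.

(* minimum eigenvalue (of a symmetric matrix, of positive size) *)
Definition lambda_min n (M : 'M[R]_n) : R := inf [set l | eigenvalue M l].

Definition left_limit (V : ptopologicalType) (f : R -> V) (t : R) : V :=
  lim (f s @[s --> t^'-]).

Definition cadlag (V : ptopologicalType) (f : R -> V) : Prop :=
  (forall t, 0 <= t -> f s @[s --> t^'+] --> f t) /\
  (forall t, 0 < t -> cvg (f s @[s --> t^'-])).

(* partial derivatives in the state variable, with multi-index the list [ix] *)
Definition dstate d p (ix : seq 'I_d) (f : 'cV[R]_d -> 'cV[R]_p -> R)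
  : 'cV[R]_d -> 'cV[R]_p -> R :=
  foldr (fun i g x th => 'D_(delta_mx i 0) (g ^~ th) x) f ix.

(* k-th partial derivative on the open set Th; at the other points (used on
   the boundary of Th only) it is the continuous extension from Th *)
Definition dparam1 p (Th : set 'cV[R]_p) (k : 'I_p) (f : 'cV[R]_p -> R)
  (th : 'cV[R]_p) : R :=
  if th \in Th then 'D_(delta_mx k 0) f th
  else lim ('D_(delta_mx k 0) f u @[u --> within Th (nbhs th)]).

Definition dparam d p (Th : set 'cV[R]_p) (jx : seq 'I_p)
  (f : 'cV[R]_d -> 'cV[R]_p -> R) : 'cV[R]_d -> 'cV[R]_p -> R :=
  foldr (fun j g x => dparam1 Th j (g x)) f jx.

Definition dparam_mx p m n (Th : set 'cV[R]_p) (k : 'I_p)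
  (M : 'cV[R]_p -> 'M[R]_(m, n)) (th : 'cV[R]_p) : 'M[R]_(m, n) :=
  \matrix_(i, j) dparam1 Th k (fun u => M u i j) th.

End generalities.

Section stochastic_calculus.
Context d0 (Omega : measurableType d0) (R : realType) (P : probability Omega R).

(* Y n --> 0 in probability, for Y n >= 0; the outer probability P^* agrees
   with P on events, and Y n (e.g. a supremum) need not be known measurable *)
Definition cvg0_in_prob (Y : nat -> Omega -> \bar R) : Prop :=
  forall e : R, 0 < e ->
    mu_ext P [set w | (e%:E <= Y n w)%E] @[n --> \oo] --> (0 : \bar R).

Definition filtration (F : R -> set (set Omega)) : Prop :=
  (forall t, 0 <= t -> sigma_algebra setT (F t) /\ F t `<=` measurable) /\
  (forall s t, 0 <= s -> s <= t -> F s `<=` F t).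

Definition measurable_wrt (G : set (set Omega)) m n
  (Y : Omega -> 'M[R]_(m, n)) : Prop :=
  forall B : set 'M[R]_(m, n), measurable B -> G (Y @^-1` B).

Definition adapted (F : R -> set (set Omega)) m n
  (Y : R -> Omega -> 'M[R]_(m, n)) : Prop :=
  forall t, 0 <= t -> measurable_wrt (F t) (Y t).

Section levy.
Context (r : nat) (Z : R -> Omega -> 'cV[R]_r).

Definition incr (s t : R) (B : set 'cV[R]_r) : set Omega :=
  [set w | B (Z t w - Z s w)].

Definition independent_increments : Prop :=
  forall (k : nat) (t : nat -> R) (B : nat -> set 'cV[R]_r),
    0 <= t 0%N -> (forall i, t i <= t i.+1) -> (forall i, measurable (B i)) ->
    P (\bigcap_(i in `I_k) incr (t i) (t i.+1) (B i)) =
    (\prod_(i < k) P (incr (t i) (t i.+1) (B i)))%E.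

Definition stationary_increments : Prop :=
  forall (s t : R) (B : set 'cV[R]_r), 0 <= s -> s <= t -> measurable B ->
    P (incr s t B) = P (Z (t - s) @^-1` B).

Definition levy_process : Prop :=
  [/\ forall t, 0 <= t -> measurable_fun setT (Z t),
      {ae P, forall w, Z 0 w = 0},
      independent_increments,
      stationary_increments &
      forall w, cadlag (Z ^~ w)].

Definition jump (w : Omega) (s : R) : 'cV[R]_r := Z s w - left_limit (Z ^~ w) s.

(* nu(B) is the expected number of jumps in B during the time interval ]0, 1] *)
Definition levy_measure (nu : {measure set 'cV[R]_r -> \bar R}) : Prop :=
  forall B : set 'cV[R]_r, measurable B ->
    nu B = (\int[P]_w
      counting [set s : R | [/\ (0 < s <= 1)%R, jump w s != 0%R & B (jump w s)]])%E.

Definition increments_independent_of (F : R -> set (set Omega)) : Prop :=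
  forall (s t : R) (A : set Omega) (B : set 'cV[R]_r),
    0 <= s -> s <= t -> F s A -> measurable B ->
    P (A `&` incr s t B) = (P A * P (incr s t B))%E.

Definition process_independent_of d (Y : Omega -> 'cV[R]_d) : Prop :=
  forall (k : nat) (t : 'I_k -> R) (B : 'I_k -> set 'cV[R]_r) (A : set 'cV[R]_d),
    (forall i, 0 <= t i) -> (forall i, measurable (B i)) -> measurable A ->
    P (Y @^-1` A `&` \bigcap_(i in setT) (Z (t i) @^-1` B i)) =
    (P (Y @^-1` A) * P (\bigcap_(i in setT) (Z (t i) @^-1` B i)))%E.

End levy.

(* sum_i xi_i 1_{]t_i, t_{i+1}]}, with xi_i bounded and F_{t_i}-measurable *)
Record simple_process d r := SimpleProcess {
  sp_size : nat;
  sp_time : nat -> R;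
  sp_val : nat -> Omega -> 'M[R]_(d, r) }.

Definition predictable_on d r (F : R -> set (set Omega)) (T : R)
  (H : simple_process d r) : Prop :=
  forall i, (i < sp_size H)%N ->
    [/\ 0 <= sp_time H i, sp_time H i <= sp_time H i.+1, sp_time H i.+1 <= T,
        measurable_wrt (F (sp_time H i)) (sp_val H i) &
        exists M : R, forall w, `|sp_val H i w| <= M].

Definition sp_eval d r (H : simple_process d r) (s : R) (w : Omega)
  : 'M[R]_(d, r) :=
  \sum_(i < sp_size H)
    (sp_time H i < s <= sp_time H i.+1)%R%:R *: sp_val H i w.

Definition sp_integral d r (Z : R -> Omega -> 'cV[R]_r)
  (H : simple_process d r) (w : Omega) : 'cV[R]_d :=
  \sum_(i < sp_size H)
    sp_val H i w *m (Z (sp_time H i.+1) w - Z (sp_time H i) w).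

(* J = int_0^T Phi_s dZ_s (Ito): J is the limit in probability of the integrals
   of simple predictable processes H_k such that
   int_0^T |Phi_s - H_{k,s}|^2 ds --> 0 in probability *)
Definition is_ito_integral d r (F : R -> set (set Omega))
  (Z : R -> Omega -> 'cV[R]_r) (Phi : R -> Omega -> 'M[R]_(d, r)) (T : R)
  (J : Omega -> 'cV[R]_d) : Prop :=
  exists H : nat -> simple_process d r,
    [/\ forall k, predictable_on F T (H k),
        cvg0_in_prob (fun k w => (\int[lebesgue_measure]_(s in `[0%R, T])
          (`|Phi s w - sp_eval (H k) s w| ^+ 2)%:E)%E) &
        cvg0_in_prob (fun k w => (`|J w - sp_integral Z (H k) w|)%:E)].

(* X is a solution of dX_t = A(X_t) dt + C(X_{t-}) dZ_t *)
Definition sde_solution d r (Z : R -> Omega -> 'cV[R]_r)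
  (A : 'cV[R]_d -> 'cV[R]_d) (C : 'cV[R]_d -> 'M[R]_(d, r))
  (X : R -> Omega -> 'cV[R]_d) : Prop :=
  exists F : R -> set (set Omega),
    [/\ filtration F,
        adapted F Z /\ increments_independent_of Z F,
        adapted F X,
        forall w, cadlag (X ^~ w) &
        forall t, 0 <= t ->
          is_ito_integral F Z (fun s w => C (left_limit (X ^~ w) s)) t
            (fun w => X t w - X 0 w -
               \col_i \int[lebesgue_measure]_(s in `[0, t]) A (X s w) i 0)].

(* Pt t x is the law of X_t given X_0 = x, i.e. the law at time t of the
   solution started at x *)
Definition transition_function d r (Z : R -> Omega -> 'cV[R]_r)
  (A : 'cV[R]_d -> 'cV[R]_d) (C : 'cV[R]_d -> 'M[R]_(d, r))
  (Pt : R -> 'cV[R]_d -> probability 'cV[R]_d R) : Prop :=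
  forall x, exists Y : R -> Omega -> 'cV[R]_d,
    [/\ sde_solution Z A C Y,
        {ae P, forall w, Y 0 w = x} &
        forall t (B : set 'cV[R]_d), 0 <= t -> measurable B ->
          Pt t x B = P (Y t @^-1` B)].

End stochastic_calculus.

(* A finite family of parametric coefficients R^d -> R^{k x l}, the m-th one
   having a parameter in Theta m, a subset of R^(pdim m). *)
Record candidates (R : realType) (d k l : nat) := Candidates {
  ncand : nat;
  pdim : 'I_ncand -> nat;
  Theta : forall m : 'I_ncand, set 'cV[R]_(pdim m);
  coef : forall m : 'I_ncand, 'cV[R]_d -> 'cV[R]_(pdim m) -> 'M[R]_(k, l) }.
Arguments Theta {R d k l c} m _.
Arguments coef {R d k l c} m _ _.
Arguments pdim {R d k l c} m.

Section specification.
Context (R : realType) (d k l : nat) (K : candidates R d k l).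

(* bounded convex domains, and coefficients that are Borel functions *)
Definition admissible : Prop :=
  forall m : 'I_(ncand K),
    [/\ Theta m !=set0, open (Theta m),
        convex_set (Theta m : set (convex_lmodType 'cV[R]_(pdim m))),
        bounded_set (Theta m) &
        measurable_fun (setT `*` closure (Theta m))
          (fun z : 'cV[R]_d * 'cV[R]_(pdim m) => coef m z.1 z.2)].

Definition true_value (F : 'cV[R]_d -> 'M[R]_(k, l)) (m : 'I_(ncand K))
  (th : 'cV[R]_(pdim m)) : Prop :=
  Theta m th /\ forall x, coef m x th = F x.
Arguments true_value F m th : clear implicits.

Definition specified (F : 'cV[R]_d -> 'M[R]_(k, l)) : {set 'I_(ncand K)} :=
  finset (fun m => `[< exists th, true_value F m th >]).

Definition specified_min (F : 'cV[R]_d -> 'M[R]_(k, l)) : set 'I_(ncand K) :=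
  argmin [set` specified F] (fun m => pdim m).

End specification.
Arguments true_value {R d k l K} F m th.
Arguments specified {R d k l} K F.
Arguments specified_min {R d k l} K F.

Section model.
Context d0 (Omega : measurableType d0) (R : realType) (P : probability Omega R).
Context (d r : nat) (X : R -> Omega -> 'cV[R]_d) (h : nat -> R).
Context (Sc : candidates R d d r) (Dr : candidates R d d 1).
Context (ghat : forall m1 : 'I_(ncand Sc), nat -> Omega -> 'cV[R]_(pdim m1)).
Context (ahat : forall (m2 : 'I_(ncand Dr)) (m1 : 'I_(ncand Sc)),
  nat -> Omega -> 'cV[R]_(pdim m2)).

Definition horizon (n : nat) : R := n%:R * h n.

Definition obs (n j : nat) (w : Omega) : 'cV[R]_d := X (j%:R * h n) w.
Definition dobs (n j : nat) (w : Omega) : 'cV[R]_d := obs n j w - obs n j.-1 w.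

Definition Smx (m1 : 'I_(ncand Sc)) (x : 'cV[R]_d) (g : 'cV[R]_(pdim m1))
  : 'M[R]_d := gram (coef m1 x g).
Arguments Smx : clear implicits.

(* [ln] and [invmx] are total: ln x = 0 for x <= 0, and invmx S = S for a
   singular S; the criteria have their usual meaning when S_{m1} is positive
   definite. *)
Definition H1 (m1 : 'I_(ncand Sc)) (n : nat) (w : Omega)
  (g : 'cV[R]_(pdim m1)) : R :=
  - 2^-1 * \sum_(1 <= j < n.+1)
    (ln (\det ((2 * pi * h n) *: Smx m1 (obs n j.-1 w) g)) +
     (h n)^-1 * mxdot (invmx (Smx m1 (obs n j.-1 w) g)) (otimes2 (dobs n j w))).

Definition H2 (m1 : 'I_(ncand Sc)) (m2 : 'I_(ncand Dr)) (n : nat) (w : Omega)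
  (al : 'cV[R]_(pdim m2)) : R :=
  \sum_(1 <= j < n.+1)
    (bilin (invmx (Smx m1 (obs n j.-1 w) (ghat m1 n w)))
       (dobs n j w) (coef m2 (obs n j.-1 w) al) -
     h n / 2 * mxdot (invmx (Smx m1 (obs n j.-1 w) (ghat m1 n w)))
       (otimes2 (coef m2 (obs n j.-1 w) al))).

Definition scale_estimator : Prop := forall (m1 : 'I_(ncand Sc)) n,
  measurable_fun setT (ghat m1 n) /\
  forall w, argmax (closure (Theta m1)) (H1 n w) (ghat m1 n w).

Definition drift_estimator : Prop :=
  forall (m1 : 'I_(ncand Sc)) (m2 : 'I_(ncand Dr)) n,
  measurable_fun setT (ahat m2 m1 n) /\
  forall w, argmax (closure (Theta m2)) (H2 m1 n w) (ahat m2 m1 n w).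

Definition GQBIC1 (m1 : 'I_(ncand Sc)) (n : nat) (w : Omega) : R :=
  - 2 * H1 n w (ghat m1 n w) + (pdim m1)%:R / h n * ln (horizon n).

Definition GQBIC2 (m1 : 'I_(ncand Sc)) (m2 : 'I_(ncand Dr)) (n : nat)
  (w : Omega) : R :=
  - 2 * H2 m1 n w (ahat m2 m1 n w) + (pdim m2)%:R * ln (horizon n).

(* [Hi] and [Hj] are the random criteria attached to two parameter spaces of
   dimensions p and q, the former being [Thi] *)
Definition nested (p q : nat) (Thi : set 'cV[R]_p)
  (Hi : nat -> Omega -> 'cV[R]_p -> R) (Hj : nat -> Omega -> 'cV[R]_q -> R)
  : Prop :=
  (p < q)%N /\
  exists (F : 'M[R]_(q, p)) (c : 'cV[R]_q),
    F^T *m F = 1%:M /\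
    forall n, {ae P, forall w th, Thi th -> Hi n w th = Hj n w (F *m th + c)}.

Definition nested_scale (i j : 'I_(ncand Sc)) : Prop :=
  nested (Theta i) (@H1 i) (@H1 j).

Definition nested_drift (m1 : 'I_(ncand Sc)) (i j : 'I_(ncand Dr)) : Prop :=
  nested (Theta i) (@H2 m1 i) (@H2 m1 j).

Section regularity.
Context (Z : R -> Omega -> 'cV[R]_r) (nu : {measure set 'cV[R]_r -> \bar R}).
Context (A : 'cV[R]_d -> 'cV[R]_d) (C : 'cV[R]_d -> 'M[R]_(d, r)).
Context (piX : probability 'cV[R]_d R).
Context (g0 : forall m1 : 'I_(ncand Sc), 'cV[R]_(pdim m1)).
Context (a0 : forall m2 : 'I_(ncand Dr), 'cV[R]_(pdim m2)).

Definition cond_R1 : Prop :=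
  [/\ forall i : 'I_r, ('E_P[fun w => (Z 1 w i 0)%R] = 0)%E,
      forall i j : 'I_r,
        ('E_P[fun w => (Z 1 w i 0 * Z 1 w j 0)%R] = (i == j)%:R%:E)%E &
      forall q : R, 0 < q -> ('E_P[fun w => (enorm (Z 1 w) `^ q)%R] < +oo)%E].

Definition regular p (Th : set 'cV[R]_p) (f : 'cV[R]_d -> 'cV[R]_p -> R) : Prop :=
  [/\ exists L : R, forall x y th, closure Th th ->
        `|f x th - f y th| <= L * enorm (x - y),
      forall (ix : seq 'I_d) th, closure Th th ->
        ((size ix < 2)%N -> forall x i, derivable (dstate ix f ^~ th) x (delta_mx i 0)) /\
        ((size ix <= 2)%N -> continuous (dstate ix f ^~ th)),
      forall (ix : seq 'I_d) (jx : seq 'I_p) x, (size ix <= 2)%N ->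
        ((size jx < 4)%N -> forall th j, Th th ->
           derivable (dparam Th jx (dstate ix f) x) th (delta_mx j 0)) /\
        ((size jx <= 4)%N ->
           {within closure Th, continuous (dparam Th jx (dstate ix f) x)}) &
      exists2 K : R, 0 <= K & exists B : R,
        forall (ix : seq 'I_d) (jx : seq 'I_p) x th,
          (size ix <= 2)%N -> (size jx <= 4)%N -> closure Th th ->
          `|dparam Th jx (dstate ix f) x th| <= B * (1 + enorm x `^ K)].

Definition cond_R2_scale (m1 : 'I_(ncand Sc)) : Prop :=
  (forall i j, regular (Theta m1) (fun x g => coef m1 x g i j)) /\
  exists2 C0 : R, 0 <= C0 & exists B : R,
    forall x g, closure (Theta m1) g ->
      0 < lambda_min (Smx m1 x g) /\
      (lambda_min (Smx m1 x g))^-1 <= B * (1 + enorm x `^ C0).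

Definition cond_R2_drift (m2 : 'I_(ncand Dr)) : Prop :=
  forall i, regular (Theta m2) (fun x al => coef m2 x al i 0).

(* The integrals are extended-real valued, with oo - oo = -oo: taking f = g
   shows that the bound forces g to be integrable for Pt t x and piX. *)
Definition cond_R3 : Prop :=
  (exists Pt : R -> 'cV[R]_d -> probability 'cV[R]_d R,
     transition_function P Z A C Pt /\
     forall q : R, 0 < q -> exists2 a : R, 0 < a & exists B : R,
       forall (x : 'cV[R]_d) (t : R) (f : 'cV[R]_d -> R), 0 <= t ->
         measurable_fun setT f ->
         (forall y, `|f y| <= 1 + enorm y `^ q) ->
         ((expR (a * t)%R)%:E *
          `| \int[Pt t x]_y (f y)%:E - \int[piX]_y (f y)%:E |
          <= (B * (1 + enorm x `^ q))%R%:E)%E) /\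
  (forall q : R, 0 < q -> exists B : R, forall t, 0 <= t ->
     ('E_P[fun w => (enorm (X t w) `^ q)%R] <= B%:E)%E).

Definition cond_R4_scale (m1 : 'I_(ncand Sc)) : Prop :=
  exists2 chi : R, 0 < chi & forall g, closure (Theta m1) g ->
    - 2^-1 * \int[piX]_x
      (\tr (invmx (Smx m1 x g) *m Smx m1 x (g0 m1) - 1%:M) +
       ln (\det (Smx m1 x g) / \det (Smx m1 x (g0 m1))))
    <= - chi * enorm (g - g0 m1) ^+ 2.

Definition cond_R4_drift (m1 : 'I_(ncand Sc)) (m2 : 'I_(ncand Dr)) : Prop :=
  exists2 chi : R, 0 < chi & forall al, closure (Theta m2) al ->
    - 2^-1 * \int[piX]_x
      mxdot (invmx (Smx m1 x (g0 m1)))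
            (otimes2 (coef m2 x al - coef m2 x (a0 m2)))
    <= - chi * enorm (al - a0 m2) ^+ 2.

Definition dSmx (m1 : 'I_(ncand Sc)) (k : 'I_(pdim m1)) (x : 'cV[R]_d)
  (g : 'cV[R]_(pdim m1)) : 'M[R]_d := dparam_mx (Theta m1) k (Smx m1 x) g.

Definition Gamma_integrand (m1 : 'I_(ncand Sc)) (k l : 'I_(pdim m1))
  (x : 'cV[R]_d) (g : 'cV[R]_(pdim m1)) : R :=
  \tr ((invmx (Smx m1 x g) *m dSmx k x g) *m (invmx (Smx m1 x g) *m dSmx l x g)).

Definition Gamma_gamma (m1 : 'I_(ncand Sc)) : 'M[R]_(pdim m1) :=
  \matrix_(k, l) (2^-1 * \int[piX]_x Gamma_integrand k l x (g0 m1)).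

Definition nu4 (s t s' t' : 'I_r) : R :=
  \int[nu]_z (z s 0 * z t 0 * z s' 0 * z t' 0).

Definition Psi (m1 : 'I_(ncand Sc)) (q : 'I_(pdim m1)) (x : 'cV[R]_d)
  (g : 'cV[R]_(pdim m1)) : 'M[R]_d :=
  dparam_mx (Theta m1) q (fun u => invmx (Smx m1 x u)) g.

Definition W_gamma (m1 : 'I_(ncand Sc)) : 'M[R]_(pdim m1) :=
  \matrix_(q, q') (4^-1 *
    \sum_(k < d) \sum_(l < d) \sum_(k' < d) \sum_(l' < d)
    \sum_(s < r) \sum_(t < r) \sum_(s' < r) \sum_(t' < r)
      nu4 s t s' t' * \int[piX]_x
        (Psi q x (g0 m1) k l * Psi q' x (g0 m1) k' l' *
         coef m1 x (g0 m1) k s * coef m1 x (g0 m1) l t *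
         coef m1 x (g0 m1) k' s' * coef m1 x (g0 m1) l' t')).

Definition Gamma_hat (m1 : 'I_(ncand Sc)) (n : nat) (w : Omega)
  : 'M[R]_(pdim m1) :=
  \matrix_(k, l) ((2 * n%:R)^-1 * \sum_(1 <= j < n.+1)
    Gamma_integrand k l (obs n j.-1 w) (ghat m1 n w)).

Definition residual (m1 : 'I_(ncand Sc)) (m2 : 'I_(ncand Dr)) (n j : nat)
  (w : Omega) : 'cV[R]_d :=
  dobs n j w - h n *: coef m2 (obs n j.-1 w) (ahat m2 m1 n w).

Definition W_hat_factor (m1 : 'I_(ncand Sc)) (m2 : 'I_(ncand Dr))
  (q : 'I_(pdim m1)) (n j : nat) (w : Omega) : R :=
  let S := Smx m1 (obs n j.-1 w) (ghat m1 n w) in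
  mxdot (invmx S *m dSmx q (obs n j.-1 w) (ghat m1 n w) *m invmx S)
        (otimes2 (residual m1 m2 n j w)).

Definition W_hat (m1 : 'I_(ncand Sc)) (m2 : 'I_(ncand Dr)) (n : nat)
  (w : Omega) : 'M[R]_(pdim m1) :=
  \matrix_(q, q') ((4 * horizon n)^-1 * \sum_(1 <= j < n.+1)
    (W_hat_factor m2 q n j w * W_hat_factor m2 q' n j w)).

Definition cond_R5 (m1 : 'I_(ncand Sc)) (m2 : 'I_(ncand Dr)) : Prop :=
  ('E_P[fun w => (\tr (invmx (Gamma_hat m1 n w) *m W_hat m1 m2 n w))%R])%E
    @[n --> \oo]
  --> (\tr (invmx (Gamma_gamma m1) *m W_gamma m1))%:E.

Definition cond_R : Prop :=
  [/\ cond_R1, cond_R3 &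
      forall m1 m2, m1 \in specified Sc C -> m2 \in specified Dr A ->
        [/\ cond_R2_scale m1, cond_R2_drift m2,
            cond_R4_scale m1, cond_R4_drift m1 m2 & cond_R5 m1 m2]].

End regularity.

Section limits.
Context (A : 'cV[R]_d -> 'cV[R]_d) (C : 'cV[R]_d -> 'M[R]_(d, r)).
Context (piX : probability 'cV[R]_d R).
Context (gstar : forall m1 : 'I_(ncand Sc), 'cV[R]_(pdim m1)).
(* For misspecified scale coefficients the drift optimum depends on m1. *)
Context (astar : forall (m2 : 'I_(ncand Dr)) (m1 : 'I_(ncand Sc)),
  'cV[R]_(pdim m2)).

Definition H10 (m1 : 'I_(ncand Sc)) (g : 'cV[R]_(pdim m1)) : R :=
  - 2^-1 * \int[piX]_x
    (\tr (invmx (Smx m1 x g) *m gram (C x)) + ln (\det (Smx m1 x g))).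

Definition H20 (m1 : 'I_(ncand Sc)) (m2 : 'I_(ncand Dr))
  (al : 'cV[R]_(pdim m2)) : R :=
  - 2^-1 * \int[piX]_x
    mxdot (invmx (Smx m1 x (gstar m1))) (otimes2 (coef m2 x al - A x)).

Definition scale_limits : Prop :=
  [/\ forall m1, argmax (closure (Theta m1)) (@H10 m1) = [set gstar m1],
      forall m1, cvg0_in_prob P (fun n w => ereal_sup
        [set (`| n%:R^-1 * H1 n w g + d%:R / 2 * ln (2 * pi * h n) - H10 g |)%:E
          | g in closure (Theta m1)]) &
      [set` specified Sc C] = argmax setT (fun m1 => H10 (gstar m1))].

Definition drift_limits : Prop :=
  forall m1 : 'I_(ncand Sc),
  [/\ forall m2, argmax (closure (Theta m2)) (@H20 m1 m2) = [set astar m2 m1],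
      forall m2, cvg0_in_prob P (fun n w => ereal_sup
        [set (`| (horizon n)^-1 * H2 m1 n w al -
                 2^-1 * \int[piX]_x mxdot (invmx (Smx m1 x (gstar m1)))
                                          (otimes2 (A x)) -
                 H20 m1 al |)%:E
          | al in closure (Theta m2)]) &
      [set` specified Dr A] = argmax setT (fun m2 => H20 m1 (astar m2 m1))].

End limits.
End model.

(* Main.v *)
From HB Require Import structures.
Require Import Defs.
From mathcomp Require Import all_boot all_order all_algebra.
From mathcomp Require Import all_classical all_reals all_analysis.
From mathcomp Require Import perm measurable_realfun ring lra.
From mathcomp Require Import zify.

(** Only orders of magnitude matter, so no limit distribution is used.

    The uniform limits of the contrasts, with the identifiability condition, give for the
    normalized log-likelihood ratio F_n(u) at a displacement u from the true value that
    F_n(u) <= - chi |u|^2 + o_P(1) uniformly. On a fixed box, a Taylor expansion gives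
    |F_n(u) - Q_n(u)| <= L_n |u| + c_n |u|^3 with Q_n homogeneous of degree 2, c_n = O_P(1)
    and L_n = O_P(T^(-1/2)). Nothing has to be known of Q_n: coercivity passes from F_n to
    Q_n on a small sphere, and so T F_n = O_P(1) at the estimator (m_estimator_rate), both
    for the scale (scale_rate) and the drift (drift_rate). In the first criterion the gain
    is therefore O_P(1 / h), in the second O_P(1), and one unit of penalty, log T / h or
    log T, exceeds it. Two correct models have the same quasi-likelihood at their true
    values, as their coefficients agree there; nestedness enters through the strict
    inequality of the dimensions. An incorrect model loses by the gap between the limits of
    the contrasts, of order n or T, against a penalty of smaller order (gap_selection). The
    selected scale is correct with probability tending to 1, and the comparison of drifts
    holds for each of the finitely many correct scales.

    The work is in the bound for L_n. An increment of X is h A + C dZ plus errors of the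
    drift and of the stochastic integral. The isometry, passed to the limit along simple
    integrands (rep_isometry), bounds the errors, and the error of the stochastic integral
    is treated as one integral over all steps (dmu_grid_eb). For the scale, the first order
    term is a sum of centred products of increments of Z (dZ_cross_sq, bip_quadratic),
    since the mean of the score vanishes (bO_score). For the drift it is a stochastic
    integral that depends on the estimated scale parameter; it is bounded uniformly in the
    parameters by chaining (bip_field), from moments of high order (transform_moment). *)

Set Implicit Arguments.
Unset Strict Implicit.
Unset Printing Implicit Defensive.
Import Order.TTheory GRing.Theory Num.Theory.
Import numFieldNormedType.Exports.
Local Open Scope classical_set_scope.
Local Open Scope ring_scope.

Local Notation meas := (measurable_fun setT).
Local Notation leb := lebesgue_measure.

Lemma eq_ler disp (T : porderType disp) (x y : T) : x = y -> (x <= y)%O.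
Proof. by move->. Qed.

Lemma le_via disp (T : porderType disp) (y x z : T) : (x <= y -> y <= z -> x <= z)%O.
Proof. exact: le_trans. Qed.
Arguments le_via {disp T} y {x z}.

Lemma norm_suml_le (R : numDomainType) (I : Type) (s : seq I) (Q : pred I) (f g : I -> R) (c : R) :
  (forall i, Q i -> `|f i| <= g i * c) -> `|\sum_(i <- s | Q i) f i| <= (\sum_(i <- s | Q i) g i) * c.
Proof. by move=> H; apply: le_trans (ler_norm_sum _ _ _) _; rewrite mulr_suml; exact: ler_sum. Qed.

(** * Random variables with all moments *)

Lemma exprD_le (R : realDomainType) (x y : R) n :
  0 <= x -> 0 <= y -> (x + y) ^+ n <= 2 ^+ n * (x ^+ n + y ^+ n).
Proof.
move=> x0 y0.
wlog xy : x y x0 y0 / x <= y.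
  move=> H; have [xy|/ltW yx] := leP x y; first exact: H.
  by rewrite addrC (addrC (_ ^+ _)); apply: H.
apply: (le_via ((2 * y) ^+ n)).
  by rewrite lerXn2r// ?nnegrE ?addr_ge0// ?mulr_ge0//; lra.
by rewrite exprMn ler_wpM2l ?exprn_ge0// lerDr exprn_ge0.
Qed.

Section moments.
Context d0 (Omega : measurableType d0) (R : realType) (P : probability Omega R).
Implicit Types f g : Omega -> R.

(** All moments finite: a class closed under sums and products, so that no exponents have to be
    tracked. The estimates only use processes of this class. *)
Definition mom f : Prop := meas f /\
  forall N : nat, P.-integrable setT (fun w => (`|f w| ^+ N)%:E).

Definition mean f : R := \int[P]_w f w.

Lemma mom_measurable f : mom f -> meas f.
Proof. by case. Qed.

Lemma mom_integrable f : mom f -> P.-integrable setT (EFin \o f).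
Proof.
move=> [mf /(_ 1%N) fi]; apply: le_integrable fi => //; first exact/measurable_EFinP.
by move=> w _; rewrite /= expr1 lee_fin normr_id.
Qed.

Lemma mom_le f g : meas f -> (forall w, `|f w| <= `|g w|) ->
  mom g -> mom f.
Proof.
move=> mf fg [mg gi]; split=> // N; apply: le_integrable (gi N) => //.
  by apply/measurable_EFinP/measurable_funX/measurableT_comp.
move=> w _; rewrite /= lee_fin !normrX !normr_id.
by rewrite lerXn2r ?nnegrE ?normr_ge0.
Qed.

Lemma mom_cst (c : R) : mom (cst c).
Proof.
split=> [|N]; first exact: measurable_cst.
exact: (finite_measure_integrable_cst P (`|c| ^+ N)).
Qed.

Lemma momD f g : mom f -> mom g -> mom (fun w => f w + g w).
Proof.
move=> [mf fi] [mg gi]; split=> [|N]; first exact: measurable_funD.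
apply: (@le_integrable _ _ _ P setT measurableT _
  (EFin \o (fun w => 2 ^+ N * (`|f w| ^+ N + `|g w| ^+ N)))); last first.
- exact: (integrableZl measurableT (2 ^+ N) (integrableD measurableT (fi N) (gi N))).
- move=> w _; rewrite /= lee_fin normrX normr_id [leRHS]ger0_norm; last first.
    by rewrite mulr_ge0 ?exprn_ge0 ?addr_ge0 ?exprn_ge0.
  apply: le_trans (exprD_le _ (normr_ge0 _) (normr_ge0 _)).
  by rewrite lerXn2r ?nnegrE ?addr_ge0 ?ler_normD.
- apply/measurable_EFinP/measurable_funX/measurableT_comp => //.
  exact: measurable_funD.
Qed.

Lemma momM f g : mom f -> mom g -> mom (fun w => f w * g w).
Proof.
move=> [mf fi] [mg gi]; split=> [|N]; first exact: measurable_funM.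
apply: (@le_integrable _ _ _ P setT measurableT _
  (EFin \o (fun w => `|f w| ^+ (N * 2) + `|g w| ^+ (N * 2)))); last first.
- exact: (integrableD measurableT (fi _) (gi _)).
- move=> w _; rewrite /= lee_fin normrX normr_id [leRHS]ger0_norm ?addr_ge0 ?exprn_ge0//.
  rewrite normrM exprMn !exprM.
  set a := _ ^+ N; set b := _ ^+ N.
  have : 0 <= a by rewrite exprn_ge0.
  have : 0 <= b by rewrite exprn_ge0.
  by have := sqr_ge0 (a - b); have := sqr_ge0 (a + b); rewrite !expr2; nra.
- apply/measurable_EFinP/measurable_funX/measurableT_comp => //.
  exact: measurable_funM.
Qed.

Lemma eq_mom f g : f =1 g -> mom f -> mom g.
Proof. by move=> /funext ->. Qed.

Lemma momZ (c : R) f : mom f -> mom (fun w => c * f w).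
Proof. by move=> mf; apply: momM => //; apply: mom_cst. Qed.

Lemma momN f : mom f -> mom (fun w => - f w).
Proof. by move=> mf; apply: eq_mom (momZ (-1) mf) => w; rewrite mulN1r. Qed.

Lemma momB f g : mom f -> mom g -> mom (fun w => f w - g w).
Proof. by move=> mf mg; apply: momD => //; apply: momN. Qed.

Lemma mom_norm f : mom f -> mom (fun w => `|f w|).
Proof.
move=> mf; apply: (mom_le _ _ mf); last by move=> w; rewrite normr_id.
by apply: measurableT_comp => //; apply: mom_measurable.
Qed.

Lemma momX f N : mom f -> mom (fun w => f w ^+ N).
Proof.
move=> mf; elim: N => [|N IH].
  by apply: eq_mom (mom_cst 1) => w; rewrite expr0.
by apply: eq_mom (momM mf IH) => w; rewrite exprS.
Qed.

Lemma mom_sum (I : Type) (s : seq I) (p : pred I) (F : I -> Omega -> R) :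
  (forall i, p i -> mom (F i)) -> mom (fun w => \sum_(i <- s | p i) F i w).
Proof.
move=> mF; elim: s => [|i s IH].
  by apply: eq_mom (mom_cst 0) => w; rewrite big_nil.
have [pi|pi] := boolP (p i).
  by apply: eq_mom (momD (mF _ pi) IH) => w; rewrite big_cons pi.
by apply: eq_mom IH => w; rewrite big_cons (negbTE pi).
Qed.

Lemma mom_bounded f (c : R) : meas f -> (forall w, `|f w| <= c) ->
  mom f.
Proof.
move=> mf fc; apply: (mom_le mf _ (mom_cst c)) => w.
exact: le_trans (fc w) (ler_norm _).
Qed.

Lemma mean_fin f : mom f -> (\int[P]_w (f w)%:E)%E = (mean f)%:E.
Proof.
by move=> /mom_integrable fi; rewrite /mean /Rintegral fineK// integrable_fin_num.
Qed.

Lemma meanD f g : mom f -> mom g -> mean (fun w => f w + g w) = mean f + mean g.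
Proof. by move=> mf mg; apply: RintegralD => //; apply: mom_integrable. Qed.

Lemma meanZ c f : mom f -> mean (fun w => c * f w) = c * mean f.
Proof. by move=> mf; apply: RintegralZl => //; apply: mom_integrable. Qed.

Lemma mean_cst c : mean (cst c) = c.
Proof.
rewrite /mean Rintegral_cst//.
by rewrite [X in fine X]probability_setT /= mulr1.
Qed.

Lemma integral_cstP c : (\int[P]_w c%:E = c%:E)%E.
Proof. by rewrite (mean_fin (mom_cst c)) mean_cst. Qed.

Lemma eq_mean f g : f =1 g -> mean f = mean g.
Proof. by move=> /funext ->. Qed.

Lemma meanN f : mom f -> mean (fun w => - f w) = - mean f.
Proof.
move=> mf; rewrite -mulN1r -meanZ//.
by apply: eq_mean => w; rewrite mulN1r.
Qed.

Lemma meanB f g : mom f -> mom g -> mean (fun w => f w - g w) = mean f - mean g.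
Proof. by move=> mf mg; rewrite meanD ?meanN//; apply: momN. Qed.

Lemma mean_sum (I : Type) (s : seq I) (p : pred I) (F : I -> Omega -> R) :
  (forall i, p i -> mom (F i)) ->
  mean (fun w => \sum_(i <- s | p i) F i w) = \sum_(i <- s | p i) mean (F i).
Proof.
move=> mF; elim: s => [|i s IH].
  by rewrite big_nil -[RHS](mean_cst 0); apply: eq_mean => w; rewrite big_nil.
rewrite big_cons; case: ifPn => pi; last first.
  by rewrite -IH; apply: eq_mean => w; rewrite big_cons (negbTE pi).
rewrite -IH -meanD; [|exact: mF|exact: mom_sum].
by apply: eq_mean => w; rewrite big_cons pi.
Qed.

Lemma le_mean f g : mom f -> mom g -> (forall w, f w <= g w) -> mean f <= mean g.
Proof. by move=> mf mg fg; apply: le_Rintegral => //; apply: mom_integrable. Qed.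

Lemma mean_ge0 f : (forall w, 0 <= f w) -> 0 <= mean f.
Proof. by move=> f0; apply: Rintegral_ge0. Qed.

(** * Outer probability *)

Local Notation PO := (mu_ext P).

Lemma PO_measurable A : measurable A -> PO A = P A.
Proof. exact: measurable_mu_extE. Qed.

Lemma PO_le A B : A `<=` B -> (PO A <= PO B)%E.
Proof. exact: le_mu_ext. Qed.

Lemma PO_U A B : (PO (A `|` B) <= PO A + PO B)%E.
Proof. exact: outer_measureU2. Qed.

Lemma PO_ge0 A : (0 <= PO A)%E.
Proof. exact: mu_ext_ge0. Qed.

Lemma PO_le1 A : (PO A <= 1)%E.
Proof.
apply: le_trans (PO_le (@subsetT _ A)) _.
by rewrite PO_measurable// probability_setT.
Qed.

End moments.

Section laws.
Context d0 (Omega : measurableType d0) (R : realType) (P : probability Omega R).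

Lemma ge0_same_law d1 (T : measurableType d1) (X Y : Omega -> T) (f : T -> R) :
  meas X -> meas Y ->
  (forall B, measurable B -> P (X @^-1` B) = P (Y @^-1` B)) ->
  meas f -> (forall x, 0 <= f x) ->
  (\int[P]_w (f (X w))%:E = \int[P]_w (f (Y w))%:E)%E.
Proof.
move=> mX mY XY mf f0.
pose X' : {mfun Omega >-> T} := HB.pack X (isMeasurableFun.Build _ _ _ _ X mX).
pose Y' : {mfun Omega >-> T} := HB.pack Y (isMeasurableFun.Build _ _ _ _ Y mY).
have H (Z : {mfun Omega >-> T}) :
    (\int[P]_w (f (Z w))%:E = \int[distribution P Z]_x (f x)%:E)%E.
  by rewrite ge0_integral_distribution//; exact/measurable_EFinP.
rewrite (H X') (H Y'); apply: eq_measure_integral => A mA _.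
exact: XY.
Qed.

Lemma same_law_mom d1 (T : measurableType d1) (X Y : Omega -> T) (f : T -> R) :
  meas X -> meas Y ->
  (forall B, measurable B -> P (X @^-1` B) = P (Y @^-1` B)) ->
  meas f -> mom P (f \o X) -> mom P (f \o Y).
Proof.
move=> mX mY XY mf [_ fi]; split; first exact: measurableT_comp.
move=> N; apply/integrableP; split.
  apply/measurable_EFinP/measurable_funX/measurableT_comp => //.
  exact: measurableT_comp.
have := integrableP _ _ _ (fi N) => -[_]; apply: le_lt_trans.
apply: eq_ler.
have mg : meas (fun x => `|f x| ^+ N).
  by apply/measurable_funX/measurableT_comp.
have := ge0_same_law mX mY XY mg (fun x => exprn_ge0 _ (normr_ge0 _)).
move=> H; transitivity (\int[P]_w (`|f (Y w)| ^+ N)%:E)%E; [|rewrite -H];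
  by apply: eq_integral => x _; rewrite gee0_abs// lee_fin exprn_ge0.
Qed.

Lemma same_law_mean d1 (T : measurableType d1) (X Y : Omega -> T) (f : T -> R) :
  meas X -> meas Y ->
  (forall B, measurable B -> P (X @^-1` B) = P (Y @^-1` B)) ->
  meas f -> mom P (f \o X) -> mean P (f \o X) = mean P (f \o Y).
Proof.
move=> mX mY XY mf mo.
have mo' := same_law_mom mX mY XY mf mo.
pose X' : {mfun Omega >-> T} := HB.pack X (isMeasurableFun.Build _ _ _ _ X mX).
pose Y' : {mfun Omega >-> T} := HB.pack Y (isMeasurableFun.Build _ _ _ _ Y mY).
have H (Z : {mfun Omega >-> T}) : mom P (f \o Z) ->
    (\int[P]_w (f (Z w))%:E = \int[distribution P Z]_x (f x)%:E)%E.
  move=> mZ; rewrite integral_distribution//; first exact/measurable_EFinP.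
  exact: mom_integrable mZ.
rewrite /mean /Rintegral; congr fine.
rewrite (H X') // (H Y') //; apply: eq_measure_integral => A mA _.
exact: XY.
Qed.

(** * Independence *)

Definition indep_rv (f g : Omega -> R) := forall A B : set R,
  measurable A -> measurable B ->
  P (f @^-1` A `&` g @^-1` B) = (P (f @^-1` A) * P (g @^-1` B))%E.

Lemma indep_comp (f g : Omega -> R) (u v : R -> R) :
  meas u -> meas v -> indep_rv f g ->
  indep_rv (u \o f) (v \o g).
Proof.
move=> mu mv fg A B mA mB; rewrite 2!comp_preimage; apply: fg.
  by rewrite -[X in measurable X]setTI; apply: mu.
by rewrite -[X in measurable X]setTI; apply: mv.
Qed.

Lemma ge0_indep_mean (f g : Omega -> R) :
  meas f -> meas g ->
  (forall w, 0 <= f w) -> (forall w, 0 <= g w) -> indep_rv f g ->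
  (\int[P]_w (f w * g w)%:E = (\int[P]_w (f w)%:E) * \int[P]_w (g w)%:E)%E.
Proof.
move=> mf mg f0 g0 fg.
pose F : {mfun Omega >-> R} := HB.pack f (isMeasurableFun.Build _ _ _ _ f mf).
pose G : {mfun Omega >-> R} := HB.pack g (isMeasurableFun.Build _ _ _ _ g mg).
have mX : meas (fun w => (f w, g w)) by exact/measurable_fun_pair.
pose X : {mfun Omega >-> (R * R)%type} :=
  HB.pack (fun w => (f w, g w)) (isMeasurableFun.Build _ _ _ _ _ mX).
have mabs : meas (fun y : R => `|y|%:E).
  by apply/measurable_EFinP; exact: normr_measurable.
pose ph (z : R * R) : \bar R := (`|z.1| * `|z.2|)%:E.
have mph : meas ph.
  by apply/measurable_EFinP/measurable_funM; apply: measurableT_comp.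
have ph0 z : (0 <= ph z)%E by rewrite lee_fin mulr_ge0.
have -> : (\int[P]_w (f w * g w)%:E = \int[distribution P X]_z ph z)%E.
  rewrite ge0_integral_distribution//; apply: eq_integral => w _.
  by rewrite /ph /= !ger0_norm.
have -> : (\int[distribution P X]_z ph z =
           \int[distribution P F \x distribution P G]_z ph z)%E.
  apply: eq_measure_integral => A mA _; apply/esym.
  by apply: product_measure_unique => // A1 A2 mA1 mA2; exact: fg.
rewrite fubini_tonelli1//.
have -> : (\int[P]_w (f w)%:E = \int[distribution P F]_x `|x|%:E)%E.
  rewrite ge0_integral_distribution//; first by apply: eq_integral => w _ /=; rewrite ger0_norm.
have -> : (\int[P]_w (g w)%:E = \int[distribution P G]_x `|x|%:E)%E.
  rewrite ge0_integral_distribution//; first by apply: eq_integral => w _ /=; rewrite ger0_norm.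
rewrite -ge0_integralZr//; last exact: integral_ge0.
apply: eq_integral => x _; rewrite /fubini_F /ph /= muleC.
rewrite -ge0_integralZr//.
by apply: eq_integral => y _; rewrite EFinM muleC.
Qed.

Lemma indep_mean (f g : Omega -> R) : mom P f -> mom P g -> indep_rv f g ->
  mean P (fun w => f w * g w) = mean P f * mean P g.
Proof.
move=> mf mg fg.
pose pp (x : R) := (`|x| + x) / 2; pose nn (x : R) := (`|x| - x) / 2.
have mpp : meas pp.
  by apply: measurable_funM => //; apply: measurable_funD => //; exact: measurableT_comp.
have mnn : meas nn.
  by apply: measurable_funM => //; apply: measurable_funB => //; exact: measurableT_comp.
have pp0 x : 0 <= pp x by rewrite /pp; have := ler_norm (- x); rewrite normrN; lra.
have nn0 x : 0 <= nn x by rewrite /nn; have := ler_norm x; lra.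
have ppnn x : x = pp x - nn x by rewrite /pp /nn; lra.
have mpm h : mom P h -> mom P (pp \o h).
  move=> mh; apply: (eq_mom (f := fun w => 2^-1 * (`|h w| + h w))).
    by move=> w; rewrite /pp /= mulrC.
  by apply/momZ/momD => //; exact: mom_norm.
have mnm h : mom P h -> mom P (nn \o h).
  move=> mh; apply: (eq_mom (f := fun w => 2^-1 * (`|h w| - h w))).
    by move=> w; rewrite /nn /= mulrC.
  by apply/momZ/momB => //; exact: mom_norm.
have key (u v : R -> R) : meas u -> meas v ->
    (forall x, 0 <= u x) -> (forall x, 0 <= v x) ->
    mom P (u \o f) -> mom P (v \o g) ->
    mean P (fun w => u (f w) * v (g w)) = mean P (u \o f) * mean P (v \o g).
  move=> mu mv u0 v0 muf mvg; apply: EFin_inj.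
  rewrite EFinM -!mean_fin//; last exact: momM.
  apply: (@ge0_indep_mean (u \o f) (v \o g)).
  - exact: mom_measurable muf.
  - exact: mom_measurable mvg.
  - by move=> w; exact: u0.
  - by move=> w; exact: v0.
  - exact: indep_comp.
have E h : mom P h -> mean P h = mean P (pp \o h) - mean P (nn \o h).
  by move=> mh; rewrite -meanB; [apply: eq_mean => w; exact: ppnn|exact: mpm|exact: mnm].
have mpf := mpm _ mf; have mnf := mnm _ mf; have mpg := mpm _ mg; have mng := mnm _ mg.
rewrite (E f)// (E g)// mulrBl !mulrBr -!key//.
rewrite -!meanB//; try exact: momM.
  apply: eq_mean => w; rewrite {1}(ppnn (f w)) {1}(ppnn (g w)); ring.
all: by apply: momB; exact: momM.
Qed.

End laws.

(** * Sub-sigma-algebras *)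

Section sub_sigma.
Context d0 (Omega : measurableType d0) (R : realType).
Implicit Types (G : set (set Omega)).

Definition mwrt G (f : Omega -> R) := forall B : set R, measurable B -> G (f @^-1` B).

Lemma mwrtP G (f : Omega -> R) : sigma_algebra setT G ->
  mwrt G f <-> measurable_fun (setT : set (g_sigma_algebraType G)) f.
Proof.
move=> sG; have GE : <<s G >> = G by exact: sigma_algebra_id.
split=> [Gf mT B mB|mf B mB].
  by rewrite setTI /measurable /= GE; exact: Gf.
by have := mf measurableT B mB; rewrite setTI /measurable /= GE.
Qed.

Lemma mwrt_measurable G (f : Omega -> R) : G `<=` measurable -> mwrt G f ->
  meas f.
Proof. by move=> sG Gf mT B mB; rewrite setTI; apply/sG/Gf. Qed.

Lemma mwrt_sub G G' (f : Omega -> R) : G `<=` G' -> mwrt G f -> mwrt G' f.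
Proof. by move=> GG Gf B mB; exact/GG/Gf. Qed.

Section closure.
Variables (G : set (set Omega)) (sG : sigma_algebra setT G).
Implicit Types f g : Omega -> R.

Lemma mwrt_cst c : mwrt G (cst c).
Proof. by apply/mwrtP. Qed.

Lemma mwrtD f g : mwrt G f -> mwrt G g -> mwrt G (fun w => f w + g w).
Proof. by move=> /mwrtP-/(_ sG) ? /mwrtP-/(_ sG) ?; apply/mwrtP => //; exact: measurable_funD. Qed.

Lemma mwrtB f g : mwrt G f -> mwrt G g -> mwrt G (fun w => f w - g w).
Proof. by move=> /mwrtP-/(_ sG) ? /mwrtP-/(_ sG) ?; apply/mwrtP => //; exact: measurable_funB. Qed.

Lemma mwrtM f g : mwrt G f -> mwrt G g -> mwrt G (fun w => f w * g w).
Proof. by move=> /mwrtP-/(_ sG) ? /mwrtP-/(_ sG) ?; apply/mwrtP => //; exact: measurable_funM. Qed.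

Lemma mwrt_comp f (u : R -> R) : meas u -> mwrt G f ->
  mwrt G (u \o f).
Proof.
move=> mu mf B mB; rewrite comp_preimage; apply: mf.
by rewrite -[X in measurable X]setTI; exact: mu.
Qed.

Lemma mwrtX f N : mwrt G f -> mwrt G (fun w => f w ^+ N).
Proof.
move=> mf; exact: (@mwrt_comp f (fun x => x ^+ N)).
Qed.

Lemma mwrt_sum (I : Type) (s : seq I) (p : pred I) (F : I -> Omega -> R) :
  (forall i, p i -> mwrt G (F i)) -> mwrt G (fun w => \sum_(i <- s | p i) F i w).
Proof.
move=> mF; elim: s => [|i s IH].
  by under eq_fun do rewrite big_nil; exact: mwrt_cst.
under eq_fun do rewrite big_cons.
by have [pi|_] := boolP (p i); [apply: mwrtD => //; exact: mF|exact: IH].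
Qed.

End closure.

End sub_sigma.

(** * Boundedness in probability *)
Section in_probability.
Context d0 (Omega : measurableType d0) (R : realType) (P : probability Omega R).
Local Notation PO := (mu_ext P).
Implicit Types Y U : nat -> Omega -> R.

(** One-sided, as log-likelihood ratios have to be bounded from above only. The outer probability
    gives a meaning to suprema over the parameter. *)
Definition bip Y := forall e : R, 0 < e -> exists2 K : R, 0 < K &
  \forall n \near \oo, (PO [set w | (K < Y n w)%R] <= e%:E)%E.

Definition vanishes (B : nat -> set Omega) := forall e : R, 0 < e ->
  \forall n \near \oo, (PO (B n) <= e%:E)%E.

Lemma PO_negligible N : P.-negligible N -> PO N = 0%E.
Proof.
move=> [A [mA PA NA]]; apply/eqP; rewrite eq_le PO_ge0 andbT.
by rewrite -PA -(PO_measurable P mA); exact: PO_le.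
Qed.

Lemma vanishes_sub A B : (\forall n \near \oo, A n `<=` B n) -> vanishes B -> vanishes A.
Proof.
move=> AB vB e e0; near=> n.
apply: (le_via (PO (B n))); last by near: n; exact: vB.
by apply: PO_le; near: n.
Unshelve. all: end_near. Qed.

Lemma vanishesU A B : vanishes A -> vanishes B -> vanishes (fun n => A n `|` B n).
Proof.
move=> vA vB e e0; have e20 : 0 < e / 2 by rewrite divr_gt0.
near=> n; apply: le_trans (PO_U _ _ _) _.
rewrite (splitr e) EFinD; apply: leeD; near: n; [exact: vA|exact: vB].
Unshelve. all: end_near. Qed.

Lemma vanishes_bigU (I : finType) (A : I -> nat -> set Omega) :
  (forall i, vanishes (A i)) -> vanishes (fun n => [set w | exists i, A i n w]).
Proof.
move=> vA; suff H (s : seq I) : vanishes (fun n => [set w | exists2 i, i \in s & A i n w]).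
  apply: vanishes_sub (H (enum I)); near=> n => w [i Ai]; exists i => //.
  by rewrite mem_enum.
elim: s => [|i s IH].
  by move=> e e0; near=> n; rewrite (_ : [set w | _] = set0) ?mu_ext0 ?lee_fin ?ltW// -subset0 => w [].
apply: vanishes_sub (vanishesU (vA i) IH); near=> n => w [j].
by rewrite inE => /orP[/eqP -> ?|js ?]; [left|right; exists j].
Unshelve. all: end_near. Qed.

Lemma vanishes_cvg1 (E : nat -> set Omega) : (forall n, measurable (E n)) ->
  vanishes (fun n => ~` E n) -> P (E n) @[n --> \oo] --> 1%E.
Proof.
move=> mE vE.
have PE n : P (E n) = (1 - fine (P (~` E n)))%R%:E.
  rewrite EFinB fineK ?fin_num_measure//; last exact: measurableC.
  rewrite probability_setC//; have := fin_num_measure P _ (mE n).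
  by move: (P (E n)) => [x| |]//= _; congr EFin; ring.
under eq_fun do rewrite PE.
apply: cvg_EFin; first by near=> n.
apply/cvgrPdist_le => e e0; near=> n => /=.
rewrite opprB addrCA subrr addr0 ger0_norm ?fine_ge0//.
rewrite -lee_fin fineK ?fin_num_measure//; last exact: measurableC.
by rewrite -PO_measurable; [near: n; exact: vE|exact: measurableC].
Unshelve. all: end_near. Qed.

Lemma bip_le Y U : (\forall n \near \oo, {ae P, forall w, Y n w <= U n w}) ->
  bip U -> bip Y.
Proof.
move=> YU bU e e0; have [K K0 HK] := bU e e0; exists K => //.
near=> n.
apply: (le_via (PO ([set w | K < U n w] `|` ~` [set w | Y n w <= U n w]))).
  apply: PO_le => w /= KY; have [YUw|] := leP (Y n w) (U n w).
    by left; exact: lt_le_trans KY YUw.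
  by move=> _; right.
apply: le_trans (PO_U _ _ _) _; rewrite [X in (_ + X)%E]PO_negligible ?adde0.
  by near: n.
by near: n.
Unshelve. all: end_near. Qed.

Lemma bip_le_all Y U : (forall n w, Y n w <= U n w) -> bip U -> bip Y.
Proof. by move=> YU; apply: bip_le; near=> n; apply: aeW. Unshelve. all: end_near. Qed.

Lemma bip_cst c : bip (fun _ _ => c).
Proof.
move=> e e0; exists (`|c| + 1); first by rewrite ltr_pwDr.
near=> n; rewrite (_ : [set w | _] = set0) ?mu_ext0 ?lee_fin ?ltW//.
rewrite -subset0 => w /=; have := ler_norm c; lra.
Unshelve. all: end_near. Qed.

Lemma bipD Y U : bip Y -> bip U -> bip (fun n w => Y n w + U n w).
Proof.
move=> bY bU e e0; have e20 : 0 < e / 2 by rewrite divr_gt0.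
have [K1 K10 H1] := bY _ e20; have [K2 K20 H2] := bU _ e20.
exists (K1 + K2); first exact: addr_gt0.
near=> n.
apply: (le_via (PO ([set w | K1 < Y n w] `|` [set w | K2 < U n w]))).
  apply: PO_le => w /= KK; have [|Y1] := ltP K1 (Y n w); [by left|right].
  lra.
apply: le_trans (PO_U _ _ _) _; rewrite (splitr e) EFinD.
by apply: leeD; near: n.
Unshelve. all: end_near. Qed.

Lemma bipM Y U : (forall n w, 0 <= Y n w) -> (forall n w, 0 <= U n w) ->
  bip Y -> bip U -> bip (fun n w => Y n w * U n w).
Proof.
move=> Y0 U0 bY bU e e0; have e20 : 0 < e / 2 by rewrite divr_gt0.
have [K1 K10 H1] := bY _ e20; have [K2 K20 H2] := bU _ e20.
exists (K1 * K2); first exact: mulr_gt0.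
near=> n.
apply: (le_via (PO ([set w | K1 < Y n w] `|` [set w | K2 < U n w]))).
  apply: PO_le => w /= KK; have [|Y1] := ltP K1 (Y n w); [by left|right].
  rewrite ltNge; apply/negP => U1; move: KK; rewrite ltNge => /negP; apply.
  by apply: ler_pM.
apply: le_trans (PO_U _ _ _) _; rewrite (splitr e) EFinD.
by apply: leeD; near: n.
Unshelve. all: end_near. Qed.

Lemma bip_sum (I : Type) (s : seq I) (F : I -> nat -> Omega -> R) :
  (forall i, bip (F i)) -> bip (fun n w => \sum_(i <- s) F i n w).
Proof.
move=> bF; elim: s => [|i s IH].
  by apply: bip_le_all (bip_cst 0) => n w; rewrite big_nil.
by apply: bip_le_all (bipD (bF i) IH) => n w; rewrite big_cons.
Qed.

Lemma bip_markov Y (K : R) : (forall n, meas (Y n)) ->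
  (forall n w, 0 <= Y n w) ->
  (\forall n \near \oo, (\int[P]_w (Y n w)%:E <= K%:E)%E) -> bip Y.
Proof.
move=> mY Y0 YK e e0; have K0 : 0 <= `|K| by [].
pose L := (`|K| + 1) / e; have L0 : 0 < L by rewrite divr_gt0// ltr_pwDr.
exists L => //; near=> n.
have mA : measurable [set w | L <= Y n w].
  have := mY n measurableT `[L, +oo[%classic (measurable_itv _).
  by rewrite setTI; congr measurable; apply/seteqP; split=> w /=; rewrite in_itv /= andbT.
apply: (le_via (PO [set w | (L <= Y n w)%R])); first by apply: PO_le => w /= /ltW.
rewrite PO_measurable//.
have : (L%:E * P [set w | (L <= Y n w)%R] <= K%:E)%E.
  apply: (le_via (\int[P]_w (Y n w)%:E)%E); last by near: n.
  rewrite -integral_cst//.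
  apply: (le_via (\int[P]_(w in [set w | (L <= Y n w)%R]) (Y n w)%:E)%E).
    apply: ge0_le_integral => //=.
    - by move=> w _; rewrite lee_fin ltW.
    - by apply/measurable_EFinP; apply: measurable_funTS.
  apply: ge0_subset_integral => //; first exact/measurable_EFinP.
  by move=> x _; rewrite lee_fin.
rewrite -(fineK (fin_num_measure P _ mA)); set p := fine _.
rewrite -EFinM !lee_fin /L => H.
have : (`|K| + 1) * p <= K * e by rewrite -ler_pdivrMr// mulrAC.
have := ler_norm K; have : 0 <= `|K| by []; move=> K1 K2 K3.
have : K * e <= `|K| * e by rewrite ler_wpM2r// ltW.
nra.
Unshelve. all: end_near. Qed.

(** This is where the logarithmic penalty beats a bounded log-likelihood ratio. *)
Lemma bip_vanishes Y (a : nat -> R) : bip Y -> a n @[n --> \oo] --> +oo ->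
  vanishes (fun n => [set w | a n <= Y n w]).
Proof.
move=> bY ay e e0; have [K K0 HK] := bY e e0.
near=> n; apply: (le_via (PO [set w | K < Y n w])); last by near: n.
apply: PO_le => w /=; apply: lt_le_trans; near: n.
by move/cvgryPgt : ay; exact.
Unshelve. all: end_near. Qed.

End in_probability.

Lemma measurable_entry (R : realType) m n D (i : 'I_m) (j : 'I_n) :
  measurable_fun D (fun M : 'M[R]_(m, n) => M i j).
Proof.
move=> mD B mB; apply: measurableI => //.
by apply: sub_sigma_algebra; exists i, j, B.
Qed.

Lemma measurable_mx (R : realType) d1 (T : measurableType d1) m n (D : set T)
  (f : T -> 'M[R]_(m, n)) :
  (forall i j, measurable_fun D (fun w => f w i j)) -> measurable_fun D f.
Proof.
move=> mf mD; suff: measurable_fun D f by exact.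
apply: (measurability (@mx_cylinders R m n)) => //.
by move=> _ [B [i [j [C [mC ->]]]] <-]; exact: mf i j mD C mC.
Qed.

(** * Moments of the increments of the driving process *)
Section additive.
Context (R : realType) (f : R -> R).
Hypothesis fD : forall s t, 0 <= s -> 0 <= t -> f (s + t) = f s + f t.

Lemma additive_natmul n t : 0 <= t -> f (n%:R * t) = n%:R * f t.
Proof.
move=> t0; have f00 : f 0 = 0 by have := fD (lexx 0) (lexx 0); rewrite addr0; lra.
elim: n => [|n IH]; first by rewrite !mul0r.
by rewrite -natr1 mulrDl mul1r fD ?mulr_ge0// IH mulrDl mul1r.
Qed.

(** Nonnegativity makes an additive function monotone; squeezing between rational multiples then
    gives linearity. *)
Lemma additive_ge0_linear : (forall t, 0 <= t -> 0 <= f t) ->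
  forall t, 0 <= t -> f t = t * f 1.
Proof.
move=> f0 t t0.
have mono s u : 0 <= s -> s <= u -> f s <= f u.
  move=> s0 su; rewrite -(subrK s u) addrC fD ?subr_ge0// lerDl.
  by apply: f0; rewrite subr_ge0.
have H n : n.+1%:R * `|f t - t * f 1| <= f 1.
  have nt0 : 0 <= n.+1%:R * t by rewrite mulr_ge0.
  pose k := Num.trunc (n.+1%:R * t).
  have /andP[k1 k2] := truncn_itv nt0.
  have H1 : k%:R * f 1 <= n.+1%:R * f t.
    by rewrite -!additive_natmul// mulr1; apply: mono.
  have H2 : n.+1%:R * f t <= (k.+1)%:R * f 1.
    by rewrite -!additive_natmul// mulr1; apply: mono => //; apply: ltW.
  rewrite -[X in X * `|_|](@ger0_norm _ n.+1%:R)// -normrM mulrBr mulrA.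
  have f10 := f0 1 ler01.
  rewrite ler_norml; apply/andP; split.
    have : n.+1%:R * t * f 1 <= k.+1%:R * f 1 by rewrite ler_wpM2r// ltW.
    by rewrite -natr1 mulrDl mul1r; lra.
  have : k%:R * f 1 <= n.+1%:R * t * f 1 by rewrite ler_wpM2r.
  by move: H2; rewrite -natr1 mulrDl mul1r; lra.
apply/eqP; rewrite -subr_eq0 -normr_le0 leNgt; apply/negP => a0.
have := archi_boundP (divr_ge0 (f0 1 ler01) (ltW a0)).
case: (Num.bound _) => [|n]; first by rewrite ltNge divr_ge0// ?f0// ltW.
by rewrite ltr_pdivrMr// ltNge H.
Qed.

End additive.

Lemma ge0_exprD_ge (R : realDomainType) (n : nat) (x y : R) : 0 <= x -> 0 <= y ->
  x ^+ n.+3 + y ^+ n.+3 + n.+3%:R * (x ^+ n.+2 * y) + n.+3%:R * (x * y ^+ n.+2)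
  <= (x + y) ^+ n.+3.
Proof.
move=> x0 y0; elim: n => [|n IH].
  by apply: eq_ler; ring.
rewrite [leRHS]exprS; apply: le_trans (ler_wpM2l (addr_ge0 x0 y0) IH).
rewrite -(natr1 n.+3) -subr_ge0.
have xn : 0 <= x ^+ n.+2 by rewrite exprn_ge0.
have yn : 0 <= y ^+ n.+2 by rewrite exprn_ge0.
have : 0 <= n.+3%:R * (x ^+ n.+2 * y * y) :> R.
  by apply: mulr_ge0; [exact: ler0n|apply: mulr_ge0 => //; exact: mulr_ge0].
have : 0 <= n.+3%:R * (x * x * y ^+ n.+2) :> R.
  by apply: mulr_ge0; [exact: ler0n|apply: mulr_ge0 => //; exact: mulr_ge0].
rewrite !(exprS _ n.+3) !(exprS _ n.+2); move: (x ^+ n.+2) (y ^+ n.+2) xn yn => X Y _ _.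
move: (n.+3%:R : R) => N H1 H2.
rewrite (_ : _ - _ = N * (X * y * y) + N * (x * x * Y)); first exact: addr_ge0.
ring.
Qed.

Lemma exprD_ge_tangent (R : realDomainType) (m : nat) (a b : R) : 0 <= a -> 0 <= a + b ->
  a ^+ m.+1 + m.+1%:R * (a ^+ m * b) <= (a + b) ^+ m.+1.
Proof.
move=> a0 ab0; elim: m => [|m IH].
  by rewrite !expr1 expr0 !mul1r.
rewrite [leRHS]exprS; apply: le_trans (ler_wpM2l ab0 IH).
rewrite -(natr1 m.+1) -subr_ge0 !(exprS _ m.+1) !(exprS _ m).
have am : 0 <= a ^+ m by rewrite exprn_ge0.
have : 0 <= m.+1%:R * (a ^+ m * b ^+ 2) :> R 
  by apply: mulr_ge0; [exact: ler0n|apply: mulr_ge0 => //; exact: sqr_ge0].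
move: (a ^+ m) am => A _; move: (m.+1%:R : R) => N H.
rewrite (_ : _ - _ = N * (A * b ^+ 2)) //; ring.
Qed.

(** The mixed terms with a first power have mean zero for independent centred x and y, and the
    remaining ones are nonnegative in total. So even moments of centred increments are superadditive
    in time. *)
Lemma even_exprD_ge (R : realDomainType) (k q : nat) (x y : R) : q = (2 * k.+2)%N ->
  x ^+ q + y ^+ q + q%:R * (x ^+ q.-1 * y) + q%:R * (x * y ^+ q.-1) <= (x + y) ^+ q.
Proof.
move=> q2; have qE : q = (2 * k).+4 by rewrite q2; lia.
wlog yx : x y / `|y| <= `|x|.
  move=> H; have [yx|/ltW xy] := leP `|y| `|x|; first exact: H.
  rewrite (addrC x y); apply: le_trans (H _ _ xy).
  by apply: eq_ler; ring.
have e z : (- z) ^+ q = z ^+ q :> R.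
  by rewrite exprNn qE !exprS exprM sqrrN !expr1n; ring.
have o z : (- z) ^+ q.-1 = - z ^+ q.-1 :> R.
  by rewrite exprNn qE /= !exprS exprM sqrrN !expr1n; ring.
wlog x0 : x y yx / 0 <= x.
  move=> H; have [x0|/ltW x0] := leP 0 x; first exact: H.
  have := H (- x) (- y); rewrite !normrN oppr_ge0 => /(_ yx x0).
  by rewrite -opprD !e !o !mulrNN.
have [y0|/ltW y0] := leP 0 y.
  by rewrite qE /=; exact: ge0_exprD_ge.
have tang : x ^+ q + q%:R * (x ^+ q.-1 * y) <= (x + y) ^+ q.
  have H1 : 0 <= x ^+ 2 + (2 * x * y + y ^+ 2).
    by have := sqr_ge0 (x + y); rewrite sqrrD; lra.
  have := exprD_ge_tangent k.+1 (sqr_ge0 x) H1.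
  rewrite (_ : x ^+ 2 + (2 * x * y + y ^+ 2) = (x + y) ^+ 2); last by ring.
  rewrite -!exprM -q2 => H2; apply: le_trans H2; rewrite lerD2l.
  have : 0 <= x ^+ (2 * k.+1) * y ^+ 2 by rewrite mulr_ge0 ?sqr_ge0// exprn_ge0.
  have -> : x ^+ q.-1 = x ^+ (2 * k.+1) * x by rewrite -exprSr; congr (_ ^+ _); lia.
  rewrite q2 natrM => H.
  have : 0 <= k.+2%:R * (x ^+ (2 * k.+1) * y ^+ 2) by rewrite mulr_ge0.
  by move: (k.+2%:R) => N; lra.
have : y ^+ q + q%:R * (x * y ^+ q.-1) <= 0.
  rewrite (_ : _ + _ = (- y ^+ q.-1) * - (y + q%:R * x)); last first.
    by rewrite {1}(_ : q = q.-1.+1) ?exprSr; [ring|rewrite qE].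
  rewrite -o.
  rewrite mulr_ge0_le0 ?exprn_ge0 ?oppr_ge0// oppr_le0.
  move: yx; rewrite ler0_norm// ger0_norm// => yx.
  have : 1 * x <= q%:R * x by rewrite ler_wpM2r// ler1n qE.
  by lra.
lra.
Qed.

(** After the linear term, which has mean zero for martingale increments, everything is controlled
    by the quadratic and the top order terms. *)
Lemma exprD_taylor1 (R : realDomainType) n : exists2 K : R, 0 <= K & forall x y : R,
  `|(x + y) ^+ n.+2 - x ^+ n.+2 - n.+2%:R * (x ^+ n.+1 * y)| <=
  K * (`|x| ^+ n * `|y| ^+ 2 + `|y| ^+ n.+2).
Proof.
have mix (a b : R) m : 0 <= a -> 0 <= b ->
    a * b ^+ m.+2 <= a ^+ m.+1 * b ^+ 2 + b ^+ m.+3 /\ a ^+ m * b ^+ 3 <= a ^+ m.+1 * b ^+ 2 + b ^+ m.+3.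
  move=> a0 b0; have [ab|ba] := leP a b.
    split; apply: (le_via (b ^+ m.+3)); rewrite ?lerDr ?mulr_ge0 ?exprn_ge0//.
      by rewrite (exprS b m.+2) ler_wpM2r ?exprn_ge0.
    by rewrite -(addn3 m) exprD ler_wpM2r ?exprn_ge0// lerXn2r.
  split; apply: (le_via (a ^+ m.+1 * b ^+ 2)); rewrite ?lerDl ?exprn_ge0//.
    have -> : a * b ^+ m.+2 = (a * b ^+ m) * b ^+ 2 by rewrite -(addn2 m) exprD mulrA.
    by rewrite (exprS a m) ler_wpM2r ?exprn_ge0// ler_wpM2l// lerXn2r ?nnegrE// ltW.
  by rewrite (exprSr a m) (exprS b 2) -!mulrA ler_wpM2l ?exprn_ge0// ler_wpM2r ?exprn_ge0// ltW.
elim: n => [|n [K K0 H]].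
  exists 1 => // x y; rewrite expr0 mul1r expr1.
  have -> : (x + y) ^+ 2 - x ^+ 2 - 2 * (x * y) = y ^+ 2 by ring.
  by rewrite normrX mul1r lerDl exprn_ge0.
exists (3 * K + n.+2%:R); first by rewrite addr_ge0// mulr_ge0.
move=> x y; set a := `|x|; set b := `|y|; have a0 : 0 <= a by exact: normr_ge0. have b0 : 0 <= b by exact: normr_ge0.
have -> : (x + y) ^+ n.+3 - x ^+ n.+3 - n.+3%:R * (x ^+ n.+2 * y) =
  (x + y) * ((x + y) ^+ n.+2 - x ^+ n.+2 - n.+2%:R * (x ^+ n.+1 * y)) + n.+2%:R * (x ^+ n.+1 * y ^+ 2).
  rewrite -[n.+3%:R]natr1 !exprS; ring.
apply: le_trans (ler_normD _ _) _; rewrite !normrM !normrX normr_nat -/a -/b.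
have [m1 m2] := mix a b n a0 b0.
have p0 : 0 <= a ^+ n.+1 * b ^+ 2 by rewrite mulr_ge0 ?exprn_ge0.
have q0 : 0 <= b ^+ n.+3 by rewrite exprn_ge0.
have xy : `|x + y| <= a + b by exact: ler_normD.
have h1 := ler_pM (normr_ge0 _) (normr_ge0 _) xy (H x y).
apply: (le_via ((a + b) * (K * (a ^+ n * b ^+ 2 + b ^+ n.+2)) + n.+2%:R * (a ^+ n.+1 * b ^+ 2))).
  by rewrite lerD2r.
have -> : (a + b) * (K * (a ^+ n * b ^+ 2 + b ^+ n.+2)) =
  K * (a ^+ n.+1 * b ^+ 2 + a * b ^+ n.+2 + a ^+ n * b ^+ 3 + b ^+ n.+3) by rewrite !exprS; ring.
set p := a ^+ n.+1 * b ^+ 2 in p0 m1 m2 *; set s := b ^+ n.+3 in q0 m1 m2 *.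
have h2 : K * (p + a * b ^+ n.+2 + a ^+ n * b ^+ 3 + s) <= K * (3 * (p + s)).
  by apply: ler_wpM2l => //; lra.
apply: (le_via (K * (3 * (p + s)) + n.+2%:R * p)); first by rewrite lerD2r.
have n0 : 0 <= (n.+2%:R : R) by [].
by have := mulr_ge0 n0 q0; lra.
Qed.

Section levy.
Context d0 (Omega : measurableType d0) (R : realType) (P : probability Omega R).
Context (r : nat) (Z : R -> Omega -> 'cV[R]_r) (F : R -> set (set Omega)).
Hypotheses (Ffilt : filtration F) (ZF : adapted F Z)
  (Zind : increments_independent_of P Z F) (Zlevy : levy_process P Z)
  (ZR1 : cond_R1 P Z).
Local Notation mean := (mean P).
Local Notation mom := (mom P).
Local Notation vanishes := (vanishes P).

Definition dZ (a : 'I_r) (s t : R) (w : Omega) : R := Z t w a 0 - Z s w a 0.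

Lemma filt_sigma t : 0 <= t -> sigma_algebra setT (F t).
Proof. by move=> t0; case: Ffilt => + _ => /(_ t t0)[]. Qed.

Lemma filt_measurable t : 0 <= t -> F t `<=` measurable.
Proof. by move=> t0; case: Ffilt => + _ => /(_ t t0)[]. Qed.

Lemma filt_le s t : 0 <= s -> s <= t -> F s `<=` F t.
Proof. by case: Ffilt => _; exact. Qed.

Lemma mwrt_filt s t (f : Omega -> R) : 0 <= s -> s <= t -> mwrt (F s) f -> mwrt (F t) f.
Proof. by move=> s0 st; apply: mwrt_sub; exact: filt_le. Qed.

Lemma mwrt_filt_measurable t (f : Omega -> R) : 0 <= t -> mwrt (F t) f ->
  meas f.
Proof. by move=> t0; apply: mwrt_measurable; exact: filt_measurable. Qed.

Lemma Z_mwrt t a : 0 <= t -> mwrt (F t) (fun w => Z t w a 0).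
Proof.
move=> t0 B mB; have /= H := ZF t0.
apply: (H ((fun M : 'cV[R]_r => M a 0) @^-1` B)).
by have := @measurable_entry R r 1 setT a 0 measurableT B mB; rewrite setTI.
Qed.

Lemma dZ_mwrt s t u a : 0 <= s -> 0 <= t -> s <= u -> t <= u -> mwrt (F u) (dZ a s t).
Proof.
move=> s0 t0 su tu; apply: mwrtB; first exact: filt_sigma (le_trans s0 su).
  by apply: mwrt_filt tu _ => //; exact: Z_mwrt.
by apply: mwrt_filt su _ => //; exact: Z_mwrt.
Qed.

Lemma Z_meas t : 0 <= t -> meas (Z t).
Proof. by case: Zlevy => + _ _ _ _; exact. Qed.

Lemma Zinc_meas s t : 0 <= s -> 0 <= t -> meas (fun w => Z t w - Z s w).
Proof.
move=> s0 t0; apply: measurable_mx => i j.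
rewrite (_ : (fun _ => _) = fun w => Z t w i j - Z s w i j); last first.
  by apply/funext => w; rewrite !mxE.
apply: measurable_funB.
  exact: (measurableT_comp (@measurable_entry R r 1 setT i j) (Z_meas t0)).
exact: (measurableT_comp (@measurable_entry R r 1 setT i j) (Z_meas s0)).
Qed.

Lemma dZ_measurable a s t : 0 <= s -> 0 <= t -> meas (dZ a s t).
Proof.
move=> s0 t0; have := measurableT_comp (@measurable_entry R r 1 setT a 0) (Zinc_meas s0 t0).
by congr measurable_fun; apply/funext => w /=; rewrite !mxE.
Qed.

Lemma Zinc_law s t (B : set 'cV[R]_r) : 0 <= s -> s <= t -> measurable B ->
  P ((fun w => Z t w - Z s w) @^-1` B) = P ((fun w => Z (t - s) w - Z 0 w) @^-1` B).
Proof.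
move=> s0 st mB; case: Zlevy => _ _ _ sta _.
have ts0 : 0 <= t - s by rewrite subr_ge0.
have := sta _ _ B s0 st mB; rewrite /incr => ->.
by have := sta _ _ B (lexx 0) ts0 mB; rewrite /incr subr0 => ->.
Qed.

Lemma dZ_indep s t (f : Omega -> R) (g : 'cV[R]_r -> R) :
  0 <= s -> s <= t -> mwrt (F s) f -> meas g ->
  indep_rv P f (fun w => g (Z t w - Z s w)).
Proof.
move=> s0 st mf mg A B mA mB.
have mgB : measurable (g @^-1` B) by rewrite -[X in measurable X]setTI; exact: mg.
exact: (Zind s0 st (mf _ mA) mgB).
Qed.

Lemma mean_indep s t (f : Omega -> R) (g : 'cV[R]_r -> R) :
  0 <= s -> s <= t -> mwrt (F s) f -> meas g ->
  mom f -> mom (fun w => g (Z t w - Z s w)) ->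
  mean (fun w => f w * g (Z t w - Z s w)) =
  mean f * mean (fun w => g (Z t w - Z s w)).
Proof. by move=> *; apply: indep_mean => //; exact: dZ_indep. Qed.

Let entryE a s t w : dZ a s t w = (Z t w - Z s w) a 0.
Proof. by rewrite /dZ !mxE. Qed.

Lemma dZ_mom_shift a s t : 0 <= s -> s <= t -> mom (dZ a 0 (t - s)) -> mom (dZ a s t).
Proof.
move=> s0 st; have ts0 : 0 <= t - s by rewrite subr_ge0.
have -> : dZ a s t = (fun M : 'cV[R]_r => M a 0) \o (fun w => Z t w - Z s w).
  by apply/funext => w; rewrite entryE.
have -> : dZ a 0 (t - s) = (fun M : 'cV[R]_r => M a 0) \o (fun w => Z (t - s) w - Z 0 w).
  by apply/funext => w; rewrite entryE.
apply: same_law_mom.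
- exact: Zinc_meas.
- by apply: Zinc_meas => //; apply: le_trans st.
- by move=> B mB; rewrite [RHS]Zinc_law.
- exact: measurable_entry.
Qed.

Lemma Z0_ae : {ae P, forall w, Z 0 w = 0}.
Proof. by case: Zlevy. Qed.

Lemma dZ01_mom a : mom (dZ a 0 1).
Proof.
have mz : meas (dZ a 0 1) by exact: dZ_measurable.
split=> // N.
apply/integrableP; split; first by apply/measurable_EFinP/measurable_funX/measurableT_comp.
case: ZR1 => _ _ /(_ N.+1%:R (ltr0Sn _ _)) H.
rewrite unlock in H.
have me0 : meas (fun w => enorm (Z 1 w)).
  rewrite /enorm; apply: (measurableT_comp (continuous_measurable_fun (@sqrt_continuous R))).
  apply: measurable_sum => i; apply: measurable_funX.
  exact: (measurableT_comp (@measurable_entry R r 1 setT i 0) (Z_meas ler01)).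
apply: (@le_lt_trans _ _ (\int[P]_w (1 + enorm (Z 1 w) `^ N.+1%:R)%:E)%E); last first.
  have me : meas (fun w => enorm (Z 1 w) `^ N.+1%:R).
    exact: (measurableT_comp (measurable_powR _) me0).
  under eq_integral do rewrite EFinD.
  rewrite ge0_integralD//; last 2 first.
  - by move=> w _; rewrite lee_fin powR_ge0.
  - exact/measurable_EFinP.
  by rewrite integral_cstP lte_add_pinfty// ltry.
have [A [mA PA NA]] := Z0_ae.
apply: ae_ge0_le_integral => //.
- by apply/measurable_EFinP/measurableT_comp => //; apply/measurable_funX/measurableT_comp.
- by move=> w _; rewrite lee_fin addr_ge0// powR_ge0.
- apply/measurable_EFinP/measurable_funD => //.
  exact: (measurableT_comp (measurable_powR _) me0).
apply: filterS Z0_ae => w Z0 _ /=.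
rewrite lee_fin normrX normr_id /dZ Z0 mxE subr0.
have ea : `|Z 1 w a 0| <= enorm (Z 1 w).
  rewrite -(sqrtr_sqr (Z 1 w a 0)); apply: ler_wsqrtr.
  by rewrite (bigD1 a)//= lerDl sumr_ge0// => i _; exact: sqr_ge0.
rewrite powR_mulrn ?(le_trans _ ea)//.
apply: (le_via (1 + `|Z 1 w a 0| ^+ N.+1)); last first.
  by rewrite lerD2l lerXn2r ?nnegrE ?(le_trans _ ea).
have [x1|x1] := leP `|Z 1 w a 0| 1.
  by apply: (le_via 1); [exact: exprn_ile1|rewrite lerDl exprn_ge0].
apply: (le_via (`|Z 1 w a 0| ^+ N.+1)); last by rewrite lerDr.
by rewrite exprS ler_peMl ?exprn_ge0// ltW.
Qed.

(** On an event where g is bounded, f and the sum differ by a constant at most, and the event is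
    independent of f. This gives moments at all times from those at time 1. *)
Lemma indep_summand_mom (f g : Omega -> R) :
  meas f -> meas g -> indep_rv P f g ->
  mom (fun w => f w + g w) -> mom f.
Proof.
move=> mf mg fg mfg; have fgi := mfg.2; split=> // N.
have mfN : meas (fun w => `|f w| ^+ N).
  exact/measurable_funX/measurableT_comp.
apply/integrableP; split; first exact/measurable_EFinP.
under eq_integral do rewrite gee0_abs ?lee_fin ?exprn_ge0//.
have mB (k : nat) : measurable [set w | `|g w| <= k%:R].
  have := measurableT_comp (@normr_measurable R setT) mg.
  move=> /(_ measurableT `]-oo, k%:R]%classic (measurable_itv _)); rewrite setTI.
  by congr measurable; apply/seteqP; split=> w /=; rewrite in_itv.
have [k Pk] : exists k : nat, P [set w | `|g w| <= k%:R] != 0%E.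
  apply/not_existsP => H.
  have : P (\bigcup_k [set w | `|g w| <= k%:R]) = 0%E.
    apply/negligibleP; first exact: bigcup_measurable.
    apply: negligible_bigcup => k; apply/negligibleP => //.
    by have /negP := H k; rewrite negbK => /eqP.
  rewrite (_ : \bigcup_k _ = setT) ?probability_setT; first by move/eqP; rewrite onee_eq0.
  apply/seteqP; split=> // w _; exists (Num.bound `|g w|) => //=.
  by apply/ltW/archi_boundP.
pose u (x : R) : R := `|x| ^+ N; pose v : R -> R := \1_[set x : R | `|x| <= k%:R].
have mu' : meas u by apply/measurable_funX; exact: normr_measurable.
have mv : meas v.
  apply: measurable_indic; have := @normr_measurable R setT measurableT `]-oo, k%:R]%classic (measurable_itv _).
  by rewrite setTI; congr measurable; apply/seteqP; split=> w /=; rewrite in_itv.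
have := ge0_indep_mean (measurableT_comp mu' mf) (measurableT_comp mv mg)
  (fun w => exprn_ge0 _ (normr_ge0 _)) (fun w => ler0n _ _) (indep_comp mu' mv fg).
have -> : (\int[P]_w ((v \o g) w)%:E = P [set w | (`|g w| <= k%:R)%R])%E.
  transitivity (\int[P]_w (\1_[set w | `|g w| <= k%:R] w)%:E)%E.
    by apply: eq_integral => w _; rewrite /v /= !indicE.
  by rewrite integral_indic// setIT.
have Pf := fin_num_measure P _ (mB k).
rewrite -(fineK Pf); set p := fine _.
have p0 : 0 < p by rewrite fine_gt0// lt0e Pk measure_ge0 ltey_eq Pf.
move=> H.
have bd : (\int[P]_w ((u \o f) w * (v \o g) w)%:E < +oo)%E.
  have := integrableP _ _ _ (fgi N) => -[mm fin].
  apply: (@le_lt_trans _ _ (\int[P]_w (2 ^+ N * (`|f w + g w| ^+ N + k%:R ^+ N))%:E)%E).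
    apply: ge0_le_integral => //.
    - by move=> w _; rewrite lee_fin mulr_ge0 ?exprn_ge0.
    - by apply/measurable_EFinP/measurable_funM; apply: measurableT_comp.
    - apply/measurable_EFinP/measurable_funM => //; apply/measurable_funD => //.
      by move/measurable_EFinP : mm.
    - move=> w _; rewrite lee_fin /u /v /= indicE; case: (boolP (g w \in _)) => gk; last first.
        by rewrite mulr0 mulr_ge0 ?exprn_ge0// addr_ge0 ?exprn_ge0.
      rewrite inE /= in gk; rewrite mulr1; apply: le_trans (exprD_le _ (normr_ge0 _) (ler0n _ _)).
      rewrite lerXn2r ?nnegrE ?addr_ge0//.
      rewrite -{1}(addrK (g w) (f w)); apply: le_trans (ler_normB _ _) _.
      by rewrite lerD2l.
  rewrite mean_fin ?ltry//; apply/momZ/momD; last exact: mom_cst.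
  exact/momX/mom_norm.
move: bd; rewrite H; set I := (\int[P]_w _)%E.
by case: I => [x| |]; rewrite ?ltry ?ltNyr// gt0_mulye ?lte_fin.
Qed.

Lemma dZ0_mom a t : 0 <= t -> mom (dZ a 0 t).
Proof.
move=> t0; have small u : 0 <= u -> u <= 1 -> mom (dZ a 0 u).
  move=> u0 u1; apply: (@indep_summand_mom _ (dZ a u 1)).
  - exact: dZ_measurable.
  - exact: dZ_measurable.
  - have := dZ_indep u0 u1 (dZ_mwrt a (lexx 0) u0 u0 (lexx u)) (@measurable_entry R r 1 setT a 0).
    by rewrite (_ : (fun _ => _) = dZ a u 1)//; apply/funext => w; rewrite entryE.
  - apply: eq_mom (dZ01_mom a) => w; rewrite /dZ; ring.
have [n] : exists n : nat, t <= n%:R.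
  by exists (Num.bound t); apply/ltW/archi_boundP.
elim: n t t0 => [|n IH] t t0 tn.
  by apply: small => //; apply: le_trans tn _.
have [t1|/ltW t1] := leP t 1; first exact: small.
have t10 : 0 <= t - 1 by rewrite subr_ge0.
have t1t : t - 1 <= t by rewrite gerBl.
apply: (@eq_mom _ _ _ _ (fun w => dZ a 0 (t - 1) w + dZ a (t - 1) t w)).
  by move=> w; rewrite /dZ; ring.
apply: momD; first by apply: IH => //; rewrite lerBlDr natr1.
apply: dZ_mom_shift => //; rewrite (_ : t - (t - 1) = 1); last by ring.
exact: dZ01_mom.
Qed.

Lemma dZ_mom a s t : 0 <= s -> s <= t -> mom (dZ a s t).
Proof. by move=> s0 st; apply: dZ_mom_shift => //; apply: dZ0_mom; rewrite subr_ge0. Qed.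

Lemma dZ_mean_shift (g : 'cV[R]_r -> R) (f f' : Omega -> R) s t : 0 <= s -> s <= t ->
  meas g ->
  (forall w, f w = g (Z t w - Z s w)) -> (forall w, f' w = g (Z (t - s) w - Z 0 w)) ->
  mom f -> mean f = mean f'.
Proof.
move=> s0 st mg /funext -> /funext -> mo; have ts0 : 0 <= t - s by rewrite subr_ge0.
apply: (@same_law_mean _ _ _ _ _ _ (fun w => Z t w - Z s w) (fun w => Z (t - s) w - Z 0 w)) => //.
- by apply: Zinc_meas => //; apply: le_trans st.
- exact: Zinc_meas.
- by move=> B mB; exact: Zinc_law.
Qed.

Lemma dZ_shift a q s t : 0 <= s -> s <= t ->
  mean (fun w => dZ a s t w ^+ q) = mean (fun w => dZ a 0 (t - s) w ^+ q).
Proof.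
move=> s0 st; apply: (@dZ_mean_shift (fun M => M a 0 ^+ q) _ _ s t) => //.
- by apply: measurable_funX; exact: measurable_entry.
- by move=> w; rewrite entryE.
- by move=> w; rewrite entryE.
- by apply: momX; exact: dZ_mom.
Qed.

Lemma mean_indep_dZ s t (f : Omega -> R) (g : 'cV[R]_r -> R) (h : Omega -> R) :
  0 <= s -> s <= t -> mwrt (F s) f -> meas g ->
  (forall w, h w = g (Z t w - Z s w)) ->
  mom f -> mom h -> mean (fun w => f w * h w) = mean f * mean h.
Proof. by move=> s0 st mf mg /funext -> *; apply: mean_indep. Qed.

Let mdZ a t := mean (dZ a 0 t).

Lemma mean_dZ_add a s t : 0 <= s -> 0 <= t -> mdZ a (s + t) = mdZ a s + mdZ a t.
Proof.
move=> s0 t0; have sst : s <= s + t by rewrite lerDl.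
rewrite /mdZ (@eq_mean _ _ _ P _ (fun w => dZ a 0 s w + dZ a s (s + t) w)); last first.
  by move=> w; rewrite /dZ; ring.
rewrite meanD; [|exact: dZ_mom|exact: dZ_mom]; congr (_ + _).
have := dZ_shift a 1 s0 sst; rewrite addrAC subrr add0r.
by under eq_fun do rewrite expr1; under [in RHS]eq_fun do rewrite expr1.
Qed.

Lemma mean_dZ01 a : mean (dZ a 0 1) = 0.
Proof.
case: ZR1 => /(_ a); rewrite unlock => H _ _.
rewrite /mean /Rintegral (@ae_eq_integral _ _ _ _ _ (fun w => (Z 1 w a 0)%:E)) ?H//.
- by apply/measurable_EFinP; exact: dZ_measurable.
- by apply/measurable_EFinP; exact: (measurableT_comp (@measurable_entry R r 1 setT a 0) (Z_meas ler01)).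
- by apply: filterS Z0_ae => w Z0 _; rewrite /dZ Z0 mxE subr0.
Qed.

(** Applied to single coordinates and to sums of two of them, this yields variances and, by
    polarization, covariances. *)
Lemma indep_centred_sq_add (g : 'cV[R]_r -> R) (c : R -> R) s t :
  meas g -> (forall x y, g (x + y) = g x + g y) ->
  (forall u, 0 <= u -> mom (fun w => g (Z u w - Z 0 w))) ->
  (forall u, 0 <= u -> mean (fun w => g (Z u w - Z 0 w)) = c u) ->
  (forall u v, 0 <= u -> 0 <= v -> c (u + v) = c u + c v) ->
  0 <= s -> 0 <= t ->
  mean (fun w => (g (Z (s + t) w - Z 0 w) - c (s + t)) ^+ 2) =
  mean (fun w => (g (Z s w - Z 0 w) - c s) ^+ 2) +
  mean (fun w => (g (Z t w - Z 0 w) - c t) ^+ 2).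
Proof.
move=> mg gD gm gc cD s0 t0; have sst : s <= s + t by rewrite lerDl.
have st0 : 0 <= s + t by rewrite addr_ge0.
pose g2 (x : 'cV[R]_r) := g x - c t.
have mg2 : meas g2 by apply: measurable_funB.
have law B : measurable B -> P ((fun w => Z t w - Z 0 w) @^-1` B) =
    P ((fun w => Z (s + t) w - Z s w) @^-1` B).
  by move=> mB; rewrite [RHS]Zinc_law// addrAC subrr add0r.
have mZ1 := Zinc_meas (lexx 0) t0; have mZ2 := Zinc_meas s0 st0.
pose A w := g (Z s w - Z 0 w) - c s.
pose B w := g2 (Z (s + t) w - Z s w).
have mA : mom A by apply: momB; [exact: gm|exact: mom_cst].
have mB' : mom (fun w => g2 (Z t w - Z 0 w)) by apply: momB; [exact: gm|exact: mom_cst].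
have mB : mom B by exact: (same_law_mom mZ1 mZ2 law mg2).
have EB : mean B = 0.
  rewrite -(same_law_mean mZ1 mZ2 law mg2)//.
  rewrite meanB; [|exact: gm|exact: mom_cst].
  by rewrite gc// mean_cst subrr.
have EB2 : mean (fun w => B w ^+ 2) = mean (fun w => g2 (Z t w - Z 0 w) ^+ 2).
  have mg3 : meas (fun x => g2 x ^+ 2) by exact: measurable_funX.
  by apply/esym/(same_law_mean mZ1 mZ2 law mg3)/momX.
have FA : mwrt (F s) A.
  apply: mwrtB; [exact: filt_sigma| |by apply: mwrt_cst; exact: filt_sigma].
  move=> C mC; have mgC : measurable (g @^-1` C) by rewrite -[X in measurable X]setTI; exact: mg.
  have H : measurable_fun (setT : set (g_sigma_algebraType (F s))) (fun w => Z s w - Z 0 w).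
    apply: measurable_mx => i j; rewrite ord1.
    rewrite (_ : (fun _ => _) = dZ i 0 s); last by apply/funext => w; rewrite entryE.
    by apply/mwrtP; [exact: filt_sigma|exact: dZ_mwrt].
  have := H measurableT _ mgC; rewrite setTI /measurable /= sigma_algebra_id//.
  exact: filt_sigma.
rewrite -/g2 -EB2 (@eq_mean _ _ _ P _ (fun w => A w ^+ 2 + B w ^+ 2 + 2 * (A w * B w))); last first.
  move=> w; rewrite /A /B /g2 cD//.
  rewrite (_ : Z (s + t) w - Z 0 w = (Z s w - Z 0 w) + (Z (s + t) w - Z s w)); last first.
    by rewrite [RHS]addrC subrKA.
  rewrite gD; ring.
have mA2 := momX 2 mA; have mB2 := momX 2 mB; have mAB := momM mA mB.
rewrite meanD; [|exact: momD|exact: momZ].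
rewrite meanD// meanZ// (mean_indep_dZ s0 sst FA mg2)// EB mulr0 mulr0 addr0//.
Qed.

Lemma measurable_coord a : meas (fun M : 'cV[R]_r => M a 0).
Proof. exact: measurable_entry. Qed.

Let vdZ a t := mean (fun w => (dZ a 0 t w - mdZ a t) ^+ 2).

Lemma var_dZ_linear a t : 0 <= t -> vdZ a t = t * vdZ a 1.
Proof.
apply: additive_ge0_linear => [s u s0 u0|u _]; last by apply: mean_ge0 => w; exact: sqr_ge0.
have E x : dZ a 0 x = fun w => (fun M : 'cV[R]_r => M a 0) (Z x w - Z 0 w).
  by apply/funext => w; rewrite entryE.
rewrite /vdZ !E.
apply: (@indep_centred_sq_add (fun M : 'cV[R]_r => M a 0) (mdZ a)) => //.
- exact: measurable_coord.
- by move=> x y; rewrite mxE.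
- by move=> x x0; rewrite -E; exact: dZ0_mom.
- by move=> x x0; rewrite -E.
- exact: mean_dZ_add.
Qed.

(** Continuity in probability at 0 follows from the paths being right continuous; it excludes the
    nonmeasurable additive functions as candidates for the mean. *)
Lemma small_dZ a (s : nat -> R) : (forall n, 0 < s n) -> s n @[n --> \oo] --> 0 ->
  mean (fun w => Num.min 1 `|dZ a 0 (s n) w|) @[n --> \oo] --> 0.
Proof.
move=> s0 sc; case: Zlevy => _ _ _ _ Zc.
have mf n : meas (fun w => Num.min 1 `|dZ a 0 (s n) w|).
  apply: measurable_minr => //; apply: measurableT_comp => //.
  exact: (dZ_measurable a (lexx 0) (ltW (s0 n))).
have bd n w : `|Num.min 1 `|dZ a 0 (s n) w| | <= 1.
  by rewrite ger0_norm ?ge_min ?lexx// le_min ler01 /=.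
have pt w : Num.min 1 `|dZ a 0 (s n) w| @[n --> \oo] --> 0.
  have [Zr _] := Zc w.
  have H : Z u w a 0 @[u --> 0^'+] --> Z 0 w a 0.
    apply: (@cvg_comp _ _ _ (fun u => Z u w) (fun M : 'cV[R]_r => M a 0) _ _ _ (Zr 0 (lexx 0))).
    exact: coord_continuous.
  have /cvg_at_rightP /(_ s (conj s0 sc)) Hs := H.
  have H2 : `|dZ a 0 (s n) w| @[n --> \oo] --> 0.
    suff : `|dZ a 0 (s n) w| @[n --> \oo] --> `|Z 0 w a 0 - Z 0 w a 0|.
      by rewrite subrr normr0.
    by apply: cvg_norm; apply: cvgB; [exact: Hs|exact: cvg_cst].
  apply: (@squeeze_cvgr _ _ _ _ (fun=> 0) (fun n => `|dZ a 0 (s n) w|)) => //; last exact: cvg_cst.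
  by near=> n; rewrite le_min ler01 normr_ge0 /= ge_min lexx orbT.
rewrite (_ : (fun n => mean _) = fun n => fine (\int[P]_w (Num.min 1 `|dZ a 0 (s n) w|)%:E)%E)//.
apply: fine_cvg; rewrite (_ : 0%:E = \int[P]_w (cst 0%E w))%E; last by rewrite integral0.
apply: (@dominated_cvg _ _ _ P setT measurableT
  (fun n w => (Num.min 1 `|dZ a 0 (s n) w|)%:E) (cst 0%E) (cst 1%E)) => //.
- by move=> n; apply/measurable_EFinP; exact: mf.
- by move=> w _; apply: cvg_EFin; [near=> n|exact: pt].
- exact: (mom_integrable (mom_cst P 1)).
- by move=> n w _; rewrite lee_fin; exact: bd.
Unshelve. all: end_near. Qed.

Lemma mean_dZ0 a t : 0 <= t -> mean (dZ a 0 t) = 0.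
Proof.
move=> t0; apply/eqP; rewrite -normr_eq0; apply: contraT => mt.
have mt0 : 0 < `|mdZ a t| by rewrite lt_def mt normr_ge0.
pose k n := Num.trunc (n.+1%:R * t); pose s n : R := (k n).+1%:R / n.+1%:R - t.
have kP n : (k n)%:R <= n.+1%:R * t < (k n).+1%:R by apply: truncn_itv; rewrite mulr_ge0.
have s0 n : 0 < s n.
  by rewrite subr_gt0 ltr_pdivlMr// mulrC; case/andP: (kP n).
have sn n : s n <= n.+1%:R^-1.
  rewrite lerBlDl -natr1 mulrDl mul1r lerD2r ler_pdivrMr// mulrC.
  by case/andP: (kP n).
have sc : s n @[n --> \oo] --> 0.
  apply: (@squeeze_cvgr _ _ _ _ (fun=> 0) (fun n => n.+1%:R^-1)); last first.
  - exact: cvg_harmonic.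
  - exact: cvg_cst.
  - by near=> n; rewrite (ltW (s0 n)) sn.
have ms n : mdZ a (s n) = - mdZ a t.
  have inv0 : 0 <= n.+1%:R^-1 :> R by rewrite invr_ge0.
  have mn : mdZ a n.+1%:R^-1 = 0.
    have := additive_natmul (mean_dZ_add a) n.+1 inv0.
    rewrite mulfV// /mdZ mean_dZ01 => /esym/eqP; rewrite mulf_eq0 pnatr_eq0 /= => /eqP; exact.
  have := additive_natmul (mean_dZ_add a) (k n).+1 inv0.
  rewrite mn mulr0; have -> : (k n).+1%:R / n.+1%:R = s n + t by rewrite /s subrK.
  by rewrite (mean_dZ_add a (ltW (s0 n)) t0) => /eqP; rewrite addr_eq0 => /eqP.
pose c := Num.min 1 `|mdZ a t|; have c0 : 0 < c by rewrite lt_min ltr01.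
have key n : c / 2 <= mean (fun w => Num.min 1 `|dZ a 0 (s n) w|) + (2 * c)^-1 * vdZ a (s n).
  have mo1 : mom (fun w => Num.min 1 `|dZ a 0 (s n) w|).
    apply: (@mom_bounded _ _ _ _ _ 1).
      apply: measurable_minr => //; apply: measurableT_comp => //.
      exact: (dZ_measurable a (lexx 0) (ltW (s0 n))).
    by move=> w; rewrite ger0_norm ?ge_min ?lexx// le_min ler01 /=.
  have mo2 : mom (fun w => (dZ a 0 (s n) w - mdZ a (s n)) ^+ 2).
    by apply/momX/momB; [apply: dZ0_mom; exact: ltW|exact: mom_cst].
  rewrite -meanZ// -meanD//; last exact: momZ.
  rewrite -(mean_cst P (c / 2)); apply: le_mean.
  - exact: mom_cst.
  - by apply: momD => //; exact: momZ.
  move=> w /=; set z := dZ a 0 (s n) w.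
  have H1 : c <= Num.min 1 `|z| + `|z - mdZ a (s n)|.
    have : `|mdZ a t| <= `|z| + `|z - mdZ a (s n)|.
      rewrite -(normrN (mdZ a t)) -(ms n) -[X in `|X| <= _](subKr z).
      exact: ler_normB.
    by rewrite /c; case: (leP 1 `|z|); case: (leP 1 `|mdZ a t|); have := normr_ge0 (z - mdZ a (s n)); lra.
  have H2 : `|z - mdZ a (s n)| <= c / 2 + (2 * c)^-1 * (z - mdZ a (s n)) ^+ 2.
    have -> : (z - mdZ a (s n)) ^+ 2 = `|z - mdZ a (s n)| ^+ 2 by rewrite real_normK ?num_real.
    set y := `|_|.
    rewrite -subr_ge0 (_ : _ - _ = (y - c) ^+ 2 / (2 * c)); first by rewrite divr_ge0 ?sqr_ge0// mulr_ge0// ltW.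
    by field; rewrite gt_eqF.
  lra.
have Mc := small_dZ a s0 sc.
have Vc : (2 * c)^-1 * vdZ a (s n) @[n --> \oo] --> 0.
  have -> : (fun n => (2 * c)^-1 * vdZ a (s n)) = (fun n => s n * ((2 * c)^-1 * vdZ a 1)).
    by apply/funext => n; rewrite (var_dZ_linear a (ltW (s0 n))) mulrCA.
  by rewrite -[X in _ --> X](mul0r ((2 * c)^-1 * vdZ a 1)); apply: cvgMl.
have : (mean (fun w => Num.min 1 `|dZ a 0 (s n) w|) + (2 * c)^-1 * vdZ a (s n))
    @[n --> \oo] --> (0 + 0 : R) by apply: cvgD.
rewrite [X in _ --> X]addr0; move/cvgrPdist_lt => /(_ (c / 2)); rewrite divr_gt0// => /(_ isT)[N _ /(_ N (leqnn N))] /=.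
rewrite sub0r normrN ltNge => /negP[]; apply: le_trans (key N) (ler_norm _).
Unshelve. all: end_near. Qed.

Lemma mean_dZ a s t : 0 <= s -> s <= t -> mean (dZ a s t) = 0.
Proof.
move=> s0 st; have mo := dZ_mom a s0 st.
have := dZ_shift a 1 s0 st; under eq_fun do rewrite expr1.
under [in X in _ = X -> _]eq_fun do rewrite expr1.
by move=> ->; rewrite mean_dZ0// subr_ge0.
Qed.

Lemma linear_sq (g : 'cV[R]_r -> R) t :
  meas g -> (forall x y, g (x + y) = g x + g y) ->
  (forall u, 0 <= u -> mom (fun w => g (Z u w - Z 0 w))) ->
  (forall u, 0 <= u -> mean (fun w => g (Z u w - Z 0 w)) = 0) -> 0 <= t ->
  mean (fun w => g (Z t w - Z 0 w) ^+ 2) = t * mean (fun w => g (Z 1 w - Z 0 w) ^+ 2).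
Proof.
move=> mg gD gm g0 t0.
apply: (@additive_ge0_linear _ (fun t => mean (fun w => g (Z t w - Z 0 w) ^+ 2))) => //.
  move=> s u s0 u0.
  have := @indep_centred_sq_add g (fun=> 0) s u mg gD gm g0 _ s0 u0.
  rewrite (_ : (fun w => (_ - _) ^+ 2) = fun w => g (Z (s + u) w - Z 0 w) ^+ 2); last first.
    by apply/funext => w; rewrite subr0.
  rewrite (_ : (fun w => (_ - _) ^+ 2) = fun w => g (Z s w - Z 0 w) ^+ 2); last first.
    by apply/funext => w; rewrite subr0.
  rewrite (_ : (fun w => (_ - _) ^+ 2) = fun w => g (Z u w - Z 0 w) ^+ 2); last first.
    by apply/funext => w; rewrite subr0.
  by apply=> *; rewrite addr0.
by move=> u u0; apply: mean_ge0 => w; exact: sqr_ge0.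
Qed.

Lemma mean_dZdZ01 a b : mean (fun w => dZ a 0 1 w * dZ b 0 1 w) = (a == b)%:R.
Proof.
case: ZR1 => _ /(_ a b) + _; rewrite unlock => H.
rewrite /mean /Rintegral (@ae_eq_integral _ _ _ _ _ (fun w => (Z 1 w a 0 * Z 1 w b 0)%:E)) ?H//.
- by apply/measurable_EFinP/measurable_funM; exact: dZ_measurable.
- by apply/measurable_EFinP/measurable_funM;
  exact: (measurableT_comp (@measurable_entry R r 1 setT _ 0) (Z_meas ler01)).
- by apply: filterS Z0_ae => w Z0 _; rewrite /dZ Z0 !mxE !subr0.
Qed.

Lemma mean_dZdZ0_linear a b t : 0 <= t ->
  mean (fun w => dZ a 0 t w * dZ b 0 t w) = t * (a == b)%:R.
Proof.
move=> t0.
have E1 c u w : (Z u w - Z 0 w) c 0 = dZ c 0 u w by rewrite entryE.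
have L c : mean (fun w => dZ c 0 t w ^+ 2) = t * mean (fun w => dZ c 0 1 w ^+ 2).
  have E u : (fun w => dZ c 0 u w ^+ 2) = fun w => (Z u w - Z 0 w) c 0 ^+ 2.
    by apply/funext => w; rewrite E1.
  rewrite !E; apply: (linear_sq (measurable_coord c)) => // [x y|u u0|u u0]; first by rewrite mxE.
    by under eq_fun do rewrite E1; exact: dZ0_mom.
  by under eq_fun do rewrite E1; exact: mean_dZ0.
have La := L a; have Lb := L b.
have Lab : mean (fun w => (dZ a 0 t w + dZ b 0 t w) ^+ 2) =
    t * mean (fun w => (dZ a 0 1 w + dZ b 0 1 w) ^+ 2).
  have E u : (fun w => (dZ a 0 u w + dZ b 0 u w) ^+ 2) =
      fun w => ((Z u w - Z 0 w) a 0 + (Z u w - Z 0 w) b 0) ^+ 2.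
    by apply/funext => w; rewrite !E1.
  rewrite !E; apply: (@linear_sq (fun M : 'cV[R]_r => M a 0 + M b 0) t) => // [|x y|u u0|u u0].
  - exact: measurable_funD (measurable_coord a) (measurable_coord b).
  - by rewrite !mxE; ring.
  - by under eq_fun do rewrite !E1; apply: momD; exact: dZ0_mom.
  - under eq_fun do rewrite !E1; rewrite meanD; [|exact: dZ0_mom|exact: dZ0_mom].
    by rewrite !mean_dZ0// addr0.
have X u : 0 <= u -> mean (fun w => (dZ a 0 u w + dZ b 0 u w) ^+ 2) =
    mean (fun w => dZ a 0 u w ^+ 2) + mean (fun w => dZ b 0 u w ^+ 2) +
    2 * mean (fun w => dZ a 0 u w * dZ b 0 u w).
  move=> u0; have ma := dZ0_mom a u0; have mb := dZ0_mom b u0.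
  rewrite -meanZ; last exact: momM.
  rewrite -meanD; [|exact: momX|exact: momX].
  rewrite -meanD; [|by apply: momD; exact: momX|by apply: momZ; exact: momM].
  by apply: eq_mean => w; ring.
have X1 := X _ ler01; rewrite (mean_dZdZ01 a b) in X1.
have := X _ t0; rewrite Lab La Lb X1; lra.
Qed.

Lemma mean_dZdZ a b s t : 0 <= s -> s <= t ->
  mean (fun w => dZ a s t w * dZ b s t w) = (t - s) * (a == b)%:R.
Proof.
move=> s0 st; have ts0 : 0 <= t - s by rewrite subr_ge0.
rewrite -mean_dZdZ0_linear//.
have mg : meas (fun M : 'cV[R]_r => M a 0 * M b 0).
  by apply: measurable_funM; exact: measurable_coord.
apply: (dZ_mean_shift s0 st mg) => [w|w|]; rewrite ?entryE//.
by apply: momM; exact: dZ_mom.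
Qed.

Let momq a q t := mean (fun w => dZ a 0 t w ^+ q).

(** By independence of the increments and the vanishing of their means. *)
Lemma even_moment_superadditive a k q s t : q = (2 * k.+2)%N -> 0 <= s -> 0 <= t ->
  momq a q s + momq a q t <= momq a q (s + t).
Proof.
move=> qE s0 t0; have sst : s <= s + t by rewrite lerDl.
pose A := dZ a 0 s; pose B := dZ a s (s + t).
have mA : mom A := dZ0_mom a s0.
have mB : mom B := dZ_mom a s0 sst.
have EX n : mean (fun w => A w ^+ n * B w) = 0.
  have FA : mwrt (F s) (fun w => A w ^+ n) by apply: mwrtX; exact: dZ_mwrt.
  have HB w : B w = (fun M : 'cV[R]_r => M a 0) (Z (s + t) w - Z s w) by rewrite /B entryE.
  by rewrite (mean_indep_dZ s0 sst FA (measurable_coord a) HB (momX n mA) mB) mean_dZ// mulr0.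
have EY n : mean (fun w => A w * B w ^+ n) = 0.
  have FA : mwrt (F s) A by exact: dZ_mwrt.
  have HB w : B w ^+ n = (fun M : 'cV[R]_r => M a 0 ^+ n) (Z (s + t) w - Z s w) by rewrite /B entryE.
  rewrite (mean_indep_dZ s0 sst FA (measurable_funX n (measurable_coord a)) HB mA (momX n mB)).
  by rewrite mean_dZ// mul0r.
have -> : momq a q t = mean (fun w => B w ^+ q).
  by rewrite /B dZ_shift// addrAC subrr add0r.
have -> : momq a q (s + t) = mean (fun w => (A w + B w) ^+ q).
  by apply: eq_mean => w; congr (_ ^+ _); rewrite /A /B /dZ; ring.
have m1 : mom (fun w => A w ^+ q.-1 * B w) by apply: momM => //; exact: momX.
have m2 : mom (fun w => A w * B w ^+ q.-1) by apply: momM => //; exact: momX.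
apply: (le_via (mean (fun w => A w ^+ q + B w ^+ q +
    q%:R * (A w ^+ q.-1 * B w) + q%:R * (A w * B w ^+ q.-1)))).
  rewrite meanD; [|by do 2 ?apply: momD; (exact: momX || exact: momZ)|exact: momZ].
  rewrite meanD; [|by apply: momD; exact: momX|exact: momZ].
  rewrite meanD; [|exact: momX|exact: momX].
  by rewrite !meanZ// EX EY !mulr0 !addr0.
apply: le_mean => [||w].
- by do 3 ?apply: momD; (exact: momX || exact: momZ).
- by apply: momX; apply: momD.
- exact: even_exprD_ge qE.
Qed.

Lemma even_ge0 k q (x : R) : q = (2 * k)%N -> 0 <= x ^+ q.
Proof. by move=> ->; rewrite exprM exprn_ge0// sqr_ge0. Qed.

(** A superadditive nonnegative function is at most linear on small times: fitting n pieces of the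
    given length into the unit interval bounds n times the moment of a piece by the moment at time
    1. *)
Lemma even_moment_le a k s t : 0 <= s -> s <= t -> t <= s + 1 ->
  mean (fun w => dZ a s t w ^+ (2 * k.+2)) <=
  2 * momq a (2 * k.+2) 1 * (t - s).
Proof.
move=> s0 st ts1; set q := (2 * k.+2)%N; have qE : q = (2 * k.+2)%N by [].
have -> : mean (fun w => dZ a s t w ^+ q) = momq a q (t - s) by exact: dZ_shift.
have [->|ts] := eqVneq t s.
  rewrite subrr mulr0 /momq; under eq_fun do rewrite /dZ subrr qE mulnS expr0n /=.
  by rewrite mean_cst.
have u0 : 0 < t - s by rewrite subr_gt0 lt_neqAle eq_sym ts.
have u1 : t - s <= 1 by lra.
move: (t - s) u0 u1 => u u0 u1.
have mq0 w : 0 <= w -> 0 <= momq a q w by move=> w0; apply: mean_ge0 => x; exact: even_ge0 qE.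
have H n : n%:R * momq a q u <= momq a q (n%:R * u).
  elim: n => [|n IH]; first by rewrite !mul0r mq0.
  rewrite -natr1 !mulrDl !mul1r; apply: le_trans (even_moment_superadditive a qE _ (ltW u0)).
    by rewrite lerD2r.
  by rewrite mulr_ge0// ltW.
have u10 : 0 <= u^-1 by rewrite invr_ge0 ltW.
have /andP[n1 n2] := truncn_itv u10; move: (Num.trunc _) n1 n2 => n n1 n2.
have nu1 : n%:R * u <= 1 by rewrite -ler_pdivlMr// mul1r.
have Hn : n%:R * momq a q u <= momq a q 1.
  apply: le_trans (H n) _.
  have := even_moment_superadditive a qE (_ : 0 <= n%:R * u) (_ : 0 <= 1 - n%:R * u).
  rewrite (_ : n%:R * u + (1 - n%:R * u) = 1); last by ring.
  move=> H1; apply: le_trans (H1 _ _); last 2 first.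
  - by rewrite mulr_ge0// ltW.
  - by rewrite subr_ge0.
  by rewrite lerDl mq0// subr_ge0.
have n12 : u^-1 <= 2 * n%:R.
  have : 1 <= u^-1 by rewrite invf_ge1.
  case: n n1 n2 {nu1 Hn} => [|n] n1 n2 H1; first by have := lt_le_trans n2 H1; rewrite ltxx.
  by apply: (ltW (lt_le_trans n2 _)); rewrite -!natr1 ; have : 0 <= n%:R :> R by []; lra.
have : u^-1 * momq a q u <= 2 * momq a q 1.
  apply: (le_via (2 * n%:R * momq a q u)); first by rewrite ler_wpM2r// mq0 ?ltW.
  by rewrite -mulrA ler_wpM2l.
by rewrite mulrC ler_pdivrMr.
Qed.

(** Jumps make all moments of order at least 2 of the same size t - s: there is no gain from higher
    orders, unlike for Brownian motion. *)
Lemma dZ_moment a i : (2 <= i)%N -> exists2 K, 0 <= K & forall s t,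
  0 <= s -> s <= t -> t <= s + 1 -> mean (fun w => `|dZ a s t w| ^+ i) <= K * (t - s).
Proof.
move=> i2; pose K := 2 * momq a (2 * i.+2) 1.
have K0 : 0 <= K by rewrite mulr_ge0//; apply: mean_ge0 => x; exact: even_ge0.
exists (1 + K) => [|s t s0 st ts]; first by rewrite addr_ge0.
have mo := dZ_mom a s0 st.
apply: (le_via (mean (fun w => dZ a s t w * dZ a s t w + dZ a s t w ^+ (2 * i.+2)))).
  apply: le_mean => [||w].
  - by apply/momX/mom_norm.
  - by apply: momD; [exact: momM|exact: momX].
  rewrite exprM -[X in _ <= _ + X ^+ _]real_normK ?num_real// -exprM -expr2.
  rewrite -[X in _ <= X + _]real_normK ?num_real//.
  have := normr_ge0 (dZ a s t w); move: `|_| => x x0.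
  have [x1|/ltW x1] := leP x 1.
    apply: (le_via (x ^+ 2)); last by rewrite lerDl exprn_ge0.
    exact: ler_wiXn2l.
  apply: (le_via (x ^+ (2 * i.+2))); last by rewrite lerDr exprn_ge0.
  by apply: ler_weXn2l => //; lia.
rewrite meanD; [|exact: momM|exact: momX].
rewrite mean_dZdZ// eqxx mulr1 mulrDl mul1r lerD2l.
exact: even_moment_le.
Qed.

Local Notation PO := (mu_ext P).

(** * Stochastic integrals of elementary integrands *)
Section grid.
Variables (t : nat -> R) (G : nat -> 'I_r -> Omega -> R).
Hypotheses (t0 : 0 <= t 0%N) (tS : forall k, t k <= t k.+1).

Definition gint (m : nat) w := \sum_(k < m) \sum_c G k c w * dZ c (t k) (t k.+1) w.
Definition gvar (m : nat) w := \sum_(k < m) \sum_c G k c w ^+ 2 * (t k.+1 - t k).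

Lemma grid_le i j : (i <= j)%N -> t i <= t j.
Proof.
move=> /subnK <-; elim: (j - i)%N => [|k IH]; first by rewrite add0n.
by rewrite addSn; apply: le_trans IH _.
Qed.

Lemma grid_ge0 i : 0 <= t i.
Proof. by apply: le_trans t0 _; exact: grid_le. Qed.

Lemma gvar_ge0 m w : 0 <= gvar m w.
Proof.
apply: sumr_ge0 => k _; apply: sumr_ge0 => c _.
by rewrite mulr_ge0 ?sqr_ge0// subr_ge0.
Qed.

Hypotheses (GF : forall k c, mwrt (F (t k)) (G k c)) (Gm : forall k c, mom (G k c)).

Lemma grid_dZ_mom k c : mom (dZ c (t k) (t k.+1)).
Proof. by apply: dZ_mom => //; exact: grid_ge0. Qed.

Lemma gint_mom m : mom (gint m).
Proof. by apply: mom_sum => k _; apply: mom_sum => c _; apply: momM => //; exact: grid_dZ_mom. Qed.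

Lemma gvar_mom m : mom (gvar m).
Proof.
apply: mom_sum => k _; apply: mom_sum => c _; apply: momM; first exact: momX.
exact: mom_cst.
Qed.

Lemma gint_mwrt m : mwrt (F (t m)) (gint m).
Proof.
have sg := filt_sigma (grid_ge0 m).
apply: mwrt_sum => // k _; apply: mwrt_sum => // c _; apply: mwrtM => //.
  by apply: (mwrt_filt (grid_ge0 k) _ (GF k c)); apply: grid_le; exact: ltnW.
apply: dZ_mwrt => //; try exact: grid_ge0; apply: grid_le => //.
exact: ltnW.
Qed.

Lemma grid_step_mean k c c' (f : Omega -> R) : mwrt (F (t k)) f -> mom f ->
  mean (fun w => f w * (dZ c (t k) (t k.+1) w * dZ c' (t k) (t k.+1) w)) =
  mean f * ((t k.+1 - t k) * (c == c')%:R).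
Proof.
move=> fF fm; rewrite -(mean_dZdZ c c' (grid_ge0 k) (tS k)).
apply: (mean_indep_dZ (grid_ge0 k) (tS k) (g := fun M => M c 0 * M c' 0)) => //.
- by apply: measurable_funM; exact: measurable_entry.
- by move=> w; rewrite !mxE.
- by apply: momM; exact: grid_dZ_mom.
Qed.

Lemma gint_isometry m : mean (fun w => gint m w ^+ 2) = mean (gvar m).
Proof.
elim: m => [|m IH].
  by apply: eq_mean => w; rewrite /gint /gvar !big_ord0 expr0n.
have dm := grid_dZ_mom m.
pose D w := \sum_c G m c w * dZ c (t m) (t m.+1) w.
have mD : mom D by apply: mom_sum => c _; exact: momM.
have mG := gint_mom m.
have mID : mom (fun w => 2 * (gint m w * D w)) by apply: momZ; exact: momM.
rewrite (@eq_mean _ _ _ P _ (fun w => gint m w ^+ 2 + 2 * (gint m w * D w) + D w ^+ 2)); last first.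
  move=> w; rewrite /gint big_ord_recr /= -/(gint m w) -/(D w); ring.
rewrite (@eq_mean _ _ _ P (gvar _) (fun w => gvar m w + \sum_c G m c w ^+ 2 * (t m.+1 - t m))); last first.
  by move=> w; rewrite /gvar big_ord_recr.
have mV : mom (fun w => \sum_c G m c w ^+ 2 * (t m.+1 - t m)).
  by apply: mom_sum => c _; apply: momM; [exact: momX|exact: mom_cst].
rewrite meanD; [|by apply: momD => //; exact: momX|exact: momX].
rewrite meanD; [|exact: momX|exact: mID].
rewrite meanD; [|exact: gvar_mom|exact: mV].
rewrite IH -addrA; congr (_ + _).
have -> : mean (fun w => 2 * (gint m w * D w)) = 0.
  rewrite meanZ; last exact: momM.
  rewrite (@eq_mean _ _ _ P _ (fun w => \sum_c (gint m w * G m c w) * dZ c (t m) (t m.+1) w)); last first.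
    by move=> w; rewrite /D mulr_sumr; apply: eq_bigr => c _; rewrite mulrA.
  rewrite mean_sum; last by move=> c _; apply: momM => //; exact: momM.
  rewrite big1 ?mulr0// => c _.
  rewrite (mean_indep_dZ (grid_ge0 m) (tS m) (g := fun M => M c 0))//.
  - by rewrite mean_dZ ?mulr0//; exact: grid_ge0.
  - by apply: (mwrtM (filt_sigma (grid_ge0 m))) => //; exact: gint_mwrt.
  - exact: measurable_entry.
  - exact: momM.
rewrite add0r.
rewrite (@eq_mean _ _ _ P _ (fun w => \sum_c \sum_c' (G m c w * G m c' w) *
   (dZ c (t m) (t m.+1) w * dZ c' (t m) (t m.+1) w))); last first.
  move=> w; rewrite expr2 /D mulr_suml; apply: eq_bigr => c _.
  by rewrite mulr_sumr; apply: eq_bigr => c' _; ring.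
rewrite mean_sum; last by move=> c _; apply: mom_sum => c' _; apply: momM; exact: momM.
rewrite mean_sum; last by move=> c _; apply: momM; [exact: momX|exact: mom_cst].
apply: eq_bigr => c _.
rewrite mean_sum; last by move=> c' _; apply: momM; exact: momM.
rewrite (bigD1 c)//= big1 ?addr0 => [|c' c'c]; rewrite grid_step_mean; try exact: momM.
- rewrite eqxx mulr1 mulrC -meanZ; last exact: momM.
  by apply: eq_mean => w; rewrite mulrC expr2.
- exact: (mwrtM (filt_sigma (grid_ge0 m)) (GF m c) (GF m c)).
- by rewrite eq_sym (negbTE c'c) !mulr0.
- exact: (mwrtM (filt_sigma (grid_ge0 m)) (GF m c) (GF m c')).
Qed.

End grid.

(** The integrand is switched off once its accumulated variance, which is known one step ahead,
    exceeds L. The switch is adapted, so the isometry still applies. *)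
Lemma gint_truncate (t : nat -> R) (G : nat -> 'I_r -> Omega -> R) m (L : R) :
  0 <= t 0%N -> (forall k, t k <= t k.+1) ->
  (forall k c, mwrt (F (t k)) (G k c)) -> (forall k c, mom (G k c)) -> 0 <= L ->
  exists J : Omega -> R, [/\ mom J,
    forall w, gvar t G m w <= L -> gint t G m w = J w &
    mean (fun w => J w ^+ 2) <= mean (fun w => Num.min (gvar t G m w) L)].
Proof.
move=> t0 tS GF Gm L0.
pose H k c w := G k c w * \1_[set w | gvar t G k.+1 w <= L] w.
have Vinc w i j : (i <= j)%N -> gvar t G i w <= gvar t G j w.
  move=> /subnK <-; elim: (j - i)%N => [|k IH]; first by rewrite add0n.
  rewrite addSn; apply: le_trans IH _; rewrite /gvar big_ord_recr /= lerDl.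
  by apply: sumr_ge0 => c _; rewrite mulr_ge0 ?sqr_ge0// subr_ge0.
have tg0 := grid_ge0 t0 tS.
have VF k : mwrt (F (t k)) (gvar t G k.+1).
  have sg := filt_sigma (tg0 k).
  apply: mwrt_sum => // i _; apply: mwrt_sum => // c _; apply: mwrtM => //; last exact: mwrt_cst.
  apply: mwrtX; apply: (mwrt_filt (tg0 i) _ (GF i c)).
  by apply: grid_le => //; rewrite -ltnS.
have iF k : mwrt (F (t k)) (\1_[set w | gvar t G k.+1 w <= L] : Omega -> R).
  have sg := filt_sigma (tg0 k).
  apply/mwrtP => //; apply: measurable_indic.
  have := (mwrtP _ sg).1 (VF k) measurableT `]-oo, L]%classic (measurable_itv _).
  by rewrite setTI; congr measurable; apply/seteqP; split=> w /=; rewrite in_itv.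
have HF k c : mwrt (F (t k)) (H k c).
  by apply: (mwrtM (filt_sigma (tg0 k))) => //; exact: iF.
have Hm k c : mom (H k c).
  apply: momM => //; apply: (@mom_bounded _ _ _ _ _ 1).
    exact: (mwrt_filt_measurable (tg0 k)).
  by move=> w; rewrite indicE ger0_norm ?ler0n//; case: (_ \in _).
have ind01 (A : set Omega) w : (\1_A w : R) ^+ 2 <= 1.
  by rewrite indicE; case: (w \in A); rewrite ?expr1n// expr0n.
have HV n w : gvar t H n w <= Num.min (gvar t G n w) L.
  rewrite le_min; apply/andP; split.
    apply: ler_sum => k _; apply: ler_sum => c _; rewrite ler_wpM2r ?subr_ge0//.
    by rewrite /H exprMn ler_piMr ?sqr_ge0// ind01.
  elim: n => [|n IH]; first by rewrite /gvar big_ord0.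
  have [VL|VL] := leP (gvar t G n.+1 w) L.
    apply: le_trans VL; apply: ler_sum => k _; apply: ler_sum => c _.
    rewrite ler_wpM2r ?subr_ge0// /H exprMn ler_piMr ?sqr_ge0// ind01.
  rewrite /gvar big_ord_recr /= [X in _ + X]big1 ?addr0// => c _.
  by rewrite /H indicE memNset ?mulr0 ?expr0n ?mul0r//= => /(lt_le_trans VL); rewrite ltxx.
exists (gint t H m); split; first exact: gint_mom.
  move=> w VL; apply: eq_bigr => k _; apply: eq_bigr => c _; rewrite /H indicE mem_set ?mulr1//=.
  by apply: le_trans VL; apply: Vinc.
rewrite gint_isometry//; apply: le_mean => //; first exact: gvar_mom.
apply: (@mom_bounded _ _ _ _ _ L).
  by apply: measurable_minr => //; apply: mom_measurable; exact: gvar_mom.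
move=> w; rewrite ger0_norm ?ge_min ?lexx ?orbT// le_min L0 gvar_ge0//.
Qed.

(** One summand of a simple integrand with values in the rows: it acts on a single component of the
    driving process, over an interval with an arbitrary right end. Lists of these are stable under
    sums and restrictions, which partitions are not. *)
Record elem := Elem { ea : R; eend : R; ec : 'I_r; exi : Omega -> R }.

HB.instance Definition _ := gen_eqMixin elem.

Definition wf_elem (e : elem) := [/\ 0 <= ea e, ea e <= eend e, mwrt (F (ea e)) (exi e) & mom (exi e)].

Definition elem_int (l : seq elem) w := \sum_(e <- l) exi e w * dZ (ec e) (ea e) (eend e) w.

Definition elem_val (l : seq elem) (c : 'I_r) (u : R) w :=
  \sum_(e <- l) ((ec e == c) && (ea e < u <= eend e))%:R * exi e w.

Definition elem_sq (l : seq elem) w (u : R) := \sum_c elem_val l c u w ^+ 2.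

Lemma telescope_sorted (s : seq R) (f : R -> R) (a b : R) : sorted <%R s ->
  a \in s -> b \in s -> a <= b ->
  f b - f a = \sum_(k < (size s).-1) ((a <= s`_k) && (s`_k.+1 <= b))%:R * (f s`_k.+1 - f s`_k).
Proof.
move=> ss ia ib ab.
pose i := index a s; pose j := index b s.
have si : s`_i = a by apply: nth_index.
have sj : s`_j = b by apply: nth_index.
have is_ : (i < size s)%N by rewrite index_mem.
have js : (j < size s)%N by rewrite index_mem.
have us : uniq s by apply: (lt_sorted_uniq ss).
have ij : (i <= j)%N.
  rewrite leqNgt; apply/negP => ji.
  have := lt_sorted_ltn_nth 0 ss; move=> /(_ j i js is_); rewrite ji si sj.
  by rewrite ltNge ab.
have cond k : (k < (size s).-1)%N -> (a <= s`_k) && (s`_k.+1 <= b) = ((i <= k) && (k < j))%N.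
  move=> ks; have ks1 : (k.+1 < size s)%N by rewrite -ltn_predRL.
  rewrite -si -sj (lt_sorted_leq_nth 0 ss) ?inE ?(ltnW ks1)//.
  by rewrite (lt_sorted_leq_nth 0 ss) ?inE.
transitivity (\sum_(i <= k < j) (f s`_k.+1 - f s`_k)).
  by rewrite telescope_sumr// si sj.
rewrite -(big_mkord xpredT (fun k => ((a <= s`_k) && (s`_k.+1 <= b))%:R * (f s`_k.+1 - f s`_k))).
have jn : (j <= (size s).-1)%N by rewrite -ltnS prednK// (leq_trans _ js).
have in_ := leq_trans ij jn.
rewrite [RHS](big_cat_nat (n := i))//= [X in _ = X + _]big_nat [X in _ = X + _]big1 ?add0r => [|k /andP[_ ki]]; last first.
  by rewrite cond ?(leq_trans ki)// leqNgt ki mul0r.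
rewrite [RHS](big_cat_nat (n := j))//= [X in _ = _ + X]big_nat [X in _ = _ + X]big1 ?addr0 => [|k /andP[jk ks]]; last first.
  by rewrite cond// (ltnNge k) jk andbF mul0r.
rewrite big_nat [RHS]big_nat; apply: eq_bigr => k /andP[ik kj].
by rewrite cond ?ik ?kj ?mul1r// (leq_trans kj).
Qed.

Lemma measurable_set_ge (f : Omega -> R) c : meas f ->
  measurable [set w | c <= f w].
Proof.
move=> mf; have := mf measurableT `[c, +oo[%classic (measurable_itv _).
by rewrite setTI; congr measurable; apply/seteqP; split=> w /=; rewrite in_itv /= andbT.
Qed.

Lemma mom_indic (A : set Omega) : measurable A -> mom (\1_A).
Proof.
move=> mA; apply: (@mom_bounded _ _ _ _ _ 1); first exact: measurable_indic.
by move=> w; rewrite indicE ger0_norm ?ler0n//; case: (_ \in _).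
Qed.

Lemma mean_indic (A : set Omega) : measurable A -> mean (\1_A) = fine (P A).
Proof. by move=> mA; rewrite /mean /Rintegral integral_indic// setIT. Qed.

Lemma measurable_itvoc (a b : R) : meas (fun u : R => ((a < u <= b)%R)%:R : R).
Proof.
rewrite (_ : (fun _ => _) = \1_(`]a, b]%classic)); first exact: measurable_indic.
apply/funext => u; rewrite indicE; congr (_%:R); congr nat_of_bool.
by apply/idP/idP; rewrite inE /= in_itv.
Qed.

Lemma elem_val_measurable l c w : meas (fun u => elem_val l c u w).
Proof.
apply: measurable_sum => e; apply: measurable_funM => //.
case: (ec e == c) => /=; first exact: measurable_itvoc.
exact: measurable_cst.
Qed.

Lemma elem_sq_measurable l w : meas (elem_sq l w).
Proof. by apply: measurable_sum => c; apply: measurable_funX; exact: elem_val_measurable. Qed.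

Lemma elem_sq_ge0 l w u : 0 <= elem_sq l w u.
Proof. by apply: sumr_ge0 => c _; exact: sqr_ge0. Qed.

Lemma step_integral (t : nat -> R) (f : R -> R) (a : nat -> R) m :
  (forall k, t k <= t k.+1) -> meas f -> (forall u, 0 <= f u) ->
  (forall k u, (k < m)%N -> t k < u <= t k.+1 -> f u = a k) ->
  (\int[leb]_(u in `]t 0%N, t m]) (f u)%:E =
   (\sum_(k < m) a k * (t k.+1 - t k))%:E)%E.
Proof.
move=> tS mf f0; elim: m => [|m IH] fa.
  by rewrite set_itvoc0 integral_set0 big_ord0.
have t0m : t 0%N <= t m by elim: (m) => // k; move/le_trans; apply.
rewrite big_ord_recr /= EFinD -IH; last by move=> k u km; apply: fa; exact: ltnW.
have -> : `]t 0%N, t m.+1]%classic = `]t 0%N, t m]%classic `|` `]t m, t m.+1]%classic.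
  by rewrite -itv_bndbnd_setU// bnd_simp.
rewrite ge0_integral_setU//=; last 3 first.
- by apply/measurable_EFinP; apply: measurable_funTS.
- by move=> u _; rewrite lee_fin.
- apply/disj_setPS => u [] /=; rewrite !in_itv /= => /andP[_ um] /andP[mu _].
  by have := le_lt_trans um mu; rewrite ltxx.
congr (_ + _)%E.
rewrite (@eq_integral _ _ _ _ _ (cst (a m)%:E)); last first.
  by move=> u; rewrite inE /= in_itv /= => /(fa m u (ltnSn m)) ->.
rewrite integral_cst//= lebesgue_measure_itv /= lte_fin; case: ifPn => [_|]; first by rewrite -EFinB -EFinM.
rewrite -leNgt => tt; have -> : t m.+1 = t m by apply/eqP; rewrite eq_le tt tS.
by rewrite subrr mulr0 mule0.
Qed.

(** Reduction of a list with overlapping intervals to a common grid, on which the isometry is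
    available. *)
Lemma elem_grid (l : seq elem) (T : R) : {in l, forall e, wf_elem e} ->
  {in l, forall e, eend e <= T} -> exists (t : nat -> R) (G : nat -> 'I_r -> Omega -> R) m,
  [/\ 0 <= t 0%N /\ (forall k, t k <= t k.+1),
      (forall k c, mwrt (F (t k)) (G k c)) /\ (forall k c, mom (G k c)),
      forall w, elem_int l w = gint t G m w &
      forall w, ((gvar t G m w)%:E <= \int[leb]_(u in `]0%R, T]) (elem_sq l w u)%:E)%E].
Proof.
move=> wfl lT.
pose s := sort <=%R (undup (0 :: map ea l ++ map eend l)).
have ss : sorted <%R s by rewrite lt_sorted_uniq_le sort_uniq undup_uniq /= sort_le_sorted.
have mem_s x : (x \in s) = (x == 0) || (x \in map ea l ++ map eend l).
  by rewrite mem_sort mem_undup inE.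
have s_ge0 x : x \in s -> 0 <= x.
  rewrite mem_s mem_cat => /orP[/eqP ->//|/orP[] /mapP[e el ->]]; have [e0 ee _ _] := wfl e el => //.
  exact: le_trans e0 ee.
have s0 : (0 < size s)%N by rewrite -has_predT; apply/hasP; exists 0 => //; rewrite mem_s eqxx.
pose m := (size s).-1.
pose t k := if (k <= m)%N then s`_k else s`_m.
have tE k : (k <= m)%N -> t k = s`_k by rewrite /t => ->.
have ms k : (k <= m)%N = (k < size s)%N by rewrite /m -ltnS prednK.
have tS k : t k <= t k.+1.
  rewrite /t; have [km|mk] := leqP k.+1 m.
    rewrite (ltnW km); apply/ltW; apply: (sorted_ltn_nth lt_trans) => //; rewrite ?inE -?ms//.
    exact: ltnW.
  case: ifP => // km; have -> // : k = m by apply/eqP; rewrite eqn_leq km.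
have tmem k : t k \in s.
  by rewrite /t; case: ifP => km; apply: mem_nth; rewrite -ms.
have t0 : 0 <= t 0%N by apply: s_ge0.
pose bb k c e := [&& ec e == c, ea e <= t k & t k.+1 <= eend e].
pose G k c w := \sum_(e <- l) (bb k c e)%:R * exi e w.
have ea_s e : e \in l -> ea e \in s.
  by move=> el; rewrite mem_s mem_cat map_f ?orbT.
have eb_s e : e \in l -> eend e \in s.
  by move=> el; rewrite mem_s mem_cat (map_f eend) ?orbT.
have termF e k c : e \in l -> mwrt (F (t k)) (fun w => (bb k c e)%:R * exi e w).
  move=> el; have [e0 ee eF em] := wfl e el.
  have sg := filt_sigma (s_ge0 _ (tmem k)).
  have [/and3P[_ ek _]|_] := boolP (bb k c e).
    apply: (mwrtM sg); first exact: mwrt_cst.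
    exact: (mwrt_filt e0 ek eF).
  under eq_fun do rewrite mul0r; exact: mwrt_cst.
have GF k c : mwrt (F (t k)) (G k c).
  have sg := filt_sigma (s_ge0 _ (tmem k)).
  rewrite /G; under eq_fun do rewrite big_seq.
  by apply: mwrt_sum => // e el; exact: termF.
have Gm k c : mom (G k c).
  rewrite /G; under eq_fun do rewrite big_seq.
  by apply: mom_sum => e el; apply: momZ; have [] := wfl e el.
exists t, G, m; split => //.
  move=> w; rewrite /gint.
  transitivity (\sum_(k < m) \sum_(e <- l) \sum_c (bb k c e)%:R * exi e w * dZ c (t k) (t k.+1) w); last first.
    by apply: eq_bigr => k _; rewrite exchange_big; apply: eq_bigr => c _; rewrite mulr_suml.
  rewrite exchange_big; apply: eq_big_seq => e el.
  have [e0 ee eF em] := wfl e el.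
  have := telescope_sorted (fun x => Z x w (ec e) 0) ss (ea_s e el) (eb_s e el) ee.
  rewrite -/(dZ (ec e) (ea e) (eend e) w) => ->.
  rewrite mulr_sumr; apply: eq_bigr => k _.
  have km : (k < m)%N by [].
  rewrite (bigD1 (ec e))//= [X in _ = _ + X]big1 ?addr0; last first.
    by move=> c cne; rewrite /bb eq_sym (negbTE cne) /= !mul0r.
  by rewrite /bb eqxx /= !tE ?(ltnW km)// /dZ; ring.
move=> w.
have vals k u : (k < m)%N -> t k < u <= t k.+1 -> elem_sq l w u = \sum_c G k c w ^+ 2.
  move=> km /andP[ku uk]; apply: eq_bigr => c _; congr (_ ^+ 2).
  apply: eq_big_seq => e el; congr (_%:R * _); rewrite /bb; congr (nat_of_bool (_ && _)).
  have kn : (k < size s)%N by rewrite -ms ltnW.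
  have k1n : (k.+1 < size s)%N by rewrite -ms.
  have nthlt x y : (x < size s)%N -> (y < size s)%N -> (s`_x < s`_y) = (x < y)%N.
    by move=> xs ys; rewrite (lt_sorted_ltn_nth 0 ss).
  have nthle x y : (x < size s)%N -> (y < size s)%N -> (s`_x <= s`_y) = (x <= y)%N.
    by move=> xs ys; rewrite (lt_sorted_leq_nth 0 ss).
  have ia : (index (ea e) s < size s)%N by rewrite index_mem ea_s.
  have ib : (index (eend e) s < size s)%N by rewrite index_mem eb_s.
  have na := nth_index 0 (ea_s e el); have nb := nth_index 0 (eb_s e el).
  rewrite !tE ?(ltnW km)// in ku uk *.
  apply/andP/andP => -[h1 h2]; split.
  - have := lt_le_trans h1 uk; rewrite -na nthlt// ltnS => h3.
    by rewrite nthle.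
  - have := lt_le_trans ku h2; rewrite -nb nthlt// => h3.
    by rewrite nthle.
  - exact: le_lt_trans h1 ku.
  - exact: le_trans uk h2.
have -> : (gvar t G m w)%:E = (\int[leb]_(u in `]t 0%N, t m]) (elem_sq l w u)%:E)%E.
  rewrite (step_integral tS (elem_sq_measurable l w) (elem_sq_ge0 l w) vals).
  by congr EFin; apply: eq_bigr => k _; rewrite mulr_suml.
have [m0|m_gt0] := posnP m.
  by rewrite m0 set_itvoc0 integral_set0; apply: integral_ge0 => u _; rewrite lee_fin elem_sq_ge0.
apply: ge0_subset_integral => //.
- by apply/measurable_EFinP; apply: measurable_funTS; exact: elem_sq_measurable.
- by move=> u _; rewrite lee_fin elem_sq_ge0.
apply: subset_itv; first by rewrite bnd_simp.
rewrite bnd_simp.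
have : t m \in s := tmem m.
rewrite mem_s mem_cat => /orP[/eqP tm0|/orP[] /mapP[e el ->]].
- have : t 0%N < t m.
    by rewrite !tE// (lt_sorted_ltn_nth 0 ss)// inE -ms.
  by rewrite tm0 ltNge t0.
- by have [_ ee _ _] := wfl e el; exact: le_trans ee (lT e el).
- exact: lT.
Qed.

Lemma elem_truncate (l : seq elem) (T L : R) : {in l, forall e, wf_elem e} ->
  {in l, forall e, eend e <= T} -> 0 <= L ->
  exists V J : Omega -> R, [/\ mom V /\ mom J,
    forall w, 0 <= V w /\ ((V w)%:E <= \int[leb]_(u in `]0%R, T]) (elem_sq l w u)%:E)%E,
    forall w, V w <= L -> elem_int l w = J w &
    mean (fun w => J w ^+ 2) <= mean (fun w => Num.min (V w) L)].
Proof.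
move=> wfl lT L0; have [t [G [m [[t0 tS] [GF Gm] EI EV]]]] := elem_grid wfl lT.
have [J [mJ JE JV]] := gint_truncate m t0 tS GF Gm L0.
exists (gvar t G m), J; split => //.
- by split => //; exact: gvar_mom.
- by move=> w; split=> //; exact: gvar_ge0.
- by move=> w VL; rewrite EI JE.
Qed.

Lemma PO_cover A (e : R) : 0 < e -> exists B, [/\ measurable B, A `<=` B & (P B <= PO A + e%:E)%E].
Proof.
move=> e0.
have fin : PO A \is a fin_num.
  by rewrite ge0_fin_numE ?PO_ge0// (le_lt_trans (PO_le1 P A))// ltry.
have [_ [F_ [mF AF] <-] Hle] := lb_ereal_inf_adherent e0 fin.
exists (\bigcup_k F_ k); split => //.
  exact: bigcupT_measurable.
apply: le_trans (ltW Hle).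
by apply: measure_sigma_subadditive => //; exact: bigcupT_measurable.
Qed.

(** A Lenglart type inequality: by truncation at a small level the second moment is small, and the
    truncation has an effect with small probability only. *)
Lemma elem_int_vanishes (l : nat -> seq elem) (T : R) (D : nat -> Omega -> \bar R) :
  (forall k, {in l k, forall e, wf_elem e}) -> (forall k, {in l k, forall e, eend e <= T}) ->
  (forall k w, (\int[leb]_(u in `]0%R, T]) (elem_sq (l k) w u)%:E <= D k w)%E) ->
  cvg0_in_prob P D -> forall e, 0 < e -> vanishes (fun k => [set w | e <= `|elem_int (l k) w|]).
Proof.
move=> wfl lT HD Dc e e0 d dd; have d20 : 0 < d / 2 by rewrite divr_gt0.
pose L := e ^+ 2 * (d / 2); have L0 : 0 < L by rewrite mulr_gt0// exprn_gt0.
near=> k.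
have [V [J [[mV mJ] VE IJ JV]]] := elem_truncate (wfl k) (lT k) (ltW L0).
apply: (le_via (PO ([set w | (L%:E <= D k w)%E] `|` [set w | e ^+ 2 <= J w ^+ 2]))).
  apply: PO_le => w /= eI; have [VL|VL] := leP (V w) L; last first.
    left; apply: le_trans (HD k w); apply: le_trans (VE w).2; by rewrite lee_fin ltW.
  right; rewrite -IJ// -[leRHS]real_normK ?num_real//.
  by rewrite lerXn2r ?nnegrE// ltW.
apply: le_trans (PO_U _ _ _) _; rewrite (splitr d) EFinD; apply: leeD.
  near: k; have := Dc L L0.
  move/fine_cvgP => [fn] /cvgrPdist_le /(_ _ d20) H; near=> k.
  have : `|0 - (fine \o (fun n => PO [set w | (L%:E <= D n w)%E])) k| <= d / 2 by near: k.
  rewrite sub0r normrN /= ger0_norm ?fine_ge0 ?PO_ge0// -lee_fin fineK//; near: k; exact: fn.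
have mJ2 := momX 2 mJ.
have mA : measurable [set w | e ^+ 2 <= J w ^+ 2].
  by apply: measurable_set_ge; exact: mom_measurable mJ2.
rewrite PO_measurable// -(fineK (fin_num_measure P _ mA)) lee_fin.
have m1 := mom_indic mA.
rewrite -mean_indic//.
have e2 : 0 < e ^+ 2 by rewrite exprn_gt0.
rewrite -(ler_pM2l e2) -meanZ//.
have mm : mom (fun w => Num.min (V w) L).
  apply: (@mom_bounded _ _ _ _ _ L).
    by apply: measurable_minr => //; exact: mom_measurable mV.
  by move=> w; rewrite ger0_norm ?ge_min ?lexx ?orbT// le_min (ltW L0) (VE w).1.
apply: (le_via (mean (fun w => J w ^+ 2))).
  apply: le_mean => // [|w]; first exact: momZ.
  rewrite indicE; case: (boolP (w \in _)) => [|_]; last by rewrite mulr0 sqr_ge0.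
  by rewrite inE /= mulr1.
apply: le_trans JV _; apply: (le_via (mean (cst L))); last by rewrite mean_cst.
by apply: le_mean; [exact: mm|exact: mom_cst|move=> w; rewrite ge_min lexx orbT].
Unshelve. all: end_near. Qed.

(** The second moments of the approximating integrals need not converge. Truncating the accumulated
    variance at a high level bounds the mean of min(J^2, M), uniformly in M. *)
Lemma ito_limit (l : nat -> seq elem) (T : R) (D : nat -> Omega -> \bar R)
  (J : Omega -> R) (V : Omega -> \bar R) :
  (forall k, {in l k, forall e, wf_elem e}) -> (forall k, {in l k, forall e, eend e <= T}) ->
  meas J -> meas V -> (forall w, (0 <= V w)%E) ->
  (forall k w, (0 <= D k w)%E) ->
  (forall k w, (\int[leb]_(u in `]0%R, T]) (elem_sq (l k) w u)%:E
     <= 2%:E * V w + 2%:E * D k w)%E) ->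
  cvg0_in_prob P D ->
  (forall e, 0 < e -> vanishes (fun k => [set w | e <= `|J w - elem_int (l k) w|])) ->
  (\int[P]_w (J w ^+ 2)%:E <= 4%:E * \int[P]_w V w)%E.
Proof.
move=> wfl lT mJ mV V0 D0 HV Dc IJ.
have EV0 : (0 <= \int[P]_w V w)%E by apply: integral_ge0.
have [/eqP EVoo|EVfin] := eqVneq (\int[P]_w V w)%E +oo%E.
  by move/eqP: EVoo => ->; rewrite gt0_muley ?lte_fin// leey.
have {EVfin} EVfin : (\int[P]_w V w)%E \is a fin_num.
  by rewrite ge0_fin_numE// ltey.
pose v := fine (\int[P]_w V w)%E.
have vE : (\int[P]_w V w)%E = v%:E by rewrite fineK.
have v0 : 0 <= v by rewrite fine_ge0.
have minb (f : Omega -> R) (M : R) : meas f -> (forall w, 0 <= f w) -> 0 <= M ->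
    mom (fun w => Num.min (f w) M).
  move=> mf f0 M0; apply: (@mom_bounded _ _ _ _ _ M); first exact: measurable_minr.
  by move=> w; rewrite ger0_norm ?ge_min ?lexx ?orbT// le_min M0 f0.
have key M : 0 <= M -> mean (fun w => Num.min (J w ^+ 2) M) <= 4 * v.
  move=> M0; apply/ler_addgt0Pr => eta eta0.
  pose L := 2 * (M + 1) * (v + 1) / eta.
  have L0 : 0 < L by rewrite divr_gt0// !mulr_gt0// ltr_pwDr.
  pose Q := 6 + 4 * (2 * L + 2) + 4 * M.
  have Q0 : 0 < Q by rewrite /Q; lra.
  pose eps := Num.min 1 (eta / (2 * Q)).
  have e0 : 0 < eps by rewrite lt_min ltr01 divr_gt0// mulr_gt0.
  have e1 : eps <= 1 by rewrite ge_min lexx.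
  have eQ : eps * Q <= eta / 2.
    rewrite -ler_pdivlMr//; apply: (le_via (eta / (2 * Q))); first by rewrite ge_min lexx orbT.
    by apply: eq_ler; field; rewrite gt_eqF.
  have ML : M / L * v <= eta / 2.
    rewrite (_ : M / L * v = (M * v) / (2 * ((M + 1) * (v + 1))) * eta); last first.
      by rewrite /L; field; rewrite !gt_eqF//= ; lra.
    rewrite mulrC ler_pM2l// ler_pdivrMr; last by rewrite !mulr_gt0//; lra.
    by nra.
  pose L' := 2 * L + 2 * eps.
  have L'0 : 0 <= L' by rewrite /L'; lra.
  have LL' : L <= L' by rewrite /L'; lra.
  have [k [Ak Bk]] : exists k, (PO [set w | (eps <= `|J w - elem_int (l k) w|)%R] <= eps%:E)%E /\
      (PO [set w | (eps%:E <= D k w)%E] <= eps%:E)%E.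
    have H1 := IJ eps e0 eps e0.
    have H2 : \forall n \near \oo, (PO [set w | (eps%:E <= D n w)%E] <= eps%:E)%E.
      have := Dc eps e0.
      move/fine_cvgP => [fn] /cvgrPdist_le /(_ _ e0) H; near=> n.
      have : `|0 - (fine \o (fun n => PO [set w | (eps%:E <= D n w)%E])) n| <= eps by near: n.
      rewrite sub0r normrN /= ger0_norm ?fine_ge0 ?PO_ge0// -lee_fin fineK//; near: n; exact: fn.
    have [N _ HN] := filterI H1 H2.
    by exists N; exact: (HN N (leqnn N)).
  have [A [mA subA PA]] := PO_cover [set w | (eps <= `|J w - elem_int (l k) w|)%R] e0.
  have [B [mB subB PB]] := PO_cover [set w | (eps%:E <= D k w)%E] e0.
  have PA2 : fine (P A) <= 2 * eps.
    rewrite -lee_fin fineK ?fin_num_measure//; apply: le_trans PA _.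
    by rewrite mulr_natl mulr2n EFinD leeD2r.
  have PB2 : fine (P B) <= 2 * eps.
    rewrite -lee_fin fineK ?fin_num_measure//; apply: le_trans PB _.
    by rewrite mulr_natl mulr2n EFinD leeD2r.
  clear PA PB Ak Bk.
  have [Vk [J' [[mVk mJ'] VE IJ' JV]]] := elem_truncate (wfl k) (lT k) L'0.
  pose Vm w := fine (mine (V w) L'%:E).
  have VmE w : (Vm w)%:E = mine (V w) L'%:E.
    rewrite /Vm fineK// ge0_fin_numE; last by rewrite le_min V0 lee_fin.
    by rewrite gt_min ltry orbT.
  have Vm0 w : 0 <= Vm w by rewrite -lee_fin VmE le_min V0 lee_fin.
  have VmL w : Vm w <= L' by rewrite -lee_fin VmE ge_min lexx orbT.
  have mVm : mom Vm.
    apply: (@mom_bounded _ _ _ _ _ L'); last by move=> w; rewrite ger0_norm.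
    apply: measurableT_comp; first exact: fine_measurable.
    by apply: measurable_mine.
  have EVm : mean Vm <= v.
    rewrite -lee_fin -vE -mean_fin//; apply: ge0_le_integral => //.
    - by move=> w _; rewrite lee_fin.
    - by apply/measurable_EFinP; exact: mom_measurable mVm.
    - by move=> w _; rewrite VmE ge_min lexx.
  have mmk := minb Vk L' (mom_measurable mVk) (fun w => (VE w).1) L'0.
  have H1 : mean (fun w => Num.min (Vk w) L') <= 2 * v + 2 * eps + L' * (2 * eps).
    apply: (le_via (mean (fun w => 2 * Vm w + 2 * eps + L' * \1_B w))).
      apply: le_mean => // [|w].
        apply: momD; last by apply: momZ; exact: mom_indic.
        by apply: momD; [exact: momZ|exact: mom_cst].
      rewrite indicE; case: (boolP (w \in B)) => [_|wB].
        rewrite mulr1; apply: ler_wpDl; last by rewrite ge_min lexx orbT.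
        by rewrite addr_ge0// mulr_ge0// ltW.
      rewrite mulr0 addr0.
      have Dw : (D k w < eps%:E)%E.
        rewrite ltNge; apply: contra wB => h; rewrite inE; exact: subB.
      have VV : ((Vk w)%:E <= 2%:E * V w + 2%:E * eps%:E)%E.
        apply: le_trans (VE w).2 _; apply: le_trans (HV k w) _.
        by rewrite leeD2l// lee_wpmul2l// ltW.
      rewrite -lee_fin EFinD EFinM VmE.
      have [VL|VL] := leP (V w) L'%:E.
        by apply: le_trans VV; rewrite lee_fin ge_min lexx.
      rewrite -EFinM -EFinD lee_fin.
      apply: (le_via L'); first by rewrite ge_min lexx orbT.
      by rewrite mulr_natl mulr2n -addrA lerDl addr_ge0// mulr_ge0// ltW.
    rewrite meanD; [|by apply: momD; [exact: momZ|exact: mom_cst]|by apply: momZ; exact: mom_indic].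
    rewrite meanD; [|exact: momZ|exact: mom_cst].
    rewrite (meanZ _ mVm) (meanZ _ (mom_indic mB)) mean_indic// mean_cst lerD//; last by rewrite ler_wpM2l.
    by rewrite lerD2r ler_wpM2l.
  have mJ2 := momX 2 mJ'.
  apply: (le_via (mean (fun w => 2 * J' w ^+ 2 + 2 * eps ^+ 2 +
      M * (\1_A w + \1_B w) + M / L * Vm w))).
    apply: le_mean => [||w].
    - by apply: minb => //; [exact: measurable_funX|move=> w; exact: sqr_ge0].
    - by apply: momD; [apply: momD; [apply: momD; [exact: momZ|exact: mom_cst]|apply/momZ/momD; exact: mom_indic]|exact: momZ].
    have ML0 : 0 <= M / L * Vm w by rewrite !mulr_ge0// invr_ge0 ltW.
    have J20 : 0 <= 2 * J' w ^+ 2 + 2 * eps ^+ 2 by rewrite addr_ge0// mulr_ge0// sqr_ge0.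
    have mM : Num.min (J w ^+ 2) M <= M by rewrite ge_min lexx orbT.
    rewrite !indicE; case: (boolP (w \in A)) => wA; first by case: (w \in B) => /=; lra.
    case: (boolP (w \in B)) => wB; first by rewrite /=; lra.
    rewrite /= addr0 mulr0 addr0.
    have [VL|VL] := leP L (Vm w).
      have : M <= M / L * Vm w by rewrite -mulrA ler_peMr// mulrC ler_pdivlMr// mul1r.
      lra.
    have Aw : `|J w - elem_int (l k) w| < eps.
      rewrite ltNge; apply: contra wA => h; rewrite inE; exact: subA.
    have Dw : (D k w < eps%:E)%E.
      rewrite ltNge; apply: contra wB => h; rewrite inE; exact: subB.
    have VwL : (V w < L%:E)%E.
      move: VL; rewrite -lte_fin VmE; case: (leP (V w) L'%:E) => // _.
      by rewrite lte_fin ltNge LL'.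
    have VkL : Vk w <= L'.
      rewrite -lee_fin; apply: le_trans (VE w).2 _; apply: le_trans (HV k w) _.
      rewrite (_ : L'%:E = 2%:E * L%:E + 2%:E * eps%:E)%E; last by rewrite -!EFinM -EFinD.
      by apply: leeD; apply: lee_wpmul2l; rewrite ?lee_fin//; exact: ltW.
    clear Dw VwL; rewrite IJ'// in Aw.
    have : J w ^+ 2 <= 2 * J' w ^+ 2 + 2 * eps ^+ 2.
      have : (J w - J' w) ^+ 2 <= eps ^+ 2.
        by rewrite -[leLHS]real_normK ?num_real// lerXn2r ?nnegrE// ltW.
      have := sqr_ge0 (J' w + J' w - J w); rewrite !expr2; nra.
    have : Num.min (J w ^+ 2) M <= J w ^+ 2 by rewrite ge_min lexx.
    lra.
  rewrite meanD; [|by apply: momD; [apply: momD; [exact: momZ|exact: mom_cst]|apply/momZ/momD; exact: mom_indic]|exact: momZ].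
  rewrite meanD; [|by apply: momD; [exact: momZ|exact: mom_cst]|apply/momZ/momD; exact: mom_indic].
  rewrite meanD; [|exact: momZ|exact: mom_cst].
  rewrite (meanZ _ mJ2) (meanZ M (momD (mom_indic mA) (mom_indic mB))) (meanZ _ mVm).
  rewrite meanD; [|exact: mom_indic|exact: mom_indic].
  rewrite !mean_indic// mean_cst.
  have B1 : M * (fine (P A) + fine (P B)) <= M * (4 * eps) by rewrite ler_wpM2l//; lra.
  have B2 : M / L * mean Vm <= M / L * v by rewrite ler_wpM2l// divr_ge0// ltW.
  have B3 : eps ^+ 2 <= eps by rewrite expr2 ler_piMl// ltW.
  have B4 : L' * eps <= (2 * L + 2) * eps by rewrite ler_wpM2r ?(ltW e0)// /L'; lra.
  move: eQ; rewrite /Q; lra.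
rewrite vE -EFinM.
pose g n w := (Num.min (J w ^+ 2) n%:R)%:E.
have mg n : meas (g n).
  by apply/measurable_EFinP/measurable_minr => //; exact: measurable_funX.
have g0 n w : setT w -> (0 <= g n w)%E by rewrite lee_fin le_min sqr_ge0 ler0n.
have ndg w : setT w -> {homo g ^~ w : n m / (n <= m)%N >-> (n <= m)%E}.
  move=> _ n m nm; rewrite lee_fin le_min ge_min lexx /= ge_min.
  by rewrite (ler_nat R n m) nm orbT.
have limg w : limn (g ^~ w) = (J w ^+ 2)%:E.
  apply: cvg_lim => //; apply: cvg_near_cst; near=> n.
  rewrite /g min_l//; apply: (le_via (Num.bound (J w ^+ 2))%:R).
    by apply/ltW/archi_boundP; exact: sqr_ge0.
  by rewrite ler_nat; near: n; exact: nbhs_infty_ge.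
rewrite (eq_integral (fun w => limn (g ^~ w))); last by move=> w _; rewrite limg.
rewrite monotone_convergence//.
apply: lime_le.
  apply: ereal_nondecreasing_is_cvgn => n m nm; apply: ge0_le_integral => //.
  - by move=> w _; exact: g0.
  - by move=> w _; apply: ndg.
near=> n; rewrite mean_fin; first by rewrite lee_fin; exact: key.
by apply: minb => //; [exact: measurable_funX|move=> w; exact: sqr_ge0].
Unshelve. all: end_near. Qed.

(** * Martingale transforms *)
Lemma mart_diff_sq (t : nat -> R) (Y : nat -> Omega -> R) n : 0 <= t 0%N -> (forall j, t j <= t j.+1) ->
  (forall j, mom (Y j)) -> (forall j, mwrt (F (t j.+1)) (Y j)) ->
  (forall j f, mwrt (F (t j)) f -> mom f -> mean (fun w => f w * Y j w) = 0) ->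
  mean (fun w => (\sum_(j < n) Y j w) ^+ 2) = \sum_(j < n) mean (fun w => Y j w ^+ 2).
Proof.
move=> t0 tS mY YF Y0; have tj0 j : 0 <= t j by elim: j => // j IH; exact: le_trans IH (tS j).
elim: n => [|n IH].
  by rewrite big_ord0 -[RHS](mean_cst P 0); apply: eq_mean => w; rewrite big_ord0 expr0n.
have mS : mom (fun w => \sum_(j < n) Y j w) by apply: mom_sum.
have SF : mwrt (F (t n)) (fun w => \sum_(j < n) Y j w).
  apply: mwrt_sum; first exact: (filt_sigma (tj0 n)).
  move=> j _; apply: (mwrt_filt (tj0 j.+1) _ (YF j)).
  by have := ltn_ord j; move: (nat_of_ord j) => k; elim: n {IH mS j} => // n IH; rewrite ltnS leq_eqVlt => /orP[/eqP ->//|/IH h]; exact: le_trans h (tS n).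
rewrite big_ord_recr /= -IH -[LHS]addr0.
have E : mean (fun w => (\sum_(j < n.+1) Y j w) ^+ 2) =
  mean (fun w => ((\sum_(j < n) Y j w) ^+ 2 + 2 * ((\sum_(j < n) Y j w) * Y n w)) + Y n w ^+ 2).
  by apply: eq_mean => w; rewrite big_ord_recr /=; ring.
rewrite addr0 E meanD; last 2 first.
- by apply: momD; [exact: momX|apply: momZ; exact: momM].
- exact: momX.
rewrite meanD; last 2 first.
- exact: momX.
- by apply: momZ; exact: momM.
rewrite meanZ; last exact: momM.
by rewrite Y0// mulr0 addr0.
Qed.

(** The products of increments minus their means are martingale differences, whose variances are of
    order h by the fourth moments of the increments. *)
Lemma dZ_cross_sq : exists2 K, 0 <= K & forall (h : R) n (G : nat -> Omega -> R) M (a b : 'I_r),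
  0 <= h -> h <= 1 ->
  (forall j, mwrt (F (j%:R * h)) (G j)) -> (forall j, mom (G j)) ->
  (forall j, mean (fun w => G j w ^+ 2) <= M) ->
  mean (fun w => (\sum_(j < n) G j w *
     (dZ a (j%:R * h) (j.+1%:R * h) w * dZ b (j%:R * h) (j.+1%:R * h) w - h * (a == b)%:R)) ^+ 2)
  <= K * M * (n%:R * h).
Proof.
have /choice[K0 HK0] : forall a : 'I_r, exists K, 0 <= K /\ forall s t,
  0 <= s -> s <= t -> t <= s + 1 -> mean (fun w => `|dZ a s t w| ^+ 4) <= K * (t - s).
  by move=> a; have [K K0 H] := @dZ_moment a 4 isT; exists K.
have S0 : 0 <= \sum_a K0 a by apply: sumr_ge0 => a _; exact: (HK0 a).1.
exists (2 * (\sum_a K0 a) + 2); first by rewrite addr_ge0// mulr_ge0.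
move=> h n G M a b h0 h1 GF mG GM; set t := fun j : nat => j%:R * h.
have t0 : 0 <= t 0%N by rewrite /t mul0r.
have tS j : t j <= t j.+1 by rewrite /t ler_wpM2r// ler_nat.
have td j : t j.+1 - t j = h by rewrite /t -mulrBl -natrB// subSnn mul1r.
have tj0 j : 0 <= t j by rewrite mulr_ge0.
have M0 : 0 <= M by apply: le_trans (GM 0%N); apply: mean_ge0 => w; exact: sqr_ge0.
pose z j w := dZ a (t j) (t j.+1) w * dZ b (t j) (t j.+1) w - h * (a == b)%:R.
have md c j : mom (dZ c (t j) (t j.+1)) by exact: dZ_mom.
have mz j : mom (z j) by apply: momB; [exact: momM|exact: mom_cst].
have z0 j : mean (z j) = 0.
  rewrite meanB; [|exact: momM|exact: mom_cst].
  by rewrite mean_cst mean_dZdZ// td subrr.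
have zg : meas (fun v : 'cV[R]_r => v a 0 * v b 0 - h * (a == b)%:R).
  by apply: measurable_funB => //; apply: measurable_funM; exact: measurable_entry.
have ze j w : z j w = (fun v : 'cV[R]_r => v a 0 * v b 0 - h * (a == b)%:R) (Z (t j.+1) w - Z (t j) w).
  by rewrite /z /dZ !mxE.
have zm j f : mwrt (F (t j)) f -> mom f -> mean (fun w => f w * z j w) = mean f * mean (z j).
  by move=> fF mf; apply: (mean_indep_dZ (tj0 j) (tS j) fF zg (ze j) mf (mz j)).
rewrite (mart_diff_sq n t0 tS (Y := fun j w => G j w * z j w)).
- apply: (le_via (\sum_(j < n) (M * ((2 * (\sum_a K0 a) + 2) * h)))); last first.
    rewrite sumr_const card_ord -mulr_natl; apply: eq_ler; ring.
  apply: ler_sum => j _.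
  rewrite (@eq_mean _ _ _ P _ (fun w => G j w ^+ 2 * z j w ^+ 2)); last by move=> w; rewrite exprMn.
  have zg2 : meas (fun v : 'cV[R]_r => (v a 0 * v b 0 - h * (a == b)%:R) ^+ 2) by exact: measurable_funX.
  rewrite (mean_indep_dZ (tj0 j) (tS j) (mwrtX 2 (GF j)) zg2 _ (momX 2 (mG j)) (momX 2 (mz j))); last by move=> w; rewrite ze.
  apply: ler_pM => //; try by apply: mean_ge0 => w; exact: sqr_ge0.
  apply: (le_via (mean (fun w => `|dZ a (t j) (t j.+1) w| ^+ 4 + `|dZ b (t j) (t j.+1) w| ^+ 4 + 2 * h))).
    have m4 c : mom (fun w => `|dZ c (t j) (t j.+1) w| ^+ 4) by apply/momX/mom_norm.
    apply: le_mean => [||w]; [exact: momX|by apply: momD; [exact: momD|exact: mom_cst]|].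
    rewrite /z; set x := dZ _ _ _ _; set y := dZ _ _ _ _; set e := _%:R.
    have -> : `|x| ^+ 4 = x ^+ 2 * x ^+ 2 by rewrite -normrX ger0_norm ?(exprM _ 2 2) ?sqr_ge0// expr2.
    have -> : `|y| ^+ 4 = y ^+ 2 * y ^+ 2 by rewrite -normrX ger0_norm ?(exprM _ 2 2) ?sqr_ge0// expr2.
    have e1 : 0 <= e ^+ 2 <= 1 by rewrite /e; case: (a == b); rewrite ?expr0n ?expr1n ?lexx ?ler01.
    have h2 : (h * e) ^+ 2 <= h.
      rewrite exprMn; apply: (le_via (h ^+ 2)); first by rewrite ler_piMr ?sqr_ge0//; case/andP: e1.
      by rewrite expr2 ler_piMr.
    have := sqr_ge0 (x * y + h * e); have := sqr_ge0 (x ^+ 2 - y ^+ 2); move: h2; rewrite !expr2; nra.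
  have m4 c : mom (fun w => `|dZ c (t j) (t j.+1) w| ^+ 4) by apply/momX/mom_norm.
  rewrite meanD; [|exact: momD|exact: mom_cst]; rewrite mean_cst meanD//.
  have K4 c : mean (fun w => `|dZ c (t j) (t j.+1) w| ^+ 4) <= (\sum_a K0 a) * h.
    apply: (le_via (K0 c * h)); first by have := (HK0 c).2 _ _ (tj0 j) (tS j); rewrite td; apply; rewrite -lerBlDl td.
    rewrite ler_wpM2r// (bigD1 c)//= lerDl; apply: sumr_ge0 => i _; exact: (HK0 i).1.
  by have := K4 a; have := K4 b; move: (\sum_a K0 a) => s4; lra.
- by move=> j; apply: momM.
- move=> j; have sg := filt_sigma (tj0 j.+1); apply: mwrtM => //.
    exact: (mwrt_filt (tj0 j) (tS j) (GF j)).
  apply: mwrtB => //; last exact: mwrt_cst.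
  by apply: mwrtM => //; exact: dZ_mwrt.
- move=> j f fF mf.
  rewrite (@eq_mean _ _ _ P _ (fun w => (f w * G j w) * z j w)); last by move=> w; rewrite mulrA.
  rewrite zm ?z0 ?mulr0//; last exact: momM.
  by apply: mwrtM; [exact: (filt_sigma (tj0 j))|exact: fF|exact: GF].
Qed.

Lemma normr_even (p : nat) (x : R) : `|x| ^+ (2 * p) = x ^+ (2 * p).
Proof. by rewrite exprM real_normK ?num_real// -exprM. Qed.

Lemma pow_sum_le (n p : nat) : exists2 K : R, 0 <= K & forall v : 'I_n -> R, (forall k, 0 <= v k) ->
  (\sum_k v k) ^+ p.+1 <= K * \sum_k v k ^+ p.+1.
Proof.
elim: n => [|n [K K0 IH]].
  by exists 0 => // v _; rewrite !big_ord0 expr0n mulr0.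
exists (2 ^+ p.+1 * (K + 1)) => [|v v0]; first by rewrite mulr_ge0 ?exprn_ge0 ?addr_ge0.
rewrite !big_ord_recr /=; apply: le_trans (exprD_le _ _ _) _ => //; first exact: sumr_ge0.
rewrite -mulrA ler_wpM2l ?exprn_ge0// mulrDl mul1r; apply: lerD.
  apply: le_trans (IH _ (fun k => v0 _)) _; apply: ler_wpM2l => //.
  by rewrite lerDl exprn_ge0.
by rewrite lerDr; apply: sumr_ge0 => k _; rewrite exprn_ge0.
Qed.

(** A discrete Burkholder inequality. Expanding the power of the partial sum at each step, the
    linear term has mean zero and the remainder satisfies a linear recursion, solved by a Gronwall
    argument; the weight 1 / T in Young inequality keeps the exponential factor bounded. *)
Lemma transform_moment p : exists2 K, 0 <= K & forall (h T : R) n (u : nat -> 'I_r -> Omega -> R) M,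
  0 <= h -> h <= 1 -> 1 <= T -> n%:R * h <= T -> 0 <= M ->
  (forall j a, mwrt (F (j%:R * h)) (u j a)) -> (forall j a, mom (u j a)) ->
  (forall j a, mean (fun w => u j a w ^+ (2 * p.+1)) <= M) ->
  mean (fun w => (\sum_(j < n) \sum_a u j a w * dZ a (j%:R * h) (j.+1%:R * h) w) ^+ (2 * p.+1))
  <= K * T ^+ p.+1 * M.
Proof.
have [C C0 HC] := exprD_taylor1 R (2 * p).
have /choice[K0 HK0] : forall a : 'I_r, exists K, 0 <= K /\ forall s t,
  0 <= s -> s <= t -> t <= s + 1 -> mean (fun w => `|dZ a s t w| ^+ (2 * p.+1)) <= K * (t - s).
  move=> a; have [|K K0 H] := @dZ_moment a (2 * p.+1); last by exists K.
  by rewrite mulnS.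
have S0 : 0 <= \sum_a K0 a by apply: sumr_ge0 => a _; exact: (HK0 a).1.
have [K2 K20 HK2] := pow_sum_le r 1; have [Kq Kq0 HKq] := pow_sum_le r (2 * p).+1.
pose c1 := C * (K2 * r%:R); pose c2 := C * (Kq * \sum_a K0 a).
have c10 : 0 <= c1 by rewrite !mulr_ge0.
have c20 : 0 <= c2 by rewrite !mulr_ge0.
exists (expR c1 * (c1 + c2)); first by rewrite mulr_ge0 ?expR_ge0// addr_ge0.
move=> h T n u M h0 h1 T1 nhT MM uF mu uM; set t := fun j : nat => j%:R * h.
have t0 : 0 <= t 0%N by rewrite /t mul0r.
have tS j : t j <= t j.+1 by rewrite /t ler_wpM2r// ler_nat.
have td j : t j.+1 - t j = h by rewrite /t -mulrBl -natrB// subSnn mul1r.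
have tj0 j : 0 <= t j by rewrite mulr_ge0.
have T0 : 0 < T by exact: lt_le_trans ltr01 T1.
have md c j : mom (dZ c (t j) (t j.+1)) by exact: dZ_mom.
pose Y j w := \sum_a u j a w * dZ a (t j) (t j.+1) w.
pose S m w := \sum_(j < m) Y j w.
have mY j : mom (Y j) by apply: mom_sum => a _; exact: momM.
have mS m : mom (S m) by apply: mom_sum.
have tm j k : (j <= k)%N -> t j <= t k by move=> jk; rewrite /t ler_wpM2r// ler_nat.
have SF m : mwrt (F (t m)) (S m).
  apply: mwrt_sum; first exact: (filt_sigma (tj0 m)).
  move=> j _; apply: mwrt_sum; first exact: (filt_sigma (tj0 m)).
  move=> a _; apply: mwrtM; first exact: (filt_sigma (tj0 m)).
    by apply: (mwrt_filt (tj0 j) _ (uF j a)); apply: tm; exact: ltnW.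
  by apply: dZ_mwrt => //; apply: tm => //; exact: ltnW.
have ind j a (f : Omega -> R) (k : R -> R) : meas k -> mwrt (F (t j)) f -> mom f ->
    mom (fun w => k (dZ a (t j) (t j.+1) w)) ->
    mean (fun w => f w * k (dZ a (t j) (t j.+1) w)) = mean f * mean (fun w => k (dZ a (t j) (t j.+1) w)).
  move=> mk fF mf mkd; apply: (mean_indep_dZ (tj0 j) (tS j) (g := fun v => k (v a 0)) fF _ _ mf mkd).
    by apply: (measurableT_comp mk); exact: measurable_entry.
  by move=> w; rewrite /dZ !mxE.
have q2 : (2 * p.+1 = (2 * p).+2)%N by rewrite mulnS.
have sqT (x y : R) : x ^+ (2 * p) * y ^+ 2 <= T^-1 * x ^+ (2 * p.+1) + T ^+ p * y ^+ (2 * p.+1).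
  have x2 : 0 <= x ^+ 2 by exact: sqr_ge0.
  have y2 : 0 <= y ^+ 2 by exact: sqr_ge0.
  rewrite !exprM; set a := x ^+ 2 in x2 *; set b := y ^+ 2 in y2 *.
  have [ab|ba] := leP a (T * b).
    apply: (le_via (T ^+ p * b ^+ p.+1)); last by rewrite lerDr; apply: mulr_ge0; [rewrite invr_ge0 ltW|exact: exprn_ge0].
    by rewrite exprSr mulrA ler_wpM2r// -exprMn lerXn2r ?nnegrE// mulr_ge0// ltW.
  apply: (le_via (T^-1 * a ^+ p.+1)); last by rewrite lerDl; apply: mulr_ge0; [exact/exprn_ge0/ltW|exact: exprn_ge0].
  have bT : b <= T^-1 * a by rewrite ler_pdivlMl// ltW.
  have -> : T^-1 * a ^+ p.+1 = a ^+ p * (T^-1 * a) by rewrite exprSr; ring.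
  by apply: ler_wpM2l => //; exact: exprn_ge0.
have M0 j a : 0 <= mean (fun w => u j a w ^+ (2 * p.+1)) by apply: mean_ge0 => w; rewrite exprM exprn_ge0 ?sqr_ge0.
pose x m := mean (fun w => S m w ^+ (2 * p.+1)).
have x0 m : 0 <= x m by apply: mean_ge0 => w; rewrite exprM exprn_ge0 ?sqr_ge0.
have Tp1 : 1 <= T ^+ p by exact: exprn_ege1.
have step m : x m.+1 <= x m + C * (K2 * (\sum_(a < r) ((T^-1 * x m + T ^+ p * M) * h))) + C * (Kq * (\sum_a (M * (K0 a * h)))).
  pose U w := \sum_a S m w ^+ (2 * p) * u m a w ^+ 2 * dZ a (t m) (t m.+1) w ^+ 2.
  pose V w := \sum_a u m a w ^+ (2 * p.+1) * `|dZ a (t m) (t m.+1) w| ^+ (2 * p.+1).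
  have mU : mom U by apply: mom_sum => a _; apply: momM; [apply: momM; exact: momX|exact: momX].
  have mV : mom V by apply: mom_sum => a _; apply: momM; [exact: momX|apply/momX/mom_norm].
  have mSY : mom (fun w => S m w ^+ (2 * p).+1 * Y m w) by apply: momM => //; exact: momX.
  apply: (le_via (mean (fun w => (S m w ^+ (2 * p.+1) + (2 * p.+1)%:R * (S m w ^+ (2 * p).+1 * Y m w)) + (C * (K2 * U w) + C * (Kq * V w))))).
    apply: le_mean => [||w].
    - exact: momX.
    - by apply: momD; [apply: momD; [exact: momX|exact: momZ]|apply: momD; apply: momZ; exact: momZ].
    rewrite /S big_ord_recr /= -/(S m w); have := HC (S m w) (Y m w); rewrite -q2 => /(le_trans (ler_norm _)).
    have h2 : `|Y m w| ^+ 2 <= K2 * \sum_a u m a w ^+ 2 * dZ a (t m) (t m.+1) w ^+ 2.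
      apply: (le_via ((\sum_a `|u m a w * dZ a (t m) (t m.+1) w|) ^+ 2)).
        by rewrite lerXn2r ?nnegrE ?sumr_ge0//; exact: ler_norm_sum.
      apply: le_trans (HK2 _ _) _ => //; rewrite ler_wpM2l//; apply: ler_sum => a _.
      by rewrite -normrX ger0_norm ?sqr_ge0// exprMn.
    have hq : `|Y m w| ^+ (2 * p.+1) <= Kq * V w.
      apply: (le_via ((\sum_a `|u m a w * dZ a (t m) (t m.+1) w|) ^+ (2 * p.+1))).
        by rewrite lerXn2r ?nnegrE ?sumr_ge0//; exact: ler_norm_sum.
      rewrite q2; apply: le_trans (HKq _ _) _ => //; rewrite ler_wpM2l// -q2; apply: ler_sum => a _.
      by rewrite normrM exprMn (normr_even p.+1 (u m a w)).
    have hU : `|S m w| ^+ (2 * p) * `|Y m w| ^+ 2 <= K2 * U w.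
      rewrite normr_even; apply: (le_via (S m w ^+ (2 * p) * (K2 * \sum_a u m a w ^+ 2 * dZ a (t m) (t m.+1) w ^+ 2))).
        by apply: ler_wpM2l => //; rewrite exprM exprn_ge0 ?sqr_ge0.
      by rewrite mulrCA ler_wpM2l// mulr_sumr; apply: ler_sum => a _; rewrite mulrA.
    have := ler_wpM2l C0 (lerD hU hq); rewrite mulrDr [in X in _ <= X -> _]mulrDr.
    set A1 := _ ^+ _; set A2 := _ ^+ _; set A3 := _ * (_ * _); lra.
  rewrite meanD; last 2 first.
  - by apply: momD; [exact: momX|exact: momZ].
  - by apply: momD; apply: momZ; exact: momZ.
  rewrite meanD ?meanD//; try exact: momX; try exact: momZ; try by apply/momZ/momZ.
  rewrite !meanZ//; try exact: momZ.
  have -> : mean (fun w => S m w ^+ (2 * p).+1 * Y m w) = 0.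
    rewrite (@eq_mean _ _ _ P _ (fun w => \sum_a (S m w ^+ (2 * p).+1 * u m a w) * dZ a (t m) (t m.+1) w)); last first.
      by move=> w; rewrite mulr_sumr; apply: eq_bigr => a _; rewrite mulrA.
    rewrite mean_sum => [|a _]; last by apply: momM => //; apply: momM => //; exact: momX.
    rewrite big1// => a _; rewrite (ind m a _ id)//; last 2 first.
    + by apply: mwrtM; [exact: (filt_sigma (tj0 m))|exact: mwrtX|exact: uF].
    + by apply: momM => //; exact: momX.
    by rewrite mean_dZ ?mulr0.
  have EU : mean U <= \sum_(a < r) ((T^-1 * x m + T ^+ p * M) * h).
    rewrite mean_sum => [|a _]; last by apply: momM; [apply: momM; exact: momX|exact: momX].
    apply: ler_sum => a _; rewrite (ind m a _ (fun y => y ^+ 2)); last 4 first.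
    + exact: measurable_funX.
    + by apply: mwrtM; [exact: (filt_sigma (tj0 m))|exact: mwrtX|apply: mwrtX; exact: uF].
    + by apply: momM; exact: momX.
    + exact: momX.
    have -> : mean (fun w => dZ a (t m) (t m.+1) w ^+ 2) = h.
      rewrite (@eq_mean _ _ _ P _ (fun w => dZ a (t m) (t m.+1) w * dZ a (t m) (t m.+1) w))//.
      by rewrite mean_dZdZ// eqxx mulr1 td.
    rewrite ler_wpM2r//; apply: (le_via (mean (fun w => T^-1 * S m w ^+ (2 * p.+1) + T ^+ p * u m a w ^+ (2 * p.+1)))).
      apply: le_mean => [||w]; [by apply: momM; exact: momX|by apply: momD; apply: momZ; exact: momX|exact: sqT].
    rewrite meanD ?meanZ//; try exact: momX; try by apply: momZ; exact: momX.
    by rewrite lerD2l ler_wpM2l// exprn_ge0// ltW.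
  have EV : mean V <= \sum_a (M * (K0 a * h)).
    rewrite mean_sum => [|a _]; last by apply: momM; [exact: momX|apply/momX/mom_norm].
    apply: ler_sum => a _; rewrite (ind m a _ (fun y => `|y| ^+ (2 * p.+1))); last 4 first.
    + by apply: measurable_funX; exact: normr_measurable.
    + apply: mwrtX; exact: uF.
    + exact: momX.
    + exact/momX/mom_norm.
    apply: ler_pM => //; first by apply: mean_ge0 => w; rewrite exprn_ge0.
    by have := (HK0 a).2 _ _ (tj0 m) (tS m); rewrite td; apply; rewrite -lerBlDl td.
  rewrite mulr0 addr0 -addrA lerD2l; apply: lerD; apply: ler_wpM2l => //; exact: ler_wpM2l.
pose B := (c1 + c2) * (h * (T ^+ p * M)).
have TM : 0 <= h * (T ^+ p * M) by rewrite !mulr_ge0 ?exprn_ge0// ltW.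
have B0 : 0 <= B by rewrite mulr_ge0// addr_ge0.
pose be := c1 * (h / T); have be0 : 0 <= be by rewrite mulr_ge0// divr_ge0// ltW.
have step' m : x m.+1 <= (1 + be) * x m + B.
  apply: le_trans (step m) _; rewrite sumr_const card_ord -mulr_natl.
  have -> : \sum_a (M * (K0 a * h)) = (\sum_a K0 a) * (h * M) by rewrite mulr_suml; apply: eq_bigr => a _; ring.
  have hM : h * M <= h * (T ^+ p * M) by rewrite ler_wpM2l// ler_peMl.
  have h3 : c2 * (h * M) <= c2 * (h * (T ^+ p * M)) by exact: ler_wpM2l.
  apply: (le_via ((1 + be) * x m + c1 * (h * (T ^+ p * M)) + c2 * (h * M))); last first.
    by rewrite /B mulrDl; lra.
  by apply: eq_ler; rewrite /be /c1 /c2; ring.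
have claim m : x m <= (1 + be) ^+ m * (m%:R * B).
  elim: m => [|m IH].
    rewrite mul0r mulr0 /x (@eq_mean _ _ _ P _ (cst 0)) ?mean_cst// => w.
    by rewrite /S big_ord0 expr0n muln_eq0.
  apply: le_trans (step' m) _; rewrite -natr1 exprS -mulrA mulrDl mul1r.
  have b1 : 1 <= (1 + be) ^+ m by apply: exprn_ege1; rewrite lerDl.
  have := ler_wpM2l (addr_ge0 ler01 be0) IH.
  have : B <= (1 + be) * ((1 + be) ^+ m * B).
    by rewrite mulrA ler_peMl// -exprS exprn_ege1// lerDl.
  have -> : (1 + be) * ((1 + be) ^+ m * ((m%:R + 1) * B)) = (1 + be) * ((1 + be) ^+ m * (m%:R * B)) + (1 + be) * ((1 + be) ^+ m * B) by ring.
  by move: ((1 + be) * (_ * (_ * B))) ((1 + be) * (_ * B)) => u1 u2; lra.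
apply: le_trans (claim n) _.
have -> : n%:R * B = (c1 + c2) * ((n%:R * h) * (T ^+ p * M)) by rewrite /B; ring.
rewrite -!mulrA; apply: ler_pM.
- by rewrite exprn_ge0// addr_ge0.
- by rewrite !mulr_ge0 ?addr_ge0 ?exprn_ge0// ltW.
- apply: (le_via (expR be ^+ n)).
    by rewrite lerXn2r ?nnegrE ?expR_ge0 ?addr_ge0// expR_ge1Dx.
  rewrite -expRM_natl ler_expR /be mulrCA -[leRHS]mulr1 ler_wpM2l// mulrA ler_pdivrMr// mul1r.
  exact: nhT.
- apply: ler_wpM2l; first by rewrite addr_ge0.
  rewrite exprS -(mulrA T) (mulrA n%:R); apply: ler_wpM2r => //.
  by rewrite mulr_ge0// exprn_ge0// ltW.
Qed.

End levy.

(** * Convergence to zero in probability *)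
Section vip.
Context d0 (Omega : measurableType d0) (R : realType) (P : probability Omega R).
Local Notation PO := (mu_ext P).
Implicit Types Y U : nat -> Omega -> \bar R.

(** For extended nonnegative variables, as approximation errors are integrals that may be infinite. *)
Definition vip Y := forall e : R, 0 < e -> vanishes P (fun k => [set w | (e%:E <= Y k w)%E]).

Lemma cvg0_vip Y : cvg0_in_prob P Y -> vip Y.
Proof.
move=> Yc e e0 d dd; have := Yc e e0.
move/fine_cvgP => [fn] /cvgrPdist_le /(_ _ dd) H; near=> n.
have : `|0 - (fine \o (fun n => PO [set w | (e%:E <= Y n w)%E])) n| <= d by near: n.
rewrite sub0r normrN /= ger0_norm ?fine_ge0 ?PO_ge0// -lee_fin fineK//; near: n; exact: fn.
Unshelve. all: end_near. Qed.

Lemma vip_cvg0 Y : vip Y -> cvg0_in_prob P Y.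
Proof.
move=> vY e e0; apply: cvg_EFin.
  near=> n; rewrite ge0_fin_numE ?PO_ge0//; apply: le_lt_trans (PO_le1 _ _) _; exact: ltry.
apply/cvgrPdist_le => d dd; near=> n => /=.
rewrite sub0r normrN ger0_norm ?fine_ge0 ?PO_ge0// -lee_fin fineK.
  by near: n; exact: vY.
by rewrite ge0_fin_numE ?PO_ge0//; apply: le_lt_trans (PO_le1 _ _) _; exact: ltry.
Unshelve. all: end_near. Qed.

Lemma vip_le Y U : (forall n w, (Y n w <= U n w)%E) -> vip U -> vip Y.
Proof.
move=> YU vU e e0; apply: vanishes_sub (vU e e0); near=> n => w /=.
by move/le_trans; apply.
Unshelve. all: end_near. Qed.

Lemma vipD Y U : (forall n w, (0 <= Y n w)%E) -> (forall n w, (0 <= U n w)%E) ->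
  vip Y -> vip U -> vip (fun n w => Y n w + U n w)%E.
Proof.
move=> Y0 U0 vY vU e e0; have e20 : 0 < e / 2 by rewrite divr_gt0.
apply: vanishes_sub (vanishesU (vY _ e20) (vU _ e20)); near=> n => w /= h.
have [|Y1] := leP (e / 2)%:E (Y n w); [by left|right].
rewrite leNgt; apply/negP => U1; move: h; rewrite leNgt => /negP; apply.
by rewrite (splitr e) EFinD lteD.
Unshelve. all: end_near. Qed.

Lemma vip0 : vip (fun _ _ => 0%E).
Proof.
move=> e e0 d dd; near=> n.
have -> : [set w : Omega | (e%:E <= 0)%E] = set0.
  by rewrite -subset0 => w /=; rewrite lee_fin leNgt e0.
by apply: (le_via 0%E); [rewrite mu_ext0|rewrite lee_fin ltW].
Unshelve. all: end_near. Qed.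

Lemma vip_sum (I : Type) (s : seq I) (Y : I -> nat -> Omega -> \bar R) :
  (forall i n w, (0 <= Y i n w)%E) -> (forall i, vip (Y i)) ->
  vip (fun n w => \sum_(i <- s) Y i n w)%E.
Proof.
move=> Y0 vY; elim: s => [|i s IH].
  by apply: vip_le vip0 => n w; rewrite big_nil.
apply: (vip_le _ (vipD (Y0 i) _ (vY i) IH)) => n w; rewrite ?big_cons//.
by apply: sume_ge0 => *; exact: Y0.
Qed.

(** The weight is bounded with probability close to 1. *)
Lemma vipM_mom (f : Omega -> R) Y : mom P f -> (forall n w, (0 <= Y n w)%E) -> vip Y ->
  vip (fun n w => `|f w|%:E * Y n w)%E.
Proof.
move=> mf Y0 vY e e0 d dd; have d20 : 0 < d / 2 by rewrite divr_gt0.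
have mnf := mom_norm mf.
pose K := (mean P (fun w => `|f w|) + 1) / (d / 2).
have mf0 : 0 <= mean P (fun w => `|f w|) by apply: mean_ge0.
have K0 : 0 < K by rewrite divr_gt0// ltr_pwDr.
have eK : 0 < e / K by rewrite divr_gt0.
near=> n.
apply: (le_via (PO ([set w | K <= `|f w|] `|` [set w | ((e / K)%:E <= Y n w)%E]))).
  apply: PO_le => w /= h; have [|fK] := leP K `|f w|; [by left|right].
  rewrite leNgt; apply/negP => YK; move: h; rewrite leNgt => /negP; apply.
  have YF : Y n w \is a fin_num.
    by rewrite ge0_fin_numE//; apply: lt_trans YK (ltry _).
  have := Y0 n w; move: YK; rewrite -(fineK YF) -EFinM !lte_fin lee_fin ltr_pdivlMr// => YK Y1.
  by apply: le_lt_trans YK; rewrite mulrC ler_wpM2l// ltW.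
apply: le_trans (PO_U _ _ _) _; rewrite (splitr d) EFinD; apply: leeD; last by near: n; exact: vY.
have mA : measurable [set w | K <= `|f w|].
  by apply: measurable_set_ge; exact: mom_measurable mnf.
rewrite PO_measurable// -(fineK (fin_num_measure P _ mA)) lee_fin -mean_indic//.
rewrite -(ler_pM2l K0) -meanZ; last exact: mom_indic.
apply: (le_via (mean P (fun w => `|f w|))).
  apply: le_mean => // [|w]; first by apply: momZ; exact: mom_indic.
  rewrite indicE; case: (boolP (w \in _)) => [|_]; last by rewrite mulr0.
  by rewrite inE /= mulr1.
by rewrite /K divfK ?gt_eqF// lerDl.
Unshelve. all: end_near. Qed.

End vip.

Lemma ge0_le_integral_nomeas d1 (T : measurableType d1) (R : realType)
  (mu : {measure set T -> \bar R}) (D : set T) (f g : T -> \bar R) :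
  (forall x, D x -> (0 <= f x)%E) -> (forall x, D x -> (f x <= g x)%E) ->
  (\int[mu]_(x in D) f x <= \int[mu]_(x in D) g x)%E.
Proof.
move=> f0 fg; have g0 x : D x -> (0 <= g x)%E by move=> Dx; apply: le_trans (f0 x Dx) (fg x Dx).
rewrite !ge0_integralE//; apply: le_ereal_sup => _ [h hf <-]; exists h => // x.
apply: le_trans (hf x) _; rewrite /patch; case: ifPn => //; rewrite inE; exact: fg.
Qed.

(** * Joint measurability of cadlag processes *)
Section joint.
Context d0 (Omega : measurableType d0) (R : realType).

(** Each approximation is piecewise constant in time, hence jointly measurable. *)
Lemma joint_measurable (y : R -> Omega -> R) (l : R -> Omega -> R) (p : nat -> nat -> R) (D : set R) :
  measurable D -> (forall v, D v -> 0 <= v) ->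
  (forall m k, meas (y (p m k))) ->
  (forall v w, D v -> y (p m.+1 (Num.trunc (m.+1%:R * v))) w @[m --> \oo] --> l v w) ->
  meas (fun z : R * Omega => \1_D z.1 * l z.1 z.2).
Proof.
move=> mD D0 my yl.
pose h (m : nat) (z : R * Omega) : R := \1_D z.1 * \sum_(k < (m.+1 * m.+1)%N)
  \1_(`[k%:R / m.+1%:R, k.+1%:R / m.+1%:R[%classic) z.1 * y (p m.+1 k) z.2.
have mi (A : set R) : measurable A -> meas (fun z : R * Omega => \1_A z.1 : R).
  move=> mA; apply: (@measurableT_comp _ _ _ _ _ _ (\1_A : R -> R) _ (@fst R Omega)) => //.
apply: (@measurable_fun_cvg _ _ _ setT h).
  move=> m; apply: measurable_funM; first exact: mi.
  apply: measurable_sum => k; apply: measurable_funM; first by apply: mi; exact: measurable_itv.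
  by apply: (measurableT_comp (my _ _)).
move=> [v w] _ /=; case: (pselect (D v)) => Dv; last first.
  rewrite indicE memNset// mul0r; apply: cvg_near_cst; near=> m.
  by rewrite /h /= indicE memNset// mul0r.
rewrite indicE mem_set// mul1r; apply: cvg_trans (yl v w Dv); apply: near_eq_cvg; near=> m.
rewrite /h /= indicE mem_set// mul1r.
have v0 := D0 _ Dv.
have mv0 : 0 <= m.+1%:R * v by rewrite mulr_ge0.
have /andP[k1 k2] := truncn_itv mv0.
set k := Num.trunc _ in k1 k2 *.
have km : (k < m.+1 * m.+1)%N.
  rewrite -(ltr_nat R); apply: le_lt_trans k1 _; rewrite natrM ltr_pM2l//.
  apply: (@lt_trans _ _ m%:R); last by rewrite ltr_nat.
  apply: (lt_le_trans (archi_boundP v0)); rewrite ler_nat; near: m; exact: nbhs_infty_ge.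
rewrite (bigD1 (Ordinal km))//= big1 ?addr0 => [|[j jm] /= jk]; last first.
  rewrite indicE memNset ?mul0r//= in_itv /= => /andP[j1 j2].
  move: jk; rewrite -val_eqE /= => /eqP; apply.
  rewrite ler_pdivrMr// in j1; rewrite ltr_pdivlMr// in j2.
  have jk : (j < k.+1)%N by rewrite -(ltr_nat R); apply: le_lt_trans k2; rewrite mulrC.
  have kj : (k < j.+1)%N by rewrite -(ltr_nat R); apply: le_lt_trans k1 _; rewrite mulrC.
  by apply/eqP; rewrite eqn_leq -ltnS jk -ltnS kj.
rewrite indicE mem_set ?mul1r//= in_itv /= ler_pdivrMr// ltr_pdivlMr//.
by rewrite mulrC k1 k2.
Unshelve. all: end_near. Qed.

Lemma grid_cvg (v : R) (c : R) : 0 <= v ->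
  ((Num.trunc (m.+1%:R * v))%:R + c) / m.+1%:R @[m --> \oo] --> v.
Proof.
move=> v0.
have h1 : m.+1%:R^-1 @[m --> \oo] --> (0 : R) by exact: cvg_harmonic.
have h2 : v + (`|c| + 1) * m.+1%:R^-1 @[m --> \oo] --> v.
  rewrite -[X in _ --> X](addr0 v); apply: cvgD; first exact: cvg_cst.
  by rewrite -[X in _ --> X](mulr0 (`|c| + 1)); apply: cvgMr.
have h3 : v - (`|c| + 1) * m.+1%:R^-1 @[m --> \oo] --> v.
  rewrite -[X in _ --> X](subr0 v); apply: cvgB; first exact: cvg_cst.
  by rewrite -[X in _ --> X](mulr0 (`|c| + 1)); apply: cvgMr.
apply: (squeeze_cvgr _ h3 h2); near=> m.
have mv0 : 0 <= m.+1%:R * v by rewrite mulr_ge0.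
have /andP[k1 k2] := truncn_itv mv0; set k := Num.trunc _ in k1 k2 *.
have mE : v = (m.+1%:R * v) / m.+1%:R by rewrite mulrAC mulfV// mul1r.
rewrite -natr1 in k2; have := ler_norm c; have := ler_norm (- c); rewrite normrN => c1 c2.
rewrite [X in X - _ <= _]mE [X in _ <= X + _]mE -mulrBl -mulrDl !ler_pM2r ?invr_gt0//; apply/andP; split; lra.
Unshelve. all: end_near. Qed.

Lemma joint_right (y : R -> Omega -> R) : (forall t, 0 <= t -> meas (y t)) ->
  (forall w t, 0 <= t -> y s w @[s --> t^'+] --> y t w) ->
  meas (fun z : R * Omega => \1_(`[0, +oo[%classic) z.1 * y z.1 z.2).
Proof.
move=> my yr; apply: (@joint_measurable y y (fun m k => k.+1%:R / m%:R)) => //.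
- by move=> v /=; rewrite in_itv /= andbT.
- by move=> m k; apply: my; rewrite divr_ge0.
move=> v w /=; rewrite in_itv /= andbT => v0.
have /cvg_at_rightP := yr w v v0; apply; split=> [m|].
  have mv0 : 0 <= m.+1%:R * v by rewrite mulr_ge0.
  by have /andP[k1 k2] := truncn_itv mv0; rewrite ltr_pdivlMr// mulrC.
by have := grid_cvg 1 v0; under eq_fun do rewrite natr1.
Qed.

Lemma joint_left (y l : R -> Omega -> R) : (forall t, 0 <= t -> meas (y t)) ->
  (forall w t, 0 < t -> y s w @[s --> t^'-] --> l t w) ->
  meas (fun z : R * Omega => \1_(`]0, +oo[%classic) z.1 * l z.1 z.2).
Proof.
move=> my yr; apply: (@joint_measurable y l (fun m k => (k.-1)%:R / m%:R)) => //.
- by move=> v /=; rewrite in_itv /= andbT => /ltW.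
- by move=> m k; apply: my; rewrite divr_ge0.
move=> v w /=; rewrite in_itv /= andbT => v0.
have /cvg_at_leftP := yr w v v0; apply; split=> [m|].
  have mv0 : 0 < m.+1%:R * v by rewrite mulr_gt0.
  have /andP[k1 k2] := truncn_itv (ltW mv0); rewrite ltr_pdivrMr//.
  case: (Num.trunc _) k1 k2 => [|k] k1 k2 /=; rewrite (mulrC v)//.
  by apply: lt_le_trans k1; rewrite ltr_nat.
apply: cvg_trans (grid_cvg (-1) (ltW v0)); apply: near_eq_cvg; near=> m.
congr (_ / _); have mv0 : 0 < m.+1%:R * v by rewrite mulr_gt0.
have /andP[k1 k2] := truncn_itv (ltW mv0).
have : (0 < Num.trunc (m.+1%:R * v))%N.
  rewrite -ltnS -(ltr_nat R); apply: le_lt_trans k2.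
  rewrite -ler_pdivrMr// mul1r; apply: (le_via (Num.bound v^-1)%:R).
    by apply/ltW/archi_boundP; rewrite invr_ge0 ltW.
  by rewrite ler_nat ltnW// ltnS; near: m; exact: nbhs_infty_ge.
by move=> /prednK <- /=; rewrite -natr1 addrK.
Unshelve. all: end_near. Qed.

End joint.

(** * A maximal inequality for random fields on a cube, by chaining *)
Section chaining.
Context d0 (Omega : measurableType d0) (R : realType) (P : probability Omega R).
Variable p : nat.
Local Notation gix l := {ffun 'I_p -> 'I_(2 ^ l.+1).+1}.

Definition cube : set ('I_p -> R) := [set y | forall i, -1 <= y i <= 1].

Definition grid l (k : (gix l)) : 'I_p -> R :=
  fun i => (k i)%:R / 2 ^+ l - 1.

Lemma grid_cube l k : cube (@grid l k).
Proof.
move=> i; rewrite /grid lerBrDr addNr lerBlDr; apply/andP; split; first by rewrite divr_ge0// exprn_ge0.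
rewrite ler_pdivrMr ?exprn_gt0// (_ : 1 + 1 = 2)// -exprS -natrX ler_nat -ltnS; exact: ltn_ord.
Qed.

Definition grid_of l (y : 'I_p -> R) : (gix l) :=
  [ffun i => inord (Num.trunc (2 ^+ l * (y i + 1)))].

Lemma grid_of_near l y i : cube y -> grid (grid_of l y) i <= y i <= grid (grid_of l y) i + (2 ^+ l)^-1.
Proof.
move=> /(_ i)/andP[y1 y2]; rewrite /grid ffunE.
have p0 : 0 < (2 : R) ^+ l by rewrite exprn_gt0.
have m0 : 0 <= 2 ^+ l * (y i + 1) by rewrite mulr_ge0// ?exprn_ge0// -lerBlDr sub0r.
have /andP[t1 t2] := truncn_itv m0; set t := Num.trunc _ in t1 t2 *.
rewrite inordK; last first.
  rewrite ltnS -(ler_nat R); apply: le_trans t1 _; rewrite natrX exprS mulrC ler_wpM2r ?exprn_ge0//; lra.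
have h1 : t%:R / 2 ^+ l <= y i + 1 by rewrite ler_pdivrMr// mulrC.
have h2 : y i + 1 <= t%:R / 2 ^+ l + (2 ^+ l)^-1.
  have -> : t%:R / 2 ^+ l + (2 ^+ l)^-1 = t.+1%:R / 2 ^+ l :> R by rewrite -(natr1 t) mulrDl mul1r.
  by rewrite ler_pdivlMr// mulrC ltW.
by move: h1 h2; set u := _ / _; set v := _^-1 => h1 h2; apply/andP; split; lra.
Qed.

Lemma card_grid l : (#|(gix l)| <= 2 ^ (p * l.+2))%N.
Proof.
rewrite card_ffun !card_ord mulnC expnM.
have [->|p0] := posnP p; first by rewrite !expn0.
by rewrite leq_exp2r// (expnS 2 l.+1) mul2n -addnn -addn1 leq_add2l expn_gt0.
Qed.

Lemma PO_exists (I : finType) (A : I -> set Omega) (e : R) :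
  (forall x, (mu_ext P (A x) <= e%:E)%E) ->
  (mu_ext P [set w | exists x, A x w] <= (#|I|%:R * e)%:E)%E.
Proof.
move=> Ae; suff H (s : seq I) : (mu_ext P [set w | exists2 x, x \in s & A x w] <= ((size s)%:R * e)%:E)%E.
  rewrite cardE; apply: le_trans (H (enum I)); apply: PO_le => w [x Ax]; exists x => //.
  by rewrite mem_enum.
elim: s => [|x s IH].
  rewrite mul0r (_ : [set w | _] = set0) ?mu_ext0// -subset0 => w [x].
  by rewrite in_nil.
apply: (le_via (mu_ext P (A x `|` [set w | exists2 x, x \in s & A x w]))).
  apply: PO_le => w [y]; rewrite inE => /orP[/eqP ->|ys] Ay; [by left|right; by exists y].
apply: le_trans (PO_U _ _ _) _; rewrite /= -natr1 mulrDl mul1r (addrC _ e) EFinD.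
by apply: leeD; [exact: Ae|exact: IH].
Qed.

Lemma PO_series (A : nat -> set Omega) (c : R) : 0 <= c ->
  (forall l, (mu_ext P (A l) <= (c * 2^-1 ^+ l)%:E)%E) ->
  (mu_ext P (\bigcup_l A l) <= (2 * c)%:E)%E.
Proof.
move=> c0 Ac; apply: le_trans (outer_measure_sigma_subadditive _ _) _.
apply: lime_le; first by apply: is_cvg_nneseries => n _ _; exact: PO_ge0.
near=> n; apply: (le_via (\sum_(0 <= l < n) (c * 2^-1 ^+ l)%:E)%E).
  by apply: lee_sum => l _; exact: Ac.
rewrite sumEFin lee_fin -mulr_sumr mulrC ler_wpM2r//.
elim: (n) => [|m IH]; first by rewrite big_nil.
suff -> : \sum_(0 <= i < m.+1) 2^-1 ^+ i = 2 - 2^-1 ^+ m :> R by rewrite lerBlDr lerDl exprn_ge0.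
elim: m {IH} => [|m IH]; first by rewrite big_nat1 expr0; ring.
by rewrite big_nat_recr//= IH exprS; lra.
Unshelve. all: end_near. Qed.

Lemma markov_even (f : Omega -> R) q (c K : R) : meas f -> 0 < c ->
  (\int[P]_w (f w ^+ (2 * q))%:E <= K%:E)%E ->
  (mu_ext P [set w | (c <= `|f w|)%R] <= (K / c ^+ (2 * q))%:E)%E.
Proof.
move=> mf c0 fK; have mA : measurable [set w | (c <= `|f w|)%R].
  by apply: measurable_set_ge; exact: measurableT_comp.
have cq : 0 < c ^+ (2 * q) by exact: exprn_gt0.
have f0 w : 0 <= f w ^+ (2 * q) by rewrite exprM exprn_ge0 ?sqr_ge0.
rewrite PO_measurable// EFinM lee_pdivlMr// muleC -integral_cst//.
apply: le_trans fK; rewrite [leLHS]integral_mkcond; apply: ge0_le_integral_nomeas => w _; rewrite patchE.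
  by case: ifPn => // _; rewrite lee_fin ltW.
case: ifPn; rewrite ?lee_fin// inE /= => cf.
by rewrite -(normr_even q (f w)) lerXn2r ?nnegrE// ltW.
Qed.

(** A union bound over pairs of neighbouring grid points at each scale: the moments of order above 4
    p, for Lipschitz increments, beat the number 2^(p(2l+5)) of pairs with thresholds decreasing
    like (3/4)^l. The pathwise Lipschitz condition, with an uncontrolled constant, passes from the
    grids to the cube. *)
Lemma chaining (B : ('I_p -> R) -> Omega -> R) (K : R) : 0 <= K ->
  (forall y, cube y -> meas (B y)) ->
  (forall y, cube y -> (\int[P]_w (B y w ^+ (2 * (2 * p).+1))%:E <= K%:E)%E) ->
  (forall y y' e, cube y -> cube y' -> (forall i, `|y i - y' i| <= e) ->
     (\int[P]_w ((B y w - B y' w) ^+ (2 * (2 * p).+1))%:E <= (K * e ^+ (2 * (2 * p).+1))%:E)%E) ->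
  (forall w, exists l : R, forall y y' e, cube y -> cube y' -> (forall i, `|y i - y' i| <= e) ->
     `|B y w - B y' w| <= l * e) ->
  forall x : R, 0 < x ->
  (mu_ext P [set w | exists2 y, cube y & (5 * x < `|B y w|)%R] <= (3 * (2 ^+ (5 * p) * (K / x ^+ (2 * (2 * p).+1))))%:E)%E.
Proof.
move=> K0 mB BK BB Bl x x0; set q := (2 * (2 * p).+1)%N in BK BB *.
have xq0 : 0 < x ^+ q by exact: exprn_gt0.
pose del l : R := (2 ^+ l)^-1; pose thr l : R := x * (3 / 4) ^+ l.
have del0 l : 0 < del l by rewrite invr_gt0 exprn_gt0.
have thr0 l : 0 < thr l by rewrite mulr_gt0// exprn_gt0.
pose c := 2 ^+ (5 * p) * (K / x ^+ q).
have c0 : 0 <= c by rewrite mulr_ge0 ?exprn_ge0// divr_ge0// ltW.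
pose A0 := [set w | exists k : (gix 0), (x <= `|B (@grid 0 k) w|)%R].
pose A l := [set w | exists k : (gix l) * (gix l.+1),
  (forall i, `|grid k.1 i - grid k.2 i| <= del l) /\ (thr l <= `|B (grid k.1) w - B (grid k.2) w|)%R].
have PA0 : (mu_ext P A0 <= c%:E)%E.
  apply: le_trans (PO_exists (A := fun k : (gix 0) => [set w | (x <= `|B (@grid 0 k) w|)%R])
    (fun k => markov_even (mB _ (@grid_cube 0 k)) x0 (BK _ (@grid_cube 0 k)))) _.
  rewrite lee_fin; apply: ler_wpM2r; first by rewrite divr_ge0// ltW.
  rewrite -natrX ler_nat; apply: leq_trans (@card_grid 0) _.
  by rewrite leq_pexp2l// mulnC leq_mul2r orbT.
have PA l : (mu_ext P (A l) <= (c * 2^-1 ^+ l)%:E)%E.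
  apply: le_trans (PO_exists (e := K * del l ^+ q / thr l ^+ q) _) _.
    move=> -[k k'] /=; have [kk|nkk] := pselect (forall i, `|grid k i - grid k' i| <= del l); last first.
      apply: (le_via (mu_ext P set0)); first by apply: PO_le => w [].
      apply: (le_via 0%E); first by rewrite mu_ext0.
      by rewrite lee_fin divr_ge0 ?mulr_ge0 ?exprn_ge0// ltW.
    apply: (le_via (mu_ext P [set w | (thr l <= `|B (grid k) w - B (grid k') w|)%R])).
      by apply: PO_le => w [].
    apply: markov_even => //; last by apply: BB => //; exact: grid_cube.
    by apply: measurable_funB; apply: mB; exact: grid_cube.
  rewrite lee_fin card_prod natrM.
  have C1 : #|{: gix l}|%:R <= 2 ^+ (p * l.+2) :> R by rewrite -natrX ler_nat card_grid.
  have C2 : #|{: gix l.+1}|%:R <= 2 ^+ (p * l.+3) :> R by rewrite -natrX ler_nat card_grid.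
  have C3 := ler_pM (ler0n _ _) (ler0n _ _) C1 C2.
  apply: (le_via (2 ^+ (p * l.+2) * 2 ^+ (p * l.+3) * (K * del l ^+ q / thr l ^+ q))).
    by apply: ler_wpM2r C3; rewrite divr_ge0 ?mulr_ge0 ?exprn_ge0// ltW.
  rewrite /del /thr exprMn invfM.
  have -> : 2 ^+ (p * l.+2) * 2 ^+ (p * l.+3) = 2 ^+ (5 * p) * (4 ^+ p) ^+ l :> R.
    rewrite -exprD -[4](_ : 2 ^+ 2 = _); last by ring.
    by rewrite -!exprM -exprD; congr (_ ^+ _); lia.
  have -> : 2 ^+ (5 * p) * (4 ^+ p) ^+ l * (K * (2 ^+ l)^-1 ^+ q * ((x ^+ q)^-1 * ((3 / 4) ^+ l ^+ q)^-1)) =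
     c * ((4 ^+ p) ^+ l * ((2 ^+ l)^-1 ^+ q * ((3 / 4) ^+ l ^+ q)^-1)) by rewrite /c; ring.
  apply: ler_wpM2l => //.
  have -> : (4 ^+ p) ^+ l * ((2 ^+ l)^-1 ^+ q * ((3 / 4) ^+ l ^+ q)^-1) = (4 ^+ p * (2^-1 ^+ q * (4 / 3) ^+ q)) ^+ l :> R.
    have e1 : (2 ^+ l)^-1 ^+ q = (2^-1 ^+ q) ^+ l :> R by rewrite -exprVn -!exprM mulnC.
    have e2 : ((3 / 4) ^+ l ^+ q)^-1 = ((4 / 3) ^+ q) ^+ l :> R by rewrite -!exprVn invf_div -!exprM mulnC.
    by rewrite e1 e2 -!exprMn.
  apply: lerXn2r; rewrite ?nnegrE ?mulr_ge0 ?exprn_ge0 ?invr_ge0//.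
  rewrite -exprMn /q mulnS mulnA exprD exprM -exprM (_ : (2 * 2 * p = 4 * p)%N)// exprM.
  rewrite mulrCA -exprMn; apply: (le_via ((2^-1 * (4 / 3)) ^+ 2 * 1)); last by lra.
  apply: ler_wpM2l; first by rewrite exprn_ge0// mulr_ge0.
  by apply: exprn_ile1; rewrite ?mulr_ge0 ?exprn_ge0//; lra.
apply: (le_via (mu_ext P (A0 `|` \bigcup_l A l))); last first.
  apply: le_trans (PO_U _ _ _) _; rewrite (_ : 3 * _ = c + 2 * c); last by rewrite /c; ring.
  by rewrite EFinD; apply: leeD => //; exact: PO_series.
apply: PO_le => w [y cy By]; apply: contrapT => nA.
have n0 k : `|B (@grid 0 k) w| < x.
  by rewrite ltNge; apply/negP => h; apply: nA; left; exists k.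
have nl l k k' : (forall i, `|grid k i - grid k' i| <= del l) -> `|B (@grid l k) w - B (@grid l.+1 k') w| < thr l.
  by move=> kk; rewrite ltNge; apply/negP => h; apply: nA; right; exists l => //; exists (k, k').
have adj l i : `|grid (grid_of l y) i - grid (grid_of l.+1 y) i| <= del l.
  have /andP[h1 h2] := grid_of_near l i cy; have /andP[h3 h4] := grid_of_near l.+1 i cy.
  have h5 : del l.+1 = del l / 2 by rewrite /del exprS invfM mulrC.
  rewrite -/(del l) in h2; rewrite -/(del l.+1) h5 in h4; have := del0 l.
  move: h1 h2 h3 h4; set g := grid _ _; set g' := grid _ _ => h1 h2 h3 h4 h6.
  rewrite ler_norml; apply/andP; split; lra.
have claim l : `|B (grid (grid_of l y)) w| < x + 4 * x * (1 - (3 / 4) ^+ l).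
  elim: l => [|l IH]; first by rewrite expr0 subrr mulr0 addr0; exact: n0.
  have := nl l _ _ (adj l); have := ler_normB (B (grid (grid_of l y)) w) (B (grid (grid_of l y)) w - B (grid (grid_of l.+1 y)) w).
  rewrite opprB addrC subrK /thr exprS => h1 h2; move: IH h1 h2.
  set a := `|_|; set b := `|_|; set e := `|_|; set u := (3 / 4) ^+ l => i1 i2 i3; lra.
have [lw Hl] := Bl w.
pose gap := `|B y w| - 5 * x; have gap0 : 0 < gap by rewrite subr_gt0.
pose l := Num.bound (`|lw| / gap).
have hl : `|lw| * del l < gap.
  have : `|lw| / gap < 2 ^+ l.
    apply: (lt_trans (archi_boundP _)); first by rewrite divr_ge0// ltW.
    by rewrite -natrX ltr_nat ltn_expl.
  by rewrite /del ltr_pdivrMr// ltr_pdivrMr ?exprn_gt0// mulrC.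
have hy : `|B y w - B (grid (grid_of l y)) w| <= lw * del l.
  apply: Hl => // [|i]; first exact: grid_cube.
  have /andP[h1 h2] := grid_of_near l i cy; rewrite -/(del l) in h2; have := del0 l => h3.
  by rewrite ler_norml; apply/andP; split; lra.
have c1 := claim l; have c2 : 0 < (3 / 4 : R) ^+ l by rewrite exprn_gt0.
have c3 := ler_normD (B y w - B (grid (grid_of l y)) w) (B (grid (grid_of l y)) w); rewrite subrK in c3.
have c4 : lw * del l <= `|lw| * del l by apply: ler_wpM2r; [exact: ltW|exact: ler_norm].
have c5 : 0 < x * (3 / 4 : R) ^+ l by rewrite mulr_gt0.
move: hl; rewrite /gap; move: c1 hy c3 c4 c5.
set a := `|_|; set b := `|_|; set e := `|_|; set u := (3 / 4) ^+ l => *; lra.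
Qed.

End chaining.

Lemma cvg_sumr (R : realType) (T : Type) (G : set_system T) {FG : Filter G} n (f : 'I_n -> T -> R) (l : 'I_n -> R) :
  (forall k, f k u @[u --> G] --> l k) -> \sum_k f k u @[u --> G] --> \sum_k l k.
Proof.
move=> fl; elim: (index_enum _) => [|k s IH].
  by under eq_fun do rewrite big_nil; rewrite big_nil; exact: cvg_cst.
by under eq_fun do rewrite big_cons; rewrite big_cons; apply: cvgD; [exact: fl|exact: IH].
Qed.

(** * Positive definite matrices *)
Section posdef.
Variable R : realType.

Definition qform n (S : 'M[R]_n) (u v : 'rV[R]_n) : R := (u *m S *m v^T) 0 0.

Lemma qformE n (S : 'M[R]_n) u v : qform S u v = \sum_i \sum_j u 0 i * S i j * v 0 j.
Proof.
rewrite /qform mxE exchange_big /=; apply: eq_bigr => j _.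
by rewrite !mxE mulr_suml.
Qed.

Lemma qform_sym n (S : 'M[R]_n) u v : S^T = S -> qform S u v = qform S v u.
Proof.
move=> ST; have E : (v *m S *m u^T)^T = u *m S *m v^T by rewrite !trmx_mul trmxK ST mulmxA.
by rewrite /qform -E mxE.
Qed.

Lemma qform_continuous n (S : 'M[R]_n) : continuous (fun u => qform S u u).
Proof.
have -> : (fun u => qform S u u) = (fun u => \sum_i \sum_j u 0 i * S i j * u 0 j).
  by apply/funext => u; rewrite qformE.
move=> u; apply: (cvg_sumr (G := nbhs u)) => i; apply: (cvg_sumr (G := nbhs u)) => j.
apply: cvgM; [apply: cvgM; [exact: coord_continuous|exact: cvg_cst]|exact: coord_continuous].
Qed.

Lemma qform1 n (u : 'rV[R]_n) : qform 1%:M u u = \sum_i u 0 i ^+ 2.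
Proof.
rewrite /qform mulmx1 mxE; apply: eq_bigr => i _; by rewrite !mxE.
Qed.

Lemma qform1_gt0 n (u : 'rV[R]_n) : u != 0 -> 0 < qform 1%:M u u.
Proof.
move=> u0; rewrite qform1 lt_def; apply/andP; split; last by apply: sumr_ge0 => i _; exact: sqr_ge0.
apply: contra u0; rewrite psumr_eq0 => [|i _]; last exact: sqr_ge0.
move/allP => H; apply/eqP/matrixP => i j; rewrite ord1 mxE; apply/eqP.
by rewrite -sqrf_eq0; apply: H; rewrite mem_index_enum.
Qed.

Lemma qform_scale n (S : 'M[R]_n) a u : qform S (a *: u) (a *: u) = a ^+ 2 * qform S u u.
Proof.
rewrite !qformE mulr_sumr; apply: eq_bigr => i _; rewrite mulr_sumr; apply: eq_bigr => j _.
by rewrite !mxE; ring.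
Qed.

Lemma qformB_scalar n (S : 'M[R]_n) m u : qform (S - m%:M) u u = qform S u u - m * qform 1%:M u u.
Proof. by rewrite /qform mulmxBr mulmxBl mul_mx_scalar mulmx1 -scalemxAl !mxE. Qed.

Lemma qformD n (S : 'M[R]_n) u v t : qform S (u + t *: v) (u + t *: v) =
  qform S u u + t * qform S u v + t * qform S v u + t ^+ 2 * qform S v v.
Proof.
rewrite !qformE !mulr_sumr -!big_split; apply: eq_bigr => i _; rewrite !mulr_sumr -!big_split.
by apply: eq_bigr => j _; rewrite !mxE /=; ring.
Qed.

Lemma quadratic_ge0_eq0 (b c : R) : (forall t, 0 <= 2 * t * b + t ^+ 2 * c) -> b = 0.
Proof.
move=> H; apply/eqP; apply: contraT => b0.
have k0 : 0 < `|c| + 1 by rewrite ltr_wpDl.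
have := H (- b / (`|c| + 1)).
have -> : 2 * (- b / (`|c| + 1)) * b + (- b / (`|c| + 1)) ^+ 2 * c = (b / (`|c| + 1)) ^+ 2 * (c - 2 * (`|c| + 1)).
  by field; rewrite gt_eqF.
rewrite pmulr_rge0; last by rewrite exprn_even_gt0//= mulf_neq0// invr_neq0// gt_eqF.
by have := ler_norm c; lra.
Qed.

(** A minimizer of the quadratic form on the compact unit sphere is an eigenvector, as the first
    variation vanishes there. *)
Lemma rayleigh n (S : 'M[R]_n.+1) (l : R) : S^T = S -> (forall a, eigenvalue S a -> l <= a) ->
  forall u, l * qform 1%:M u u <= qform S u u.
Proof.
move=> ST Hl; pose K := [set u : 'rV[R]_n.+1 | qform 1%:M u u = 1].
have K0 : K !=set0.
  exists (delta_mx 0 0); rewrite /K /= qform1 (bigD1 0)//= big1 => [|i i0]; rewrite !mxE ?eqxx ?addr0 ?expr1n//.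
  by rewrite (negbTE i0) andbF expr0n.
have cK : compact K.
  have box := @rV_compact R n.+1 (fun=> `[-1, 1]%classic) (fun=> @segment_compact R (-1) 1).
  apply: (subclosed_compact _ box).
    apply: (@closed_comp _ _ (fun u => qform 1%:M u u) [set 1]) => [u _|]; first exact: qform_continuous.
    exact: closed_eq.
  move=> u; rewrite /K /= qform1 => u1 i; rewrite in_itv /=.
  have : u ord0 i ^+ 2 <= 1.
    by rewrite -u1 (bigD1 i)//= lerDl; apply: sumr_ge0 => j _; exact: sqr_ge0.
  by rewrite -(real_normK (num_real (u ord0 i))) expr_le1// ler_norml.
have cS : {within K, continuous (fun u => qform S u u)}.
  by apply: continuous_subspaceT => u; exact: qform_continuous.
have [u0 u0K Hu0] := compact_EVT_min K0 cK cS.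
rewrite inE /K /= in u0K; set m := qform S u0 u0 in Hu0.
have Hm u : 0 <= qform (S - m%:M) u u.
  rewrite qformB_scalar subr_ge0; have [->|nu] := eqVneq u 0; first by rewrite /qform !mul0mx !mxE mulr0.
  have n0 := qform1_gt0 nu; set N := qform 1%:M u u in n0 *.
  have s0 : 0 < Num.sqrt N by rewrite sqrtr_gt0.
  have := Hu0 ((Num.sqrt N)^-1 *: u); rewrite inE /K /= !qform_scale exprVn sqr_sqrtr ?(ltW n0)//.
  rewrite -/N mulVf ?gt_eqF// => /(_ erefl).
  by rewrite ler_pdivlMl// mulrC.
have eig : u0 *m (S - m%:M) = 0.
  apply/matrixP => i j; rewrite ord1 [RHS]mxE.
  pose v : 'rV[R]_n.+1 := delta_mx 0 j.
  have -> : (u0 *m (S - m%:M)) 0 j = qform (S - m%:M) u0 v.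
    by rewrite /qform /v trmx_delta -colE [RHS]mxE.
  apply: (@quadratic_ge0_eq0 _ (qform (S - m%:M) v v)) => t.
  have ST' : (S - m%:M)^T = S - m%:M by rewrite linearB /= ST tr_scalar_mx.
  have := Hm (u0 + t *: v).
  have -> : qform (S - m%:M) (u0 + t *: v) (u0 + t *: v) =
     qform (S - m%:M) u0 u0 + t * qform (S - m%:M) u0 v + t * qform (S - m%:M) v u0 + t ^+ 2 * qform (S - m%:M) v v.
    exact: qformD.
  rewrite (qform_sym v u0 ST').
  have -> : qform (S - m%:M) u0 u0 = 0.
    by rewrite qformB_scalar u0K mulr1 subrr.
  by rewrite add0r => h; lra.
have lm : l <= m.
  apply: Hl; apply/eigenvalueP; exists u0.
    by move: eig; rewrite mulmxBr mul_mx_scalar => /eqP; rewrite subr_eq0 => /eqP.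
  by apply: contra_eq_neq u0K => ->; rewrite /qform !mul0mx !mxE eq_sym oner_eq0.
move=> u; apply: (le_via (m * qform 1%:M u u)).
  by apply: ler_wpM2r => //; rewrite qform1; apply: sumr_ge0 => i _; exact: sqr_ge0.
rewrite -subr_ge0; have := Hm u.
by rewrite qformB_scalar.
Qed.

Lemma gram_sym d r (c : 'M[R]_(d, r)) : (gram c)^T = gram c.
Proof. by rewrite /gram trmx_mul trmxK. Qed.

Lemma qform_gram_ge0 d r (c : 'M[R]_(d, r)) u : 0 <= qform (gram c) u u.
Proof.
rewrite /qform /gram mulmxA -mulmxA -trmx_mul mxE; apply: sumr_ge0 => i _.
by rewrite [_^T _ _]mxE -expr2 sqr_ge0.
Qed.

Lemma lambda_min_rayleigh d r (c : 'M[R]_(d, r)) : (0 < d)%N -> forall u,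
  lambda_min (gram c) * qform 1%:M u u <= qform (gram c) u u.
Proof.
case: d c => // d c _; apply: rayleigh; first exact: gram_sym.
move=> a ea; apply: ge_inf => //; exists 0 => b /eigenvalueP[v vb v0].
have := qform_gram_ge0 c v; rewrite /qform vb -scalemxAl mxE -[v]mulmx1 -/(qform 1%:M v v).
by rewrite pmulr_lge0//; have := qform1_gt0 v0; rewrite /qform mulmx1.
Qed.

Lemma posdef_unit n (S : 'M[R]_n) (l : R) : 0 < l ->
  (forall u, l * qform 1%:M u u <= qform S u u) -> S \in unitmx.
Proof.
move=> l0 H; rewrite -row_free_unit -kermx_eq0; apply/eqP/row_matrixP => i; rewrite row0.
apply/eqP; apply: contraT => v0; have /sub_kermxP vS : (row i (kermx S) <= kermx S)%MS by exact: row_sub.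
have := H (row i (kermx S)); rewrite [X in _ <= X]/qform vS mul0mx mxE.
by rewrite leNgt mulr_gt0// qform1_gt0.
Qed.

(** The rows u of the inverse satisfy l |u|^2 <= u S u^T, which is a diagonal entry of the inverse. *)
Lemma invmx_entry_le n (S : 'M[R]_n) (l : R) : S^T = S -> 0 < l ->
  (forall u, l * qform 1%:M u u <= qform S u u) -> forall a b, `|invmx S a b| <= l^-1.
Proof.
move=> ST l0 H a b; have US := posdef_unit l0 H.
pose u := row a (invmx S).
have uS : u *m S = delta_mx 0 a by rewrite -row_mul mulVmx// row1.
have E : qform S u u = invmx S a a.
  by rewrite /qform uS -rowE !mxE.
have Hu := H u; rewrite E qform1 in Hu.
have sq (i : 'I_n) : u 0 i ^+ 2 <= \sum_i u 0 i ^+ 2.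
  by rewrite (bigD1 i)//= lerDl; apply: sumr_ge0 => j _; exact: sqr_ge0.
have ua : u 0 a = invmx S a a by rewrite mxE.
have ub : u 0 b = invmx S a b by rewrite mxE.
have m0 : 0 <= invmx S a a by apply: le_trans Hu; rewrite mulr_ge0 ?(ltW l0)//; apply: sumr_ge0 => i _; exact: sqr_ge0.
have m1 : invmx S a a <= l^-1.
  have := le_trans (ler_wpM2l (ltW l0) (sq a)) Hu; rewrite ua expr2 => h.
  rewrite -[leRHS]mulr1 ler_pdivlMl//; have [-> |mp] := eqVneq (invmx S a a) 0; first by rewrite mulr0.
  by rewrite -(ler_pM2r (_ : 0 < invmx S a a)) ?mul1r -?mulrA// lt_def mp.
have h2 : `|invmx S a b| ^+ 2 <= l^-1 ^+ 2.
  rewrite real_normK ?num_real// -ub; apply: le_trans (sq b) _.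
  rewrite expr2 ler_pdivlMl//; exact: le_trans Hu m1.
by rewrite -(@ler_pXn2r _ 2)// nnegrE// invr_ge0 ltW.
Qed.

Lemma posdef_det_gt0 n (S : 'M[R]_n) (l : R) : 0 < l ->
  (forall u, l * qform 1%:M u u <= qform S u u) -> 0 < \det S.
Proof.
move=> l0 H; rewrite lt_def; apply/andP; split.
  by have := posdef_unit l0 H; rewrite unitmxE unitfE.
rewrite leNgt; apply/negP => dS.
pose M : 'M[{poly R}]_n := \matrix_(i, j) ((i == j)%:R%:P + 'X * (S i j - (i == j)%:R)%:P).
have ev t : (\det M).[t] = \det (1%:M + t *: (S - 1%:M)).
  rewrite -[LHS]/(horner_eval t (\det M)) -det_map_mx; congr (\det _); apply/matrixP => i j.
  by rewrite mxE [LHS]horner_evalE !mxE hornerD hornerM hornerX !hornerC.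
have p0 : (\det M).[0] = 1 by rewrite ev scale0r addr0 det1.
have p1 : (\det M).[1] = \det S by rewrite ev scale1r addrC subrK.
have [|t /andP[t0 t1] /rootP] := @poly_ivt R (- \det M) 0 1 ler01.
  by rewrite !hornerN p0 p1 lerN10 oppr_ge0 ltW.
rewrite hornerN => /eqP; rewrite oppr_eq0 ev => /eqP dt.
have m0 : 0 < Num.min 1 l by rewrite lt_min ltr01.
suff : 1%:M + t *: (S - 1%:M) \in unitmx by rewrite unitmxE dt unitr0.
apply: (posdef_unit m0) => u.
have -> : qform (1%:M + t *: (S - 1%:M)) u u = (1 - t) * qform 1%:M u u + t * qform S u u.
  by rewrite /qform mulmxDr mulmxDl -scalemxAr -scalemxAl mulmxBr mulmxBl !mxE; ring.
have q0 : 0 <= qform 1%:M u u by rewrite qform1; apply: sumr_ge0 => i _; exact: sqr_ge0.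
have h1 : t * (l * qform 1%:M u u) <= t * qform S u u by exact: ler_wpM2l.
have h2 : Num.min 1 l * qform 1%:M u u <= qform 1%:M u u by rewrite ler_piMl// ge_min lexx.
have h3 : Num.min 1 l * qform 1%:M u u <= l * qform 1%:M u u by rewrite ler_wpM2r// ge_min lexx orbT.
have h4 : (1 - t) * (Num.min 1 l * qform 1%:M u u) <= (1 - t) * qform 1%:M u u by rewrite ler_wpM2l// subr_ge0.
have h5 : t * (Num.min 1 l * qform 1%:M u u) <= t * (l * qform 1%:M u u) by rewrite ler_wpM2l.
move: h1 h4 h5; set q := qform _ _ _; set qS := qform _ _ _; set m := Num.min _ _; lra.
Qed.

End posdef.

(** * Taylor expansions on a box *)
Section taylor.
Context (R : realType) (p : nat).
Local Notation V := 'cV[R]_p.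
Local Notation dl q := (delta_mx q 0 : V).

Lemma is_derive_line (f : V -> R) (b v : V) (t : R) : derivable f (b + t *: v) v ->
  is_derive t (1 : R) (fun s : R => f (b + s *: v)) ('D_v f (b + t *: v)).
Proof.
move=> df; have E : (fun h : R => h^-1 *: (((fun s : R => f (b + s *: v)) \o shift t) (h *: 1) - f (b + t *: v))) =
    (fun h : R => h^-1 *: ((f \o shift (b + t *: v)) (h *: v) - f (b + t *: v))).
  apply/funext => h /=; congr (_ *: (f _ - _)).
  by rewrite -[h *: 1]/(h * 1) mulr1 scalerDl addrCA addrA addrAC.
by apply: DeriveDef; [rewrite /derivable E|rewrite /derive E].
Qed.

Lemma derivable_shift (f : V -> R) (b x v : V) : derivable f (b + x) v ->
  derivable (fun y => f (b + y)) x v /\ 'D_v (fun y => f (b + y)) x = 'D_v f (b + x).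
Proof.
have E : (fun h : R => h^-1 *: (((fun y => f (b + y)) \o shift x) (h *: v) - f (b + x))) =
    (fun h : R => h^-1 *: ((f \o shift (b + x)) (h *: v) - f (b + x))).
  by apply/funext => h /=; congr (_ *: (f _ - _)); rewrite addrCA.
by rewrite /derivable /derive E.
Qed.

Lemma mvt_between (g g' : R -> R) (e a b : R) : (forall t, `|t| <= e -> is_derive t (1 : R) g (g' t)) ->
  `|a| <= e -> `|b| <= e -> exists2 c, `|c| <= e /\ `|c| <= Num.max `|a| `|b| & g b - g a = (b - a) * g' c.
Proof.
have H (x y : R) : (forall t, `|t| <= e -> is_derive t (1 : R) g (g' t)) -> `|x| <= e -> `|y| <= e -> x < y ->
    exists2 c, `|c| <= e /\ `|c| <= Num.max `|x| `|y| & g y - g x = (y - x) * g' c.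
  move=> dg xe ye xy.
  have inI t : x <= t <= y -> `|t| <= e /\ `|t| <= Num.max `|x| `|y|.
    move: xe ye; rewrite !(ler_norml _ e) => /andP[x1 x2] /andP[y1 y2] /andP[t1 t2]; split; first by apply/andP; split; lra.
    have [t0|t0] := leP 0 t; rewrite le_max.
      by apply/orP; right; rewrite ger0_norm//; apply: le_trans t2 (ler_norm _).
    by apply/orP; left; rewrite ltr0_norm//; apply: (le_via (- x)); [rewrite lerN2|rewrite -normrN; exact: ler_norm].
  have [||c] := @MVT R g g' x y xy.
  - move=> t; rewrite in_itv /= => /andP[t1 t2]; apply: dg.
    by apply: (inI t _).1; rewrite (ltW t1) (ltW t2).
  - apply: derivable_within_continuous => t; rewrite in_itv /= => /inI[te _].
    by have := dg t te; case.
  rewrite in_itv /= => /andP[c1 c2] E; exists c; last by rewrite E mulrC.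
  by apply: inI; rewrite (ltW c1) (ltW c2).
move=> dg ae be; have [ab|ba|->] := ltgtP a b.
- exact: H.
- have [c [c1 c2] E] := H b a dg be ae ba; exists c; first by split => //; rewrite maxC.
  by rewrite -opprB E -mulNr opprB.
- by exists b; [split => //; rewrite le_max lexx|rewrite !subrr mul0r].
Qed.

Lemma taylor_step (g g' : R -> R) (s B : R) k : (forall t, `|t| <= `|s| -> is_derive t (1 : R) g (g' t)) ->
  (forall t, `|t| <= `|s| -> `|g' t| <= B * `|t| ^+ k) -> `|g s - g 0| <= B * `|s| ^+ k.+1.
Proof.
move=> dg gB; have [||c [cs _] ->] := mvt_between (a := 0) (b := s) dg; rewrite ?normr0//.
have B0 : 0 <= B * `|s| ^+ k by apply: le_trans (gB s _).
rewrite subr0 normrM; have [->|s0] := eqVneq s 0; first by rewrite normr0 mul0r expr0n mulr0.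
have sk : 0 < `|s| ^+ k by rewrite exprn_gt0// normr_gt0.
have BB : 0 <= B by rewrite -(pmulr_lge0 _ sk).
rewrite exprS mulrCA ler_wpM2l//; apply: le_trans (gB c cs) _.
by rewrite ler_wpM2l// lerXn2r.
Qed.

Lemma taylor3 (g g1 g2 g3 : R -> R) (s B : R) :
  (forall t, `|t| <= `|s| -> is_derive t (1 : R) g (g1 t)) ->
  (forall t, `|t| <= `|s| -> is_derive t (1 : R) g1 (g2 t)) ->
  (forall t, `|t| <= `|s| -> is_derive t (1 : R) g2 (g3 t)) ->
  (forall t, `|t| <= `|s| -> `|g3 t| <= B) ->
  `|g s - g 0 - s * g1 0 - 2^-1 * s ^+ 2 * g2 0| <= B * `|s| ^+ 3.
Proof.
move=> d1 d2 d3 gB.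
have s2 t : `|t| <= `|s| -> `|g2 t - g2 0| <= B * `|t| ^+ 1.
  move=> ts; apply: (@taylor_step g2 g3 t B 0) => u ut; first by apply: d3; exact: le_trans ts.
  by rewrite expr0 mulr1; apply: gB; exact: le_trans ts.
have s1 t : `|t| <= `|s| -> `|g1 t - t * g2 0 - g1 0| <= B * `|t| ^+ 2.
  move=> ts; have := @taylor_step (fun t => g1 t - t * g2 0) (fun t => g2 t - g2 0) t B 1.
  rewrite mul0r subr0; apply=> u ut; last by apply: s2; exact: le_trans ts.
  have := d2 u (le_trans ut ts) => du.
  by apply: is_derive_eq; rewrite -[X in _ - X](_ : g2 0 = _)// -[RHS]/(_ * _ + _ * _) ?mulr1 ?scaler0 ?add0r ?addr0// /GRing.scale /= ?mulr0 ?mulr1 ?add0r ?addr0.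
have := @taylor_step (fun t => g t - t * g1 0 - 2^-1 * t ^+ 2 * g2 0) (fun t => g1 t - g1 0 - t * g2 0) s B 2.
rewrite expr0n mulr0 !mul0r !subr0; have -> : g s - s * g1 0 - 2^-1 * s ^+ 2 * g2 0 - g 0 = g s - g 0 - s * g1 0 - 2^-1 * s ^+ 2 * g2 0 by ring.
apply=> u us; last by rewrite addrAC; exact: s1.
have du := d1 u us.
apply: is_derive_eq; rewrite !scaler0 /GRing.scale /= !mulr1; lra.
Qed.

Definition box (e : R) : set V := [set v | forall i, `|v i 0| <= e].
(** The sum norm, in which products over the coordinates are estimated without constants. *)
Definition gau (v : V) : R := \sum_i `|v i 0|.

Lemma gau_ge0 v : 0 <= gau v. Proof. exact: sumr_ge0. Qed.
Lemma gau0 : gau 0 = 0. Proof. by rewrite /gau big1// => i _; rewrite mxE normr0. Qed.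
Lemma box0 e : 0 <= e -> box e 0. Proof. by move=> e0 i; rewrite mxE normr0. Qed.

Lemma coord_gau (v : V) i : `|v i 0| <= gau v.
Proof. by rewrite /gau (bigD1 i)//= lerDl; exact: sumr_ge0. Qed.

Lemma gauZ t v : gau (t *: v) = `|t| * gau v.
Proof. by rewrite /gau mulr_sumr; apply: eq_bigr => i _; rewrite mxE normrM. Qed.

Lemma gau_box e v : box e v -> gau v <= p%:R * e.
Proof.
move=> bv; rewrite mulr_natl -[X in _ *+ X](card_ord p) -sumr_const; apply: ler_sum => i _; exact: bv.
Qed.

Definition pder (e : R) (f : V -> R) (f' : 'I_p -> V -> R) := forall v, box e v -> forall q,
  derivable f v (dl q) /\ 'D_(dl q) f v = f' q v.

(** Interpolation from v' to v changing one coordinate at a time, so that only derivatives in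
    coordinate directions occur. *)
Definition mix (q : nat) (v v' : V) : V := \col_i (if (i < q)%N then v i 0 else v' i 0).

Lemma mix0 v v' : mix 0 v v' = v'. Proof. by apply/matrixP => i j; rewrite ord1 mxE. Qed.
Lemma mixp v v' : mix p v v' = v. Proof. by apply/matrixP => i j; rewrite ord1 mxE ltn_ord. Qed.

Lemma mixS (q : 'I_p) v v' : mix q.+1 v v' = mix q v v' + (v q 0 - v' q 0) *: dl q.
Proof.
apply/matrixP => i j; rewrite ord1 !mxE eqxx andbT ltnS leq_eqVlt val_eqE.
have [->|iq] := eqVneq i q; first by rewrite ltnn /= mulr1 addrC subrK.
by rewrite mulr0 addr0.
Qed.

Lemma mix_coord q (v v' : V) i : `|mix q v v' i 0| <= Num.max `|v i 0| `|v' i 0|.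
Proof. by rewrite mxE; case: ifP => _; rewrite le_max lexx ?orbT. Qed.

Lemma mix_line_coord (q : 'I_p) (v v' : V) t i : `|t| <= Num.max `|v q 0| `|v' q 0| ->
  `|(mix q v v' + (t - v' q 0) *: dl q) i 0| <= Num.max `|v i 0| `|v' i 0|.
Proof.
move=> ht; rewrite !mxE eqxx andbT; have [->|iq] := eqVneq i q.
  by rewrite ltnn mulr1 addrC subrK.
rewrite mulr0 addr0; case: ifP => _; by rewrite le_max lexx ?orbT.
Qed.

Lemma mean_value e f f' v v' : pder e f f' -> box e v -> box e v' ->
  exists2 xi : 'I_p -> V, (forall q i, `|xi q i 0| <= Num.max `|v i 0| `|v' i 0|) &
    f v - f v' = \sum_q (v q 0 - v' q 0) * f' q (xi q).
Proof.
move=> df bv bv'.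
have H (q : 'I_p) : exists x : V, (forall i, `|x i 0| <= Num.max `|v i 0| `|v' i 0|) /\
    f (mix q.+1 v v') - f (mix q v v') = (v q 0 - v' q 0) * f' q x.
  pose b := mix q v v' - v' q 0 *: dl q.
  pose g t := f (b + t *: dl q); pose g' t := f' q (b + t *: dl q).
  have bE t : b + t *: dl q = mix q v v' + (t - v' q 0) *: dl q.
    by rewrite /b scalerBl addrAC -addrA.
  pose e1 := Num.max `|v q 0| `|v' q 0|.
  have dg t : `|t| <= e1 -> is_derive t (1 : R) g (g' t).
    move=> te; have bb : box e (b + t *: dl q).
      by move=> i; rewrite bE; apply: le_trans (mix_line_coord i te) _; rewrite ge_max bv bv'.
    have [d1 d2] := df _ bb q; rewrite /g' -d2; exact: is_derive_line.
  have [||c [c1 _] E] := mvt_between (a := v' q 0) (b := v q 0) dg; rewrite ?le_max ?lexx ?orbT//.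
  exists (b + c *: dl q); split; first by move=> i; rewrite bE; exact: mix_line_coord.
  by rewrite -E /g !bE mixS subrr scale0r addr0.
have [xi Hxi] := choice H; exists xi => [q i|]; first exact: (Hxi q).1.
rewrite -[in LHS](mixp v v') -[in X in _ - X](mix0 v v').
rewrite -(telescope_sumr (fun k => f (mix k v v')) (leq0n p)) big_mkord.
by apply: eq_bigr => q _; rewrite (Hxi q).2.
Qed.

Definition quad_part (f2 : 'I_p -> 'I_p -> R) (v : V) : R :=
  \sum_q (2^-1 * v q 0 ^+ 2 * f2 q q + v q 0 * \sum_(i < p) (i < q)%N%:R * v i 0 * f2 q i).

Lemma quad_partZ f2 t v : quad_part f2 (t *: v) = t ^+ 2 * quad_part f2 v.
Proof.
rewrite /quad_part mulr_sumr; apply: eq_bigr => q _; rewrite !mxE.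
under eq_bigr do rewrite mxE. rewrite !mulr_sumr mulrDr mulr_sumr; congr (_ + _); first by ring.
by apply: eq_bigr => i _; ring.
Qed.

Lemma gau_le (v v' : V) : (forall i, `|v i 0| <= `|v' i 0|) -> gau v <= gau v'.
Proof. by move=> H; apply: ler_sum. Qed.

Lemma taylor_box e f f1 f2 f3 (B : R) v : 0 <= e ->
  pder e f f1 -> (forall q, pder e (f1 q) (f2 q)) -> (forall q i, pder e (f2 q i) (f3 q i)) ->
  (forall q i k u, box e u -> `|f3 q i k u| <= B) -> box e v ->
  `|f v - f 0 - \sum_q v q 0 * f1 q 0 - quad_part (fun q i => f2 q i 0) v| <= (3 * p%:R) * B * gau v ^+ 3.
Proof.
move=> e0 d1 d2 d3 HB bv.
have mc q i : `|mix q v 0 i 0| <= `|v i 0|.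
  by apply: le_trans (mix_coord q v 0 i) _; rewrite mxE normr0 ge_max lexx normr_ge0.
have mb q : box e (mix q v 0) by move=> i; exact: le_trans (mc q i) (bv i).
have first_order (h : V -> R) (h' : 'I_p -> V -> R) (m : V) : pder e h h' -> box e m ->
    (forall q u, box e u -> `|h' q u| <= B) -> `|h m - h 0| <= gau m * B.
  move=> dh bm hB; have [xi xi1 ->] := mean_value dh bm (box0 e0).
  rewrite /gau mulr_suml; apply: le_trans (ler_norm_sum _ _ _) _; apply: ler_sum => q _.
  rewrite mxE subr0 normrM ler_wpM2l//; apply: hB => i.
  by apply: le_trans (xi1 q i) _; rewrite mxE normr0 ge_max bm e0.
have [p0|pp] := posnP p.
  have no (i : 'I_p) : False by case: i => k hk; move: (hk); rewrite [X in (_ < X)%N]p0.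
  have -> : v = 0 by apply/matrixP => i; case: (no i).
  rewrite gau0 expr0n mulr0 subrr /quad_part !big1 ?subr0 ?normr0// => q _; case: (no q).
have B0 : 0 <= B by apply: le_trans (HB (Ordinal pp) (Ordinal pp) (Ordinal pp) 0 (box0 e0)).
have second_order (q : 'I_p) (m : V) : box e m ->
    `|f1 q m - f1 q 0 - \sum_i m i 0 * f2 q i 0| <= gau m ^+ 2 * B.
  move=> bm; have [xi xi1 ->] := mean_value (d2 q) bm (box0 e0).
  rewrite -sumrB expr2 -mulrA {1}/gau mulr_suml; apply: le_trans (ler_norm_sum _ _ _) _; apply: ler_sum => i _.
  have xim k : `|xi i k 0| <= `|m k 0| by apply: le_trans (xi1 i k) _; rewrite mxE normr0 ge_max lexx normr_ge0.
  rewrite mxE subr0 -mulrBr normrM ler_wpM2l//.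
  have bx : box e (xi i) by move=> k; exact: le_trans (xim k) (bm k).
  apply: le_trans (first_order _ _ _ (d3 q i) bx (HB q i)) _.
  by rewrite ler_wpM2r//; exact: gau_le.
pose D (q : 'I_p) := f (mix q.+1 v 0) - f (mix q v 0) - v q 0 * f1 q 0 -
  (2^-1 * v q 0 ^+ 2 * f2 q q 0 + v q 0 * \sum_(i < p) (i < q)%N%:R * v i 0 * f2 q i 0).
have -> : f v - f 0 - \sum_q v q 0 * f1 q 0 - quad_part (fun q i => f2 q i 0) v = \sum_q D q.
  rewrite /D /quad_part !sumrB; congr (_ - _ - _).
  rewrite -[in LHS](mixp v 0) -[in X in _ - X](mix0 v 0).
  by rewrite -sumrB -(telescope_sumr (fun k => f (mix k v 0)) (leq0n p)) big_mkord.
apply: le_trans (ler_norm_sum _ _ _) _.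
have -> : (3 * p%:R) * B * gau v ^+ 3 = \sum_(q < p) (3 * B * gau v ^+ 3).
  by rewrite sumr_const card_ord -mulr_natr; ring.
apply: ler_sum => q _.
have vq : `|v q 0| <= gau v := coord_gau v q.
have g0 := gau_ge0 v.
have inb t : `|t| <= `|v q 0| -> box e (mix q v 0 + t *: dl q).
  move=> tv i; have hh : `|t| <= Num.max `|v q 0| `|(0 : V) q 0| by rewrite le_max tv.
  have := mix_line_coord i hh; rewrite [X in t - X]mxE subr0 => /le_trans; apply.
  by rewrite mxE normr0 ge_max bv e0.
have T3 := @taylor3 (fun t => f (mix q v 0 + t *: dl q)) (fun t => f1 q (mix q v 0 + t *: dl q))
  (fun t => f2 q q (mix q v 0 + t *: dl q)) (fun t => f3 q q q (mix q v 0 + t *: dl q)) (v q 0) B.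
have {T3} T3 : `|f (mix q.+1 v 0) - f (mix q v 0) - v q 0 * f1 q (mix q v 0) - 2^-1 * v q 0 ^+ 2 * f2 q q (mix q v 0)| <= B * `|v q 0| ^+ 3.
  have := T3; rewrite scale0r addr0 mixS mxE subr0; apply=> t tv; have bt := inb t tv.
  - by have [h1 <-] := d1 _ bt q; exact: is_derive_line.
  - by have [h1 <-] := d2 q _ bt q; exact: is_derive_line.
  - by have [h1 <-] := d3 q q _ bt q; exact: is_derive_line.
  - exact: HB.
have gm : gau (mix q v 0) <= gau v by apply: gau_le; exact: mc.
have S2 := second_order q _ (mb q).
have F2 := first_order _ _ _ (d3 q q) (mb q) (HB q q).
have E : \sum_i mix q v 0 i 0 * f2 q i 0 = \sum_(i < p) (i < q)%N%:R * v i 0 * f2 q i 0.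
  by apply: eq_bigr => i _; rewrite !mxE; case: ltnP => _; rewrite ?mul1r ?mul0r.
rewrite E in S2.
rewrite /D; set s := \sum_i _ in S2 *; set x := v q 0 in vq T3 *; set m := mix q v 0 in T3 S2 F2 gm *.
have -> : f (mix q.+1 v 0) - f m - x * f1 q 0 - (2^-1 * x ^+ 2 * f2 q q 0 + x * s) =
  (f (mix q.+1 v 0) - f m - x * f1 q m - 2^-1 * x ^+ 2 * f2 q q m) +
  (x * (f1 q m - f1 q 0 - s) + 2^-1 * x ^+ 2 * (f2 q q m - f2 q q 0)) by ring.
have x0 : 0 <= `|x| by [].
have gx2 : `|x| ^+ 2 <= gau v ^+ 2 by rewrite lerXn2r.
have gm2 : gau m ^+ 2 <= gau v ^+ 2 by rewrite lerXn2r ?nnegrE ?gau_ge0.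
have a1 : B * `|x| ^+ 3 <= B * gau v ^+ 3 by rewrite ler_wpM2l// lerXn2r.
have a2 : `|x * (f1 q m - f1 q 0 - s)| <= B * gau v ^+ 3.
  rewrite normrM; apply: (le_via (gau v * (gau v ^+ 2 * B))).
    by apply: ler_pM => //; apply: le_trans S2 _; rewrite ler_wpM2r.
  by rewrite mulrA -exprS mulrC.
have a3 : `|2^-1 * x ^+ 2 * (f2 q q m - f2 q q 0)| <= B * gau v ^+ 3.
  rewrite normrM; apply: (le_via (gau v ^+ 2 * (gau v * B))).
    apply: ler_pM => //.
      rewrite normrM normrX ger0_norm ?invr_ge0//; apply: le_trans gx2.
      by rewrite ler_piMl ?exprn_ge0//; lra.
    by apply: le_trans F2 _; rewrite ler_wpM2r.
  by rewrite mulrA -exprSr mulrC.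
apply: le_trans (ler_normD _ _) _; apply: le_trans (lerD T3 (ler_normD _ _)) _.
by move: a1 a2 a3; set G := B * gau v ^+ 3; rewrite -(mulrA 3) -/G; lra.
Qed.

End taylor.

(** * Expansions with polynomially growing coefficients *)
Section bigO.
Context (R : realType) (T : Type) (w : T -> R) (w1 : forall x, 1 <= w x) (p : nat) (e : R) (e0 : 0 < e).
Local Notation V := 'cV[R]_p.
Implicit Types f g : T -> V -> R.

(** Terms of order k at the centre of the box, uniformly up to a polynomial weight in the state x.
    After averaging over the observations the weights become bounded in probability. *)
Definition bO k f := exists B : R, exists N : nat, 0 <= B /\
  forall x v, box e v -> `|f x v| <= B * w x ^+ N * gau v ^+ k.

Lemma w0 x : 0 <= w x. Proof. exact: le_trans ler01 (w1 x). Qed.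

Lemma w_le x m n : (m <= n)%N -> w x ^+ m <= w x ^+ n.
Proof. by move=> mn; rewrite ler_weXn2l. Qed.

Lemma bO_le k f g : (forall x v, box e v -> `|f x v| <= `|g x v|) -> bO k g -> bO k f.
Proof.
move=> fg [B [N [B0 H]]]; exists B, N; split => // x v bv; exact: le_trans (fg x v bv) (H x v bv).
Qed.

Lemma bO_eq k f g : (forall x v, box e v -> f x v = g x v) -> bO k g -> bO k f.
Proof. by move=> fg; apply: bO_le => x v bv; rewrite fg. Qed.

Lemma bOD k f g : bO k f -> bO k g -> bO k (fun x v => f x v + g x v).
Proof.
move=> [B [N [B0 H]]] [B' [N' [B'0 H']]]; exists (B + B'), (N + N')%N; split; first exact: addr_ge0.
move=> x v bv; apply: le_trans (ler_normD _ _) _; rewrite !mulrDl; apply: lerD.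
  apply: le_trans (H x v bv) _; apply: ler_wpM2r; first by rewrite exprn_ge0// gau_ge0.
  by apply: ler_wpM2l => //; apply: w_le; exact: leq_addr.
apply: le_trans (H' x v bv) _; apply: ler_wpM2r; first by rewrite exprn_ge0// gau_ge0.
by apply: ler_wpM2l => //; apply: w_le; exact: leq_addl.
Qed.

Lemma bOM k l f g : bO k f -> bO l g -> bO (k + l) (fun x v => f x v * g x v).
Proof.
move=> [B [N [B0 H]]] [B' [N' [B'0 H']]]; exists (B * B'), (N + N')%N; split; first exact: mulr_ge0.
move=> x v bv; rewrite normrM !exprD.
have -> : B * B' * (w x ^+ N * w x ^+ N') * (gau v ^+ k * gau v ^+ l) =
  (B * w x ^+ N * gau v ^+ k) * (B' * w x ^+ N' * gau v ^+ l) by ring.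
by apply: ler_pM => //; [exact: H|exact: H'].
Qed.

Lemma bO_weak k l f : (l <= k)%N -> bO k f -> bO l f.
Proof.
move=> lk [B [N [B0 H]]]; exists (B * (p%:R * e) ^+ (k - l)), N; split.
  by rewrite mulr_ge0// exprn_ge0// mulr_ge0// ltW.
move=> x v bv; apply: le_trans (H x v bv) _.
rewrite -{1}(subnK lk) exprD.
have -> : B * (p%:R * e) ^+ (k - l) * w x ^+ N * gau v ^+ l = B * w x ^+ N * ((p%:R * e) ^+ (k - l) * gau v ^+ l) by ring.
apply: ler_wpM2l; first by rewrite mulr_ge0 ?exprn_ge0 ?w0.
apply: ler_wpM2r; first by rewrite exprn_ge0// gau_ge0.
by rewrite lerXn2r ?nnegrE ?gau_ge0 ?gau_box// mulr_ge0// ltW.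
Qed.

Lemma bO_cst (c : R) : bO 0 (fun _ _ => c).
Proof. by exists `|c|, 0%N; split => // x v _; rewrite !expr0 !mulr1. Qed.

Lemma bON k f : bO k f -> bO k (fun x v => - f x v).
Proof. by apply: bO_le => x v _; rewrite normrN. Qed.

Lemma bOB k f g : bO k f -> bO k g -> bO k (fun x v => f x v - g x v).
Proof. by move=> Of Og; apply: bOD => //; exact: bON. Qed.

Lemma bO_zero k : bO k (fun _ _ => 0).
Proof. by exists 0, 0%N; split => // x v _; rewrite normr0 !mul0r. Qed.

Lemma bO_sum k (I : Type) (s : seq I) (P : pred I) (F : I -> T -> V -> R) : (forall i, bO k (F i)) ->
  bO k (fun x v => \sum_(i <- s | P i) F i x v).
Proof.
move=> OF; elim: s => [|i s IH]; first by apply: bO_eq (bO_zero k) => x v _; rewrite big_nil.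
have [Pi|Pi] := boolP (P i).
  by apply: bO_eq (bOD (OF i) IH) => x v _; rewrite big_cons Pi.
by apply: bO_eq IH => x v _; rewrite big_cons (negbTE Pi).
Qed.

Lemma bO_prod (I : Type) (s : seq I) (P : pred I) (F : I -> T -> V -> R) : (forall i, bO 0 (F i)) ->
  bO 0 (fun x v => \prod_(i <- s | P i) F i x v).
Proof.
move=> OF; elim: s => [|i s IH]; first by apply: bO_eq (bO_cst 1) => x v _; rewrite big_nil.
have [Pi|Pi] := boolP (P i).
  by apply: bO_eq (bOM (OF i) IH) => x v _; rewrite big_cons Pi.
by apply: bO_eq IH => x v _; rewrite big_cons (negbTE Pi).
Qed.

Lemma bO_coord q : bO 1 (fun _ v => v q 0).
Proof. by exists 1, 0%N; split => // x v _; rewrite expr0 !mul1r expr1 coord_gau. Qed.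

Lemma bO_at0 f : bO 0 f -> bO 0 (fun x _ => f x 0).
Proof.
move=> [B [N [B0 H]]]; exists B, N; split => // x v _.
by have := H x 0 (box0 (ltW e0)); rewrite !expr0.
Qed.

Lemma bO_0 k f x : bO k.+1 f -> f x 0 = 0.
Proof.
move=> [B [N [B0 H]]]; have := H x 0 (box0 (ltW e0)); rewrite gau0 expr0n mulr0.
by rewrite normr_le0 => /eqP.
Qed.

Definition lin (lf : 'I_p -> T -> R) x (v : V) := \sum_q v q 0 * lf q x.

Lemma bO_lin lf : (forall q, bO 0 (fun x _ => lf q x)) -> bO 1 (lin lf).
Proof. by move=> H; apply: bO_sum => q; apply: bOM (bO_coord q) (H q). Qed.

(** Second order expansions in v with a linear part and a homogeneous quadratic part. They form an
    algebra, so expansions of inverses, determinants and logarithms follow from those of the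
    coefficients without computing derivatives. *)
Definition jets f (lf : 'I_p -> T -> R) (qf : T -> V -> R) :=
  [/\ bO 0 (fun x _ => f x 0), forall q, bO 0 (fun x _ => lf q x), bO 2 qf,
      forall x v t, qf x (t *: v) = t ^+ 2 * qf x v &
      bO 3 (fun x v => f x v - f x 0 - lin lf x v - qf x v)].

Lemma jets_bO1 f lf qf : jets f lf qf -> bO 1 (fun x v => f x v - f x 0).
Proof.
move=> [h0 h1 h2 _ h3]; apply: bO_eq (bOD (bOD (bO_weak (isT : (1 <= 3)%N) h3) (bO_lin h1)) (bO_weak (isT : (1 <= 2)%N) h2)) => x v _.
by ring.
Qed.

Lemma jets_bO2 f lf qf : jets f lf qf -> bO 2 (fun x v => f x v - f x 0 - lin lf x v).
Proof.
move=> [h0 h1 h2 _ h3]; apply: bO_eq (bOD (bO_weak (isT : (2 <= 3)%N) h3) h2) => x v _; by ring.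
Qed.

Lemma jets_bO0 f lf qf : jets f lf qf -> bO 0 f.
Proof.
move=> H; have [h0 _ _ _ _] := H.
apply: bO_eq (bOD (bO_weak (isT : (0 <= 1)%N) (jets_bO1 H)) h0) => x v _; by ring.
Qed.

Lemma jets_eq f g lf qf : (forall x v, box e v -> f x v = g x v) -> jets g lf qf -> jets f lf qf.
Proof.
move=> fg [h0 h1 h2 h2' h3].
have b0 := box0 (ltW e0).
split => //; first by apply: bO_eq h0 => x v _; rewrite fg.
by apply: bO_eq h3 => x v bv; rewrite !fg.
Qed.

Lemma jets_cst (a : T -> R) : bO 0 (fun x _ => a x) -> jets (fun x _ => a x) (fun _ _ => 0) (fun _ _ => 0).
Proof.
move=> Oa; split => //; try by move=> *; exact: bO_zero.
- by move=> x v t; rewrite mulr0.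
- by apply: bO_eq (bO_zero 3) => x v _; rewrite /lin big1 => [|q _]; rewrite ?mulr0//; ring.
Qed.

Lemma jets_bO3 f : bO 3 f -> jets f (fun _ _ => 0) (fun _ _ => 0).
Proof.
move=> Of; split => //; try by move=> *; exact: bO_zero.
- by apply: bO_eq (bO_zero 0) => x v _; exact: bO_0 Of.
- by move=> x v t; rewrite mulr0.
- by apply: (bO_eq _ Of) => x v _; rewrite (bO_0 x Of) /lin big1 => [|q _]; rewrite ?mulr0//; ring.
Qed.

Lemma linD lf lg x v : lin (fun q x => lf q x + lg q x) x v = lin lf x v + lin lg x v.
Proof. by rewrite /lin -big_split; apply: eq_bigr => q _; rewrite mulrDr. Qed.

Lemma linZ a lf x v : lin (fun q x => a x * lf q x) x v = a x * lin lf x v.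
Proof. by rewrite /lin mulr_sumr; apply: eq_bigr => q _; rewrite mulrCA. Qed.

Lemma jetsD f g lf qf lg qg : jets f lf qf -> jets g lg qg ->
  jets (fun x v => f x v + g x v) (fun q x => lf q x + lg q x) (fun x v => qf x v + qg x v).
Proof.
move=> [h0 h1 h2 h2' h3] [k0 k1 k2 k2' k3]; split.
- exact: bOD.
- by move=> q; exact: bOD.
- exact: bOD.
- by move=> x v t; rewrite h2' k2' mulrDr.
- by apply: bO_eq (bOD h3 k3) => x v _; rewrite linD; ring.
Qed.

Lemma jetsM f g lf qf lg qg : jets f lf qf -> jets g lg qg ->
  jets (fun x v => f x v * g x v) (fun q x => f x 0 * lg q x + g x 0 * lf q x)
    (fun x v => f x 0 * qg x v + g x 0 * qf x v + lin lf x v * lin lg x v).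
Proof.
move=> Jf Jg; have [h0 h1 h2 h2' h3] := Jf; have [k0 k1 k2 k2' k3] := Jg; split.
- exact: (bOM h0 k0).
- by move=> q; apply: bOD; [exact: (bOM h0 (k1 q))|exact: (bOM k0 (h1 q))].
- apply: bOD; [apply: bOD; [exact: (bOM h0 k2)|exact: (bOM k0 h2)]|exact: (bOM (bO_lin h1) (bO_lin k1))].
- move=> x v t; rewrite h2' k2'; have E (u1 : 'I_p -> T -> R) : lin u1 x (t *: v) = t * lin u1 x v.
    by rewrite /lin mulr_sumr; apply: eq_bigr => q _; rewrite mxE mulrA.
  by rewrite !E; ring.
- apply: bO_eq (bOD (bOD (bOM h0 k3) (bOM (bO_lin h1) (jets_bO2 Jg))) (bOD (bOM h2 (jets_bO1 Jg)) (bOM h3 (jets_bO0 Jg)))) => x v _.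
  by rewrite linD !linZ; ring.
Qed.

Definition jet f := exists lf qf, jets f lf qf.

Lemma jetD f g : jet f -> jet g -> jet (fun x v => f x v + g x v).
Proof. by move=> [lf [qf Jf]] [lg [qg Jg]]; do 2 eexists; exact: jetsD Jf Jg. Qed.

Lemma jetM f g : jet f -> jet g -> jet (fun x v => f x v * g x v).
Proof. by move=> [lf [qf Jf]] [lg [qg Jg]]; do 2 eexists; exact: jetsM Jf Jg. Qed.

Lemma jet_eq f g : (forall x v, box e v -> f x v = g x v) -> jet g -> jet f.
Proof. by move=> fg [lf [qf J]]; do 2 eexists; exact: jets_eq fg J. Qed.

Lemma jet_cst (a : T -> R) : bO 0 (fun x _ => a x) -> jet (fun x _ => a x).
Proof. by move=> Oa; do 2 eexists; exact: jets_cst. Qed.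

Lemma jet_bO3 f : bO 3 f -> jet f.
Proof. by move=> Of; do 2 eexists; exact: jets_bO3. Qed.

Lemma jet_sum (I : Type) (s : seq I) (F : I -> T -> V -> R) : (forall i, jet (F i)) ->
  jet (fun x v => \sum_(i <- s) F i x v).
Proof.
move=> JF; elim: s => [|i s IH]; first by apply: jet_eq (jet_cst (bO_cst 0)) => x v _; rewrite big_nil.
by apply: jet_eq (jetD (JF i) IH) => x v _; rewrite big_cons.
Qed.

Lemma jet_prod (I : Type) (s : seq I) (F : I -> T -> V -> R) : (forall i, jet (F i)) ->
  jet (fun x v => \prod_(i <- s) F i x v).
Proof.
move=> JF; elim: s => [|i s IH]; first by apply: jet_eq (jet_cst (bO_cst 1)) => x v _; rewrite big_nil.
by apply: jet_eq (jetM (JF i) IH) => x v _; rewrite big_cons.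
Qed.

Lemma jet_bO0 f : jet f -> bO 0 f. Proof. by move=> [lf [qf J]]; exact: jets_bO0 J. Qed.
Lemma jet_bO1 f : jet f -> bO 1 (fun x v => f x v - f x 0). Proof. by move=> [lf [qf J]]; exact: jets_bO1 J. Qed.
Lemma jet_at0 f : jet f -> bO 0 (fun x _ => f x 0). Proof. by move=> [lf [qf [J _ _ _ _]]]. Qed.

Lemma jet_sub0 f : jet f -> jet (fun x v => f x v - f x 0).
Proof. by move=> J; apply: (jetD J); apply: (@jet_cst (fun x => - f x 0)); apply: bON; exact: jet_at0 J. Qed.

(** The linear part is recovered as a limit along rays, where a term of second order contributes
    nothing. *)
Lemma jets_lin0 f lf qf : jets f lf qf -> bO 2 f -> forall q x, lf q x = 0.
Proof.
move=> Jf Of q x; have := bOB Of (jets_bO2 Jf) => -[B [N [B0 H]]].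
have f0 : f x 0 = 0 := bO_0 x Of.
apply/eqP; rewrite -normr_le0; apply/ler_addgt0Pr => d d0; rewrite add0r.
pose c := B * w x ^+ N; have c0 : 0 <= c by rewrite mulr_ge0 ?exprn_ge0 ?w0.
pose t := Num.min e (d / (c + 1)).
have t0 : 0 < t by rewrite lt_min e0 divr_gt0// ltr_pwDr.
have te : t <= e by rewrite ge_min lexx.
have tc : t * c <= d.
  apply: (le_via (d / (c + 1) * c)); first by rewrite ler_wpM2r// ge_min lexx orbT.
  by rewrite mulrAC ler_pdivrMr ?ltr_pwDr// ler_wpM2l ?(ltW d0)// lerDl.
have := H x (t *: delta_mx q 0).
have gE : gau (t *: (delta_mx q 0 : V)) = t.
  rewrite gauZ gtr0_norm// /gau (bigD1 q)//= big1 => [|i iq]; rewrite !mxE ?eqxx ?normr1 ?addr0 ?mulr1//.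
  by rewrite (negbTE iq) normr0.
have lE : lin lf x (t *: delta_mx q 0) = t * lf q x.
  rewrite /lin (bigD1 q)//= big1 => [|i iq]; rewrite !mxE ?eqxx ?mulr1 ?addr0//.
  by rewrite (negbTE iq) mulr0 mul0r.
rewrite gE lE f0 => /(_ _); have -> : f x (t *: delta_mx q 0) - (f x (t *: delta_mx q 0) - 0 - t * lf q x) = t * lf q x by ring.
have bt : box e (t *: (delta_mx q 0 : V)).
  move=> i; rewrite !mxE normrM gtr0_norm//; apply: le_trans te; rewrite ler_piMr ?(ltW t0)//.
  by case: (_ && _); rewrite ?normr1 ?normr0.
move=> /(_ bt); rewrite normrM gtr0_norm// -/c expr2 mulrA [c * t * t]mulrC ler_pM2l// mulrC => h.
exact: le_trans h tc.
Qed.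

Lemma ln1D_taylor (z : R) : 0 < 1 + z ->
  `|ln (1 + z) - z + 2^-1 * z ^+ 2| <= (1 + (1 + z)^-1) * `|z| ^+ 3 /\
  `|ln (1 + z) - z| <= (1 + (1 + z)^-1) * `|z| ^+ 2.
Proof.
move=> z1; have zi : 0 < (1 + z)^-1 by rewrite invr_gt0.
have P (t : R) : Num.min 0 z <= t <= Num.max 0 z -> 0 < 1 + t /\ (1 + t)^-1 <= 1 + (1 + z)^-1 /\ `|t| <= `|z|.
  have [z0|z0] := leP 0 z => /andP[t1 t2].
    have h : 0 < 1 + t by lra.
    split=> //; split; last by rewrite !ger0_norm.
    apply: (le_via 1); last by rewrite lerDl ltW.
    by rewrite invf_le1//; lra.
  have h : 0 < 1 + t by lra.
  split=> //; split; last by rewrite (ltr0_norm z0) ler0_norm ?lerN2.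
  apply: (le_via (1 + z)^-1); last by rewrite lerDr.
  by rewrite lef_pV2 ?posrE// lerD2l.
have dl t : Num.min 0 z <= t <= Num.max 0 z -> is_derive t (1 : R) (fun s : R => ln (1 + s)) (1 + t)^-1.
  move=> /P[t0 _].
  have h1 : is_derive (1 + t) (1 : R) (@ln R) (1 + t)^-1 by exact: is_derive1_ln.
  have h2 : is_derive t (1 : R) (fun s : R => 1 + s) 1.
    rewrite (_ : (fun s : R => 1 + s) = shift 1); first exact: is_derive_shift.
    by apply/funext => s; rewrite /= addrC.
  by have := is_derive1_comp h1 h2; rewrite ?mulr1 ?mul1r.
have mv (g g' : R -> R) (B : R) : 0 <= B -> g 0 = 0 ->
    (forall t, Num.min 0 z <= t <= Num.max 0 z -> is_derive t (1 : R) g (g' t)) ->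
    (forall t, Num.min 0 z <= t <= Num.max 0 z -> `|g' t| <= B) -> `|g z| <= B * `|z|.
  move=> B0 g00 dg gB.
  have C x y : Num.min 0 z <= x -> y <= Num.max 0 z -> {within `[x, y], continuous g}.
    move=> hx hy; apply: derivable_within_continuous => t; rewrite in_itv /= => /andP[t1 t2].
    by have := dg t; rewrite (le_trans hx t1) (le_trans t2 hy) => /(_ isT); case.
  have [z0|z0|z0] := ltgtP z 0.
  - have mz : Num.min 0 z = z by rewrite minC; apply/min_idPl/ltW. have Mz : Num.max 0 z = 0 by apply/max_idPl/ltW.
    have [||c] := @MVT R g g' z 0 z0.
    + by move=> t; rewrite in_itv /= => /andP[t1 t2]; apply: dg; rewrite mz Mz !ltW.
    + by apply: C; rewrite ?mz ?Mz.
    rewrite in_itv /= => /andP[c1 c2]; rewrite g00 !sub0r => E.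
    have -> : `|g z| = `|g' c| * `|z| by rewrite -normrN E normrM normrN.
    by rewrite ler_wpM2r// gB// mz Mz !ltW.
  - have mz : Num.min 0 z = 0 by apply/min_idPl/ltW. have Mz : Num.max 0 z = z by apply/max_idPr/ltW.
    have [||c] := @MVT R g g' 0 z z0.
    + by move=> t; rewrite in_itv /= => /andP[t1 t2]; apply: dg; rewrite mz Mz !ltW.
    + by apply: C; rewrite ?mz ?Mz.
    rewrite in_itv /= => /andP[c1 c2]; rewrite g00 !subr0 => ->.
    by rewrite normrM ler_wpM2r// gB// mz Mz !ltW.
  - by rewrite z0 g00 !normr0 mulr0.
have n0 : 0 <= 1 + (1 + z)^-1 by rewrite addr_ge0// ltW.
split.
  have -> : (1 + (1 + z)^-1) * `|z| ^+ 3 = ((1 + (1 + z)^-1) * `|z| ^+ 2) * `|z| by rewrite -mulrA -exprSr.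
  apply: (mv (fun t : R => ln (1 + t) - t + 2^-1 * t ^+ 2) (fun t : R => t ^+ 2 / (1 + t))).
  - by rewrite mulr_ge0 ?exprn_ge0.
  - by rewrite addr0 ln1 subr0 expr0n mulr0 addr0.
  - move=> t tz; have dlt := dl t tz; have [t0 _] := P t tz.
    by apply: is_derive_eq; rewrite /GRing.scale /= ?mulr1 ?mulr0 ?add0r; field; rewrite gt_eqF.
  - move=> t tz; have [t0 [t1 t2]] := P t tz.
    rewrite normrM normrX (ger0_norm (_ : 0 <= (1 + t)^-1)) ?invr_ge0 ?(ltW t0)// mulrC.
    by apply: ler_pM; rewrite ?invr_ge0 ?(ltW t0)// ?exprn_ge0// lerXn2r.
rewrite expr2 mulrA; apply: (mv (fun t => ln (1 + t) - t) (fun t => - t / (1 + t))).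
- by rewrite mulr_ge0.
- by rewrite addr0 ln1 subr0.
- move=> t tz; have dlt := dl t tz; have [t0 _] := P t tz.
  by apply: is_derive_eq; field; rewrite gt_eqF.
- move=> t tz; have [t0 [t1 t2]] := P t tz.
  rewrite normrM normrN (ger0_norm (_ : 0 <= (1 + t)^-1)) ?invr_ge0 ?(ltW t0)// mulrC.
  by apply: ler_pM; rewrite ?invr_ge0 ?(ltW t0).
Qed.

Definition bOmx k m n (M : T -> V -> 'M[R]_(m, n)) := forall i j, bO k (fun x v => M x v i j).
Definition jetmx m n (M : T -> V -> 'M[R]_(m, n)) := forall i j, jet (fun x v => M x v i j).

Lemma bOmxM k l m n q (M : T -> V -> 'M[R]_(m, n)) (N : T -> V -> 'M[R]_(n, q)) :
  bOmx k M -> bOmx l N -> bOmx (k + l) (fun x v => M x v *m N x v).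
Proof.
move=> OM ON i j; apply: bO_eq (bO_sum (index_enum 'I_n) xpredT (fun a => bOM (OM i a) (ON a j))) => x v _.
by rewrite mxE.
Qed.

Lemma jetmxM m n q (M : T -> V -> 'M[R]_(m, n)) (N : T -> V -> 'M[R]_(n, q)) :
  jetmx M -> jetmx N -> jetmx (fun x v => M x v *m N x v).
Proof.
move=> JM JN i j; apply: jet_eq (jet_sum (index_enum 'I_n) (fun a => jetM (JM i a) (JN a j))) => x v _.
by rewrite mxE.
Qed.

Lemma jetmxD m n (M N : T -> V -> 'M[R]_(m, n)) :
  jetmx M -> jetmx N -> jetmx (fun x v => M x v + N x v).
Proof. by move=> JM JN i j; apply: jet_eq (jetD (JM i j) (JN i j)) => x v _; rewrite mxE. Qed.

Lemma jetmxN m n (M : T -> V -> 'M[R]_(m, n)) : jetmx M -> jetmx (fun x v => - M x v).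
Proof.
move=> JM i j; apply: jet_eq (jetM (jet_cst (bO_cst (-1))) (JM i j)) => x v _; by rewrite mxE mulN1r.
Qed.

Lemma jetmx_trmx m n (M : T -> V -> 'M[R]_(m, n)) : jetmx M -> jetmx (fun x v => (M x v)^T).
Proof. by move=> JM i j; apply: jet_eq (JM j i) => x v _; rewrite mxE. Qed.

Lemma bOmxN k m n (M : T -> V -> 'M[R]_(m, n)) : bOmx k M -> bOmx k (fun x v => - M x v).
Proof. by move=> OM i j; apply: bO_eq (bON (OM i j)) => x v _; rewrite mxE. Qed.

Section inverse.
Variables (d : nat) (S : T -> V -> 'M[R]_d).
Hypotheses (JS : jetmx S) (US : forall x v, box e v -> S x v \in unitmx)
  (Sdet : forall x v, box e v -> 0 < \det (S x v))
  (OI : bOmx 0 (fun x v => invmx (S x v))) (ST : forall x v, (S x v)^T = S x v).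
Let M x v := invmx (S x v).
Let D x v := S x v - S x 0.
Let b0 : box e (0 : V) := box0 (ltW e0).

Let OM0 : bOmx 0 (fun x (v : V) => M x 0).
Proof. by move=> i j; exact: bO_at0 (OI i j). Qed.

Let OD : bOmx 1 D.
Proof. by move=> i j; apply: bO_eq (jet_bO1 (JS i j)) => x v _; rewrite !mxE. Qed.

Let JD : jetmx D.
Proof. by move=> i j; apply: jet_eq (jet_sub0 (JS i j)) => x v _; rewrite !mxE. Qed.

Let JM0 : jetmx (fun x (v : V) => M x 0).
Proof. by move=> i j; apply: (@jet_cst (fun x => M x 0 i j)); exact: OM0. Qed.

Lemma inv_neumann x v : box e v -> M x v = M x 0 - M x 0 *m D x v *m M x v.
Proof.
move=> bv; rewrite /D mulmxBr mulmxBl -mulmxA mulmxV ?US// mulmx1 mulVmx ?US// mul1mx.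
by rewrite opprB addrC subrK.
Qed.

(** Iterating the resolvent identity three times leaves a remainder of third order. *)
Lemma jetmx_inv : jetmx M.
Proof.
have J1 := jetmxM JM0 JD; have J2 := jetmxM J1 JM0; have J3 := jetmxM J1 J2.
have O3 := bOmxN (bOmxM (bOmxM OM0 OD) (bOmxM (bOmxM OM0 OD) (bOmxM (bOmxM OM0 OD) OI))).
have Jr : jetmx (fun x v => - (M x 0 *m D x v *m (M x 0 *m D x v *m (M x 0 *m D x v *m invmx (S x v))))).
  by move=> i j; apply: jet_bO3; exact: O3.
have := jetmxD (jetmxD (jetmxD JM0 (jetmxN J2)) J3) Jr => J i j.
apply: jet_eq (J i j) => x v bv; congr (fun_of_matrix _ i j).
rewrite {1}inv_neumann//; have E1 := inv_neumann x bv; rewrite {1}E1 {1}E1.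
by rewrite !mulmxBr opprB -/(M x v) !addrA addrAC; congr (_ - _); rewrite addrAC.
Qed.

Lemma bO_invdet : bO 0 (fun x v => (\det (S x v))^-1).
Proof.
have H : bO 0 (fun x v => \det (M x v)).
  apply: bO_sum => s; apply: (bOM (k := 0%N) (l := 0%N)); first exact: bO_cst.
  by apply: bO_prod => i; exact: OI.
by apply: bO_eq H => x v bv; rewrite det_inv.
Qed.

Lemma jet_det : jet (fun x v => \det (S x v)).
Proof.
apply: jet_sum => s; apply: jetM; first by apply: jet_cst; exact: bO_cst.
by apply: jet_prod => i; exact: JS.
Qed.

Lemma lndet_split x v : box e v -> ln (\det (S x v)) - ln (\det (S x 0)) = ln (1 + (\det (S x v) / \det (S x 0) - 1)).
Proof. by move=> bv; rewrite [in RHS](addrC 1) subrK lnM ?posrE ?invr_gt0 ?Sdet// lnV ?posrE ?Sdet. Qed.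

Let z x v := \det (S x v) / \det (S x 0) - 1.

Let Oi0 : bO 0 (fun x (v : V) => (\det (S x 0))^-1) := bO_at0 bO_invdet.

Let Jz : jet z.
Proof.
apply: jet_eq (jetD (jetM jet_det (jet_cst Oi0)) (jet_cst (bO_cst (-1)))) => x v _; by [].
Qed.

Let Oz : bO 1 z.
Proof.
apply: bO_eq (jet_bO1 Jz) => x v _; rewrite /z mulfV ?subrr ?subr0// gt_eqF// Sdet//.
Qed.

Let Or : bO 0 (fun x v => 1 + (1 + z x v)^-1).
Proof.
apply: bOD (bO_cst 1) _.
have O0 : bO 0 (fun x (v : V) => \det (S x 0)) by exact: bO_at0 (jet_bO0 jet_det).
by apply: bO_eq (bOM O0 bO_invdet) => x v _; rewrite /z addrC subrK invf_div.
Qed.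

Let z1 x v : box e v -> 0 < 1 + z x v.
Proof. by move=> bv; rewrite /z addrC subrK divr_gt0// Sdet. Qed.

Lemma bOX k f n : bO k f -> bO (n * k) (fun x v => f x v ^+ n).
Proof.
move=> Of; elim: n => [|n IH]; first by apply: bO_eq (bO_cst 1) => x v _; rewrite expr0.
by rewrite mulSn; apply: bO_eq (bOM Of IH) => x v _; rewrite exprS.
Qed.

Lemma jet_lndet : jet (fun x v => ln (\det (S x v)) - ln (\det (S x 0))).
Proof.
have J3 : jet (fun x v => ln (1 + z x v) - z x v + 2^-1 * z x v ^+ 2).
  apply: jet_bO3; apply: (@bO_le _ _ (fun x v => (1 + (1 + z x v)^-1) * z x v ^+ 3)); last exact: (bOM Or (bOX 3 Oz)).
  move=> x v bv; rewrite normrM normrX; apply: le_trans (ln1D_taylor (z1 x bv)).1 _.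
  by apply: ler_wpM2r; [exact: exprn_ge0|exact: ler_norm].
apply: jet_eq (jetD (jetD J3 Jz) (jetM (jet_cst (bO_cst (- 2^-1))) (jetM Jz Jz))) => x v bv.
by rewrite lndet_split// -/(z x v); ring.
Qed.

Let E x v := M x 0 *m D x v.

Let OE : bOmx 1 E := bOmxM OM0 OD.

Let detE x v : box e v -> 1 + z x v = \det (1%:M + E x v).
Proof.
move=> bv; rewrite /z addrC subrK mulrC -det_inv -det_mulmx /E /D mulmxBr mulVmx ?US//.
by rewrite addrC subrK.
Qed.

Lemma bO_det1D : bO 2 (fun x v => \det (1%:M + E x v) - 1 - \tr (E x v)).
Proof.
have O0 i j : bO 0 (fun x v => (1%:M + E x v) i j).
  by apply: bO_eq (bOD (bO_cst ((1%:M : 'M[R]_d) i j)) (bO_weak (isT : (0 <= 1)%N) (OE i j))) => x v _; rewrite mxE.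
have diag (s : seq 'I_d) : bO 1 (fun x v => \sum_(i <- s) E x v i i) /\
    bO 2 (fun x v => \prod_(i <- s) (1%:M + E x v) i i - 1 - \sum_(i <- s) E x v i i).
  elim: s => [|i s [IH1 IH2]]; split.
  - by apply: bO_eq (bO_zero 1) => x v _; rewrite big_nil.
  - by apply: bO_eq (bO_zero 2) => x v _; rewrite !big_nil; ring.
  - by apply: bO_eq (bOD (OE i i) IH1) => x v _; rewrite big_cons.
  - have O1 : bO 1 (fun x v => \prod_(i <- s) (1%:M + E x v) i i - 1).
      by apply: bO_eq (bOD (bO_weak (isT : (1 <= 2)%N) IH2) IH1) => x v _; ring.
    apply: bO_eq (bOD IH2 (bOM (OE i i) O1)) => x v _; rewrite !big_cons !mxE eqxx /=.
    by ring.
have off (s : {perm 'I_d}) : s != 1%g -> bO 2 (fun x v => \prod_i (1%:M + E x v) i (s i)).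
  move=> s1; have [i si] : exists i, s i != i.
    by apply/existsP; apply: contraR s1 => /existsPn H; apply/eqP/permP => i; rewrite perm1; apply/eqP; have := H i; rewrite negbK.
  have sji : s (s i) != s i by rewrite (inj_eq perm_inj).
  have Oo a b : a != b -> bO 1 (fun x v => (1%:M + E x v) a b).
    by move=> ab; apply: bO_eq (OE a b) => x v _; rewrite !mxE (negbTE ab) add0r.
  have i1 : i != s i by rewrite eq_sym.
  have i2 : s i != s (s i) by rewrite eq_sym.
  apply: bO_eq (bOM (bOM (Oo _ _ i1) (Oo _ _ i2)) (bO_prod (index_enum 'I_d) (fun j => (j != i) && (j != s i)) (fun j => O0 j (s j)))) => x v _.
  by rewrite (bigD1 i)//= (bigD1 (s i))//= mulrA.
have O1 : bO 2 (fun x v => \prod_i (1%:M + E x v) i i - 1 - \tr (E x v)) := (diag (index_enum 'I_d)).2.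
have O2 : bO 2 (fun x v => \sum_(s : {perm 'I_d} | s != 1%g) (-1) ^+ s * \prod_i (1%:M + E x v) i (s i)).
  have H (s : {perm 'I_d}) : bO 2 (fun x v => if s != 1%g then (-1) ^+ s * \prod_i (1%:M + E x v) i (s i) else 0).
    case: (boolP (s != 1%g)) => s1; last exact: bO_zero.
    exact: (bOM (bO_cst _) (off s s1)).
  by apply: bO_eq (bO_sum (index_enum {perm 'I_d}) xpredT H) => x v _; rewrite -big_mkcond.
apply: bO_eq (bOD O1 O2) => x v _; rewrite /determinant (bigD1 (1%g : {perm 'I_d}))//= odd_perm1 expr0 mul1r.
under [X in X + _ - 1 - _]eq_bigr do rewrite perm1.
by ring.
Qed.

(** The scale contrast has no linear part in its mean: the derivative of the log-determinant cancels
    that of the trace. Hence at the true value only the fluctuation of the squared increments is of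
    first order. *)
Lemma bO_score : bO 2 (fun x v => ln (\det (S x v)) - ln (\det (S x 0)) +
  \sum_a \sum_b (M x v a b - M x 0 a b) * S x 0 a b).
Proof.
have O1 : bO 2 (fun x v => ln (1 + z x v) - z x v).
  apply: (@bO_le _ _ (fun x v => (1 + (1 + z x v)^-1) * z x v ^+ 2)); last exact: (bOM Or (bOX 2 Oz)).
  move=> x v bv; rewrite normrM normrX; apply: le_trans (ln1D_taylor (z1 x bv)).2 _.
  by apply: ler_wpM2r; [exact: exprn_ge0|exact: ler_norm].
have OS0 : bOmx 0 (fun x (v : V) => S x 0) by move=> i j; exact: bO_at0 (jet_bO0 (JS i j)).
have O2 : bO 2 (fun x v => \tr (E x v *m (E x v *m (M x v *m S x 0)))).
  apply: bO_sum => i; exact: (bOmxM OE (bOmxM OE (bOmxM OI OS0))).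
apply: bO_eq (bOD (bOD O1 bO_det1D) O2) => x v bv.
rewrite lndet_split// -/(z x v) -(detE x bv).
have -> : \sum_a \sum_b (M x v a b - M x 0 a b) * S x 0 a b = \tr ((M x v - M x 0) *m S x 0).
  rewrite /mxtrace; apply: eq_bigr => a _; rewrite mxE; apply: eq_bigr => b _.
  by rewrite !mxE -[in RHS](ST x 0) mxE.
have -> : (M x v - M x 0) *m S x 0 = - E x v + E x v *m (E x v *m (M x v *m S x 0)).
  have N := inv_neumann x bv; rewrite -/(E x v) in N.
  have -> : M x v - M x 0 = - (E x v *m M x 0) + E x v *m (E x v *m M x v).
    have h : M x v - M x 0 = - (E x v *m M x v) by rewrite {1}N addrC addKr.
    by rewrite h {1}N mulmxBr opprB addrC.
  rewrite mulmxDl mulNmx -!mulmxA mulVmx ?US// mulmx1 //.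
by rewrite linearD linearN /=; ring.
Qed.

End inverse.

End bigO.

(** * Regular coefficients *)
Section regular_coef.
Context (R : realType) (d : nat).
Local Notation X := 'cV[R]_d.

Definition wt (x : X) : R := 1 + \sum_k `|x k 0|.

Lemma wt_ge1 x : 1 <= wt x. Proof. by rewrite lerDl; exact: sumr_ge0. Qed.

Lemma sum_sqr_le n (v : 'I_n -> R) : (forall k, 0 <= v k) -> \sum_k v k ^+ 2 <= (\sum_k v k) ^+ 2.
Proof.
move=> v0; rewrite expr2 mulr_suml; apply: ler_sum => k _; rewrite expr2 ler_wpM2l//.
by rewrite (bigD1 k)//= lerDl; exact: sumr_ge0.
Qed.

Lemma enorm_le_sum (x : X) : enorm x <= \sum_k `|x k 0|.
Proof.
have s0 : 0 <= \sum_k `|x k 0| by exact: sumr_ge0.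
rewrite /enorm -(ger0_norm s0) -sqrtr_sqr; apply: ler_wsqrtr.
apply: le_trans (sum_sqr_le (fun k => normr_ge0 (x k 0))).
by apply: ler_sum => k _; rewrite real_normK// num_real.
Qed.

Lemma enorm_ge0 n (x : 'cV[R]_n) : 0 <= enorm x. Proof. exact: sqrtr_ge0. Qed.

Lemma growth_enorm (K : R) : 0 <= K -> exists N : nat, forall x, 1 + enorm x `^ K <= 2 * wt x ^+ N.
Proof.
move=> K0; exists (Num.bound K) => x; have w1 := wt_ge1 x; have w0 := le_trans ler01 w1.
have h1 : 1 <= wt x ^+ Num.bound K by exact: exprn_ege1.
suff : enorm x `^ K <= wt x ^+ Num.bound K by lra.
apply: (le_via (wt x `^ K)).
  apply: ge0_ler_powR => //; rewrite ?nnegrE ?enorm_ge0//.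
  by apply: le_trans (enorm_le_sum x) _; rewrite lerDr.
rewrite -powR_mulrn//; apply: ler_powR => //; exact/ltW/archi_boundP.
Qed.

Section regular.
Variables (p : nat) (Th : set 'cV[R]_p) (f : X -> 'cV[R]_p -> R) (th0 : 'cV[R]_p) (e : R).
Hypotheses (Rf : regular Th f) (e0 : 0 < e) (bTh : forall v, box e v -> Th (th0 + v)).

Lemma regular_bound : exists B N, 0 <= B /\ forall x th, closure Th th -> `|f x th| <= B * wt x ^+ N.
Proof.
have [_ _ _ [K K0 [B H]]] := Rf; have [N HN] := growth_enorm K0.
exists (`|B| * 2), N; split; first by rewrite mulr_ge0.
move=> x th cth; apply: le_trans (H [::] [::] x th isT isT cth) _.
apply: (le_via (`|B| * (1 + enorm x `^ K))).
  by apply: ler_wpM2r; [rewrite addr_ge0// powR_ge0|exact: ler_norm].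
by rewrite -mulrA ler_wpM2l.
Qed.

Lemma regular_lip : exists L, 0 <= L /\ forall x y th, closure Th th ->
  `|f x th - f y th| <= L * \sum_k `|x k 0 - y k 0|.
Proof.
have [[L H] _ _ _] := Rf; exists `|L|; split => // x y th cth.
apply: le_trans (H x y th cth) _; apply: (le_via (`|L| * enorm (x - y))).
  by apply: ler_wpM2r; [exact: enorm_ge0|exact: ler_norm].
apply: ler_wpM2l => //; apply: le_trans (enorm_le_sum _) _.
by apply: ler_sum => k _; rewrite !mxE.
Qed.

Definition dpar jx (x : X) (v : 'cV[R]_p) := dparam Th jx f x (th0 + v).

Lemma dpar_bO jx : (size jx <= 4)%N -> bO wt e 0 (dpar jx).
Proof.
move=> s4; have [_ _ _ [K K0 [B H]]] := Rf; have [N HN] := growth_enorm K0.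
exists (`|B| * 2), N; split; first by rewrite mulr_ge0.
move=> x v bv; rewrite expr0 mulr1.
apply: le_trans (H [::] jx x (th0 + v) isT s4 _) _; first by apply: subset_closure; exact: bTh.
apply: (le_via (`|B| * (1 + enorm x `^ K))).
  by apply: ler_wpM2r; [rewrite addr_ge0// powR_ge0|exact: ler_norm].
by rewrite -mulrA ler_wpM2l.
Qed.

Lemma dpar_pder jx x : (size jx < 4)%N -> pder e (dpar jx x) (fun q => dpar (q :: jx) x).
Proof.
move=> s4 v bv q; have [_ _ D _] := Rf; have [Dd _] := D [::] jx x isT.
have T := bTh bv; have := Dd s4 _ q T => /= dd.
have [h1 h2] := derivable_shift dd; split => //.
by rewrite h2 /dpar /= /dparam1 mem_set.
Qed.

Lemma regular_jets : jets wt e (fun x v => f x (th0 + v)) (fun q x => dpar [:: q] x 0)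
  (fun x v => quad_part (fun q i => dpar [:: i; q] x 0) v).
Proof.
have O1 q := @dpar_bO [:: q] isT; have O2 q i := @dpar_bO [:: i; q] isT.
have w1 := wt_ge1; split.
- by apply: (bO_at0 e0 (f := fun x v => f x (th0 + v))); exact: (@dpar_bO [::] isT).
- by move=> q; apply: (bO_at0 e0 (O1 q)).
- rewrite /quad_part; apply: bO_sum => // q; apply: bOD => //.
    have := bOM (bOM (bO_cst wt p e (2^-1)) (bOM (bO_coord wt e q) (bO_coord wt e q))) (bO_at0 e0 (O2 q q)).
    by apply: bO_eq => x v _; rewrite expr2.
  have H (i : 'I_p) : bO wt e 1 (fun x (v : 'cV[R]_p) => (i < q)%N%:R * v i 0 * dpar [:: i; q] x 0).
    exact: (bOM (bOM (bO_cst wt p e _) (bO_coord wt e i)) (bO_at0 e0 (O2 q i))).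
  exact: (bOM (bO_coord wt e q) (bO_sum w1 (index_enum 'I_p) xpredT H)).
- by move=> x v t; exact: quad_partZ.
- have [_ _ _ [K K0 [B H]]] := Rf; have [N HN] := growth_enorm K0.
  exists (3 * p%:R * (`|B| * 2)), N; split; first by rewrite !mulr_ge0.
  move=> x v bv.
  have := @taylor_box _ _ e (dpar [::] x) (fun q => dpar [:: q] x) (fun q i => dpar [:: i; q] x) (fun q i k => dpar [:: k; i; q] x)
    (`|B| * 2 * wt x ^+ N) v (ltW e0) (@dpar_pder [::] x isT) (fun q => @dpar_pder [:: q] x isT) (fun q i => @dpar_pder [:: i; q] x isT).
  rewrite /dpar /= => /(_ _ bv)/le_trans; apply; last by rewrite !mulrA.
  move=> q i k u bu; have := H [::] [:: k; i; q] x (th0 + u) isT isT => /= /(_ _)/le_trans; apply.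
    by apply: subset_closure; exact: bTh.
  apply: (le_via (`|B| * (1 + enorm x `^ K))).
    by apply: ler_wpM2r; [rewrite addr_ge0// powR_ge0|exact: ler_norm].
  by rewrite -mulrA ler_wpM2l.
Qed.

Lemma regular_jet : jet wt e (fun x v => f x (th0 + v)).
Proof. by eexists; eexists; exact: regular_jets. Qed.

Lemma dpar_lip jx : (size jx < 4)%N -> exists B N, 0 <= B /\ forall x v v', box e v -> box e v' ->
  `|dpar jx x v - dpar jx x v'| <= B * wt x ^+ N * gau (v - v').
Proof.
move=> s4; have /choice[B HB] : forall q, exists BN : R * nat, 0 <= BN.1 /\
    forall x v, box e v -> `|dpar (q :: jx) x v| <= BN.1 * wt x ^+ BN.2.
  move=> q; have [B [N [B0 H]]] := @dpar_bO (q :: jx) s4; exists (B, N); split => // x v bv.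
  by have := H x v bv; rewrite expr0 mulr1.
exists (\sum_q (B q).1), (\sum_q (B q).2)%N; split; first by apply: sumr_ge0 => q _; exact: (HB q).1.
move=> x v v' bv bv'; have [xi xi1 ->] := mean_value (dpar_pder x s4) bv bv'.
apply: le_trans (ler_norm_sum _ _ _) _; rewrite /gau mulr_sumr; apply: ler_sum => q _.
rewrite normrM !mxE mulrC ler_wpM2r//.
have bx : box e (xi q) by move=> i; apply: le_trans (xi1 q i) _; rewrite ge_max bv bv'.
apply: le_trans ((HB q).2 x _ bx) _; apply: ler_pM.
- exact: (HB q).1.
- by rewrite exprn_ge0// (le_trans ler01 (wt_ge1 x)).
- by rewrite [leRHS](bigD1 q)//= lerDl; apply: sumr_ge0 => i _; exact: (HB i).1.
- by apply: ler_weXn2l; [exact: wt_ge1|rewrite [leqRHS](bigD1 q)//= leq_addr].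
Qed.

End regular.

(** Coefficients of the expansion are limits of difference quotients, hence measurable in x. *)
Lemma jets_measurable p e (f : X -> 'cV[R]_p -> R) lf qf q : 0 < e -> jets wt e f lf qf ->
  (forall v, box e v -> meas (f ^~ v)) -> meas (lf q).
Proof.
move=> e0 J mf; have [B [N [B0 H]]] := jets_bO2 wt_ge1 e0 J.
pose t n := e / n.+1%:R.
have t0 n : 0 < t n by rewrite divr_gt0.
have te n : t n <= e by rewrite ler_pdivrMr// ler_peMr ?(ltW e0)// ler1n.
have bt n : box e (t n *: delta_mx q 0).
  move=> i; rewrite !mxE normrM (gtr0_norm (t0 n)); apply: le_trans (te n).
  by rewrite ler_piMr ?(ltW (t0 n))//; case: (_ && _); rewrite ?normr1 ?normr0.
have gt n : gau (t n *: delta_mx q 0 : 'cV[R]_p) = t n.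
  rewrite gauZ (gtr0_norm (t0 n)) /gau (bigD1 q)//= !mxE !eqxx normr1 big1 ?addr0 ?mulr1// => i iq.
  by rewrite mxE (negbTE iq) normr0.
apply: (@measurable_fun_cvg _ _ _ setT (fun n x => (t n)^-1 * (f x (t n *: delta_mx q 0) - f x 0))).
  by move=> n; apply: measurable_funM => //; apply: measurable_funB; apply: mf => //; exact/box0/ltW.
move=> x _; apply/cvgrPdist_le => d0 d00.
have c0 : 0 < B * wt x ^+ N * e + 1.
  by rewrite ltr_wpDl// !mulr_ge0 ?(ltW e0)// exprn_ge0// (le_trans ler01 (wt_ge1 x)).
near=> n; rewrite distrC.
have L : lin lf x (t n *: delta_mx q 0) = t n * lf q x.
  rewrite /lin (bigD1 q)//= !mxE !eqxx mulr1 big1 ?addr0// => i iq.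
  by rewrite !mxE (negbTE iq) mulr0 mul0r.
have -> : (t n)^-1 * (f x (t n *: delta_mx q 0) - f x 0) - lf q x =
   (t n)^-1 * (f x (t n *: delta_mx q 0) - f x 0 - t n * lf q x).
  by field; rewrite gt_eqF.
rewrite normrM ger0_norm ?invr_ge0 ?(ltW (t0 n))// mulrC ler_pdivrMr//.
have := H x _ (bt n); rewrite L gt => /le_trans; apply.
rewrite expr2 mulrA ler_wpM2r ?(ltW (t0 n))// /t mulrA ler_pdivrMr//.
apply: (le_via (B * wt x ^+ N * e + 1)); first by rewrite lerDl.
rewrite [leRHS]mulrC -ler_pdivrMr//; apply: (le_via (n%:R : R)); last by rewrite ler_nat.
by near: n; exact: nbhs_infty_ger.
Unshelve. all: end_near. Qed.

End regular_coef.
Arguments wt {R d} x.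

(** * Measurability of determinants and inverses *)
Section matrix_measurability.
Context d0 (T : measurableType d0) (R : realType).
Implicit Types n : nat.

Lemma measurable_inv (f : T -> R) : meas f -> meas (fun x => (f x)^-1).
Proof.
move=> mf; have E x : (f x)^-1 = f x * (f x ^+ 2) `^ (-1).
  rewrite powR_inv1 ?sqr_ge0//; have [->|fx] := eqVneq (f x) 0; first by rewrite invr0 mul0r.
  by field.
under eq_fun do rewrite E; apply: measurable_funM => //.
by apply: (@measurableT_comp _ _ _ _ _ _ (fun y : R => y `^ (-1))); [exact: measurable_powR|exact: measurable_funX].
Qed.

Lemma measurable_bigprod (I : Type) (s : seq I) (F : I -> T -> R) :
  (forall i, meas (F i)) -> meas (fun x => \prod_(i <- s) F i x).
Proof.
move=> mF; elim: s => [|i s IH]; first by under eq_fun do rewrite big_nil; exact: measurable_cst.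
by under eq_fun do rewrite big_cons; apply: measurable_funM.
Qed.

Definition mmx m n (M : T -> 'M[R]_(m, n)) := forall i j, meas (fun x => M x i j).

Lemma measurable_det n (M : T -> 'M[R]_n) : mmx M -> meas (fun x => \det (M x)).
Proof.
move=> mM; apply: measurable_sum => s; apply: measurable_funM => //.
by apply: measurable_bigprod => i; exact: mM.
Qed.

Lemma mmxM m n p (M : T -> 'M[R]_(m, n)) (N : T -> 'M[R]_(n, p)) : mmx M -> mmx N -> mmx (fun x => M x *m N x).
Proof.
move=> mM mN i j; under eq_fun do rewrite mxE.
by apply: measurable_sum => k; apply: measurable_funM; [exact: mM|exact: mN].
Qed.

Lemma mmx_trmx m n (M : T -> 'M[R]_(m, n)) : mmx M -> mmx (fun x => (M x)^T).
Proof. by move=> mM i j; under eq_fun do rewrite mxE; exact: mM. Qed.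

Lemma mmx_invmx n (M : T -> 'M[R]_n) : mmx M -> mmx (fun x => invmx (M x)).
Proof.
move=> mM i j; have md := measurable_det mM.
have E x : invmx (M x) i j = if \det (M x) == 0 then M x i j else (\det (M x))^-1 * (\adj (M x)) i j.
  by rewrite /invmx unitmxE unitfE; case: eqP => //= _; rewrite mxE.
under eq_fun do rewrite E; apply: measurable_fun_ifT.
- by apply: measurable_fun_eqr => //; exact: measurable_cst.
- exact: mM.
- apply: measurable_funM; first exact: measurable_inv.
  under eq_fun do rewrite mxE /cofactor; apply: measurable_funM => //.
  by apply: measurable_det => k l; under eq_fun do rewrite !mxE; exact: mM.
Qed.

End matrix_measurability.

Lemma entryB (R : realType) m n (A B : 'M[R]_(m, n)) i j : (A - B) i j = A i j - B i j.
Proof. by rewrite !mxE. Qed.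

(** * Bounded Lipschitz families with polynomial weights *)
Section lipschitz_families.
Context (R : realType) (d : nat).
Local Notation X := 'cV[R]_d.

(** Bounded and Lipschitz on the box with polynomial weights: exactly the hypotheses under which
    chaining applies. *)
Definition bL p (e : R) (f : X -> 'cV[R]_p -> R) := exists B N, 0 <= B /\ forall x,
  (forall v, box e v -> `|f x v| <= B * wt x ^+ N) /\
  (forall v v', box e v -> box e v' -> `|f x v - f x v'| <= B * wt x ^+ N * gau (v - v')).

Let wt0 (x : X) : 0 <= wt x. Proof. exact: le_trans ler01 (wt_ge1 x). Qed.
Let wt_le (x : X) m n : (m <= n)%N -> wt x ^+ m <= wt x ^+ n.
Proof. by move=> mn; apply: ler_weXn2l => //; exact: wt_ge1. Qed.

Lemma bLM p e (f g : X -> 'cV[R]_p -> R) : bL e f -> bL e g -> bL e (fun x v => f x v * g x v).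
Proof.
move=> [B [N [B0 F]]] [B' [N' [B'0 G]]].
exists (2 * (B * B')), (N + N')%N; split; first by rewrite !mulr_ge0.
move=> x; have [F1 F2] := F x; have [G1 G2] := G x.
set u := B * wt x ^+ N in F1 F2; set u' := B' * wt x ^+ N' in G1 G2.
have u0 : 0 <= u by rewrite mulr_ge0// exprn_ge0.
have u'0 : 0 <= u' by rewrite mulr_ge0// exprn_ge0.
have -> : 2 * (B * B') * wt x ^+ (N + N') = 2 * (u * u') by rewrite exprD /u /u'; ring.
split=> [v bv|v v' bv bv'].
  rewrite normrM; apply: (le_via (u * u')); first by apply: ler_pM; rewrite ?F1 ?G1.
  by rewrite mulrDl mul1r lerDl mulr_ge0.
have -> : f x v * g x v - f x v' * g x v' = f x v * (g x v - g x v') + (f x v - f x v') * g x v' by ring.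
apply: le_trans (ler_normD _ _) _; rewrite !normrM.
have -> : 2 * (u * u') * gau (v - v') = u * (u' * gau (v - v')) + (u * gau (v - v')) * u' by ring.
by apply: lerD; apply: ler_pM; rewrite ?F1 ?F2 ?G1 ?G2.
Qed.

Lemma bLD p e (f g : X -> 'cV[R]_p -> R) : bL e f -> bL e g -> bL e (fun x v => f x v + g x v).
Proof.
move=> [B [N [B0 F]]] [B' [N' [B'0 G]]].
exists (B + B'), (N + N')%N; split; first by rewrite addr_ge0.
move=> x; have [F1 F2] := F x; have [G1 G2] := G x.
have h1 : B * wt x ^+ N <= B * wt x ^+ (N + N') by rewrite ler_wpM2l// wt_le// leq_addr.
have h2 : B' * wt x ^+ N' <= B' * wt x ^+ (N + N') by rewrite ler_wpM2l// wt_le// leq_addl.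
split=> [v bv|v v' bv bv'].
  apply: le_trans (ler_normD _ _) _; rewrite mulrDl.
  by apply: lerD; [apply: le_trans (F1 v bv) h1|apply: le_trans (G1 v bv) h2].
rewrite opprD addrACA; apply: le_trans (ler_normD _ _) _; rewrite !mulrDl; apply: lerD.
  by apply: le_trans (F2 v v' bv bv') _; apply: ler_wpM2r => //; exact: gau_ge0.
by apply: le_trans (G2 v v' bv bv') _; apply: ler_wpM2r => //; exact: gau_ge0.
Qed.

Lemma bL_fix p e (a : X -> R) : (exists B N, 0 <= B /\ forall x, `|a x| <= B * wt x ^+ N) ->
  bL e (fun x (v : 'cV[R]_p) => a x).
Proof.
move=> [B [N [B0 H]]]; exists B, N; split => // x; split => // v v' _ _.
by rewrite subrr normr0 !mulr_ge0 ?exprn_ge0 ?gau_ge0.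
Qed.

Lemma bL_sum p e (I : Type) (s : seq I) (F : I -> X -> 'cV[R]_p -> R) : (forall i, bL e (F i)) ->
  bL e (fun x v => \sum_(i <- s) F i x v).
Proof.
move=> HF; elim: s => [|i s IH].
  under eq_fun do (under eq_fun do rewrite big_nil); apply: bL_fix.
  by exists 0, 0%N; split => // x; rewrite normr0 mul0r.
by under eq_fun do (under eq_fun do rewrite big_cons); exact: bLD.
Qed.

Lemma bL_usub p q e (f : X -> 'cV[R]_p -> R) : bL e f -> bL e (fun x (v : 'cV[R]_(p + q)) => f x (usubmx v)).
Proof.
move=> [B [N [B0 F]]]; exists B, N; split => // x; have [F1 F2] := F x.
have bu (v : 'cV[R]_(p + q)) : box e v -> box e (usubmx v) by move=> bv i; rewrite mxE.
split=> [v bv|v v' bv bv']; first exact: F1 (bu _ bv).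
apply: le_trans (F2 _ _ (bu _ bv) (bu _ bv')) _; apply: ler_wpM2l; first by rewrite mulr_ge0// exprn_ge0.
rewrite /gau big_split_ord /= -[leLHS]addr0; apply: lerD; last exact: sumr_ge0.
by apply: ler_sum => i _; rewrite !mxE.
Qed.

Lemma bL_dsub p q e (f : X -> 'cV[R]_q -> R) : bL e f -> bL e (fun x (v : 'cV[R]_(p + q)) => f x (dsubmx v)).
Proof.
move=> [B [N [B0 F]]]; exists B, N; split => // x; have [F1 F2] := F x.
have bu (v : 'cV[R]_(p + q)) : box e v -> box e (dsubmx v) by move=> bv i; rewrite mxE.
split=> [v bv|v v' bv bv']; first exact: F1 (bu _ bv).
apply: le_trans (F2 _ _ (bu _ bv) (bu _ bv')) _; apply: ler_wpM2l; first by rewrite mulr_ge0// exprn_ge0.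
rewrite /gau big_split_ord /= -[leLHS]add0r; apply: lerD; first exact: sumr_ge0.
by apply: ler_sum => i _; rewrite !mxE.
Qed.

Lemma bL_dpar p (Th : set 'cV[R]_p) f th0 e jx : regular Th f -> 0 < e ->
  (forall v, box e v -> Th (th0 + v)) -> (size jx < 4)%N -> bL e (dpar Th f th0 jx).
Proof.
move=> Rf e0 bTh s4; have [B [N [B0 F]]] := dpar_bO Rf bTh (ltnW s4).
have [B' [N' [B'0 G]]] := dpar_lip Rf bTh s4.
exists (B + B'), (N + N')%N; split; first by rewrite addr_ge0.
move=> x; split=> [v bv|v v' bv bv'].
  have := F x v bv; rewrite expr0 mulr1 => /le_trans; apply; apply: ler_pM; rewrite ?exprn_ge0//.
    by rewrite lerDl.
  by rewrite wt_le// leq_addr.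
apply: le_trans (G x v v' bv bv') _; apply: ler_wpM2r; first exact: gau_ge0.
apply: ler_pM; rewrite ?exprn_ge0//; first by rewrite lerDr.
by rewrite wt_le// leq_addl.
Qed.

End lipschitz_families.

(** * The diffusion matrix of a regular scale coefficient *)
Section scale_coef.
Context (R : realType) (d r p : nat) (d_gt0 : (0 < d)%N).
Local Notation X := 'cV[R]_d.
Variables (Th : set 'cV[R]_p) (c : X -> 'cV[R]_p -> 'M[R]_(d, r)) (C0 BC : R).
Hypotheses (Rc : forall i j, regular Th (fun x g => c x g i j)) (C00 : 0 <= C0)
  (lamc : forall x g, closure Th g -> 0 < lambda_min (gram (c x g)) /\
      (lambda_min (gram (c x g)))^-1 <= BC * (1 + enorm x `^ C0)).
Local Notation S x g := (gram (c x g)).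
Local Notation iS x g := (invmx (S x g)).

Lemma S_unit x g : closure Th g -> S x g \in unitmx.
Proof.
by move=> cg; have [l0 _] := lamc x cg; apply: (posdef_unit l0) => u; exact: lambda_min_rayleigh.
Qed.

Lemma S_det x g : closure Th g -> 0 < \det (S x g).
Proof.
by move=> cg; have [l0 _] := lamc x cg; apply: (posdef_det_gt0 l0) => u; exact: lambda_min_rayleigh.
Qed.

Lemma iS_bound : exists B N, 0 <= B /\ forall x g a b, closure Th g -> `|iS x g a b| <= B * wt x ^+ N.
Proof.
have [N HN] := growth_enorm (R := R) d C00.
exists (`|BC| * 2), N; split; first by rewrite mulr_ge0.
move=> x g a b cg; have [l0 lb] := lamc x cg.
apply: le_trans (invmx_entry_le (gram_sym _) l0 _ a b) _; first by move=> u; exact: lambda_min_rayleigh.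
apply: le_trans lb _; apply: (le_via (`|BC| * (1 + enorm x `^ C0))).
  by apply: ler_wpM2r; [rewrite addr_ge0// powR_ge0|exact: ler_norm].
by rewrite -mulrA ler_wpM2l.
Qed.

Section local_box.
Variables (g0 : 'cV[R]_p) (e : R).
Hypotheses (e0 : 0 < e) (bTh : forall v, box e v -> Th (g0 + v)).
Let bcl v : box e v -> closure Th (g0 + v). Proof. by move=> bv; apply: subset_closure; exact: bTh. Qed.

Lemma S_jet : jetmx wt e (fun x v => S x (g0 + v)).
Proof.
have J : jetmx wt e (fun x v => c x (g0 + v)) by move=> i j; exact: (regular_jet (Rc i j) e0 bTh).
exact: (jetmxM (@wt_ge1 R d) e0 J (jetmx_trmx e0 J)).
Qed.

Lemma iS_bO : bOmx wt e 0 (fun x v => iS x (g0 + v)).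
Proof.
move=> i j; have [B [N [B0 H]]] := iS_bound; exists B, N; split => // x v bv.
by rewrite expr0 mulr1; apply: H; exact: bcl.
Qed.

Lemma iS_jet : jetmx wt e (fun x v => iS x (g0 + v)).
Proof.
apply: (jetmx_inv (@wt_ge1 R d) e0 S_jet _ iS_bO) => x v bv; apply: S_unit; exact: bcl.
Qed.

Lemma iS_bL i j : bL e (fun x v => iS x (g0 + v) i j).
Proof.
have Lc k l : bL e (fun x v => c x (g0 + v) k l) := bL_dpar (Rc k l) e0 bTh (jx := [::]) isT.
have LS k l : bL e (fun x v => S x (g0 + v) k l).
  have := bL_sum (index_enum 'I_r) (fun m => bLM (Lc k m) (Lc l m)).
  congr (bL e _); apply/funext => x; apply/funext => v; rewrite mxE; apply: eq_bigr => m _; by rewrite !mxE.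
have [B [N [B0 H]]] := iS_bound; have /choice[K HK] : forall kl : 'I_d * 'I_d, exists BN : R * nat, 0 <= BN.1 /\ forall x v v',
    box e v -> box e v' -> `|S x (g0 + v) kl.1 kl.2 - S x (g0 + v') kl.1 kl.2| <= BN.1 * wt x ^+ BN.2 * gau (v - v').
  by move=> [k l]; have [B' [N' [B'0 G]]] := LS k l; exists (B', N'); split => // x; exact: (G x).2.
pose KN := (\sum_k \sum_l (K (k, l)).2)%N.
have K0 kl : 0 <= (K kl).1 := (HK kl).1.
have w0 x n : 0 <= wt x ^+ n by rewrite exprn_ge0// (le_trans ler01)// wt_ge1.
exists (B + \sum_k \sum_l (K (k, l)).1 * B ^+ 2), (N + (N + KN + N))%N; split.
  by rewrite addr_ge0//; apply: sumr_ge0 => k _; apply: sumr_ge0 => l _; rewrite mulr_ge0// exprn_ge0.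
move=> x; split=> [v bv|v v' bv bv'].
  apply: le_trans (H x _ i j (bcl bv)) _; apply: ler_pM; rewrite ?w0//.
    by rewrite lerDl; apply: sumr_ge0 => k _; apply: sumr_ge0 => l _; rewrite mulr_ge0// exprn_ge0.
  by apply: ler_weXn2l; [exact: wt_ge1|rewrite leq_addr].
have E : iS x (g0 + v) - iS x (g0 + v') = iS x (g0 + v) *m ((S x (g0 + v') - S x (g0 + v)) *m iS x (g0 + v')).
  rewrite mulmxBl mulmxBr mulmxV ?mulmx1; last by apply: S_unit; exact: bcl.
  by rewrite mulmxA mulVmx ?mul1mx//; apply: S_unit; exact: bcl.
have -> : iS x (g0 + v) i j - iS x (g0 + v') i j = (iS x (g0 + v) - iS x (g0 + v')) i j by rewrite entryB.
rewrite E mxE; apply: le_trans (ler_norm_sum _ _ _) _; rewrite mulrDl mulrDl; apply: ler_wpDl.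
  by rewrite mulr_ge0 ?gau_ge0// mulr_ge0 ?w0.
rewrite !mulr_suml; apply: ler_sum => k _; rewrite mxE normrM mulr_suml.
apply: le_trans (ler_wpM2l (normr_ge0 _) (ler_norm_sum _ _ _)) _.
rewrite mulr_sumr mulr_suml; apply: ler_sum => l _; rewrite normrM entryB distrC.
have hK : wt x ^+ (K (k, l)).2 <= wt x ^+ KN.
  apply: ler_weXn2l; first exact: wt_ge1.
  by rewrite /KN (bigD1 k)//= (bigD1 l)//= -addnA leq_addr.
have h1 := H x _ i k (bcl bv); have h2 := H x _ l j (bcl bv'); have h3 := (HK (k, l)).2 x _ _ bv bv'.
apply: (le_via ((B * wt x ^+ N) * ((K (k, l)).1 * wt x ^+ KN * gau (v - v') * (B * wt x ^+ N)))).
  apply: ler_pM; rewrite ?normr_ge0 ?mulr_ge0//.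
  apply: ler_pM; rewrite ?normr_ge0//; apply: le_trans h3 _; apply: ler_wpM2r; first exact: gau_ge0.
  by rewrite ler_wpM2l.
have -> : B * wt x ^+ N * ((K (k, l)).1 * wt x ^+ KN * gau (v - v') * (B * wt x ^+ N)) =
   ((K (k, l)).1 * B ^+ 2) * wt x ^+ (N + KN + N) * gau (v - v') by rewrite !exprD; ring.
apply: ler_wpM2r; first exact: gau_ge0.
apply: ler_wpM2l; first by rewrite mulr_ge0// exprn_ge0.
by apply: ler_weXn2l; [exact: wt_ge1|rewrite leq_addl].
Qed.

Lemma lndet_jet : jet wt e (fun x v => ln (\det (S x (g0 + v))) - ln (\det (S x g0))).
Proof.
have := jet_lndet (@wt_ge1 R d) e0 S_jet _ iS_bO; rewrite addr0; apply => x v bv; apply: S_det; exact: bcl.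
Qed.

Lemma score_bO : bO wt e 2 (fun x v => ln (\det (S x (g0 + v))) - ln (\det (S x g0)) +
  \sum_a \sum_b (iS x (g0 + v) a b - iS x g0 a b) * S x g0 a b).
Proof.
have := bO_score (@wt_ge1 R d) e0 S_jet _ _ iS_bO _; rewrite addr0; apply => x v.
- by move=> bv; apply: S_unit; exact: bcl.
- by move=> bv; apply: S_det; exact: bcl.
- exact: gram_sym.
Qed.

End local_box.
End scale_coef.

(** * M-estimation with a locally quadratic contrast *)
Section m_estimation.
Context (R : realType) (p : nat).
Local Notation V := 'cV[R]_p.

Lemma box_gau (r : R) (v : V) : gau v <= r -> box r v.
Proof. by move=> vr i; apply: le_trans (coord_gau v i) vr. Qed.

(** Coercivity confines the maximizer vh to a small ball; inside it the bound of F - Q, together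
    with homogeneity of Q, transfers the coercivity from F to Q with constant chi / 2, and the
    linear term L alone determines the size of vh. *)
Lemma quadratic_contrast (F Q : V -> R) (chi e K r L c eta : R) (vh : V) :
  0 <= L -> 0 < chi -> 0 < r -> r <= e -> 4 * K * r <= chi ->
  (forall v t, Q (t *: v) = t ^+ 2 * Q v) ->
  (forall v, box e v -> `|F v - Q v| <= L * gau v + c * gau v ^+ 3) ->
  c <= K -> eta <= chi * r ^+ 2 / 8 -> L <= chi * r / 8 ->
  (forall v, box e v \/ v = vh -> F v <= - chi * gau v ^+ 2 + eta) -> 0 <= F vh ->
  [/\ gau vh <= r, gau vh * chi <= 4 * L & F vh * chi <= 4 * L ^+ 2].
Proof.
move=> L0 chi0 r0 re Kr Qh FQ cK etar Lr FB F0.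
have bre (v : V) : gau v <= r -> box e v by move=> vr i; apply: le_trans (coord_gau v i) _; exact: le_trans re.
have Qle v : Q v <= - (chi / 2) * gau v ^+ 2.
  have [v0|v0] := eqVneq (gau v) 0.
    have -> : v = 0 by apply/matrixP => i j; rewrite !ord1 mxE; apply/eqP; rewrite -normr_le0 -v0; exact: coord_gau.
    by have := Qh 0 0; rewrite scale0r gau0 !expr0n !mul0r mulr0 => ->.
  have g0 : 0 < gau v by rewrite lt_neqAle eq_sym v0 gau_ge0.
  pose u := (r / gau v) *: v.
  have gu : gau u = r by rewrite gauZ ger0_norm ?divr_ge0 ?(ltW r0) ?gau_ge0// divfK.
  have bu : box e u by apply: bre; rewrite gu.
  have h1 := FB u (or_introl bu); have h2 := FQ u bu; rewrite gu in h1 h2.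
  have h3 : Q u <= - (chi / 2) * r ^+ 2.
    have r3 : c * r ^+ 3 <= chi * r ^+ 2 / 4.
      have : c * r ^+ 3 <= K * r ^+ 3 by rewrite ler_wpM2r// exprn_ge0// ltW.
      have := ler_wpM2r (sqr_ge0 r) Kr; rewrite (exprS r 2); lra.
    have lr : L * r <= chi * r ^+ 2 / 8 by have := ler_wpM2r (ltW r0) Lr; rewrite expr2; lra.
    move: h2; rewrite ler_norml => /andP[h2 _]; lra.
  have -> : v = (gau v / r) *: u by rewrite scalerA mulrA divfK ?gt_eqF// divff// scale1r.
  rewrite Qh gauZ gu ger0_norm ?divr_ge0 ?gau_ge0 ?(ltW r0)// divfK ?gt_eqF//.
  have := ler_wpM2l (sqr_ge0 (gau v / r)) h3; move=> /le_trans; apply.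
  by apply: eq_ler; field; rewrite gt_eqF.
have gvr : gau vh <= r.
  have h := FB vh (or_intror erefl).
  rewrite -ler_sqr ?nnegrE ?gau_ge0 ?(ltW r0)// -(ler_pM2l chi0).
  have : 0 <= chi * r ^+ 2 by rewrite mulr_ge0 ?sqr_ge0// ltW.
  lra.
have bv := bre _ gvr; have h := FQ vh bv.
have g0 := gau_ge0 vh.
have c3 : c * gau vh ^+ 3 <= chi / 4 * gau vh ^+ 2.
  have [c0|/ltW c0] := leP 0 c; last first.
    apply: (le_via 0); first by rewrite mulr_le0_ge0// exprn_ge0.
    by rewrite mulr_ge0 ?sqr_ge0// divr_ge0// ltW.
  rewrite (exprS _ 2) mulrA ler_wpM2r ?sqr_ge0//.
  have : c * gau vh <= K * r by apply: ler_pM.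
  lra.
have Q1 := Qle vh; move: h; rewrite ler_norml => /andP[_ h].
have key : F vh <= L * gau vh - chi / 4 * gau vh ^+ 2 by lra.
have s0 := sqr_ge0 (gau vh).
have gL : gau vh * chi <= 4 * L.
  have [->|gn] := eqVneq (gau vh) 0; first by rewrite mul0r mulr_ge0.
  have gp : 0 < gau vh by rewrite lt_neqAle eq_sym gn.
  have : (gau vh * chi) * gau vh <= 4 * L * gau vh by rewrite expr2 in key; lra.
  by rewrite ler_pM2r.
split => //.
have F1 : F vh <= L * gau vh by have := mulr_ge0 (ltW chi0) s0; lra.
have := ler_wpM2r (ltW chi0) F1; have := ler_wpM2l L0 gL; rewrite expr2; lra.
Qed.

Context d0 (Omega : measurableType d0) (P : probability Omega R).

(** The usual argument needs a central limit theorem and a limiting information matrix. For a rate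
    it suffices that the random linear term is of order T^(-1/2), while the quadratic part may be
    any homogeneous function. *)
Lemma m_estimator_rate (T : nat -> R) (F Q : nat -> Omega -> V -> R) (vh : nat -> Omega -> V)
  (L c : nat -> Omega -> R) (Dom : set V) (chi e : R) :
  0 < chi -> 0 < e -> T n @[n --> \oo] --> +oo ->
  (forall n w, 0 <= L n w) -> (forall n w v t, Q n w (t *: v) = t ^+ 2 * Q n w v) ->
  (forall v, box e v -> Dom v) -> (forall n w, Dom (vh n w)) -> (forall n w, 0 <= F n w (vh n w)) ->
  bip P (fun n w => Num.sqrt (T n) * L n w) -> bip P c ->
  (forall del, 0 < del -> vanishes P (fun n => [set w | exists2 v, Dom v & - chi * gau v ^+ 2 + del < F n w v])) ->
  vanishes P (fun n => [set w | ~ forall v, box e v ->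
    `|F n w v - Q n w v| <= L n w * gau v + c n w * gau v ^+ 3]) ->
  [/\ vanishes P (fun n => [set w | ~ box e (vh n w)]),
      bip P (fun n w => Num.sqrt (T n) * gau (vh n w)) &
      bip P (fun n w => T n * F n w (vh n w))].
Proof.
move=> chi0 e0 Toy L0 Qh bD Dv F0 bL bc vB vC.
pose Good K n := [set w | [/\ box e (vh n w), Num.sqrt (T n) * gau (vh n w) <= K & T n * F n w (vh n w) <= K]].
suff key : forall eps, 0 < eps -> exists2 K : R, 0 < K &
    \forall n \near \oo, (mu_ext P (~` Good K n) <= eps%:E)%E.
  split=> eps eps0; have [K K0 H] := key eps eps0; try (exists K => //); near=> n;
    (apply: (le_via (mu_ext P (~` Good K n))); [apply: PO_le|near: n; exact: H]); move=> w /= A [B1 B2 B3].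
  - exact: A.
  - by move: A; rewrite ltNge B2.
  - by move: A; rewrite ltNge B3.
move=> eps eps0; have eps4 : 0 < eps / 4 by rewrite divr_gt0.
have [K K0 HK] := bc _ eps4; have [K1 K10 HK1] := bL _ eps4.
pose r := Num.min e (chi / (4 * K)).
have r0 : 0 < r by rewrite lt_min e0 divr_gt0// mulr_gt0.
have re : r <= e by rewrite ge_min lexx.
have Kr : 4 * K * r <= chi.
  have : r <= chi / (4 * K) by rewrite ge_min lexx orbT.
  by rewrite ler_pdivlMr ?mulr_gt0// mulrC.
pose del := chi * r ^+ 2 / 8; have del0 : 0 < del by rewrite divr_gt0// mulr_gt0// exprn_gt0.
exists (4 * K1 / chi + 4 * K1 ^+ 2 / chi).
  by rewrite addr_gt0// divr_gt0// mulr_gt0// exprn_gt0.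
near=> n.
pose A1 := [set w | K < c n w]; pose A2 := [set w | K1 < Num.sqrt (T n) * L n w].
pose A3 := [set w | exists2 v, Dom v & - chi * gau v ^+ 2 + del < F n w v].
pose A4 := [set w | ~ forall v, box e v -> `|F n w v - Q n w v| <= L n w * gau v + c n w * gau v ^+ 3].
apply: (le_via (mu_ext P ((A1 `|` A2) `|` (A3 `|` A4)))); last first.
  have -> : eps = (eps / 4 + eps / 4) + (eps / 4 + eps / 4) by field.
  rewrite !EFinD; apply: le_trans (PO_U _ _ _) _; apply: leeD; (apply: le_trans (PO_U _ _ _) _; apply: leeD).
  - by rewrite /A1; near: n; exact: HK.
  - by rewrite /A2; near: n; exact: HK1.
  - by rewrite /A3; near: n; exact: vB.
  - by rewrite /A4; near: n; exact: vC.
apply: PO_le => w /=; apply: contra_notP => /not_orP[/not_orP[]].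
rewrite /A1 /A2 /A3 /A4 /= => /negP; rewrite -leNgt => cK /negP; rewrite -leNgt => LK /not_orP[nB /contrapT nC].
have FB v : Dom v -> F n w v <= - chi * gau v ^+ 2 + del.
  by move=> Dv'; rewrite leNgt; apply/negP => bad; apply: nB; exists v.
have T0 : 0 < T n by near: n; move/cvgryPgt : Toy; exact.
have sT0 : 0 < Num.sqrt (T n) by rewrite sqrtr_gt0.
have Lr : L n w <= chi * r / 8.
  have : K1 <= Num.sqrt (T n) * (chi * r / 8).
    have cr : 0 < chi * r / 8 by rewrite divr_gt0// mulr_gt0.
    have q0 : 0 <= K1 / (chi * r / 8) by rewrite divr_ge0 ?(ltW K10) ?(ltW cr).
    rewrite -ler_pdivrMr// -(ger0_norm q0) -sqrtr_sqr; apply: ler_wsqrtr.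
    by near: n; move/cvgryPge : Toy; exact.
  by move=> h; have := le_trans LK h; rewrite ler_pM2l.
have FBv v : box e v \/ v = vh n w -> F n w v <= - chi * gau v ^+ 2 + del.
  by move=> [b|->]; apply: FB => //; exact: bD.
have [B1 B2 B3] := quadratic_contrast (L0 n w) chi0 r0 re Kr (Qh n w) nC cK (lexx _) Lr FBv (F0 n w).
have LK1 : Num.sqrt (T n) * L n w <= K1 by [].
have LK2 : T n * L n w ^+ 2 <= K1 ^+ 2.
  rewrite -[X in X * _](sqr_sqrtr (ltW T0)) -exprMn lerXn2r// nnegrE ?(ltW K10)//.
  by rewrite mulr_ge0 ?(ltW sT0).
have i0 : 0 <= chi^-1 by rewrite invr_ge0 ltW.
split.
- by apply: box_gau; exact: le_trans B1 re.
- apply: (le_via (4 * K1 / chi)); last first.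
    by rewrite lerDl divr_ge0 ?(ltW chi0)// mulr_ge0// sqr_ge0.
  rewrite ler_pdivlMr// -mulrA; apply: le_trans (ler_wpM2l (ltW sT0) B2) _.
  by rewrite mulrCA ler_wpM2l.
- apply: (le_via (4 * K1 ^+ 2 / chi)); last first.
    by rewrite lerDr divr_ge0 ?(ltW chi0)// mulr_ge0// ltW.
  rewrite ler_pdivlMr// -mulrA; apply: le_trans (ler_wpM2l (ltW T0) B3) _.
  by rewrite mulrCA ler_wpM2l.
Unshelve. all: end_near. Qed.

End m_estimation.

(** * Bounds for expectations *)
Section expectation_bounds.
Context d0 (Omega : measurableType d0) (R : realType) (P : probability Omega R).
Implicit Types Y U : Omega -> R.

(** An upper bound for the expectation of a nonnegative variable, with its side conditions, so that
    linear estimates compose. *)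
Definition eb Y (c : R) := [/\ meas Y, forall w, 0 <= Y w & (\int[P]_w (Y w)%:E <= c%:E)%E].

Lemma eb_weak Y c c' : c <= c' -> eb Y c -> eb Y c'.
Proof. by move=> cc [m Y0 H]; split => //; apply: le_trans H _; rewrite lee_fin. Qed.

Lemma eb_le Y U c : meas Y -> (forall w, 0 <= Y w <= U w) -> eb U c -> eb Y c.
Proof.
move=> mY YU [mU U0 H]; split => // [w|]; first by have /andP[] := YU w.
apply: le_trans H; apply: ge0_le_integral_nomeas => w _; rewrite lee_fin; first by have /andP[] := YU w.
by have /andP[] := YU w.
Qed.

Lemma ebD Y U a b : eb Y a -> eb U b -> eb (fun w => Y w + U w) (a + b).
Proof.
move=> [mY Y0 HY] [mU U0 HU]; split; first exact: measurable_funD.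
  by move=> w; rewrite addr_ge0.
under eq_integral do rewrite EFinD.
rewrite ge0_integralD//; first by rewrite EFinD; exact: leeD.
- by move=> w _; rewrite lee_fin.
- exact/measurable_EFinP.
- by move=> w _; rewrite lee_fin.
- exact/measurable_EFinP.
Qed.

Lemma ebZ Y a c : 0 <= a -> eb Y c -> eb (fun w => a * Y w) (a * c).
Proof.
move=> a0 [mY Y0 HY]; split; first exact: measurable_funM.
  by move=> w; rewrite mulr_ge0.
under eq_integral do rewrite EFinM.
rewrite ge0_integralZl//; first by rewrite EFinM; exact: lee_wpmul2l.
- exact/measurable_EFinP.
- by move=> w _; rewrite lee_fin.
Qed.

Lemma eb_sumI (I : finType) (Y : I -> Omega -> R) (c : I -> R) : (forall i, eb (Y i) (c i)) ->
  eb (fun w => \sum_i Y i w) (\sum_i c i).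
Proof.
move=> H; suff G (s : seq I) : eb (fun w => \sum_(i <- s) Y i w) (\sum_(i <- s) c i) by exact: G.
elim: s => [|i s IH].
  by under eq_fun do rewrite big_nil; rewrite big_nil; split => //; rewrite integral0.
by under eq_fun do rewrite big_cons; rewrite big_cons; exact: ebD.
Qed.

Lemma eb_sum (Y : nat -> Omega -> R) n c : (forall j, (j < n)%N -> eb (Y j) c) ->
  eb (fun w => \sum_(j < n) Y j w) (n%:R * c).
Proof.
by move=> H; have := eb_sumI (fun j : 'I_n => H j (ltn_ord j)); rewrite sumr_const card_ord mulr_natl.
Qed.

Lemma eb_mean Y c : mom P Y -> (forall w, 0 <= Y w) -> mean P Y <= c -> eb Y c.
Proof. by move=> mY Y0 H; split => //; [exact: mom_measurable mY|rewrite mean_fin// lee_fin]. Qed.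

Lemma bip_eb (Y : nat -> Omega -> R) K : (\forall n \near \oo, eb (Y n) K) -> bip P Y.
Proof.
move=> H; pose Y' n := if `[< eb (Y n) K >] then Y n else cst 0.
apply: (@bip_le _ _ _ P Y Y'); first by near=> n; apply: aeW => w; rewrite /Y' asboolT//; near: n.
apply: (@bip_markov _ _ _ P Y' K).
- by move=> n; rewrite /Y'; case: asboolP => [[]|].
- by move=> n w; rewrite /Y'; case: asboolP => [[]|].
- by near=> n; rewrite /Y' asboolT; [suff [] : eb (Y n) K by []; near: n|near: n].
Unshelve. all: end_near. Qed.

Lemma bip_eb_sq (Y : nat -> Omega -> R) K : (\forall n \near \oo, eb (fun w => Y n w ^+ 2) K) ->
  bip P (fun n w => `|Y n w|).
Proof.
move=> /bip_eb b2; apply: bip_le_all (bipD (bip_cst P 1) b2) => n w.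
have := sqr_ge0 (`|Y n w| - 1); rewrite -[X in 1 + X]real_normK ?num_real//.
have : 0 <= `|Y n w| by []; rewrite !expr2; nra.
Qed.

End expectation_bounds.

(** * Increments of the solution *)
Lemma fatou_left d0 (Omega : measurableType d0) (R : realType) (P : probability Omega R)
  (s u : R) (y : R -> Omega -> R) (l : Omega -> R) (B : R) : s < u ->
  (forall v, s <= v < u -> meas (y v)) -> (forall v w, 0 <= y v w) ->
  (forall w, y v w @[v --> u^'-] --> l w) ->
  (forall v, s <= v < u -> (\int[P]_w (y v w)%:E <= B%:E)%E) ->
  (\int[P]_w (l w)%:E <= B%:E)%E.
Proof.
move=> su my y0 yl yB.
pose v (n : nat) : R := u - (u - s) * n.+1%:R^-1.
have us0 : 0 < u - s by rewrite subr_gt0.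
have vI n : s <= v n < u.
  rewrite /v ltrBlDr ltrDl mulr_gt0//= lerBrDl addrC -lerBrDl.
  by rewrite -[leRHS]mulr1 ler_pM2l// invf_le1// ler1n.
have vu : v n @[n --> \oo] --> u.
  rewrite -[X in _ --> X](subr0 u) /v; apply: cvgB; first exact: cvg_cst.
  by rewrite -[X in _ --> X](mulr0 (u - s)); apply: cvgMr; exact: cvg_harmonic.
have yv w : (y (v n) w)%:E @[n --> \oo] --> (l w)%:E.
  apply: cvg_EFin; first by near=> n.
  by have /cvg_at_leftP := yl w; apply; split => // n; have /andP[] := vI n.
have F1 := @fatou _ _ _ P setT measurableT (fun n w => (y (v n) w)%:E).
have {F1} F1 : (\int[P]_w (l w)%:E <= limn_einf (fun n => \int[P]_w (y (v n) w)%:E))%E.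
  under eq_integral do rewrite -(cvg_limn_einf_sup (yv _)).1.
  apply: F1 => [n|n w _]; last by rewrite lee_fin.
  by apply/measurable_EFinP; exact: my.
apply: le_trans F1 _; rewrite limn_einf_lim; apply: lime_le; first exact: is_cvg_einfs.
near=> n; apply: le_trans (yB _ (vI n)).
by apply: ereal_inf_lbound; exists n => //=.
Unshelve. all: end_near. Qed.

Lemma lebesgue_itvoc (R : realType) (s t : R) : s <= t ->
  leb `]s, t]%classic = (t - s)%:E.
Proof.
move=> st; rewrite lebesgue_measure_itv /= lte_fin; case: ifPn => [_|]; first by rewrite -EFinB.
by rewrite -leNgt => ts; rewrite (le_anti (introT andP (conj st ts))) subrr.
Qed.

Lemma time_CS_aux (R : realFieldType) (J I m T : R) :
  0 <= J + - (2 * m) * I + m ^+ 2 * T -> I = m * T -> 0 < T -> I ^+ 2 <= T * J.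
Proof.
move=> H IE T0; have H2 : m ^+ 2 * T <= J by move: H; rewrite IE; nra.
by rewrite IE exprMn (expr2 T) mulrA mulrC ler_pM2l.
Qed.

Lemma integrable_cst_fin (R : realType) (D : set R) (c : R) : measurable D ->
  (leb D < +oo)%E -> leb.-integrable D (EFin \o cst c).
Proof.
move=> mD lD; apply/integrableP; split; first by apply/measurable_EFinP; exact: measurable_cst.
under eq_integral do rewrite /=.
by rewrite integral_cst//=; apply: lte_mul_pinfty => //; rewrite lee_fin.
Qed.

Lemma sq_integrable (R : realType) (D : set R) (f : R -> R) : measurable D ->
  (leb D < +oo)%E -> measurable_fun D f ->
  (\int[leb]_(u in D) (f u ^+ 2)%:E < +oo)%E ->
  leb.-integrable D (EFin \o (fun u => f u ^+ 2)) /\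
  leb.-integrable D (EFin \o f).
Proof.
move=> mD lD mf fin.
have if2 : leb.-integrable D (EFin \o (fun u => f u ^+ 2)).
  apply/integrableP; split; first by apply/measurable_EFinP; exact: measurable_funX.
  by under eq_integral do rewrite /= ger0_norm ?sqr_ge0//.
split=> //; have H : leb.-integrable D (EFin \o (fun u => 1 + f u ^+ 2)).
  by have H1 := integrableD _ (integrable_cst_fin 1 mD lD) if2; have := H1 mD; apply: eq_integrable.
apply: le_integrable H => //; first exact/measurable_EFinP.
move=> u _ /=; rewrite lee_fin [leRHS]ger0_norm; last by rewrite addr_ge0// sqr_ge0.
by rewrite -(real_normK (num_real (f u))); have := sqr_ge0 (`|f u| - 1); rewrite !expr2; nra.
Qed.

(** Cauchy-Schwarz in the time variable; the right-hand side may be infinite. *)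
Lemma time_CS (R : realType) (s t : R) (f : R -> R) : s <= t -> measurable_fun `]s, t]%classic f ->
  (((\int[leb]_(u in `]s, t]) f u) ^+ 2)%:E <=
   (t - s)%:E * \int[leb]_(u in `]s, t]) (f u ^+ 2)%:E)%E.
Proof.
move=> st mf; set D := `]s, t]%classic.
have mD : measurable D by exact: measurable_itv.
have lebD : leb D = (t - s)%:E by exact: lebesgue_itvoc.
have ldD : (leb D < +oo)%E by rewrite lebD ltry.
have [ts|ts] := ltP s t; last first.
  rewrite (_ : D = set0) ?Rintegral_set0 ?integral_set0 ?expr0n ?mule0//.
  by rewrite /D set_itv_ge// bnd_simp -leNgt.
have ts0 : 0 < t - s by rewrite subr_gt0.
have i0 : (0 <= \int[leb]_(u in D) (f u ^+ 2)%:E)%E by apply: integral_ge0 => u _; rewrite lee_fin sqr_ge0.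
have [ioo|] := eqVneq (\int[leb]_(u in D) (f u ^+ 2)%:E)%E +oo%E.
  by rewrite ioo gt0_muley ?leey// lte_fin.
move=> ifin.
have [if2 if1] := sq_integrable mD ldD mf (ltac:(by rewrite ltey)).
set I := \int[leb]_(u in D) f u; pose m := I / (t - s).
have E2 : (\int[leb]_(u in D) (f u ^+ 2)%:E = (\int[leb]_(u in D) (f u ^+ 2))%R%:E)%E.
  by rewrite /Rintegral fineK// integrable_fin_num.
rewrite E2 -EFinM lee_fin.
have : 0 <= \int[leb]_(u in D) ((f u ^+ 2 + (- (2 * m)) * f u) + m ^+ 2).
  by apply: Rintegral_ge0 => u _; have := sqr_ge0 (f u - m); rewrite !expr2; lra.
have ifm : leb.-integrable D (EFin \o (fun u => - (2 * m) * f u)).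
  by have H1 := integrableZl _ (- (2 * m)) if1; have := H1 mD.
rewrite RintegralD//; last 2 first.
- by have H1 := integrableD _ if2 ifm; have := H1 mD; apply: eq_integrable.
- exact: integrable_cst_fin.
rewrite RintegralD// RintegralZl// -/I.
have -> : \int[leb]_(_ in D) (m ^+ 2) = m ^+ 2 * (t - s).
  by rewrite Rintegral_cst//; congr (_ * _); have := congr1 fine lebD.
move=> H.
have mI : I = m * (t - s) by rewrite /m divfK// gt_eqF.
exact: time_CS_aux H mI ts0.
Qed.

Section sde.
Context d0 (Omega : measurableType d0) (R : realType) (P : probability Omega R).
Context (d r : nat) (Z : R -> Omega -> 'cV[R]_r) (F : R -> set (set Omega)).
Hypotheses (Ffilt : filtration F) (ZF : adapted F Z)
  (Zind : increments_independent_of P Z F) (Zlevy : levy_process P Z)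
  (ZR1 : cond_R1 P Z).
Context (X : R -> Omega -> 'cV[R]_d) (A : 'cV[R]_d -> 'cV[R]_d) (C : 'cV[R]_d -> 'M[R]_(d, r)).
Hypotheses (XF : adapted F X) (Xc : forall w, cadlag (X ^~ w)).
Hypothesis Xito : forall t, 0 <= t ->
  is_ito_integral P F Z (fun s w => C (left_limit (X ^~ w) s)) t
    (fun w => X t w - X 0 w - \col_i \int[leb]_(s in `[0, t]) A (X s w) i 0).
Variable L : R.
Local Notation lip f := (forall x y : 'cV[R]_d, `|f x - f y| <= L * \sum_k `|x k 0 - y k 0|).
Hypotheses (L0 : 0 <= L)
  (CL : forall x y i a, `|C x i a - C y i a| <= L * \sum_k `|x k 0 - y k 0|)
  (AL : forall x y i, `|A x i 0 - A y i 0| <= L * \sum_k `|x k 0 - y k 0|)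
  (mC : forall i a, meas (fun x : 'cV[R]_d => C x i a))
  (mA : forall i, meas (fun x : 'cV[R]_d => A x i 0)).
Local Notation dZ := (dZ Z).
Local Notation PO := (mu_ext P).

Definition drift_int i t w := \int[leb]_(s in `[0, t]) A (X s w) i 0.
Definition martpart i t w := X t w i 0 - X 0 w i 0 - drift_int i t w.
Definition Phi i a u w := C (left_limit (X ^~ w) u) i a.

Lemma X_mwrt t (f : 'cV[R]_d -> R) : 0 <= t -> meas f -> mwrt (F t) (fun w => f (X t w)).
Proof.
move=> t0 mf B mB; have /= H := XF t0.
apply: (H (f @^-1` B)).
by have := mf measurableT B mB; rewrite setTI.
Qed.

Lemma X_measurable t (f : 'cV[R]_d -> R) : 0 <= t -> meas f ->
  meas (fun w => f (X t w)).
Proof.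
move=> t0 mf; apply: (mwrt_filt_measurable Ffilt t0); exact: X_mwrt.
Qed.

Lemma lip_cvg (T : Type) (G : set_system T) {FG : Filter G} (f : 'cV[R]_d -> R) (g : T -> 'cV[R]_d) x :
  lip f ->
  g @ G --> x -> f (g u) @[u --> G] --> f x.
Proof.
move=> fL gx; apply/cvgrPdist_le => e e0.
have gk k : g u k 0 @[u --> G] --> x k 0.
  apply: (@cvg_comp _ _ _ g (fun M : 'cV[R]_d => M k 0) _ _ _ gx).
  exact: coord_continuous.
have : L * \sum_k `|x k 0 - g u k 0| @[u --> G] --> 0.
  have E : L * \sum_k `|x k 0 - x k 0| = 0 by rewrite big1 ?mulr0// => k _; rewrite subrr normr0.
  rewrite -[X in _ --> X]E.
  apply: cvgMr; apply: cvg_sumr => k; apply: cvg_norm.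
  by apply: cvgB; [exact: cvg_cst|exact: gk].
move/cvgrPdist_le => /(_ e e0); apply: filterS => u.
rewrite sub0r normrN; apply: le_trans; apply: le_trans (fL _ _) _; exact: ler_norm.
Qed.

Lemma X_right w t (f : 'cV[R]_d -> R) : lip f ->
  0 <= t -> f (X s w) @[s --> t^'+] --> f (X t w).
Proof. by move=> fL t0; apply: lip_cvg => //; have [+ _] := Xc w; exact. Qed.

Lemma X_left w t (f : 'cV[R]_d -> R) : lip f ->
  0 < t -> f (X s w) @[s --> t^'-] --> f (left_limit (X ^~ w) t).
Proof. by move=> fL t0; apply: lip_cvg => //; have [_] := Xc w => /(_ t t0). Qed.

Lemma jointA i : meas (fun z : R * Omega => \1_(`[0, +oo[%classic) z.1 * A (X z.1 z.2) i 0).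
Proof.
apply: (@joint_right _ Omega R (fun t w => A (X t w) i 0)).
  by move=> t t0; apply: (@X_measurable t (fun x => A x i 0)).
by move=> w t t0; apply: (@X_right w t (fun x => A x i 0)).
Qed.

Lemma jointC i a : meas (fun z : R * Omega => \1_(`]0, +oo[%classic) z.1 * Phi i a z.1 z.2).
Proof.
apply: (@joint_left _ Omega R (fun t w => C (X t w) i a)).
  by move=> t t0; apply: (@X_measurable t (fun x => C x i a)).
by move=> w t t0; apply: (@X_left w t (fun x => C x i a)).
Qed.

Lemma Phi_measurable i a w (D : set R) : measurable D -> D `<=` `]0, +oo[%classic ->
  measurable_fun D (fun u => Phi i a u w).
Proof.
move=> mD D0; have := measurableT_comp (jointC i a) (measurable_pair2 w).
move=> H; apply: (@eq_measurable_fun _ _ _ _ D (fun u => \1_(`]0, +oo[%classic) u * Phi i a u w)).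
  by move=> u; rewrite inE => Du; rewrite indicE mem_set ?mul1r//; exact: D0.
exact: measurable_funTS.
Qed.

Lemma measurable_time_integral (f : R * Omega -> R) : meas f ->
  meas (fun w => \int[leb]_u f (u, w)).
Proof.
move=> mf; have mfE : meas (EFin \o f) by exact/measurable_EFinP.
rewrite /Rintegral; apply: measurableT_comp; first exact: fine_measurable.
under eq_fun do rewrite integralE.
apply: emeasurable_funB.
- have H := @measurable_fun_fubini_tonelli_G _ _ _ _ _ leb _ (measurable_funepos mfE) (fun x => funepos_ge0 _ x).
  apply: (@eq_measurable_fun _ _ _ _ setT _ _ _ H) => w _; rewrite /fubini_G; apply: eq_integral => u _.
  by rewrite !funeposE.
- have H := @measurable_fun_fubini_tonelli_G _ _ _ _ _ leb _ (measurable_funeneg mfE) (fun x => funeneg_ge0 _ x).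
  apply: (@eq_measurable_fun _ _ _ _ setT _ _ _ H) => w _; rewrite /fubini_G; apply: eq_integral => u _.
  by rewrite !funenegE.
Qed.

Lemma drift_int_measurable i t : meas (drift_int i t).
Proof.
have mi : meas (fun z : R * Omega => \1_(`[0, t]%classic) z.1 : R).
  by apply: (@measurableT_comp _ _ _ _ _ _ (\1_(`[0, t]%classic) : R -> R) _ (@fst R Omega)) => //.
have H := measurable_time_integral (measurable_funM mi (jointA i)).
apply: eq_measurable_fun H => w _; rewrite /drift_int [in RHS]Rintegral_mkcond /=.
apply: eq_Rintegral => u _; rewrite patchE indicE; have [ut|ut] := pselect (`[0, t]%classic u); last by rewrite !memNset// mul0r.
rewrite !mem_set// mul1r indicE mem_set ?mul1r//=.
by move: ut; rewrite /= !in_itv /= => /andP[-> _].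
Qed.

Lemma martpart_measurable i t : 0 <= t -> meas (martpart i t).
Proof.
move=> t0; apply: measurable_funB; last exact: drift_int_measurable.
by apply: measurable_funB; apply: (@X_measurable _ (fun x => x i 0)) => //; exact: measurable_entry.
Qed.

Lemma mx_entry_norm m n (M : 'M[R]_(m, n)) i j : `|M i j| <= `|M|.
Proof. by rewrite [in leRHS]/Num.norm /= mx_normrE (le_bigmax _ _ (i, j)). Qed.

(** One row of a matrix integrand as a list of elementary integrands. *)
Definition row_elems (i : 'I_d) (H : simple_process Omega R d r) : seq (elem Omega R r) :=
  flatten [seq [seq Elem (sp_time H q) (sp_time H q.+1) c (fun w => sp_val H q w i c)
     | c <- enum 'I_r] | q <- iota 0 (sp_size H)].

Lemma big_row_elems i H (f : elem Omega R r -> R) : \sum_(e <- row_elems i H) f e =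
  \sum_(q < sp_size H) \sum_c f (Elem (sp_time H q) (sp_time H q.+1) c (fun w => sp_val H q w i c)).
Proof.
rewrite big_flatten /= big_map -[in RHS](big_mkord xpredT (fun q => \sum_c f (Elem (sp_time H q) (sp_time H q.+1) c (fun w => sp_val H q w i c)))).
by rewrite /index_iota subn0; apply: eq_bigr => q _; rewrite big_map big_enum.
Qed.

Lemma row_elems_int i H w : elem_int Z (row_elems i H) w = sp_integral Z H w i 0.
Proof.
rewrite /elem_int big_row_elems /sp_integral summxE; apply: eq_bigr => q _.
by rewrite mxE; apply: eq_bigr => c _; rewrite !mxE.
Qed.

Lemma row_elems_val i H c u w : elem_val (row_elems i H) c u w = sp_eval H u w i c.
Proof.
rewrite /elem_val big_row_elems /sp_eval summxE; apply: eq_bigr => q _.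
rewrite (bigD1 c)//= eqxx /= big1 ?addr0 => [|c' /negPf -> /=]; last by rewrite mul0r.
by rewrite mxE.
Qed.

Lemma row_elems_wf i H T e : predictable_on F T H -> e \in row_elems i H ->
  wf_elem P F e /\ eend e <= T.
Proof.
move=> Hp /flattenP[s /mapP[q]]; rewrite mem_iota add0n /= => qH -> /mapP[c _ ->] /=.
have [t0 tS tT Hw [M HM]] := Hp q qH; split=> //; split=> //=.
  move=> B mB; apply: (Hw ((fun M : 'M[R]_(d, r) => M i c) @^-1` B)).
  by rewrite -[X in measurable X]setTI; apply: measurable_entry.
apply: (@mom_bounded _ _ _ _ _ M).
  apply: (mwrt_filt_measurable Ffilt t0) => B mB; apply: (Hw ((fun M : 'M[R]_(d, r) => M i c) @^-1` B)).
  by rewrite -[X in measurable X]setTI; apply: measurable_entry.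
by move=> w; apply: le_trans (HM w); exact: mx_entry_norm.
Qed.

(** The second alternative is a null integrand on the target interval: it keeps the list well
    formed. *)
Definition restr (a b : R) (e : elem Omega R r) : elem Omega R r :=
  if ea e <= b then Elem (Num.max (ea e) a) (Num.max (Num.max (ea e) a) (Num.min (eend e) b)) (ec e) (exi e)
  else Elem a b (ec e) (cst 0).

Lemma restr_wf a b e : 0 <= a -> a <= b -> wf_elem P F e -> wf_elem P F (restr a b e).
Proof.
move=> a0 ab [e0 ee me moe]; rewrite /restr; case: ifPn => _; last first.
  by split => //=; [exact: mwrt_cst (filt_sigma Ffilt a0) _|exact: mom_cst].
split => //=; [by rewrite le_max e0|by rewrite le_max lexx|].
by apply: (mwrt_filt Ffilt e0 _ me); rewrite le_max lexx.
Qed.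

Lemma restr_val a b l c u w : elem_val (map (restr a b) l) c u w =
  (a < u <= b)%R%:R * elem_val l c u w.
Proof.
rewrite /elem_val big_map mulr_sumr; apply: eq_bigr => e _; rewrite /restr mulrA -natrM mulnb.
case: (leP (ea e) b) => eab /=; last first.
  rewrite mulr0; case: (boolP (_ && _)) => [|_]; last by rewrite mul0r.
  move=> /andP[/andP[_ ub] /andP[_ /andP[eu _]]].
  by have := lt_le_trans (lt_trans eab eu) ub; rewrite ltxx.
congr (_%:R * _).
case: (ec e == c); rewrite ?andbF//= gt_max !le_max le_min.
by have [h1|h1] := ltP (ea e) u; have [h2|h2] := ltP a u; rewrite ?(lt_geF h1) ?(lt_geF h2) ?andbF //= andbC.
Qed.

Lemma restr_int a s b l w : a <= s -> s <= b -> {in l, forall e, [/\ a <= ea e, ea e <= eend e & eend e <= b]} ->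
  elem_int Z (map (restr a s) l) w + elem_int Z (map (restr s b) l) w = elem_int Z l w.
Proof.
move=> as_ sb ab; rewrite /elem_int !big_map -big_split; apply: eq_big_seq => e /ab[ae ee be] /=.
rewrite /restr (le_trans ee be) /=; case: (leP (ea e) s) => es /=; last first.
  by rewrite mul0r add0r /dZ (min_idPl be) (max_idPr ee).
rewrite -mulrDr; congr (_ * _); rewrite /dZ (max_idPl ae) (min_idPl be).
have [es'|se'] := leP (eend e) s; first by rewrite (max_idPr ee) subrr addr0.
by rewrite (max_idPr es) addrC subrKA.
Qed.

Lemma restr_bounds a b e : a <= b -> a <= ea (restr a b e) /\ eend (restr a b e) <= b.
Proof.
move=> ab; rewrite /restr; case: ifPn => eab //=; rewrite le_max lexx orbT.
by split=> //; rewrite !ge_max eab ab ge_min lexx orbT.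
Qed.

Definition ierr (D : set R) (g : 'I_r -> R -> R) := (\int[leb]_(u in D) (\sum_c g c u ^+ 2)%:E)%E.

Lemma ierr_ge0 D g : (0 <= ierr D g)%E.
Proof. by apply: integral_ge0 => u _; rewrite lee_fin; apply: sumr_ge0 => c _; exact: sqr_ge0. Qed.

Lemma ierr_le D D' g g' : (forall u, D u -> (D' u /\ forall c, g c u ^+ 2 <= g' c u ^+ 2) \/ forall c, g c u = 0) ->
  (ierr D g <= ierr D' g')%E.
Proof.
have s0 (f : 'I_r -> R -> R) u : (0 <= (\sum_c f c u ^+ 2)%:E)%E.
  by rewrite lee_fin; apply: sumr_ge0 => c _; exact: sqr_ge0.
move=> H; rewrite /ierr integral_mkcond [leRHS]integral_mkcond; apply: ge0_le_integral_nomeas => u _; rewrite !patchE.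
  by case: ifPn.
have [Du|Du] := pselect (D u); last by rewrite memNset//; case: ifPn.
rewrite mem_set//; have [[D'u gg]|g0] := H u Du.
  by rewrite mem_set// lee_fin; apply: ler_sum => c _.
rewrite big1 => [|c _]; last by rewrite g0 expr0n.
by case: ifPn.
Qed.

(** J is the stochastic integral of phi over the interval ]a, b], as a limit in probability along
    elementary integrands. The integrands approximate phi in quadratic mean in time, in probability. *)
Definition rep (a b : R) (J : Omega -> R) (phi : 'I_r -> R -> Omega -> R) :=
  (forall c w, measurable_fun `]a, b]%classic (fun u => phi c u w)) /\
  exists l : nat -> seq (elem Omega R r),
  [/\ forall k, {in l k, forall e, wf_elem P F e},
      forall k, {in l k, forall e, a <= ea e /\ eend e <= b},
      vip P (fun k w => ierr `]a, b]%classic (fun c u => phi c u w - elem_val (l k) c u w)) &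
      vip P (fun k w => (`|J w - elem_int Z (l k) w|)%:E)].

Lemma integral_sum_sq (D : set R) (f : 'I_r -> R -> R) : measurable D ->
  (forall c, measurable_fun D (fun u => f c u)) ->
  (\int[leb]_(u in D) (\sum_c f c u ^+ 2)%:E = \sum_c \int[leb]_(u in D) (f c u ^+ 2)%:E)%E.
Proof.
move=> mD mf; under eq_integral do rewrite -sumEFin.
rewrite ge0_integral_sum// => c; last by move=> u _; rewrite lee_fin sqr_ge0.
by apply/measurable_EFinP; apply: (@measurable_funX _ _ _ D (fun u => f c u) 2); exact: mf.
Qed.

Lemma rep_martpart i t : 0 <= t -> rep 0 t (martpart i t) (Phi i).
Proof.
move=> t0; have mPhi c w : measurable_fun `]0, t]%classic (fun u => Phi i c u w).
  by apply: Phi_measurable => // u /=; rewrite !in_itv /= andbT => /andP[].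
split=> //; have [H [Hp H2 HJ]] := Xito t0.
exists (fun k => row_elems i (H k)); split.
- by move=> k e /(row_elems_wf (Hp k))[].
- by move=> k e el; have [[e0 _ _ _] eT] := row_elems_wf (Hp k) el.
- apply: (@vip_le _ _ _ _ _ (fun k w => \sum_(c : 'I_r) \int[leb]_(u in `[0%R, t])
    (`|C (left_limit (X ^~ w) u) - sp_eval (H k) u w| ^+ 2)%:E)%E); last first.
    apply: vip_sum => [c k w|c]; last exact: cvg0_vip.
    by apply: integral_ge0 => u _; rewrite lee_fin sqr_ge0.
  move=> k w; rewrite /ierr integral_sum_sq//; last first.
    move=> c; apply: measurable_funB => //; apply: measurable_funTS; exact: elem_val_measurable.
  apply: lee_sum => c _; rewrite integral_mkcond [leRHS]integral_mkcond.
  apply: ge0_le_integral_nomeas => u _; rewrite !patchE; first by case: ifPn => // _; rewrite lee_fin sqr_ge0.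
  case: ifPn => [|_]; last by case: ifPn => // _; rewrite lee_fin sqr_ge0.
  rewrite inE /= in_itv /= => /andP[u0 ut]; rewrite mem_set; last by rewrite /= in_itv /= ltW.
  rewrite lee_fin row_elems_val.
  have := mx_entry_norm (C (left_limit (X ^~ w) u) - sp_eval (H k) u w) i c; rewrite !mxE => HH.
  by rewrite -[leLHS]ger0_norm ?sqr_ge0// normrX ler_pXn2r ?nnegrE.
- apply: (vip_le _ (cvg0_vip HJ)) => k w; rewrite lee_fin row_elems_int /martpart.
  by have := mx_entry_norm (X t w - X 0 w - \col_i0 \int[leb]_(s in `[0, t]) A (X s w) i0 0 - sp_integral Z (H k) w) i 0; rewrite !mxE.
Qed.

Lemma sum_sqrD_le (f g1 g2 : 'I_r -> R) : (forall c, f c = g1 c + g2 c) ->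
  \sum_c f c ^+ 2 <= (\sum_c g1 c ^+ 2 + \sum_c g1 c ^+ 2) + (\sum_c g2 c ^+ 2 + \sum_c g2 c ^+ 2).
Proof.
move=> fE; rewrite -!big_split; apply: ler_sum => c _; rewrite fE /=.
by have := sqr_ge0 (g1 c - g2 c); rewrite !expr2; lra.
Qed.

Lemma ierrD_le (D : set R) (f g1 g2 : 'I_r -> R -> R) : measurable D ->
  (forall c, measurable_fun D (fun u => g1 c u)) -> (forall c, measurable_fun D (fun u => g2 c u)) ->
  (forall c u, D u -> f c u = g1 c u + g2 c u) ->
  (ierr D f <= (ierr D g1 + ierr D g1) + (ierr D g2 + ierr D g2))%E.
Proof.
rewrite /ierr => mD m1 m2 fE.
have ms (g : 'I_r -> R -> R) : (forall c, measurable_fun D (fun u => g c u)) ->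
    measurable_fun D (fun u => (\sum_c g c u ^+ 2)%:E).
  move=> mg; apply/measurable_EFinP; apply: measurable_sum => c.
  exact: (@measurable_funX _ _ _ D (fun u => g c u) 2).
have s0 (g : 'I_r -> R -> R) u : (0 <= (\sum_c g c u ^+ 2)%:E)%E.
  by rewrite lee_fin; apply: sumr_ge0 => c _; exact: sqr_ge0.
have e1 := ms _ m1; have e2 := ms _ m2.
rewrite -!ge0_integralD//; try by move=> u _; rewrite ?adde_ge0.
  apply: ge0_le_integral_nomeas => u Du //.
  rewrite -!EFinD lee_fin; apply: sum_sqrD_le => c; exact: fE.
all: try by apply: emeasurable_funD.
Qed.

Lemma rep_ext a b J J' phi phi' : rep a b J phi -> J =1 J' ->
  (forall c u w, a < u <= b -> phi c u w = phi' c u w) -> rep a b J' phi'.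
Proof.
move=> [mphi [l [wl bl el Jl]]] /funext <- E; split.
  move=> c w; apply: eq_measurable_fun (mphi c w) => u; rewrite inE /= in_itv /=; exact: E.
exists l; split; [exact: wl|exact: bl| |exact: Jl]; apply: vip_le el => k w; apply: ierr_le => u /=.
by rewrite in_itv /= => uab; left; split => // c; rewrite E.
Qed.

Lemma measurable_err (D : set R) (phi : 'I_r -> R -> Omega -> R) (l : seq (elem Omega R r)) w c :
  measurable_fun D (fun u => phi c u w) -> measurable_fun D (fun u => phi c u w - elem_val l c u w).
Proof. by move=> m; apply: measurable_funB => //; apply: measurable_funTS; exact: elem_val_measurable. Qed.

Lemma vip_double (Y : nat -> Omega -> \bar R) : (forall n w, (0 <= Y n w)%E) -> vip P Y ->
  vip P (fun n w => Y n w + Y n w)%E.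
Proof. by move=> Y0 vY; apply: vipD. Qed.

Lemma rep_add a b J J' phi phi' : rep a b J phi -> rep a b J' phi' ->
  rep a b (fun w => J w + J' w) (fun c u w => phi c u w + phi' c u w).
Proof.
move=> [mphi [l [wl bl el Jl]]] [mphi' [l' [wl' bl' el' Jl']]]; split.
  by move=> c w; apply: measurable_funD.
exists (fun k => l k ++ l' k); split.
- by move=> k e; rewrite mem_cat => /orP[/wl|/wl'].
- by move=> k e; rewrite mem_cat => /orP[/bl|/bl'].
- apply: vip_le (vipD _ _ (vip_double _ el) (vip_double _ el')) => k w; try exact: ierr_ge0; try by apply: adde_ge0; exact: ierr_ge0.
  apply: ierrD_le => //; try by move=> c; exact: measurable_err.
  by move=> c u _; rewrite /elem_val big_cat /=; ring.
- apply: vip_le (vipD _ _ Jl Jl') => k w; rewrite ?lee_fin//.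
  by rewrite /elem_int big_cat /= opprD addrACA ler_normD.
Qed.

Lemma rep0 a b : rep a b (cst 0) (fun _ _ _ => 0).
Proof.
split; first by move=> *; exact: measurable_cst.
exists (fun _ => [::]); split => //; apply: vip_le (vip0 P) => k w.
  rewrite /ierr (_ : (fun _ => _) = cst 0%E) ?integral0//; apply/funext => u /=.
  by rewrite big1// => c _; rewrite /elem_val big_nil subr0 expr0n.
by rewrite /elem_int big_nil subr0 normr0.
Qed.

Lemma rep_sum a b (I : Type) (s : seq I) J phi : (forall i, rep a b (J i) (phi i)) ->
  rep a b (fun w => \sum_(i <- s) J i w) (fun c u w => \sum_(i <- s) phi i c u w).
Proof.
move=> H; elim: s => [|i s IH].
  by apply: rep_ext (rep0 a b) _ _ => [w|c u w _]; rewrite big_nil.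
by apply: rep_ext (rep_add (H i) IH) _ _ => [w|c u w _]; rewrite big_cons.
Qed.

Lemma rep_widen a b a' b' J phi : a' <= a -> b <= b' -> rep a b J phi ->
  rep a' b' J (fun c u w => (a < u <= b)%R%:R * phi c u w).
Proof.
move=> aa bb [mphi [l [wl bl el Jl]]].
have sub : `]a, b]%classic `<=` (`]a', b']%classic : set R).
  by move=> u /=; rewrite !in_itv /= => /andP[au ub]; rewrite (le_lt_trans aa au) (le_trans ub bb).
have E c w : (fun u => (a < u <= b)%R%:R * phi c u w) = (fun u => phi c u w) \_ `]a, b]%classic.
  apply/funext => u; rewrite patchE; case: ifPn.
    by rewrite inE /= in_itv /= => ->; rewrite mul1r.
  by rewrite notin_setE /= in_itv /= => /negP/negPf ->; rewrite mul0r.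
split.
  move=> c w; rewrite E; apply: measurable_funTS.
  by apply/(measurable_restrictT _ _).1 => //; exact: measurable_itv.
exists l; split; [exact: wl| | |exact: Jl].
  by move=> k e /bl[ae be]; split; [exact: le_trans ae|exact: le_trans bb].
apply: vip_le el => k w; apply: ierr_le => u /=; rewrite !in_itv /= => ub'.
have [uab|uab] := boolP (a < u <= b); first by left; split => // c; rewrite mul1r.
right=> c; rewrite mul0r sub0r /elem_val big1_seq ?oppr0// => e /andP[_ /bl[ae be]].
case: (boolP ((ec e == c) && (ea e < u <= eend e))) => [|_]; last by rewrite mul0r.
move=> /andP[_ /andP[u1 u2]]; case/negP: uab; rewrite (le_lt_trans ae u1); exact: le_trans u2 be.
Qed.

Lemma elem_val_scale (W : Omega -> R) (l : seq (elem Omega R r)) c u w :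
  elem_val [seq Elem (ea e) (eend e) (ec e) (fun w => W w * exi e w) | e <- l] c u w = W w * elem_val l c u w.
Proof. by rewrite /elem_val big_map mulr_sumr; apply: eq_bigr => e _ /=; rewrite mulrCA. Qed.

Lemma elem_int_scale (W : Omega -> R) (l : seq (elem Omega R r)) w :
  elem_int Z [seq Elem (ea e) (eend e) (ec e) (fun w => W w * exi e w) | e <- l] w = W w * elem_int Z l w.
Proof. by rewrite /elem_int big_map mulr_sumr; apply: eq_bigr => e _ /=; rewrite mulrA. Qed.

Lemma rep_scale a b J phi W : 0 <= a -> mwrt (F a) W -> mom P W -> rep a b J phi ->
  rep a b (fun w => W w * J w) (fun c u w => W w * phi c u w).
Proof.
move=> a0 WF mW [mphi [l [wl bl el Jl]]]; split.
  by move=> c w; apply: measurable_funM => //; exact: measurable_cst.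
exists (fun k => [seq Elem (ea e) (eend e) (ec e) (fun w => W w * exi e w) | e <- l k]); split.
- move=> k _ /mapP[e el' ->]; have [e0 ee me moe] := wl k e el'; have [ae _] := bl k e el'.
  split => //=; last exact: momM.
  by apply: mwrtM => //; [exact: filt_sigma Ffilt _ e0|exact: (mwrt_filt Ffilt a0 ae)].
- by move=> k _ /mapP[e el' ->] /=; exact: bl el'.
- apply: vip_le (vipM_mom (momX 2 mW) _ el) => k w; last exact: ierr_ge0.
  rewrite /ierr -ge0_integralZl//; last 2 first.
  + apply/measurable_EFinP; apply: measurable_sum => c.
    by apply: (@measurable_funX _ _ _ _ (fun u => phi c u w - elem_val (l k) c u w) 2); exact: measurable_err.
  + by move=> u _; rewrite lee_fin; apply: sumr_ge0 => c _; exact: sqr_ge0.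
  apply: ge0_le_integral_nomeas => u _; first by rewrite lee_fin; apply: sumr_ge0 => c _; exact: sqr_ge0.
  rewrite -EFinM lee_fin mulr_sumr; apply: ler_sum => c _.
  by rewrite elem_val_scale -mulrBr exprMn ler_wpM2r ?sqr_ge0// ler_norm.
- apply: vip_le (vipM_mom mW _ Jl) => k w; rewrite ?lee_fin//.
  by rewrite elem_int_scale -mulrBr normrM.
Qed.

Lemma rep_dZ a b c : 0 <= a -> a <= b -> rep a b (dZ c a b) (fun c' _ _ => (c' == c)%:R).
Proof.
move=> a0 ab; split; first by move=> *; exact: measurable_cst.
exists (fun _ => [:: Elem a b c (cst 1)]); split.
- move=> k e; rewrite inE => /eqP -> ; split => //=; [exact: mwrt_cst (filt_sigma Ffilt a0) _|exact: mom_cst].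
- by move=> k e; rewrite inE => /eqP ->.
- apply: vip_le (vip0 P) => k w; apply: (le_via (ierr set0 (fun _ _ => 0))).
    apply: ierr_le => u /=; rewrite in_itv /= => uab; right => c'.
    by rewrite /elem_val big_seq1 /= uab andbT mulr1 eq_sym subrr.
  by rewrite /ierr integral_set0.
- apply: vip_le (vip0 P) => k w; by rewrite /elem_int big_seq1 /= mul1r subrr normr0.
Qed.

(** Subtracting the approximations on ]0, s] of both integrals gives elementary integrals whose
    integrands vanish, hence the integrals vanish. *)
Lemma rep_diff s t J J' phi : 0 <= s -> s <= t -> rep 0 t J phi -> rep 0 s J' phi ->
  rep s t (fun w => J w - J' w) phi.
Proof.
move=> s0 st [mphi [l [wl bl el Jl]]] [mphi' [l' [wl' bl' el' Jl']]].
have sub : `]s, t]%classic `<=` (`]0, t]%classic : set R).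
  by move=> u /=; rewrite !in_itv /= => /andP[au ->]; rewrite (le_lt_trans s0 au).
split; first by move=> c w; apply: measurable_funS (mphi c w).
pose m k := map (restr 0 s) (l k) ++ [seq Elem (ea e) (eend e) (ec e) (fun w => -1 * exi e w) | e <- l' k].
have wneg k : {in l' k, forall e, wf_elem P F (Elem (ea e) (eend e) (ec e) (fun w => -1 * exi e w))}.
  move=> e el'0; have [e0 ee me moe] := wl' k e el'0; split => //=; last exact: momZ.
  by apply: mwrtM => //; [exact: filt_sigma Ffilt _ e0|exact: mwrt_cst (filt_sigma Ffilt e0) _].
have wm k : {in m k, forall e, wf_elem P F e}.
  move=> e; rewrite mem_cat => /orP[|] /mapP[e' el0 ->]; [exact: restr_wf (wl k _ el0)|exact: wneg el0].
have bm k : {in m k, forall e, eend e <= s}.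
  move=> e; rewrite mem_cat => /orP[|] /mapP[e' el0 ->]; last by have [_] := bl' k _ el0.
  exact: (restr_bounds e' s0).2.
have mv k c u w : elem_val (m k) c u w = (0 < u <= s)%R%:R * elem_val (l k) c u w - elem_val (l' k) c u w.
  by rewrite -restr_val /elem_val /m big_cat /= -/(elem_val _ c u w) -/(elem_val _ c u w) elem_val_scale mulN1r.
have mI k w : elem_int Z (m k) w = elem_int Z (map (restr 0 s) (l k)) w - elem_int Z (l' k) w.
  by rewrite /elem_int /m big_cat /= -/(elem_int Z _ w) -/(elem_int Z _ w) elem_int_scale mulN1r.
pose E1 k w := ierr `]0, t]%classic (fun c u => phi c u w - elem_val (l k) c u w).
pose E2 k w := ierr `]0, s]%classic (fun c u => phi c u w - elem_val (l' k) c u w).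
have E10 k w : (0 <= E1 k w)%E by exact: ierr_ge0.
have E20 k w : (0 <= E2 k w)%E by exact: ierr_ge0.
have vD : vip P (fun k w => (E2 k w + E2 k w) + (E1 k w + E1 k w))%E.
  have v1 := vip_double E20 el'; have v2 := vip_double E10 el.
  exact: (vipD (fun k w => adde_ge0 (E20 k w) (E20 k w)) (fun k w => adde_ge0 (E10 k w) (E10 k w)) v1 v2).
have HD k w : (\int[leb]_(u in `]0%R, s]) (elem_sq (m k) w u)%:E <= (E2 k w + E2 k w) + (E1 k w + E1 k w))%E.
  pose g1 c u := phi c u w - elem_val (l' k) c u w.
  pose g2 c u := - (phi c u w - elem_val (l k) c u w).
  have mg1 c : measurable_fun `]0, s]%classic (g1 c) by exact: measurable_err.
  have mg2 c : measurable_fun `]0, s]%classic (g2 c).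
    apply: measurableT_comp => //; apply: measurable_err.
    by apply: measurable_funS (mphi c w) => // u /=; rewrite !in_itv /= => /andP[-> us]; rewrite (le_trans us st).
  have Efg c u : (`]0, s]%classic : set R) u -> elem_val (m k) c u w = g1 c u + g2 c u.
    by rewrite /= in_itv /= mv => ->; rewrite /g1 /g2 mul1r; ring.
  have := ierrD_le (measurable_itv _) mg1 mg2 Efg; rewrite /ierr => /le_trans; apply.
  apply: leeD => //; apply: leeD; apply: ierr_le => u /=; rewrite !in_itv /= => /andP[-> us]; left; rewrite (le_trans us st);
    by split => // c; rewrite sqrrN.
have vm := elem_int_vanishes Ffilt ZF Zind Zlevy ZR1 wm bm HD (vip_cvg0 vD).
have vmv : vip P (fun k w => (`|elem_int Z (m k) w|)%:E).
  move=> e e0; apply: vanishes_sub (vm e e0); near=> n => w /=; by rewrite lee_fin.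
exists (fun k => map (restr s t) (l k)); split.
- by move=> k _ /mapP[e el0 ->]; apply: restr_wf => //; exact: wl el0.
- by move=> k _ /mapP[e el0 ->]; exact: restr_bounds.
- apply: vip_le el => k w; apply: ierr_le => u /=; rewrite !in_itv /= => ust; left.
  by case/andP: (ust) => su ->; rewrite (le_lt_trans s0 su); split=> // c; rewrite restr_val ust mul1r.
- apply: (vip_le _ (vipD _ _ (vipD _ _ Jl Jl') vmv)) => k w; rewrite ?adde_ge0 ?lee_fin//.
  have lk : {in l k, forall e, [/\ 0 <= ea e, ea e <= eend e & eend e <= t]}.
    by move=> e el0; have [? ? _ _] := wl k e el0; have [? ?] := bl k e el0.
  have := restr_int w s0 st lk => RI.
  rewrite mI.
  have -> : J w - J' w - elem_int Z (map (restr s t) (l k)) w = (J w - elem_int Z (l k) w) - (J' w - elem_int Z (l' k) w)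
     + (elem_int Z (map (restr 0 s) (l k)) w - elem_int Z (l' k) w) by rewrite -RI; ring.
  by apply: le_trans (ler_normD _ _) _; rewrite lerD2r; exact: ler_normB.
Unshelve. all: end_near. Qed.

(** The constant 4 is the price of approximating integrals whose second moments need not converge. *)
Lemma rep_isometry a b J phi (B : R) : 0 <= a -> a <= b -> rep a b J phi -> meas J ->
  (forall c, meas (fun z : R * Omega => \1_(`]a, b]%classic) z.1 * phi c z.1 z.2)) ->
  (forall u, a < u <= b -> (\int[P]_w (\sum_c phi c u w ^+ 2)%:E <= B%:E)%E) ->
  (\int[P]_w (J w ^+ 2)%:E <= (4 * (B * (b - a)))%:E)%E.
Proof.
move=> a0 ab [mphi [l [wl bl el Jl]]] mJ jphi HB.
pose f (z : R * Omega) : R := \sum_c (\1_(`]a, b]%classic) z.1 * phi c z.1 z.2) ^+ 2.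
have mf : meas (EFin \o f).
  by apply/measurable_EFinP; apply: measurable_sum => c; apply: measurable_funX.
have f0 z : (0 <= (EFin \o f) z)%E by rewrite lee_fin; apply: sumr_ge0 => c _; exact: sqr_ge0.
pose V w := (\int[leb]_u (f (u, w))%:E)%E.
have fE u w : f (u, w) = (a < u <= b)%R%:R * \sum_c phi c u w ^+ 2.
  rewrite /f mulr_sumr; apply: eq_bigr => c _; rewrite exprMn indicE /=; congr (_ * _).
  have [uab|uab] := boolP (a < u <= b); first by rewrite mem_set /= ?in_itv//= expr1n.
  by rewrite memNset /= ?in_itv//= ?expr0n//; exact/negP.
have mV : meas V := @measurable_fun_fubini_tonelli_G _ _ _ _ _ leb _ mf f0.
have V0 w : (0 <= V w)%E by apply: integral_ge0 => u _; exact: (f0 (u, w)).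
have VE w : V w = ierr `]a, b]%classic (fun c u => phi c u w).
  rewrite /V /ierr [RHS]integral_mkcond; apply: eq_integral => u _; rewrite fE patchE.
  have [uab|uab] := boolP (a < u <= b); first by rewrite mem_set /= ?in_itv//= mul1r.
  by rewrite memNset /= ?in_itv//= ?mul0r//; exact/negP.
apply: (le_via (4%:E * \int[P]_w V w)%E); last first.
  have -> : (\int[P]_w V w = \int[leb]_u \int[P]_w (f (u, w))%:E)%E.
    exact: (esym (@fubini_tonelli _ _ _ _ _ leb P (EFin \o f) mf f0)).
  rewrite EFinM lee_pmul2l//.
  apply: (le_via (\int[leb]_(u in `]a, b]) B%:E)%E); last first.
    rewrite integral_cst//= lebesgue_measure_itv /= lte_fin; case: ifPn => [ab'|]; first by rewrite -EFinB -EFinM.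
    by rewrite -leNgt => ba; rewrite (le_anti (introT andP (conj ab ba))) subrr mulr0 mule0.
  rewrite [leRHS]integral_mkcond; apply: ge0_le_integral_nomeas => u _; first by apply: integral_ge0 => w _; exact: (f0 (u, w)).
  rewrite patchE; under eq_integral do rewrite fE.
  have [uab|uab] := boolP (a < u <= b).
    by rewrite mem_set /= ?in_itv//=; under eq_integral do rewrite mul1r; exact: HB.
  rewrite memNset /= ?in_itv//=; last exact/negP.
  by under eq_integral do rewrite mul0r; rewrite integral0.
pose D k w := ierr `]a, b]%classic (fun c u => phi c u w - elem_val (l k) c u w).
have D0 k w : (0 <= D k w)%E by exact: ierr_ge0.
apply: (@ito_limit _ _ _ P _ Z F Ffilt ZF Zind Zlevy ZR1 l b D J V) => //.
- by move=> k e /bl[].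
- move=> k w; rewrite VE.
  pose g1 c u := phi c u w.
  pose g2 c u := - (phi c u w - elem_val (l k) c u w).
  have mg2 c : measurable_fun `]a, b]%classic (g2 c).
    by apply: measurableT_comp => //; apply: measurable_err.
  have Efg c u : (`]a, b]%classic : set R) u -> elem_val (l k) c u w = g1 c u + g2 c u.
    by move=> _; rewrite /g1 /g2; ring.
  have H := ierrD_le (measurable_itv _) (fun c => mphi c w) mg2 Efg.
  apply: (le_via (ierr `]a, b]%classic (fun c u => elem_val (l k) c u w))).
    apply: ierr_le => u /=; rewrite !in_itv /= => /andP[u0 ub]; have [au|ua] := ltP a u; first by left.
    right=> c; rewrite /elem_val big1_seq// => e /andP[_ /bl[ae be]].
    case: (boolP ((ec e == c) && (ea e < u <= eend e))) => [|_]; last by rewrite mul0r.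
    by move=> /andP[_ /andP[u1 u2]]; have := le_lt_trans (le_trans ua ae) u1; rewrite ltxx.
  apply: le_trans H _; rewrite !mule_natl !mule2n; apply: leeD => //.
  by apply: leeD; apply: ierr_le => u Du; left; split => // c; rewrite sqrrN.
- exact: vip_cvg0.
Qed.

Definition nX (t : R) (w : Omega) : R := \sum_k `|X t w k 0|.
Hypothesis XM : forall N : nat, exists B : R, forall t, 0 <= t ->
  (\int[P]_w (nX t w ^+ N)%:E <= B%:E)%E.

Lemma nX_ge0 t w : 0 <= nX t w.
Proof. exact: sumr_ge0. Qed.

Lemma nX_measurable t : 0 <= t -> meas (nX t).
Proof.
move=> t0; apply: measurable_sum => k; apply: measurableT_comp => //.
by apply: (X_measurable t0 (f := fun x => x k 0)); exact: measurable_entry.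
Qed.

Lemma nX_mom t : 0 <= t -> mom P (nX t).
Proof.
move=> t0; split=> [|N]; first exact: nX_measurable.
have [B HB] := XM N; apply/integrableP; split.
  by apply/measurable_EFinP/measurable_funX/measurableT_comp => //; exact: nX_measurable.
under eq_integral do rewrite /= ger0_norm ?exprn_ge0// ger0_norm ?nX_ge0//.
by apply: le_lt_trans (HB t t0) (ltry _).
Qed.

Lemma nX_mean N : exists2 B, 0 <= B & forall t, 0 <= t -> mean P (fun w => nX t w ^+ N) <= B.
Proof.
have [B HB] := XM N; exists (Num.max B 0); first by rewrite le_max lexx orbT.
by move=> t t0; rewrite -lee_fin -mean_fin; [apply: le_trans (HB t t0) _; rewrite lee_fin le_max lexx|exact: momX (nX_mom t0)].
Qed.

(** Closed under products, with all moments along the solution bounded in time. *)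
Definition pw (f : 'cV[R]_d -> R) := meas f /\
  exists B N, 0 <= B /\ forall x, `|f x| <= B * wt x ^+ N.

Let wt0 (x : 'cV[R]_d) n : 0 <= wt x ^+ n.
Proof. by rewrite exprn_ge0// (le_trans ler01 (wt_ge1 x)). Qed.

Lemma pwM f g : pw f -> pw g -> pw (fun x => f x * g x).
Proof.
move=> [mf [B [N [B0 H]]]] [mg [B' [N' [B'0 H']]]]; split; first exact: measurable_funM.
exists (B * B'), (N + N')%N; split; first exact: mulr_ge0.
move=> x; rewrite normrM exprD; apply: le_trans (ler_pM _ _ (H x) (H' x)) _ => //.
by apply: eq_ler; ring.
Qed.

Lemma pwD f g : pw f -> pw g -> pw (fun x => f x + g x).
Proof.
move=> [mf [B [N [B0 H]]]] [mg [B' [N' [B'0 H']]]]; split; first exact: measurable_funD.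
exists (B + B'), (N + N')%N; split; first exact: addr_ge0.
move=> x; apply: le_trans (ler_normD _ _) _; rewrite mulrDl; apply: lerD.
  by apply: le_trans (H x) _; rewrite ler_wpM2l//; apply: ler_weXn2l; [exact: wt_ge1|exact: leq_addr].
by apply: le_trans (H' x) _; rewrite ler_wpM2l//; apply: ler_weXn2l; [exact: wt_ge1|exact: leq_addl].
Qed.

Lemma pw_cst c : pw (fun _ => c).
Proof. by split => //; exists `|c|, 0%N; split => // x; rewrite expr0 mulr1. Qed.

Lemma pw_sum (I : Type) (s : seq I) (f : I -> 'cV[R]_d -> R) : (forall i, pw (f i)) ->
  pw (fun x => \sum_(i <- s) f i x).
Proof.
move=> H; elim: s => [|i s IH]; first by under eq_fun do rewrite big_nil; exact: pw_cst.
by under eq_fun do rewrite big_cons; exact: pwD.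
Qed.

Lemma pw_wt N : pw (fun x => wt x ^+ N).
Proof.
split; last by exists 1, N; split => // x; rewrite mul1r ger0_norm.
apply: measurable_funX; apply: measurable_funD => //; apply: measurable_sum => k.
by apply: measurableT_comp => //; exact: measurable_entry.
Qed.

Lemma pw_lip (f : 'cV[R]_d -> R) : meas f -> lip f -> pw f.
Proof.
move=> mf fL; split => //; exists (L + `|f 0|), 1%N; split => [|x]; first exact: addr_ge0.
rewrite expr1 -[X in `|X|](subrK (f 0)); apply: le_trans (ler_normD _ _) _; rewrite mulrDl.
apply: lerD; last by rewrite ler_peMr// wt_ge1.
apply: le_trans (fL x 0) _; rewrite ler_wpM2l// /wt; under eq_bigr do rewrite mxE subr0.
by rewrite lerDr.
Qed.

Lemma pw_C i a : pw (fun x => C x i a). Proof. exact: pw_lip (mC i a) (fun x y => CL x y i a). Qed.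
Lemma pw_A i : pw (fun x => A x i 0). Proof. exact: pw_lip (mA i) (fun x y => AL x y i). Qed.

Lemma pw_mwrt f t : pw f -> 0 <= t -> mwrt (F t) (fun w => f (X t w)).
Proof. by move=> [mf _] t0; exact: (X_mwrt t0 mf). Qed.

Lemma pw_meas f t : pw f -> 0 <= t -> meas (fun w => f (X t w)).
Proof. by move=> [mf _] t0; exact: (X_measurable t0). Qed.

Lemma wtX_mom t N : 0 <= t -> mom P (fun w => wt (X t w) ^+ N).
Proof. by move=> t0; apply: momX; apply: momD (mom_cst P 1) (nX_mom t0). Qed.

Lemma pw_mom f t : pw f -> 0 <= t -> mom P (fun w => f (X t w)).
Proof.
move=> pf t0; have mf := pw_meas pf t0; have [_ [B [N [B0 H]]]] := pf.
apply: mom_le mf _ (momZ B (wtX_mom N t0)) => w.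
by rewrite [leRHS]ger0_norm ?mulr_ge0.
Qed.

Lemma pw_mean f q : pw f -> exists2 M, 0 <= M & forall t, 0 <= t -> mean P (fun w => `|f (X t w)| ^+ q) <= M.
Proof.
move=> pf; have [_ [B [N [B0 H]]]] := pf.
have [M M0 HM] := nX_mean (N * q).
exists (B ^+ q * (2 ^+ (N * q) * (1 + M))); first by rewrite !mulr_ge0 ?exprn_ge0// addr_ge0.
move=> t t0; have mn := nX_mom t0.
apply: (le_via (mean P (fun w => B ^+ q * (2 ^+ (N * q) * (1 + nX t w ^+ (N * q)))))).
  apply: le_mean => [||w]; first by apply/momX/mom_norm; exact: pw_mom.
    by apply: momZ; apply: momZ; apply: momD (mom_cst P 1) (momX _ mn).
  apply: (le_via ((B * wt (X t w) ^+ N) ^+ q)); first by rewrite lerXn2r ?nnegrE// mulr_ge0.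
  rewrite exprMn -exprM ler_wpM2l ?exprn_ge0//.
  by have := exprD_le (N * q) ler01 (nX_ge0 t w); rewrite expr1n.
rewrite !meanZ; try by do ?apply: momZ; apply: momD (mom_cst P 1) (momX _ mn).
rewrite ler_wpM2l ?exprn_ge0// ler_wpM2l ?exprn_ge0//.
by rewrite meanD ?mean_cst ?lerD2l ?HM//; [exact: mom_cst|exact: momX].
Qed.

Lemma pw_mean4 f : pw f -> exists2 M, 0 <= M & forall t, 0 <= t -> mean P (fun w => f (X t w) ^+ 4) <= M.
Proof.
move=> pf; have [M M0 H] := pw_mean 4 pf; exists M => // t t0.
rewrite (_ : mean _ _ = mean P (fun w => `|f (X t w)| ^+ 4)) ?H//.
by apply: eq_mean => w; rewrite -normrX ger0_norm// exprn_even_ge0.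
Qed.

Lemma mean_sq_mul f g : mom P f -> mom P g ->
  mean P (fun w => (f w * g w) ^+ 2) <= mean P (fun w => f w ^+ 4) + mean P (fun w => g w ^+ 4).
Proof.
move=> mf mg; rewrite -meanD; try exact: momX.
apply: le_mean => [||w]; first exact: momX (momM mf mg).
  by apply: momD; exact: momX.
rewrite exprMn (exprM (f w) 2 2) (exprM (g w) 2 2).
have := sqr_ge0 (f w ^+ 2); have := sqr_ge0 (g w ^+ 2); have := sqr_ge0 (f w ^+ 2 - g w ^+ 2).
rewrite !(expr2 (_ ^+ 2)) !(expr2 (_ - _)); nra.
Qed.

Lemma pw_mean_sq f g : pw f -> pw g -> exists2 M, 0 <= M & forall s t, 0 <= s -> 0 <= t ->
  eb P (fun w => (f (X s w) * g (X t w)) ^+ 2) M.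
Proof.
move=> pf pg; have [M M0 HM] := pw_mean4 pf; have [N N0 HN] := pw_mean4 pg.
exists (M + N) => [|s t s0 t0]; first exact: addr_ge0.
have mf := pw_mom pf s0; have mg := pw_mom pg t0.
apply: eb_mean => [|w|]; [exact: momX (momM mf mg)|exact: sqr_ge0|].
by apply: le_trans (mean_sq_mul mf mg) _; apply: lerD; [exact: HM|exact: HN].
Qed.

Lemma joint_restr (D : set R) (f : R -> Omega -> R) (W : Omega -> R) (D0 : set R) :
  measurable D -> D `<=` D0 -> meas W ->
  meas (fun z : R * Omega => \1_D0 z.1 * f z.1 z.2) ->
  meas (fun z : R * Omega => \1_D z.1 * (W z.2 * f z.1 z.2)).
Proof.
move=> mD DD mW mf.
have mi : meas (fun z : R * Omega => \1_D z.1 : R).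
  by apply: (@measurableT_comp _ _ _ _ _ _ (\1_D : R -> R) _ (@fst R Omega)) => //.
have mW2 : meas (fun z : R * Omega => W z.2) by exact: (measurableT_comp mW).
apply: eq_measurable_fun (measurable_funM mi (measurable_funM mW2 mf)) => z _ /=.
rewrite !indicE; have [Dz|Dz] := pselect (D z.1); last by rewrite memNset// !mul0r.
by rewrite !mem_set//= ?mul1r//; exact: DD.
Qed.

Lemma sub0oc s t : 0 <= s -> `]s, t]%classic `<=` (`]0, +oo[%classic : set R).
Proof. by move=> s0 u /=; rewrite !in_itv /= andbT => /andP[su _]; exact: le_lt_trans su. Qed.

Lemma sub0oc' s t : 0 <= s -> `]s, t]%classic `<=` (`[0, +oo[%classic : set R).
Proof. by move=> s0 u /=; rewrite !in_itv /= andbT => /andP[su _]; apply/ltW/(le_lt_trans s0). Qed.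

Lemma joint_restrB (D D0 : set R) (f : R -> Omega -> R) (W B : Omega -> R) :
  measurable D -> D `<=` D0 -> meas W -> meas B ->
  meas (fun z : R * Omega => \1_D0 z.1 * f z.1 z.2) ->
  meas (fun z : R * Omega => \1_D z.1 * (W z.2 * (f z.1 z.2 - B z.2))).
Proof.
move=> mD DD mW mB mf; have mT : meas (fun z : R * Omega => \1_setT z.1 * B z.2).
  by under eq_fun do rewrite indicT mul1r; exact: (measurableT_comp mB).
have := measurable_funB (joint_restr mD DD mW mf) (joint_restr (f := fun _ => B) mD (@subsetT _ D) mW mT).
by apply: eq_measurable_fun => z _ /=; ring.
Qed.

Lemma time_int_sq s t (f : R -> Omega -> R) (B : R) : s <= t ->
  meas (fun z : R * Omega => \1_(`]s, t]%classic) z.1 * f z.1 z.2) ->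
  (forall u, s < u <= t -> (\int[P]_w (f u w ^+ 2)%:E <= B%:E)%E) ->
  (\int[P]_w ((\int[leb]_(u in `]s, t]) f u w) ^+ 2)%:E <= ((t - s) ^+ 2 * B)%:E)%E.
Proof.
move=> st mf fB; have ts0 : 0 <= t - s by rewrite subr_ge0.
pose g (z : R * Omega) : R := (\1_(`]s, t]%classic) z.1 * f z.1 z.2) ^+ 2.
have mg : meas (EFin \o g) by apply/measurable_EFinP; exact: measurable_funX.
have g0 z : (0 <= (EFin \o g) z)%E by rewrite lee_fin sqr_ge0.
have gE u w : g (u, w) = (s < u <= t)%R%:R * f u w ^+ 2.
  rewrite /g exprMn indicE /=; congr (_ * _).
  have [uab|uab] := boolP (s < u <= t); first by rewrite mem_set /= ?in_itv//= expr1n.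
  by rewrite memNset /= ?in_itv//= ?expr0n//; exact/negP.
have mu w : measurable_fun `]s, t]%classic (fun u => f u w).
  have H := measurableT_comp mf (measurable_pair2 w).
  apply: (@eq_measurable_fun _ _ _ _ _ (fun u => \1_(`]s, t]%classic) u * f u w)).
    by move=> u; rewrite inE => Du; rewrite indicE mem_set ?mul1r.
  exact: measurable_funTS.
apply: (le_via (\int[P]_w ((t - s)%:E * \int[leb]_u (EFin \o g) (u, w)))%E).
  apply: ge0_le_integral_nomeas => w _; first by rewrite lee_fin sqr_ge0.
  have E : (\int[leb]_u (EFin \o g) (u, w) = \int[leb]_(u in `]s, t]) (f u w ^+ 2)%:E)%E.
    rewrite [RHS]integral_mkcond; apply: eq_integral => u _; rewrite patchE /= gE.
    have [uab|uab] := boolP (s < u <= t); first by rewrite mem_set /= ?in_itv//= mul1r.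
    by rewrite memNset /= ?in_itv//= ?mul0r//; exact/negP.
  by rewrite E; exact: (time_CS st (mu w)).
rewrite ge0_integralZl//; last 2 first.
- exact: (@measurable_fun_fubini_tonelli_G _ _ _ _ _ leb _ mg g0).
- by move=> w _; apply: integral_ge0 => u _; exact: (g0 (u, w)).
rewrite -(@fubini_tonelli _ _ _ _ _ leb P (EFin \o g) mg g0).
rewrite expr2 -mulrA (EFinM (t - s)); apply: lee_wpmul2l; first by rewrite lee_fin.
apply: (le_via (\int[leb]_(u in `]s, t]) B%:E)%E); last first.
  rewrite integral_cst//= lebesgue_measure_itv /= lte_fin; case: ifPn => [ab'|]; first by rewrite -EFinB -EFinM mulrC.
  by rewrite -leNgt => ba; rewrite (le_anti (introT andP (conj st ba))) subrr mul0r mule0.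
rewrite [leRHS]integral_mkcond; apply: ge0_le_integral_nomeas => u _.
  by apply: integral_ge0 => w _; exact: (g0 (u, w)).
rewrite patchE; under eq_integral do rewrite /= gE.
have [uab|uab] := boolP (s < u <= t).
  by rewrite mem_set /= ?in_itv//=; under eq_integral do rewrite mul1r; exact: fB.
rewrite memNset /= ?in_itv//=; last exact/negP.
by under eq_integral do rewrite mul0r; rewrite integral0.
Qed.

(** By the theorem of Fubini, from the moments of the solution: this makes the pathwise integrals
    additive in the interval. *)
Lemma A_integrable_ae i t : 0 <= t ->
  {ae P, forall w, leb.-integrable `[0, t]%classic (fun u => (A (X u w) i 0)%:E)}.
Proof.
move=> t0; have [B B0 HB] := pw_mean 2 (pw_A i).
pose g (z : R * Omega) : R := (\1_(`[0, t]%classic) z.1 * (1 * A (X z.1 z.2) i 0)) ^+ 2.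
have sub : `[0, t]%classic `<=` (`[0, +oo[%classic : set R).
  by move=> u /=; rewrite !in_itv /= andbT => /andP[].
have mc : meas (cst 1 : Omega -> R) by exact: measurable_cst.
have mj := joint_restr (f := fun u w => A (X u w) i 0) (measurable_itv _) sub mc (jointA i).
have mg : meas (EFin \o g) by apply/measurable_EFinP; exact: measurable_funX mj.
have g0 z : (0 <= (EFin \o g) z)%E by rewrite lee_fin sqr_ge0.
have gE u w : (`[0, t]%classic : set R) u -> g (u, w) = A (X u w) i 0 ^+ 2.
  by move=> Du; rewrite /g indicE /= mem_set// !mul1r.
have gE0 u w : ~ (`[0, t]%classic : set R) u -> g (u, w) = 0.
  by move=> Du; rewrite /g indicE /= memNset// mul0r expr0n.
pose V w := (\int[leb]_u (EFin \o g) (u, w))%E.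
have mV : meas V by exact: (@measurable_fun_fubini_tonelli_G _ _ _ _ _ leb _ mg g0).
have V0 w : (0 <= V w)%E by apply: integral_ge0 => u _; exact: (g0 (u, w)).
have lt : (leb (`[0%R, t]%classic : set R) < +oo)%E.
  by rewrite lebesgue_measure_itv /=; case: ifPn => // _; rewrite -EFinB ltry.
have VI : P.-integrable setT V.
  apply/integrableP; split => //; under eq_integral do rewrite gee0_abs//.
  rewrite -(@fubini_tonelli _ _ _ _ _ leb P (EFin \o g) mg g0).
  apply: (@le_lt_trans _ _ (\int[leb]_(u in `[0%R, t]) B%:E)%E); last first.
    by rewrite integral_cst//=; apply: lte_mul_pinfty => //; rewrite lee_fin.
  rewrite [leRHS]integral_mkcond; apply: ge0_le_integral_nomeas => u _.
    by apply: integral_ge0 => w _; exact: (g0 (u, w)).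
  rewrite patchE; have [Du|Du] := pselect ((`[0, t]%classic : set R) u).
    rewrite mem_set//; have u0 : 0 <= u by move: Du; rewrite /= in_itv /= => /andP[].
    under eq_integral do rewrite /= gE//.
    rewrite mean_fin; last by apply: momX; exact: (pw_mom (pw_A i) u0).
    rewrite lee_fin; apply: le_trans (HB u u0).
    by rewrite (@eq_mean _ _ _ P _ (fun w => `|A (X u w) i 0| ^+ 2))// => w; rewrite real_normK// num_real.
  rewrite memNset//; under eq_integral do rewrite /= gE0//.
  by rewrite integral0.
have mu w : measurable_fun `[0, t]%classic (fun u => A (X u w) i 0).
  have H := measurableT_comp mj (measurable_pair2 w).
  apply: (@eq_measurable_fun _ _ _ _ _ (fun u => \1_(`[0, t]%classic) u * (1 * A (X u w) i 0))).
    by move=> u; rewrite inE => Du; rewrite indicE mem_set ?mul1r.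
  exact: measurable_funTS.
have := integrable_ae measurableT VI; apply: filterS => w /(_ I) Vfin.
have VE : V w = (\int[leb]_(u in `[0%R, t]) (A (X u w) i 0 ^+ 2)%:E)%E.
  rewrite [RHS]integral_mkcond; apply: eq_integral => u _; rewrite patchE /=.
  by have [Du|Du] := pselect ((`[0, t]%classic : set R) u); [rewrite mem_set// gE|rewrite memNset// gE0].
suff [_] : leb.-integrable `[0, t]%classic (EFin \o (fun u => A (X u w) i 0 ^+ 2)) /\
  leb.-integrable `[0, t]%classic (EFin \o (fun u => A (X u w) i 0)) by [].
by apply: sq_integrable => //; rewrite -VE ltey_eq Vfin.
Qed.

Lemma drift_int_incr s t i : 0 <= s -> s <= t ->
  {ae P, forall w, leb.-integrable `]s, t]%classic (fun u => (A (X u w) i 0)%:E) /\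
    drift_int i t w - drift_int i s w = \int[leb]_(u in `]s, t]) A (X u w) i 0}.
Proof.
move=> s0 st; have t0 := le_trans s0 st; have := A_integrable_ae i t0; apply: filterS => w it.
split.
  apply: integrableS it => //; last by move=> u /=; rewrite !in_itv /= => /andP[su ->]; rewrite (ltW (le_lt_trans s0 su)).
by rewrite /drift_int; apply: Rintegral_itvB => //; rewrite bnd_simp.
Qed.

Lemma meas_int s t (f : R -> Omega -> R) :
  meas (fun z : R * Omega => \1_(`]s, t]%classic) z.1 * f z.1 z.2) ->
  meas (fun w => \int[leb]_(u in `]s, t]) f u w).
Proof.
move=> mf; apply: eq_measurable_fun (measurable_time_integral mf) => w _ /=.
rewrite [in RHS]Rintegral_mkcond; apply: eq_Rintegral => u _; rewrite patchE indicE.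
by have [Du|Du] := pselect ((`]s, t]%classic : set R) u); [rewrite !mem_set// mul1r|rewrite !memNset// mul0r].
Qed.

Lemma ae_le_int (f g : Omega -> R) B : meas f -> meas g ->
  {ae P, forall w, f w = g w} -> (\int[P]_w (g w ^+ 2)%:E <= B)%E -> (\int[P]_w (f w ^+ 2)%:E <= B)%E.
Proof.
move=> mf mg fg; apply: le_trans; rewrite (@ae_eq_integral _ _ _ P setT (fun w => (g w ^+ 2)%:E))//.
- by apply/measurable_EFinP; exact: measurable_funX.
- by apply/measurable_EFinP; exact: measurable_funX.
- by move: fg; apply: filterS => w -> _.
Qed.

(** The integrand of the martingale part involves left limits; bounds for the values pass to them by
    the lemma of Fatou. *)
Lemma Phi_sq_le i s u (W : Omega -> R) (B : 'I_r -> Omega -> R) (K : R) : 0 <= s -> s < u ->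
  (forall v, s <= v < u -> eb P (fun w => \sum_c (W w * (C (X v w) i c - B c w)) ^+ 2) K) ->
  (\int[P]_w (\sum_c (W w * (Phi i c u w - B c w)) ^+ 2)%:E <= K%:E)%E.
Proof.
move=> s0 su H; apply: (fatou_left (y := fun v w => \sum_c (W w * (C (X v w) i c - B c w)) ^+ 2) su).
- by move=> v /H[].
- by move=> v w; apply: sumr_ge0 => c _; exact: sqr_ge0.
- move=> w; have u0 := le_lt_trans s0 su; apply: cvg_sumr => c.
  have HC : C (X v w) i c @[v --> u^'-] --> Phi i c u w := X_left (f := fun x => C x i c) (fun x y => CL x y i c) u0.
  have HD : W w * (C (X v w) i c - B c w) @[v --> u^'-] --> W w * (Phi i c u w - B c w).
    by apply: cvgM; [exact: cvg_cst|apply: cvgB => //; exact: cvg_cst].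
  by rewrite expr2; under eq_fun do rewrite expr2; apply: cvgM.
- by move=> v /H[].
Qed.

Lemma martpart_incr_sq f i : pw f -> exists2 K, 0 <= K & forall s t, 0 <= s -> s <= t ->
  eb P (fun w => (f (X s w) * (martpart i t w - martpart i s w)) ^+ 2) (K * (t - s)).
Proof.
move=> pf; have /choice[K HK] : forall c : 'I_r, exists K, 0 <= K /\ forall s t, 0 <= s -> 0 <= t ->
    eb P (fun w => (f (X s w) * C (X t w) i c) ^+ 2) K.
  by move=> c; have [K K0 H] := pw_mean_sq pf (pw_C i c); exists K.
exists (4 * \sum_c K c); first by rewrite mulr_ge0// sumr_ge0// => c _; exact: (HK c).1.
move=> s t s0 st; have t0 := le_trans s0 st; have mW := pw_meas pf s0.
have mm : meas (fun w => f (X s w) * (martpart i t w - martpart i s w)).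
  by apply: measurable_funM => //; apply: measurable_funB; exact: martpart_measurable.
split=> [|w|]; [exact: measurable_funX|exact: sqr_ge0|rewrite -mulrA].
apply: (rep_isometry s0 st (rep_scale s0 (pw_mwrt pf s0) (pw_mom pf s0)
  (rep_diff s0 st (rep_martpart i t0) (rep_martpart i s0))) mm).
  by move=> c; apply: joint_restr (sub0oc s0) mW (jointC i c).
move=> u /andP[su ut]; have := @Phi_sq_le i s u (fun w => f (X s w)) (fun _ _ => 0) (\sum_c K c) s0 su.
under eq_integral do under eq_bigr do rewrite subr0.
apply=> v /andP[sv _]; apply: eb_sumI => c; under eq_fun do rewrite subr0.
by apply: (HK c).2 => //; exact: le_trans sv.
Qed.

Lemma time_eb s t (g : R -> Omega -> R) (J : Omega -> R) B : s <= t -> meas J ->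
  meas (fun z : R * Omega => \1_(`]s, t]%classic) z.1 * g z.1 z.2) ->
  {ae P, forall w, J w = \int[leb]_(u in `]s, t]) g u w} ->
  (forall u, s < u <= t -> eb P (fun w => g u w ^+ 2) B) -> eb P (fun w => J w ^+ 2) ((t - s) ^+ 2 * B).
Proof.
move=> st mJ mg JE gB; split=> [|w|]; [exact: measurable_funX|exact: sqr_ge0|].
apply: ae_le_int mJ (meas_int mg) JE _; apply: time_int_sq st mg _.
by move=> u /gB[].
Qed.

Lemma drift_incr_sq f i : pw f -> exists2 K, 0 <= K & forall s t, 0 <= s -> s <= t ->
  eb P (fun w => (f (X s w) * (drift_int i t w - drift_int i s w)) ^+ 2) ((t - s) ^+ 2 * K).
Proof.
move=> pf; have [K K0 HK] := pw_mean_sq pf (pw_A i); exists K => // s t s0 st; have mW := pw_meas pf s0.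
apply: (time_eb (g := fun u w => f (X s w) * A (X u w) i 0)) => //.
- by apply: measurable_funM => //; apply: measurable_funB; exact: drift_int_measurable.
- exact: (joint_restr (f := fun u w => A (X u w) i 0) (measurable_itv _) (@sub0oc' s t s0) mW (jointA i)).
- by have := drift_int_incr i s0 st; apply: filterS => w [Hi ->]; rewrite RintegralZl.
- by move=> u /andP[su _]; apply: HK => //; exact: le_trans (ltW su).
Qed.

Lemma sqrD_le (a b : R) : (a + b) ^+ 2 <= 2 * a ^+ 2 + 2 * b ^+ 2.
Proof. by have := sqr_ge0 (a - b); rewrite !expr2; lra. Qed.

Definition dX i s t w := X t w i 0 - X s w i 0.

Lemma dX_measurable i s t : 0 <= s -> 0 <= t -> meas (dX i s t).
Proof.
by move=> s0 t0; apply: measurable_funB; apply: (X_measurable _ (f := fun x => x i 0)) => //; exact: measurable_entry.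
Qed.

(** The weight is a function of the state at the left end. It is adapted, so it enters the integrand
    of the martingale part and the isometry applies. *)
Lemma dX_eb f i : pw f -> exists2 K, 0 <= K & forall s t, 0 <= s -> s <= t -> t <= s + 1 ->
  eb P (fun w => (f (X s w) * dX i s t w) ^+ 2) (K * (t - s)).
Proof.
move=> pf; have [K1 K10 H1] := martpart_incr_sq i pf; have [K2 K20 H2] := drift_incr_sq i pf.
exists (2 * K1 + 2 * K2) => [|s t s0 st ts1]; first by rewrite addr_ge0// mulr_ge0.
have t0 := le_trans s0 st; have i2 : (0 : R) <= 2 by [].
have h0 : 0 <= t - s by rewrite subr_ge0.
have h1 : t - s <= 1 by rewrite lerBlDl.
apply: eb_weak (eb_le _ _ (ebD (ebZ i2 (H1 s t s0 st)) (ebZ i2 (H2 s t s0 st)))).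
- have : K2 * (t - s) ^+ 2 <= K2 * (t - s) by rewrite ler_wpM2l// expr2 ler_piMr.
  by lra.
- by apply/measurable_funX/measurable_funM; [exact: pw_meas|exact: dX_measurable].
- move=> w; rewrite sqr_ge0 /=; apply: le_trans (sqrD_le _ _).
  by rewrite -mulrDr /martpart /dX; apply: eq_ler; congr ((_ * _) ^+ 2); ring.
Qed.

Lemma lip_incr_sq f (g : 'cV[R]_d -> R) : pw f -> meas g -> lip g ->
  exists2 K, 0 <= K & forall s t, 0 <= s -> s <= t -> t <= s + 1 ->
  eb P (fun w => (f (X s w) * (g (X t w) - g (X s w))) ^+ 2) (K * (t - s)).
Proof.
move=> pf mg gL; have [K2 K20 HK2] := @pow_sum_le R d 1.
have /choice[K HK] : forall k : 'I_d, exists K, 0 <= K /\ forall s t, 0 <= s -> s <= t -> t <= s + 1 ->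
    eb P (fun w => (f (X s w) * dX k s t w) ^+ 2) (K * (t - s)).
  by move=> k; have [K K0 H] := dX_eb k pf; exists K.
have c0 : 0 <= L ^+ 2 * K2 by rewrite mulr_ge0// sqr_ge0.
exists (L ^+ 2 * K2 * \sum_k K k) => [|s t s0 st ts1].
  by rewrite mulr_ge0// sumr_ge0// => k _; exact: (HK k).1.
have t0 := le_trans s0 st; have mX u : 0 <= u -> meas (fun w => g (X u w)) by move=> u0; exact: X_measurable.
apply: eb_weak (eb_le _ _ (ebZ c0 (eb_sumI (fun k => (HK k).2 s t s0 st ts1)))).
- by rewrite -mulr_suml mulrA.
- by apply/measurable_funX/measurable_funM; [exact: pw_meas|apply: measurable_funB; exact: mX].
- move=> w; rewrite sqr_ge0 /=.
  apply: (le_via ((L * \sum_k `|f (X s w) * dX k s t w|) ^+ 2)).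
    rewrite -(real_normK (num_real (f (X s w) * _))) lerXn2r ?nnegrE ?mulr_ge0 ?sumr_ge0//.
    under eq_bigr do rewrite normrM; rewrite -mulr_sumr mulrCA normrM ler_wpM2l//; exact: gL.
  rewrite exprMn -[leRHS]mulrA; apply: ler_wpM2l; first exact: sqr_ge0.
  apply: le_trans (HK2 _ _) _ => //.
  by apply: eq_ler; congr (_ * _); apply: eq_bigr => k _; rewrite real_normK ?num_real.
Qed.

Definition ddelta i s t w := drift_int i t w - drift_int i s w - (t - s) * A (X s w) i 0.

Lemma ddelta_measurable i s t : 0 <= s -> meas (ddelta i s t).
Proof.
move=> s0; apply: measurable_funB; first by apply: measurable_funB; exact: drift_int_measurable.
by apply: measurable_funM => //; exact: (X_measurable s0 (mA i)).
Qed.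

Lemma ddelta_eb f i : pw f -> exists2 K, 0 <= K & forall s t, 0 <= s -> s <= t -> t <= s + 1 ->
  eb P (fun w => (f (X s w) * ddelta i s t w) ^+ 2) (K * (t - s) ^+ 3).
Proof.
move=> pf; have [K K0 H] := lip_incr_sq pf (mA i) (fun x y => AL x y i); exists K => // s t s0 st ts1.
have mW := pw_meas pf s0; have mAs := X_measurable s0 (mA i).
have -> : K * (t - s) ^+ 3 = (t - s) ^+ 2 * (K * (t - s)) by rewrite !exprS; ring.
apply: (time_eb (g := fun u w => f (X s w) * (A (X u w) i 0 - A (X s w) i 0))) => //.
- by apply: measurable_funM => //; exact: ddelta_measurable.
- exact: (joint_restrB (f := fun u w => A (X u w) i 0) (measurable_itv _) (@sub0oc' s t s0) mW mAs (jointA i)).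
- have := drift_int_incr i s0 st; apply: filterS => w [Hi E].
  have ic : leb.-integrable `]s, t]%classic (EFin \o cst (A (X s w) i 0)).
    by apply: integrable_cst_fin => //; rewrite lebesgue_itvoc// ltry.
  have H1 := integrableB _ Hi ic; have Hd := H1 (measurable_itv _).
  rewrite RintegralZl// RintegralB// Rintegral_cst// /ddelta E; congr (_ * (_ - _)).
  by rewrite mulrC; congr (_ * _); have := congr1 fine (lebesgue_itvoc st).
- move=> u /andP[su ut]; apply: eb_weak (H s u s0 (ltW su) (le_trans ut ts1)).
  by rewrite ler_wpM2l// lerD2r.
Qed.

Definition dmu i s t w := martpart i t w - martpart i s w - \sum_a C (X s w) i a * dZ a s t w.

Lemma dmu_measurable i s t : 0 <= s -> s <= t -> meas (dmu i s t).
Proof.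
move=> s0 st; have t0 := le_trans s0 st.
apply: measurable_funB; first by apply: measurable_funB; exact: martpart_measurable.
apply: measurable_sum => a; apply: measurable_funM; first exact: (X_measurable s0 (mC i a)).
exact: (dZ_measurable Zlevy).
Qed.

Lemma rep_dmu i s t (W : Omega -> R) : 0 <= s -> s <= t -> mwrt (F s) W -> mom P W ->
  rep s t (fun w => W w * dmu i s t w) (fun c u w => W w * (Phi i c u w - C (X s w) i c)).
Proof.
move=> s0 st WF mW; have t0 := le_trans s0 st.
have R1 := rep_diff s0 st (rep_martpart i t0) (rep_martpart i s0).
have R2 a : rep s t (fun w => - C (X s w) i a * dZ a s t w) (fun c u w => - C (X s w) i a * (c == a)%:R).
  apply: (rep_scale s0 _ _ (rep_dZ a s0 st)).
    by apply: (X_mwrt s0 (f := fun x => - C x i a)); apply: measurableT_comp => //; exact: mC.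
  by apply: momN; exact: (pw_mom (pw_C i a) s0).
have R3 := rep_scale s0 WF mW (rep_add R1 (rep_sum (index_enum 'I_r) R2)).
apply: rep_ext R3 _ _ => [w|c u w _].
  by rewrite /dmu; congr (_ * (_ + _)); rewrite -sumrN; apply: eq_bigr => a _; rewrite mulNr.
congr (_ * (_ + _)); rewrite (bigD1 c)//= eqxx mulr1 big1 ?addr0// => a ac.
by rewrite eq_sym (negbTE ac) mulr0.
Qed.

(** A single stochastic integral over the whole grid: the errors of different steps are orthogonal,
    so that their variances of order h^2 add up. Bounding the steps one by one would lose a factor
    n. *)
Lemma dmu_grid_eb f i : pw f -> exists2 K, 0 <= K & forall (t : nat -> R) n h, 0 <= t 0%N ->
  (forall j, t j <= t j.+1 <= t j + 1) -> (forall j, t j.+1 - t j <= h) ->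
  eb P (fun w => (\sum_(j < n) f (X (t j) w) * dmu i (t j) (t j.+1) w) ^+ 2) (K * h * (t n - t 0%N)).
Proof.
move=> pf; have /choice[K HK] : forall c, exists K, 0 <= K /\ forall s t, 0 <= s -> s <= t -> t <= s + 1 ->
    eb P (fun w => (f (X s w) * (C (X t w) i c - C (X s w) i c)) ^+ 2) (K * (t - s)).
  by move=> c; have [K K0 H] := lip_incr_sq pf (mC i c) (fun x y => CL x y i c); exists K.
have S0 : 0 <= \sum_c K c by apply: sumr_ge0 => c _; exact: (HK c).1.
exists (4 * \sum_c K c) => [|t n h t0 tS hS]; first exact: mulr_ge0.
have tm j k : (j <= k)%N -> t j <= t k.
  by move=> /subnK <-; elim: (k - j)%N => [|m IH]; rewrite ?add0n// addSn; apply: le_trans IH _; case/andP: (tS (m + j)%N).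
have tj0 j : 0 <= t j := le_trans t0 (tm _ _ (leq0n j)).
have tjS j : t j <= t j.+1 by exact: tm.
have R1 j : rep (t 0%N) (t n) (fun w => (j < n)%N%:R * (f (X (t j) w) * dmu i (t j) (t j.+1) w))
    (fun c u w => (j < n)%N%:R * ((t j < u <= t j.+1)%R%:R * (f (X (t j) w) * (Phi i c u w - C (X (t j) w) i c)))).
  have [jn|jn] := boolP (j < n)%N.
    apply: rep_ext (rep_widen (tm _ _ (leq0n j)) (tm _ _ jn)
      (rep_dmu i (tj0 j) (tjS j) (pw_mwrt pf (tj0 j)) (pw_mom pf (tj0 j)))) _ _ => [w|c u w _].
      by rewrite mul1r.
    by rewrite mul1r.
  by apply: rep_ext (rep0 _ _) _ _ => [w|c u w _]; rewrite mul0r.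
have R2 := rep_sum (index_enum 'I_n) (fun j : 'I_n => R1 j).
have E : (fun w => \sum_(j < n) (j < n)%N%:R * (f (X (t j) w) * dmu i (t j) (t j.+1) w)) =
         (fun w => \sum_(j < n) f (X (t j) w) * dmu i (t j) (t j.+1) w).
  by apply/funext => w; apply: eq_bigr => j _; rewrite ltn_ord mul1r.
have mm : meas (fun w => \sum_(j < n) f (X (t j) w) * dmu i (t j) (t j.+1) w).
  by apply: measurable_sum => j; apply: measurable_funM; [exact: pw_meas|exact: dmu_measurable].
split=> [|w|]; [exact: measurable_funX|exact: sqr_ge0|rewrite -!mulrA (mulrA _ h)].
rewrite E in R2; apply: (rep_isometry t0 (tm _ _ (leq0n n)) R2 mm).
  move=> c; have mt j := joint_restrB (measurable_itv _) (@sub0oc (t j) (t j.+1) (tj0 j)) (pw_meas pf (tj0 j))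
    (X_measurable (tj0 j) (mC i c)) (jointC i c).
  have := @measurable_sum _ _ _ setT _ (index_enum 'I_n) _ (fun j : 'I_n => mt j).
  apply: eq_measurable_fun => -[u w] _ /=.
  rewrite mulr_sumr; apply: eq_bigr => j _; rewrite ltn_ord mul1r.
  rewrite !indicE; have [uj|uj] := boolP (t j < u <= t j.+1); last first.
    rewrite [in LHS]memNset; last by rewrite /= in_itv /=; exact/negP.
    by rewrite !mul0r mulr0.
  rewrite !mem_set ?mul1r//= in_itv//=; case/andP: uj => u1 u2.
  by rewrite (le_lt_trans (tm _ _ (leq0n j)) u1) (le_trans u2 (tm _ _ (ltn_ord j))).
move=> u _; have [[j uj]|nj] := pselect (exists j : 'I_n, t j < u <= t j.+1); last first.
  rewrite integral0_eq => [|w _]; last first.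
    rewrite big1// => c _; rewrite big1 ?expr0n// => j _.
    by case: (boolP (t j < u <= t j.+1)) => [uj|_]; [case: nj; exists j|rewrite mul0r mulr0].
  by rewrite lee_fin mulr_ge0//; apply: le_trans (hS 0%N); rewrite subr_ge0.
case/andP: (uj) => u1 u2.
have uniq (k : 'I_n) : k != j -> (t k < u <= t k.+1) = false.
  move=> kj; apply/negP => /andP[v1 v2]; have [lt|lt|e] := ltngtP k j.
  - by have := lt_le_trans (le_lt_trans (tm _ _ lt) u1) v2; rewrite ltxx.
  - by have := lt_le_trans (le_lt_trans (tm _ _ lt) v1) u2; rewrite ltxx.
  - by move: kj; rewrite -val_eqE /= e eqxx.
under eq_integral => w _.
  under eq_bigr => c _.
    rewrite (bigD1 j)//= big1 ?addr0 => [|k kj]; last by rewrite uniq// mul0r mulr0.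
    rewrite ltn_ord uj !mul1r; over.
  over.
apply: Phi_sq_le (tj0 j) u1 _ => v /andP[sv vu]; have vS := le_trans (ltW vu) u2.
have vt1 : v <= t j + 1 by apply: le_trans vS _; case/andP: (tS j).
apply: eb_weak (eb_sumI (fun c => (HK c).2 _ _ (tj0 j) sv vt1)).
by rewrite -mulr_suml ler_wpM2l//; apply: le_trans (hS j); rewrite lerD2r.
Qed.

Lemma dmu_sum_eb f i : pw f -> exists2 K, 0 <= K & forall n h, 0 <= h <= 1 ->
  eb P (fun w => (\sum_(j < n) f (X (j%:R * h) w) * dmu i (j%:R * h) (j.+1%:R * h) w) ^+ 2) (K * h * (n%:R * h)).
Proof.
move=> pf; have [K K0 H] := dmu_grid_eb i pf; exists K => // n h /andP[h0 h1].
have tS j : j.+1%:R * h = j%:R * h + h by rewrite -natr1 mulrDl mul1r.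
have := H (fun j => j%:R * h) n h; rewrite mul0r subr0; apply => // j; rewrite tS.
  by rewrite lerDl h0 lerD2l.
by rewrite addrAC subrr add0r.
Qed.

Lemma dmu_eb f i : pw f -> exists2 K, 0 <= K & forall s t, 0 <= s -> s <= t -> t <= s + 1 ->
  eb P (fun w => (f (X s w) * dmu i s t w) ^+ 2) (K * (t - s) ^+ 2).
Proof.
move=> pf; have [K K0 H] := dmu_grid_eb i pf; exists K => // s t s0 st ts1.
have := H (fun j => if j is 0%N then s else t) 1%N (t - s) s0; under eq_fun do rewrite big_ord1 /=.
rewrite expr2 mulrA; apply=> -[|j] /=; by rewrite ?st ?lexx ?lerDl ?subrr ?subr_ge0 ?ts1 ?ler01.
Qed.

(** The part of an increment that is of higher order than the driving increments. *)
Definition rho i s t w := dX i s t w - \sum_a C (X s w) i a * dZ a s t w.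

Lemma rhoE i s t w : rho i s t w = (t - s) * A (X s w) i 0 + ddelta i s t w + dmu i s t w.
Proof. by rewrite /rho /dX /ddelta /dmu /martpart; ring. Qed.

Lemma rho_measurable i s t : 0 <= s -> 0 <= t -> meas (rho i s t).
Proof.
move=> s0 t0; apply: measurable_funB; first exact: dX_measurable.
apply: measurable_sum => a; apply: measurable_funM; first exact: (X_measurable s0 (mC i a)).
exact: (dZ_measurable Zlevy).
Qed.

Lemma rho_eb f i : pw f -> exists2 K, 0 <= K & forall s t, 0 <= s -> s <= t -> t <= s + 1 ->
  eb P (fun w => (f (X s w) * rho i s t w) ^+ 2) (K * (t - s) ^+ 2).
Proof.
move=> pf; have [K1 K10 H1] := ddelta_eb i pf; have [K2 K20 H2] := dmu_eb i pf.
have [M M0 HM] := pw_mean 2 (pwM pf (pw_A i)).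
exists (4 * M + (4 * K1 + 4 * K2)); first by rewrite !addr_ge0// mulr_ge0.
move=> s t s0 st ts1; have t0 := le_trans s0 st.
have u0 : 0 <= t - s by rewrite subr_ge0.
have u1 : t - s <= 1 by rewrite lerBlDl.
have e1 : eb P (fun w => `|f (X s w) * A (X s w) i 0| ^+ 2) M.
  apply: eb_mean; last exact: HM.
    by apply/momX/mom_norm; exact: (pw_mom (pwM pf (pw_A i))).
  by move=> w; exact: exprn_ge0.
have c0 : 0 <= 4 * (t - s) ^+ 2 by rewrite mulr_ge0// sqr_ge0.
have i4 : (0 : R) <= 4 by [].
have e := ebD (ebZ c0 e1) (ebD (ebZ i4 (H1 s t s0 st ts1)) (ebZ i4 (H2 s t s0 st ts1))).
apply: eb_weak (eb_le _ _ e).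
- rewrite !mulrDl; apply: lerD; first by apply: eq_ler; ring.
  have : K1 * (t - s) ^+ 3 <= K1 * (t - s) ^+ 2.
    by rewrite ler_wpM2l// (exprS _ 2) -[leRHS]mul1r ler_wpM2r// sqr_ge0.
  set a := K1 * _; set b := K1 * _; rewrite -!mulrA -/b; set c := K2 * _; lra.
- by apply/measurable_funX/measurable_funM; [exact: pw_meas|exact: rho_measurable].
- move=> w; rewrite sqr_ge0 /= rhoE real_normK ?num_real//.
  have := sqrD_le (f (X s w) * ((t - s) * A (X s w) i 0)) (f (X s w) * (ddelta i s t w + dmu i s t w)).
  have := sqrD_le (f (X s w) * ddelta i s t w) (f (X s w) * dmu i s t w).
  rewrite -mulrDr => h1; rewrite -mulrDr addrA => h2; apply: le_trans h2 _.
  have := sqr_ge0 (f (X s w) * ((t - s) * A (X s w) i 0)).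
  move: h1; rewrite !exprMn; set a := f _ ^+ 2; lra.
Qed.

(** * Bounds in probability along the observations *)
Variable h : nat -> R.
Hypotheses (h_gt0 : forall n, 0 < h n) (Toy : n%:R * h n @[n --> \oo] --> +oo)
  (nh2 : n%:R * h n ^+ 2 @[n --> \oo] --> 0).
Local Notation t_ n j := (j%:R * h n).
Local Notation T_ n := (n%:R * h n).

Definition small_step n :=
  [/\ 0 < n%:R :> R, h n <= 1, 1 <= n%:R * h n & n%:R * h n ^+ 2 <= 1].

Lemma regime : \forall n \near \oo, small_step n.
Proof.
near=> n.
have T1 : 1 <= n%:R * h n by near: n; move/cvgryPge : Toy; exact.
have n2 : n%:R * h n ^+ 2 <= 1.
  suff : `|0 - n%:R * h n ^+ 2| <= 1 by rewrite sub0r normrN => /(le_trans (ler_norm _)).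
  by near: n; move/cvgrPdist_le : nh2; exact.
split => //; first by rewrite ltr0n; near: n; exact: nbhs_infty_gt.
have := ler_wpM2r (ltW (h_gt0 n)) T1; rewrite mul1r -mulrA -expr2 => h1; exact: le_trans h1 n2.
Unshelve. all: end_near. Qed.

Let tn0 n j : 0 <= t_ n j. Proof. by rewrite mulr_ge0// ltW. Qed.
Let tnS n j : t_ n j.+1 = t_ n j + h n. Proof. by rewrite -natr1 mulrDl mul1r. Qed.
Let tnle n j : t_ n j <= t_ n j.+1. Proof. by rewrite tnS lerDl ltW. Qed.
Let tnd n j : t_ n j.+1 - t_ n j = h n. Proof. by rewrite tnS addrAC subrr add0r. Qed.

Lemma bip_average (Y : nat -> nat -> Omega -> R) (a : nat -> R) K : (forall n, 0 < a n) ->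
  (\forall n \near \oo, forall j, eb P (Y n j) (K * a n)) ->
  bip P (fun n w => (n%:R * a n)^-1 * \sum_(j < n) Y n j w).
Proof.
move=> a0 H; apply: (@bip_eb _ _ _ _ _ K); near=> n.
have n0 : 0 < n%:R :> R by rewrite ltr0n; near: n; exact: nbhs_infty_gt.
have na : 0 <= (n%:R * a n)^-1 by rewrite invr_ge0 mulr_ge0// ltW.
have E : (n%:R * a n)^-1 * (n%:R * (K * a n)) = K by have := a0 n => an; field; rewrite !gt_eqF.
have Hn : forall j, eb P (Y n j) (K * a n) by near: n.
by have := ebZ na (@eb_sum _ _ _ P (Y n) n _ (fun j _ => Hn j)); rewrite E.
Unshelve. all: end_near. Qed.

Lemma eb_abs (y : Omega -> R) K b : 0 < b -> meas y ->
  eb P (fun w => y w ^+ 2) (K * b ^+ 2) -> eb P (fun w => `|y w|) ((1 + K) * b).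
Proof.
move=> b0 my H; have bi : 0 <= b^-1 by rewrite invr_ge0 ltW.
have eb1 : eb P (fun=> b) b by split => // [w|]; [exact: ltW|rewrite integral_cstP].
apply: eb_weak (eb_le _ _ (ebD eb1 (ebZ bi H))).
- by rewrite mulrDl mul1r lerD2l; apply: eq_ler; field; rewrite gt_eqF.
- exact: measurableT_comp.
move=> w; rewrite normr_ge0 /=; rewrite -[X in _ <= _ + b^-1 * X]real_normK ?num_real//.
rewrite -(ler_pM2l b0) mulrDr mulrA divff ?gt_eqF// mul1r.
have := sqr_ge0 (b - `|y w|); have := mulr_ge0 (ltW b0) (normr_ge0 (y w)); rewrite !expr2; lra.
Qed.

Section one_function.
Variables (f : 'cV[R]_d -> R).
Hypothesis pf : pw f.

Lemma bip_state : bip P (fun n w => n%:R^-1 * \sum_(j < n) `|f (X (t_ n j) w)|).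
Proof.
have [M M0 HM] := pw_mean 1 pf.
apply: (bip_le_all (U := fun n w => (n%:R * 1)^-1 * \sum_(j < n) `|f (X (t_ n j) w)|)) => [n w|].
  by rewrite mulr1.
apply: (@bip_average (fun n j w => `|f (X (t_ n j) w)|) (fun _ => 1) M) => //; near=> n => j.
rewrite mulr1; apply: eb_mean => [|//|]; first by apply/mom_norm/pw_mom.
by have := HM _ (tn0 n j).
Unshelve. all: end_near. Qed.

Lemma bip_square_incr i : bip P (fun n w => (T_ n)^-1 *
  \sum_(j < n) (f (X (t_ n j) w) * dX i (t_ n j) (t_ n j.+1) w) ^+ 2).
Proof.
have [K K0 H] := dX_eb i pf; apply: (@bip_average (fun n j w => (f (X (t_ n j) w) * dX i (t_ n j) (t_ n j.+1) w) ^+ 2) h K) => //; near=> n => j.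
have := H (t_ n j) (t_ n j.+1) (tn0 n j) (tnle n j); rewrite tnd; apply; rewrite tnS lerD2l; near: n.
by move: regime; apply: filterS => n [].
Unshelve. all: end_near. Qed.

Lemma bip_mu i : bip P (fun n w => (T_ n)^-1 *
  \sum_(j < n) `|f (X (t_ n j) w) * dmu i (t_ n j) (t_ n j.+1) w|).
Proof.
have [K K0 H] := dmu_eb i pf; apply: (@bip_average (fun n j w => `|f (X (t_ n j) w) * dmu i (t_ n j) (t_ n j.+1) w|) h (1 + K)) => //; near=> n => j.
apply: eb_abs => //.
  apply: measurable_funM; first exact: pw_meas.
  exact: dmu_measurable.
have := H (t_ n j) (t_ n j.+1) (tn0 n j) (tnle n j); rewrite tnd; apply; rewrite tnS lerD2l; near: n.
by move: regime; apply: filterS => n [].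
Unshelve. all: end_near. Qed.

(** Terms of order h^(3/2) per step are negligible since n h^2 stays bounded. *)
Lemma bip_small (y : nat -> nat -> Omega -> R) K :
  (\forall n \near \oo, forall j, eb P (fun w => `|y n j w|) (K * (h n * Num.sqrt (h n)))) ->
  bip P (fun n w => Num.sqrt (T_ n) * ((T_ n)^-1 * \sum_(j < n) `|y n j w|)).
Proof.
move=> H; have s0 n : 0 < h n * Num.sqrt (h n) by rewrite mulr_gt0// sqrtr_gt0.
apply: bip_le (bip_average s0 H); near=> n; apply: aeW => w.
have [n0 h1 T1 n2] : small_step n by near: n; exact: regime.
rewrite [leLHS]mulrA; apply: ler_wpM2r => /=; first exact: sumr_ge0.
have T0 : 0 < n%:R * h n := lt_le_trans ltr01 T1.
have -> : (n%:R * (h n * Num.sqrt (h n)))^-1 = (T_ n)^-1 * (Num.sqrt (h n))^-1.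
  by rewrite mulrA invfM.
rewrite mulrC ler_wpM2l ?invr_ge0 ?(ltW T0)//.
rewrite -[leRHS]mul1r ler_pdivlMr ?sqrtr_gt0// -sqrtrM ?(ltW T0)// -mulrA -expr2.
by rewrite -[leRHS]sqrtr1; apply: ler_wsqrtr.
Unshelve. all: end_near. Qed.

Lemma bip_delta i : bip P (fun n w => Num.sqrt (T_ n) * ((T_ n)^-1 *
  \sum_(j < n) `|f (X (t_ n j) w) * ddelta i (t_ n j) (t_ n j.+1) w|)).
Proof.
have [K K0 H] := ddelta_eb i pf; apply: (@bip_small (fun n j w => f (X (t_ n j) w) * ddelta i (t_ n j) (t_ n j.+1) w) (1 + K)); near=> n => j.
apply: eb_abs; first by rewrite mulr_gt0// sqrtr_gt0.
  apply: measurable_funM; first exact: pw_meas.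
  exact: ddelta_measurable.
rewrite exprMn sqr_sqrtr ?ltW// -exprSr.
have := H (t_ n j) (t_ n j.+1) (tn0 n j) (tnle n j); rewrite tnd; apply; rewrite tnS lerD2l; near: n.
by move: regime; apply: filterS => n [].
Unshelve. all: end_near. Qed.

Lemma bip_sqrt_sum (y : nat -> Omega -> R) K :
  (\forall n \near \oo, eb P (fun w => y n w ^+ 2) (K * (T_ n))) ->
  bip P (fun n w => Num.sqrt (T_ n) * `|(T_ n)^-1 * y n w|).
Proof.
move=> H; have E : \forall n \near \oo, eb P (fun w => (Num.sqrt (T_ n) * ((T_ n)^-1 * y n w)) ^+ 2) K.
  near=> n; have T0 : 0 < n%:R * h n by near: n; move/cvgryPgt : Toy; exact.
  have -> : K = (T_ n)^-1 * (K * (T_ n)) by rewrite mulrCA mulVf ?mulr1// gt_eqF.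
  have -> : (fun w => (Num.sqrt (T_ n) * ((T_ n)^-1 * y n w)) ^+ 2) = fun w => (T_ n)^-1 * y n w ^+ 2.
    apply/funext => w; rewrite exprMn sqr_sqrtr ?ltW//; set T := n%:R * h n in T0 *; rewrite exprMn.
    by field; rewrite gt_eqF.
  by apply: ebZ; [rewrite invr_ge0 ltW|near: n].
apply: bip_le_all (bip_eb_sq E) => n w; by rewrite [leRHS]normrM ger0_norm ?sqrtr_ge0.
Unshelve. all: end_near. Qed.

Lemma bip_mu_sum i : bip P (fun n w => Num.sqrt (T_ n) * `|(T_ n)^-1 *
  \sum_(j < n) f (X (t_ n j) w) * dmu i (t_ n j) (t_ n j.+1) w|).
Proof.
have [K K0 H] := dmu_sum_eb i pf; apply: (@bip_sqrt_sum _ K); near=> n.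
have [n0 h1 T1 n2] : small_step n by near: n; exact: regime.
apply: eb_weak (H n (h n) _); last by rewrite (ltW (h_gt0 n)).
by rewrite ler_wpM2r ?tn0// ler_piMr.
Unshelve. all: end_near. Qed.

End one_function.

Lemma bip_cross f c c' : pw f -> bip P (fun n w => Num.sqrt (T_ n) * `|(T_ n)^-1 *
  \sum_(j < n) f (X (t_ n j) w) * (dZ c (t_ n j) (t_ n j.+1) w * dZ c' (t_ n j) (t_ n j.+1) w - h n * (c == c')%:R)|).
Proof.
move=> pf; have [K K0 H] := dZ_cross_sq Ffilt ZF Zind Zlevy ZR1.
have [M M0 HM] := pw_mean 2 pf.
apply: (@bip_sqrt_sum _ (K * M)); near=> n.
have [n0 h1 T1 n2] : small_step n by near: n; exact: regime.
apply: eb_mean.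
- apply: momX; apply: mom_sum => j _; apply: momM; first exact: pw_mom.
  apply: momB (mom_cst _ _); apply: momM; exact: (dZ_mom Ffilt ZF Zind Zlevy ZR1).
- by move=> w; exact: sqr_ge0.
- apply: (H (h n) n (fun j w => f (X (t_ n j) w)) M c c') => [||j|j|j]; rewrite ?(ltW (h_gt0 n))//.
  + exact: pw_mwrt.
  + exact: pw_mom.
  rewrite (_ : mean _ _ = mean P (fun w => `|f (X (t_ n j) w)| ^+ 2)) ?HM//.
  by apply: eq_mean => w; rewrite real_normK// num_real.
Unshelve. all: end_near. Qed.

Lemma bip_incr_rho f a b : pw f -> bip P (fun n w => Num.sqrt (T_ n) * ((T_ n)^-1 *
  \sum_(j < n) `|f (X (t_ n j) w) * (dX a (t_ n j) (t_ n j.+1) w * rho b (t_ n j) (t_ n j.+1) w)|)).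
Proof.
move=> pf; have [K1 K10 H1] := dX_eb a pf; have [K2 K20 H2] := rho_eb b (pw_cst 1).
apply: (@bip_small (fun n j w => f (X (t_ n j) w) * (dX a (t_ n j) (t_ n j.+1) w * rho b (t_ n j) (t_ n j.+1) w)) (K1 + K2)).
near=> n => j.
have [n0 h1 T1 n2] : small_step n by near: n; exact: regime.
have s0 : 0 < Num.sqrt (h n) by rewrite sqrtr_gt0.
have ts : t_ n j.+1 <= t_ n j + 1 by rewrite tnS lerD2l.
have e1 := H1 _ _ (tn0 n j) (tnle n j) ts; have e2 := H2 _ _ (tn0 n j) (tnle n j) ts.
rewrite tnd in e1 e2.
have i0 : 0 <= (Num.sqrt (h n))^-1 by rewrite invr_ge0 ltW.
apply: eb_weak (eb_le _ _ (ebD (ebZ (ltW s0) e1) (ebZ i0 e2))).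
- have E : h n = Num.sqrt (h n) ^+ 2 by rewrite sqr_sqrtr// ltW.
  by apply: eq_ler; set s := Num.sqrt (h n) in E s0 *; rewrite E; field; rewrite gt_eqF.
- apply: measurableT_comp => //; apply: measurable_funM; first exact: pw_meas.
  by apply: measurable_funM; [exact: dX_measurable|exact: rho_measurable].
- move=> w; rewrite normr_ge0 /= mulrA normrM mul1r.
  set x := f _ * _; set y := rho _ _ _ _; set s := Num.sqrt (h n) in s0 *.
  clearbody x y s.
  rewrite -(ler_pM2l s0) mulrDr (mulrA s s^-1) divff ?gt_eqF// mul1r.
  rewrite -(real_normK (num_real x)) -(real_normK (num_real y)).
  have := sqr_ge0 (s * `|x| - `|y|); have := mulr_ge0 (ltW s0) (mulr_ge0 (normr_ge0 x) (normr_ge0 y)); rewrite !expr2; lra.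
Unshelve. all: end_near. Qed.

Lemma bip_rho_rho f a b : pw f -> bip P (fun n w => Num.sqrt (T_ n) * ((T_ n)^-1 *
  \sum_(j < n) `|f (X (t_ n j) w) * (rho a (t_ n j) (t_ n j.+1) w * rho b (t_ n j) (t_ n j.+1) w)|)).
Proof.
move=> pf; have [K1 K10 H1] := rho_eb a pf; have [K2 K20 H2] := rho_eb b (pw_cst 1).
apply: (@bip_small (fun n j w => f (X (t_ n j) w) * (rho a (t_ n j) (t_ n j.+1) w * rho b (t_ n j) (t_ n j.+1) w)) (K1 + K2)).
near=> n => j.
have [n0 h1 T1 n2] : small_step n by near: n; exact: regime.
have s0 : 0 < Num.sqrt (h n) by rewrite sqrtr_gt0.
have ts : t_ n j.+1 <= t_ n j + 1 by rewrite tnS lerD2l.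
have e1 := H1 _ _ (tn0 n j) (tnle n j) ts; have e2 := H2 _ _ (tn0 n j) (tnle n j) ts.
rewrite tnd in e1 e2.
apply: eb_weak (eb_le _ _ (ebD e1 e2)).
- rewrite -mulrDl ler_wpM2l ?addr_ge0// expr2 ler_wpM2l ?(ltW (h_gt0 n))//.
  rewrite -[leLHS]sqr_sqrtr ?(ltW (h_gt0 n))// expr2 -[leRHS]mul1r ler_wpM2r ?(ltW s0)//.
  by rewrite -sqrtr1; exact: ler_wsqrtr.
- apply: measurableT_comp => //; apply: measurable_funM; first exact: pw_meas.
  by apply: measurable_funM; exact: rho_measurable.
- move=> w; rewrite normr_ge0 /= mulrA normrM mul1r.
  set x := f _ * _; set y := rho _ _ _ _.
  rewrite -[X in X + _]real_normK ?num_real// -[X in _ + X]real_normK ?num_real//.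
  have := sqr_ge0 (`|x| - `|y|); have := mulr_ge0 (normr_ge0 x) (normr_ge0 y); rewrite !expr2; lra.
Unshelve. all: end_near. Qed.

(** The main term is a martingale transform of centred products of driving increments; all others
    contain a factor rho. *)
Lemma quadratic_split a b s t w : dX a s t w * dX b s t w - (t - s) * gram (C (X s w)) a b =
  \sum_c \sum_c' C (X s w) a c * C (X s w) b c' * (dZ c s t w * dZ c' s t w - (t - s) * (c == c')%:R)
  + (dX a s t w * rho b s t w + (dX b s t w * rho a s t w - rho a s t w * rho b s t w)).
Proof.
pose m i := \sum_c C (X s w) i c * dZ c s t w.
have E i : dX i s t w = m i + rho i s t w by rewrite /rho addrC subrK.
have -> : \sum_c \sum_c' C (X s w) a c * C (X s w) b c' * (dZ c s t w * dZ c' s t w - (t - s) * (c == c')%:R)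
  = m a * m b - (t - s) * gram (C (X s w)) a b.
  rewrite /m mulr_suml mxE mulr_sumr -sumrB; apply: eq_bigr => c _.
  have -> : (t - s) * (C (X s w) a c * (C (X s w))^T c b) =
      \sum_c' C (X s w) a c * C (X s w) b c' * ((t - s) * (c == c')%:R).
    rewrite (bigD1 c)//= eqxx mulr1 big1 ?addr0 => [|c' cc']; first by rewrite mxE; ring.
    by rewrite eq_sym (negbTE cc') !mulr0.
  by rewrite mulr_sumr -sumrB; apply: eq_bigr => c' _; ring.
by rewrite (E a) (E b); ring.
Qed.

Lemma bip_quadratic f a b : pw f -> bip P (fun n w => Num.sqrt (T_ n) * `|(T_ n)^-1 *
  \sum_(j < n) f (X (t_ n j) w) *
     (dX a (t_ n j) (t_ n j.+1) w * dX b (t_ n j) (t_ n j.+1) w - h n * gram (C (X (t_ n j) w)) a b)|).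
Proof.
move=> pf; have B1 c := bip_sum (index_enum 'I_r) (fun c' => bip_cross c c' (pwM pf (pwM (pw_C a c) (pw_C b c')))).
have B2 := bip_sum (index_enum 'I_r) B1.
apply: (bip_le_all _ (bipD B2 (bipD (bip_incr_rho a b pf) (bipD (bip_incr_rho b a pf) (bip_rho_rho a b pf))))) => n w.
set sT := Num.sqrt _; have s0 : 0 <= sT by exact: sqrtr_ge0.
set Ti := (T_ n)^-1; have T0 : 0 <= Ti by rewrite invr_ge0 mulr_ge0// ltW.
have -> : \sum_(c <- index_enum 'I_r) \sum_(c' <- index_enum 'I_r) sT * `|Ti * \sum_(j < n)
    f (X (t_ n j) w) * (C (X (t_ n j) w) a c * C (X (t_ n j) w) b c') *
    (dZ c (t_ n j) (t_ n j.+1) w * dZ c' (t_ n j) (t_ n j.+1) w - h n * (c == c')%:R)| =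
   sT * (Ti * (\sum_c \sum_c' `|\sum_(j < n)
    f (X (t_ n j) w) * (C (X (t_ n j) w) a c * C (X (t_ n j) w) b c') *
    (dZ c (t_ n j) (t_ n j.+1) w * dZ c' (t_ n j) (t_ n j.+1) w - h n * (c == c')%:R)|)).
  rewrite !mulr_sumr; apply: eq_bigr => c _; rewrite !mulr_sumr; apply: eq_bigr => c' _.
  by rewrite normrM (ger0_norm T0).
rewrite -!mulrDr normrM (ger0_norm T0); apply: ler_wpM2l => //; apply: ler_wpM2l => //.
have -> : \sum_(j < n) f (X (t_ n j) w) * (dX a (t_ n j) (t_ n j.+1) w * dX b (t_ n j) (t_ n j.+1) w -
     h n * gram (C (X (t_ n j) w)) a b) =
  (\sum_c \sum_c' \sum_(j < n) f (X (t_ n j) w) * (C (X (t_ n j) w) a c * C (X (t_ n j) w) b c') *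
    (dZ c (t_ n j) (t_ n j.+1) w * dZ c' (t_ n j) (t_ n j.+1) w - h n * (c == c')%:R)) +
  \sum_(j < n) (f (X (t_ n j) w) * (dX a (t_ n j) (t_ n j.+1) w * rho b (t_ n j) (t_ n j.+1) w) +
   (f (X (t_ n j) w) * (dX b (t_ n j) (t_ n j.+1) w * rho a (t_ n j) (t_ n j.+1) w) -
    f (X (t_ n j) w) * (rho a (t_ n j) (t_ n j.+1) w * rho b (t_ n j) (t_ n j.+1) w))).
  under [X in X + _]eq_bigr do rewrite exchange_big /=; rewrite exchange_big /= -big_split /=.
  apply: eq_bigr => j _; have := quadratic_split a b (t_ n j) (t_ n j.+1) w; rewrite tnd => ->.
  rewrite [LHS]mulrDr; congr (_ + _); last by ring.
  rewrite mulr_sumr; apply: eq_bigr => c _.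
  by rewrite mulr_sumr; apply: eq_bigr => c' _; rewrite mulrA.
apply: le_trans (ler_normD _ _) _; apply: lerD.
  by apply: le_trans (ler_norm_sum _ _ _) _; apply: ler_sum => c _; exact: ler_norm_sum.
apply: le_trans (ler_norm_sum _ _ _) _; rewrite -!big_split /=; apply: ler_sum => j _.
apply: le_trans (ler_normD _ _) _; rewrite lerD2l; exact: ler_normB.
Qed.

Section stochastic_integral_field.
Variables (p : nat) (e : R) (U : 'I_r -> 'cV[R]_d -> 'cV[R]_p -> R).
Hypotheses (e0 : 0 < e) (UL : forall c, bL e (U c))
  (mU : forall c v, box e v -> meas (U c ^~ v)).

Let q := (2 * (2 * p).+1)%N.
Let vec (y : 'I_p -> R) : 'cV[R]_p := \col_i (e * y i).
Let ycube (y : 'I_p -> R) := cube (R := R) (p := p) y.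

Lemma box_vec y : ycube y -> box e (vec y).
Proof.
move=> cy i; rewrite mxE normrM (gtr0_norm e0) -[leRHS]mulr1 ler_wpM2l ?(ltW e0)//.
by rewrite ler_norml; exact: cy.
Qed.

Lemma gau_vec y y' s : (forall i, `|y i - y' i| <= s) -> gau (vec y - vec y') <= p%:R * (e * s).
Proof.
move=> H; rewrite /gau; apply: (le_via (\sum_(i < p) e * s)).
  apply: ler_sum => i _; rewrite !mxE -mulrBr normrM (gtr0_norm e0) ler_wpM2l ?(ltW e0)//.
by rewrite sumr_const card_ord -[leLHS]mulr_natl.
Qed.

Let I n (u : 'I_r -> 'cV[R]_d -> R) w := \sum_(j < n) \sum_c u c (X (t_ n j) w) * dZ c (t_ n j) (t_ n j.+1) w.
Let nrm n (x : R) := Num.sqrt (T_ n) * ((T_ n)^-1 * x).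

Lemma I_measurable n u : (forall c, meas (u c)) -> meas (I n u).
Proof.
move=> mu; apply: measurable_sum => j; apply: measurable_sum => c; apply: measurable_funM.
  exact: (X_measurable (tn0 n j) (mu c)).
exact: (dZ_measurable Zlevy).
Qed.

Lemma I_moment : exists2 K, 0 <= K & forall n (u : 'I_r -> 'cV[R]_d -> R) (B : R) (N : nat) (s : R), 1 <= n%:R * h n -> h n <= 1 -> 0 <= B -> 0 <= s ->
  (forall c, meas (u c)) -> (forall c x, `|u c x| <= B * wt x ^+ N * s) ->
  forall M, (forall t, 0 <= t -> mean P (fun w => `|wt (X t w) ^+ N| ^+ q) <= M) ->
  eb P (fun w => nrm n (I n u w) ^+ q) (K * (B ^+ q * M * s ^+ q)).
Proof.
have [K K0 H] := transform_moment Ffilt ZF Zind Zlevy ZR1 (2 * p); exists K => //.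
move=> n u B N s T1 h1 B0 s0 mu uB M HM.
have T0 : 0 < n%:R * h n := lt_le_trans ltr01 T1.
have pu c : pw (u c).
  split => //; exists (B * s), N; split; first exact: mulr_ge0.
  by move=> x; apply: le_trans (uB c x) _; rewrite mulrAC.
have M0 : 0 <= M by apply: le_trans (HM 0 (lexx _)); apply: mean_ge0 => w; exact: exprn_ge0.
have evq (x : R) : x ^+ q = `|x| ^+ q by rewrite -normrX ger0_norm// exprn_even_ge0// oddM.
have := @H (h n) (T_ n) n (fun j c w => u c (X (t_ n j) w)) (B ^+ q * M * s ^+ q)
  (ltW (h_gt0 n)) h1 T1 (lexx _) _ (fun j c => pw_mwrt (pu c) (tn0 n j)) (fun j c => pw_mom (pu c) (tn0 n j)).
have h1' : 0 <= B ^+ q * M * s ^+ q by rewrite !mulr_ge0// exprn_ge0.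
have h2 (j : nat) c : mean P (fun w => u c (X (t_ n j) w) ^+ q) <= B ^+ q * M * s ^+ q.
  apply: (le_via (mean P (fun w => (B ^+ q * s ^+ q) * `|wt (X (t_ n j) w) ^+ N| ^+ q))).
    apply: le_mean => [||w]; first by apply: momX; exact: pw_mom.
      by apply: momZ; apply/momX/mom_norm; exact: wtX_mom.
    rewrite evq -!exprMn lerXn2r ?nnegrE ?mulr_ge0//.
    by apply: le_trans (uB c _) _; rewrite (ger0_norm (wt0 _ _)) mulrAC.
  rewrite meanZ; last by apply/momX/mom_norm; exact: wtX_mom.
  by rewrite [leRHS]mulrAC ler_wpM2l ?mulr_ge0 ?exprn_ge0// HM.
move=> /(_ h1' h2) HH.
have E w : nrm n (I n u w) ^+ q = (T_ n) ^- (2 * p).+1 * I n u w ^+ q.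
  have n2 : nrm n (I n u w) ^+ 2 = (T_ n)^-1 * I n u w ^+ 2.
    rewrite /nrm exprMn sqr_sqrtr ?ltW//; set T := n%:R * h n in T0 *; field; by rewrite gt_eqF.
  by rewrite /q 2!exprM n2 exprMn exprVn.
have mI : mom P (fun w => I n u w ^+ q).
  apply: momX; apply: mom_sum => j _; apply: mom_sum => c _; apply: momM; first exact: pw_mom.
  exact: (dZ_mom Ffilt ZF Zind Zlevy ZR1).
under eq_fun do rewrite E.
have Tp : 0 <= (T_ n) ^- (2 * p).+1 by rewrite invr_ge0 exprn_ge0// ltW.
have -> : K * (B ^+ q * M * s ^+ q) = (T_ n) ^- (2 * p).+1 * (K * (T_ n) ^+ (2 * p).+1 * (B ^+ q * M * s ^+ q)).
  have : (T_ n) ^+ (2 * p).+1 != 0 by rewrite expf_neq0// gt_eqF.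
  by set Tm := (T_ n) ^+ _ => Tm0; field.
apply: ebZ => //; apply: eb_mean => // w; by rewrite exprn_even_ge0// oddM.
Qed.

(** The moments of the increments of the field in v are those of martingale transforms of
    differences of the integrands, which are Lipschitz in v; this is what chaining asks for. *)
Lemma bip_field : exists Y : nat -> Omega -> R, [/\ bip P Y, forall n w, 0 <= Y n w &
  forall n w v, box e v -> Num.sqrt (T_ n) * `|(T_ n)^-1 *
    \sum_(j < n) \sum_c U c (X (t_ n j) w) v * dZ c (t_ n j) (t_ n j.+1) w| <= Y n w].
Proof.
have /choice[BN HBN] : forall c, exists BN : R * nat, 0 <= BN.1 /\ forall x,
  (forall v, box e v -> `|U c x v| <= BN.1 * wt x ^+ BN.2) /\
  (forall v v', box e v -> box e v' -> `|U c x v - U c x v'| <= BN.1 * wt x ^+ BN.2 * gau (v - v')).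
  by move=> c; have [B [N HB]] := UL c; exists (B, N).
pose B := \sum_c (BN c).1; pose N := (\sum_c (BN c).2)%N.
have B0 : 0 <= B by apply: sumr_ge0 => c _; exact: (HBN c).1.
have BNle c (x : 'cV[R]_d) : (BN c).1 * wt x ^+ (BN c).2 <= B * wt x ^+ N.
  apply: ler_pM => //; first exact: (HBN c).1.
    by rewrite /B (bigD1 c)//= lerDl; apply: sumr_ge0 => c' _; exact: (HBN c').1.
  by apply: ler_weXn2l; [exact: wt_ge1|rewrite /N (bigD1 c)//= leq_addr].
have UB c x v : box e v -> `|U c x v| <= B * wt x ^+ N.
  by move=> bv; apply: le_trans (((HBN c).2 x).1 v bv) (BNle c x).
have UBL c x v v' : box e v -> box e v' -> `|U c x v - U c x v'| <= B * wt x ^+ N * gau (v - v').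
  by move=> bv bv'; apply: le_trans (((HBN c).2 x).2 v v' bv bv') _; rewrite ler_wpM2r ?gau_ge0// BNle.
have [K K0 HK] := I_moment; have [M M0 HM] := pw_mean q (pw_wt N).
pose G n y w := nrm n (I n (fun c x => U c x (vec y)) w).
have GB n y y' w : G n y w - G n y' w = nrm n (I n (fun c x => U c x (vec y) - U c x (vec y')) w).
  rewrite /G /nrm -!mulrBr; congr (_ * (_ * _)); rewrite /I -sumrB; apply: eq_bigr => j _.
  by rewrite -sumrB; apply: eq_bigr => c _; rewrite mulrBl.
have Glip n w : exists2 l, 0 <= l & forall y y' s, ycube y -> ycube y' -> (forall i, `|y i - y' i| <= s) ->
    `|G n y w - G n y' w| <= l * s.
  pose l := Num.sqrt (T_ n) * ((T_ n)^-1 *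
     (\sum_(j < n) \sum_c B * wt (X (t_ n j) w) ^+ N * (p%:R * e) * `|dZ c (t_ n j) (t_ n j.+1) w|)).
  exists l.
    rewrite !mulr_ge0 ?sqrtr_ge0 ?invr_ge0 ?tn0//; apply: sumr_ge0 => j _; apply: sumr_ge0 => c _.
    by rewrite !mulr_ge0// ltW.
  move=> y y' s cy cy' ss; rewrite GB /nrm normrM ger0_norm ?sqrtr_ge0// normrM ger0_norm ?invr_ge0 ?tn0//.
  rewrite /l -!mulrA ler_wpM2l ?sqrtr_ge0// ler_wpM2l ?invr_ge0 ?tn0//.
  apply: norm_suml_le => j _.
  apply: norm_suml_le => c _.
  rewrite normrM [leRHS]mulrAC; apply: ler_wpM2r => //.
  apply: le_trans (UBL c _ _ _ (box_vec cy) (box_vec cy')) _; rewrite -!mulrA ler_wpM2l// ler_wpM2l//.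
  exact: gau_vec.
have c0 : ycube (fun _ => 0) by move=> i; rewrite lerN10 ler01.
have supP n w : has_ubound [set `|G n y w| | y in ycube].
  have [l l0 Hl] := Glip n w; exists (`|G n (fun=> 0) w| + l) => _ [y cy <-].
  rewrite -lerBlDl; apply: le_trans (lerB_dist _ _) _.
  have := Hl y (fun=> 0) 1 cy c0; rewrite mulr1; apply.
  by move=> i; rewrite subr0 ler_norml; exact: cy.
exists (fun n w => sup [set `|G n y w| | y in ycube]); split.
- pose K0' := K * (B ^+ q * M) * (1 + (p%:R * e) ^+ q).
  have K0'0 : 0 <= K0' by rewrite !mulr_ge0 ?exprn_ge0// addr_ge0// exprn_ge0// mulr_ge0// ltW.
  move=> eps eps0.
  pose x := 1 + 3 * (2 ^+ (5 * p) * K0') / eps.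
  have a0 : 0 <= 3 * (2 ^+ (5 * p) * K0') by apply: mulr_ge0 => //; apply: mulr_ge0 => //; exact: exprn_ge0.
  have x1 : 1 <= x by rewrite lerDl divr_ge0// ltW.
  have x0 : 0 < x := lt_le_trans ltr01 x1.
  exists (5 * x); first by rewrite mulr_gt0.
  near=> n.
  have [n0 h1 T1 n2] : small_step n by near: n; exact: regime.
  apply: (le_via (mu_ext P [set w | exists2 y, ycube y & (5 * x < `|G n y w|)%R])).
    apply: PO_le => w /= hs; have [|_ [y cy <-] hy] := sup_gt _ hs; last by exists y.
    by exists `|G n (fun=> 0) w|; exists (fun=> 0).
  have mG y : ycube y -> meas (G n y).
    move=> cy; apply: measurable_funM => //; apply: measurable_funM => //; apply: I_measurable => c.
    by apply: mU; exact: box_vec.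
  apply: (le_trans (@chaining _ _ _ P p (G n) K0' K0'0 mG _ _ _ x x0)).
  + move=> y cy.
    have H : eb P (fun w => G n y w ^+ q) (K * (B ^+ q * M * 1 ^+ q)).
      by apply: HK => // [c|c z|]; [apply: mU; exact: box_vec|rewrite mulr1; apply: UB; exact: box_vec|exact: HM].
    move: H => [_ _ H].
    apply: le_trans H _; rewrite lee_fin expr1n mulr1 /K0' ler_peMr ?mulr_ge0 ?exprn_ge0//.
    by rewrite lerDl exprn_ge0// mulr_ge0// ltW.
  + move=> y y' s cy cy' ss; under eq_integral do rewrite GB.
    have s0 : 0 <= p%:R * e * `|s| by rewrite !mulr_ge0// ltW.
    have H : eb P (fun w => nrm n (I n (fun c x => U c x (vec y) - U c x (vec y')) w) ^+ q)
        (K * (B ^+ q * M * (p%:R * e * `|s|) ^+ q)).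
      apply: HK => // [c|c z|]; last exact: HM.
        by apply: measurable_funB; apply: mU; exact: box_vec.
      apply: le_trans (UBL c z _ _ (box_vec cy) (box_vec cy')) _.
      rewrite ler_wpM2l ?mulr_ge0// -mulrA; apply: gau_vec => i; exact: le_trans (ss i) (ler_norm _).
    move: H => [_ _ H]; apply: le_trans H _.
    have sq0 : 0 <= s ^+ q by rewrite exprn_even_ge0// oddM.
    have -> : (p%:R * e * `|s|) ^+ q = (p%:R * e) ^+ q * s ^+ q by rewrite exprMn -normrX ger0_norm.
    rewrite lee_fin -/q /K0' !mulrA ler_wpM2r//; apply: ler_wpM2l; last by rewrite lerDr.
    by rewrite !mulr_ge0// exprn_ge0.
  + by move=> w; have [l l0 Hl] := Glip n w; exists l.
  have xq : 0 < x ^+ q by exact: exprn_gt0.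
  have E3 (a b c u : R) : a * (b * (c / u)) = a * (b * c) / u by rewrite !mulrA.
  rewrite lee_fin -/q E3 ler_pdivrMr//.
  apply: (le_via (eps * x)).
    have Ee (u : R) : eps * (1 + u / eps) = eps + u by field; rewrite gt_eqF.
    by rewrite /x Ee lerDr ltW.
  rewrite ler_wpM2l ?(ltW eps0)// -[leLHS]expr1; apply: ler_weXn2l => //.
- move=> n w; apply: (le_via `|G n (fun=> 0) w|) => //.
  by apply: (ub_le_sup (supP n w)); exists (fun=> 0).
move=> n w v bv.
pose y i := e^-1 * v i 0.
have cy : ycube y.
  by move=> i; rewrite -ler_norml normrM ger0_norm ?invr_ge0 ?(ltW e0)// mulrC ler_pdivrMr// mul1r.
have vy : vec y = v by apply/matrixP => i j; rewrite ord1 mxE mulrA divff ?gt_eqF// mul1r.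
apply: (le_via `|G n y w|); last by apply: (ub_le_sup (supP n w)); exists y.
by rewrite /G /nrm vy [leRHS]normrM (ger0_norm (sqrtr_ge0 _)).
Unshelve. all: end_near. Qed.

End stochastic_integral_field.
End sde.

Lemma pw_bO (R : realType) d p (e : R) (a : 'cV[R]_d -> R) : 0 < e -> meas a ->
  bO (p := p) wt e 0 (fun z _ => a z) -> pw a.
Proof.
move=> e0 ma [B [N [B0 H]]]; split => //; exists B, N; split => // z.
by have := H z 0 (box0 (ltW e0)); rewrite expr0 mulr1.
Qed.

Lemma vanishes0 d0 (Omega : measurableType d0) (R : realType) (P : probability Omega R) (A : nat -> set Omega) :
  (\forall n \near \oo, A n = set0) -> vanishes P A.
Proof.
move=> A0 eps eps0; near=> n; rewrite (_ : A n = set0); last by near: n.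
by apply: (le_via 0%E); [rewrite mu_ext0|exact: ltW].
Unshelve. all: end_near. Qed.

(** * The scale contrast *)
Section scale_contrast.
Context d0 (Omega : measurableType d0) (R : realType) (P : probability Omega R).
Context (d r p : nat) (d_gt0 : (0 < d)%N).
Local Notation V := 'cV[R]_p.
Variables (h : nat -> R) (x : nat -> nat -> Omega -> 'cV[R]_d) (y : 'I_d -> nat -> nat -> Omega -> R)
  (C : 'cV[R]_d -> 'M[R]_(d, r)).
Local Notation T_ n := (n%:R * h n).
Hypotheses (h_gt0 : forall n, 0 < h n) (Toy : n%:R * h n @[n --> \oo] --> +oo).
Hypotheses (pS : forall a b, pw (fun z => gram (C z) a b))
  (Hstate : forall f, pw f -> bip P (fun n w => n%:R^-1 * \sum_(j < n) `|f (x n j w)|))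
  (Hsquare : forall f i, pw f -> bip P (fun n w => (T_ n)^-1 * \sum_(j < n) (f (x n j w) * y i n j w) ^+ 2))
  (Hquad : forall f a b, pw f -> bip P (fun n w => Num.sqrt (T_ n) * `|(T_ n)^-1 *
      \sum_(j < n) f (x n j w) * (y a n j w * y b n j w - h n * gram (C (x n j w)) a b)|)).
Variables (Th : set V) (c : 'cV[R]_d -> V -> 'M[R]_(d, r)) (C0 BC : R) (g0 : V) (e : R).
Hypotheses (Rc : forall i j, regular Th (fun z g => c z g i j)) (C00 : 0 <= C0)
  (lamc : forall z g, closure Th g -> 0 < lambda_min (gram (c z g)) /\
      (lambda_min (gram (c z g)))^-1 <= BC * (1 + enorm z `^ C0))
  (mc : forall g, closure Th g -> mmx (fun z => c z g))
  (e0 : 0 < e) (bTh : forall v, box e v -> Th (g0 + v)) (cg0 : forall z, c z g0 = C z).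
Local Notation S z g := (gram (c z g)).
Local Notation iS z g := (invmx (S z g)).

(** Up to the factor -1/2, the contribution of one observation to the difference of
    quasi-log-likelihoods at g0 + v and g0. *)
Definition scale_term (z : 'cV[R]_d) (k : R) (u : 'I_d -> R) (v : V) :=
  ln (\det (S z (g0 + v))) - ln (\det (S z g0)) +
  k^-1 * \sum_a \sum_b (iS z (g0 + v) a b - iS z g0 a b) * (u a * u b).

Definition scale_ratio n w v := - 2^-1 * (n%:R^-1 * \sum_(j < n) scale_term (x n j w) (h n) (fun i => y i n j w) v).

Let w1 := @wt_ge1 R d.

(** The mean of each term, given the past, has no linear part, and the deviation is a linear
    statistic of the centred squared increments: the linear coefficient is of order T^(-1/2). *)
Lemma scale_rate (gh : nat -> Omega -> V) chi : 0 < chi ->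
  (forall n w, closure Th (gh n w)) -> (forall n w, 0 <= scale_ratio n w (gh n w - g0)) ->
  (forall del, 0 < del -> vanishes P (fun n => [set w | exists2 v, closure Th (g0 + v) &
     - chi * gau v ^+ 2 + del < scale_ratio n w v])) ->
  [/\ vanishes P (fun n => [set w | ~ box e (gh n w - g0)]),
      bip P (fun n w => Num.sqrt (T_ n) * gau (gh n w - g0)) &
      bip P (fun n w => (T_ n) * scale_ratio n w (gh n w - g0))].
Proof.
move=> chi0 cgh F0 HB.
have jl := lndet_jet d_gt0 Rc C00 lamc e0 bTh.
have sc := score_bO d_gt0 Rc C00 lamc e0 bTh.
have ji := iS_jet d_gt0 Rc C00 lamc e0 bTh.
have box_cl v : box e v -> closure Th (g0 + v) by move=> bv; apply: subset_closure; exact: bTh.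
have S0E z : S z g0 = gram (C z) by rewrite cg0.
have /choice[lf Hlf] : forall ab : 'I_d * 'I_d, exists l, exists qf, jets wt e (fun z v => iS z (g0 + v) ab.1 ab.2) l qf.
  by move=> [a b]; exact: ji.
have {Hlf}/choice[qf J] := Hlf.
have O0 a b : bO wt e 0 (fun z (v : V) => S z g0 a b).
  by have := jet_at0 (S_jet Rc e0 bTh a b); rewrite addr0.
have js : jet wt e (fun z v => ln (\det (S z (g0 + v))) - ln (\det (S z g0)) +
    \sum_a \sum_b (iS z (g0 + v) a b - iS z g0 a b) * S z g0 a b).
  apply: (jetD w1) => //; apply: (jet_sum w1 e0) => a; apply: (jet_sum w1 e0) => b.
  apply: (jetM w1 e0); last exact: jet_cst.
  by have := jet_sub0 w1 (ji a b); rewrite addr0.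
have [ls [qs Js]] := js.
have ls0 := jets_lin0 w1 e0 Js sc.
have [_ _ _ Qsh [Bs [Ns [Bs0 Hs]]]] := Js.
have /choice[Bi HBi] : forall ab : 'I_d * 'I_d, exists BN : R * nat, 0 <= BN.1 /\ forall z v, box e v ->
    `|iS z (g0 + v) ab.1 ab.2 - iS z g0 ab.1 ab.2 - lin (lf ab) z v - qf ab z v| <= BN.1 * wt z ^+ BN.2 * gau v ^+ 3.
  move=> ab; have [_ _ _ _ [B [N [B0 H]]]] := J ab; exists (B, N); split => // z v bv.
  by have := H z v bv; rewrite addr0.
have mS v a b : box e v -> meas (fun z => iS z (g0 + v) a b).
  move=> bv; have mcv := mc (box_cl _ bv); exact: (mmx_invmx (mmxM mcv (mmx_trmx mcv))).
have pl ab q : pw (lf ab q).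
  have [_ Ol _ _ _] := J ab; apply: (pw_bO e0) (Ol q).
  by apply: (jets_measurable q e0 (J ab)) => v bv; exact: mS.
pose Bw ab (z : 'cV[R]_d) := (Bi ab).1 * wt z ^+ (Bi ab).2.
have pB ab : pw (Bw ab) by apply: pwM; [exact: pw_cst|exact: pw_wt].
pose D n w (j : nat) a b := (h n)^-1 * (y a n j w * y b n j w) - gram (C (x n j w)) a b.
pose L n w := \sum_a \sum_b \sum_q `|(T_ n)^-1 *
   \sum_(j < n) lf (a, b) q (x n j w) * (y a n j w * y b n j w - h n * gram (C (x n j w)) a b)|.
pose cc n w := n%:R^-1 * (\sum_(j < n) `|Bs * wt (x n j w) ^+ Ns|) + \sum_a \sum_b
   ((T_ n)^-1 * (\sum_(j < n) (Bw (a, b) (x n j w) * y a n j w) ^+ 2) +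
    ((T_ n)^-1 * (\sum_(j < n) (1 * y b n j w) ^+ 2) +
     n%:R^-1 * (\sum_(j < n) `|Bw (a, b) (x n j w) * gram (C (x n j w)) a b|))).
pose Q n w v := - 2^-1 * (n%:R^-1 * \sum_(j < n) (qs (x n j w) v + \sum_a \sum_b qf (a, b) (x n j w) v * D n w j a b)).
apply: (@m_estimator_rate R p _ _ P (fun n => n%:R * h n) scale_ratio Q (fun n w => gh n w - g0) L cc
  [set v | closure Th (g0 + v)] chi e chi0 e0 Toy) => //.
- by move=> n w; do 3!(apply: sumr_ge0 => ? _).
- move=> n w v t; rewrite /Q [RHS]mulrCA; congr (_ * _); rewrite [RHS]mulrCA; congr (_ * _).
  rewrite mulr_sumr; apply: eq_bigr => j _; rewrite Qsh mulrDr; congr (_ + _).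
  rewrite mulr_sumr; apply: eq_bigr => a _; rewrite mulr_sumr; apply: eq_bigr => b _.
  by have [_ _ _ -> _] := J (a, b); rewrite mulrA.
- by move=> n w /=; rewrite addrC subrK.
- have B1 := bip_sum (index_enum 'I_d) (fun a => bip_sum (index_enum 'I_d) (fun b =>
     bip_sum (index_enum 'I_p) (fun q => Hquad a b (pl (a, b) q)))).
  apply: bip_le_all B1 => n w; rewrite /L mulr_sumr; apply: ler_sum => a _; rewrite mulr_sumr; apply: ler_sum => b _.
  by rewrite mulr_sumr; apply: ler_sum.
- have Bc1 := Hstate (pwM (pw_cst d Bs) (pw_wt R d Ns)).
  have Bc2 := bip_sum (index_enum 'I_d) (fun a => bip_sum (index_enum 'I_d) (fun b =>
    bipD (Hsquare a (pB (a, b))) (bipD (Hsquare b (pw_cst d 1)) (Hstate (pwM (pB (a, b)) (pS a b)))))).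
  exact: (bip_le_all (fun n w => lexx (cc n w)) (bipD Bc1 Bc2)).
apply: vanishes0; near=> n; rewrite -subset0 => w /=; apply => v bv.
have n0 : 0 < n%:R :> R by rewrite ltr0n; near: n; exact: nbhs_infty_gt.
have hn := h_gt0 n.
pose Rs (j : nat) := ln (\det (S (x n j w) (g0 + v))) - ln (\det (S (x n j w) g0)) +
    \sum_a \sum_b (iS (x n j w) (g0 + v) a b - iS (x n j w) g0 a b) * S (x n j w) g0 a b - qs (x n j w) v.
pose Ri (j : nat) ab := iS (x n j w) (g0 + v) ab.1 ab.2 - iS (x n j w) g0 ab.1 ab.2 - lin (lf ab) (x n j w) v - qf ab (x n j w) v.
have hRs j : `|Rs j| <= `|Bs * wt (x n j w) ^+ Ns| * gau v ^+ 3.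
  rewrite (@ger0_norm _ (Bs * _)); last by rewrite mulr_ge0// exprn_ge0// (le_trans ler01 (w1 _)).
  have Z0 : \sum_a \sum_b (iS (x n j w) g0 a b - iS (x n j w) g0 a b) * S (x n j w) g0 a b = 0.
    by rewrite big1// => a _; rewrite big1// => b _; rewrite subrr mul0r.
  have := Hs (x n j w) v bv; rewrite addr0 subrr Z0 addr0 subr0.
  have Z1 : lin ls (x n j w) v = 0 by rewrite /lin big1// => q _; rewrite ls0 mulr0.
  by rewrite Z1 subr0.
have hRi j ab : `|Ri j ab| <= Bw ab (x n j w) * gau v ^+ 3 by apply: (HBi ab).2.
have E : scale_ratio n w v - Q n w v = - 2^-1 * ((n%:R^-1 * \sum_(j < n) Rs j) +
   (\sum_a \sum_b \sum_q v q 0 * ((T_ n)^-1 * \sum_(j < n) lf (a, b) q (x n j w) *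
       (y a n j w * y b n j w - h n * gram (C (x n j w)) a b))) +
   \sum_a \sum_b n%:R^-1 * \sum_(j < n) Ri j (a, b) * D n w j a b).
  have Ej (j : nat) : scale_term (x n j w) (h n) (fun i => y i n j w) v =
      qs (x n j w) v + \sum_a \sum_b qf (a, b) (x n j w) v * D n w j a b + (Rs j +
      (\sum_a \sum_b lin (lf (a, b)) (x n j w) v * D n w j a b + \sum_a \sum_b Ri j (a, b) * D n w j a b)).
    have -> : \sum_a \sum_b Ri j (a, b) * D n w j a b =
        \sum_a \sum_b (iS (x n j w) (g0 + v) a b - iS (x n j w) g0 a b) * ((h n)^-1 * (y a n j w * y b n j w))
        - \sum_a \sum_b (iS (x n j w) (g0 + v) a b - iS (x n j w) g0 a b) * S (x n j w) g0 a b
        - \sum_a \sum_b lin (lf (a, b)) (x n j w) v * D n w j a b - \sum_a \sum_b qf (a, b) (x n j w) v * D n w j a b.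
      rewrite -!sumrB; apply: eq_bigr => a _; rewrite -!sumrB; apply: eq_bigr => b _.
      by rewrite /Ri /D S0E /=; ring.
    rewrite /Rs /scale_term mulr_sumr.
    under [X in _ + X]eq_bigr do rewrite mulr_sumr.
    under [X in _ + X]eq_bigr do under eq_bigr do rewrite mulrCA.
    by ring.
  rewrite /scale_ratio /Q -mulrBr -mulrBr; congr (_ * _).
  have -> : \sum_a \sum_b \sum_q v q 0 * ((T_ n)^-1 * \sum_(j < n) lf (a, b) q (x n j w) *
       (y a n j w * y b n j w - h n * gram (C (x n j w)) a b)) =
     n%:R^-1 * \sum_(j < n) \sum_a \sum_b lin (lf (a, b)) (x n j w) v * D n w j a b.
    rewrite [in RHS]exchange_big /= [RHS]mulr_sumr; apply: eq_bigr => a _.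
    rewrite [in RHS]exchange_big /= [RHS]mulr_sumr; apply: eq_bigr => b _.
    rewrite /lin; under [in RHS]eq_bigr do rewrite mulr_suml.
    rewrite [in RHS]exchange_big /= [RHS]mulr_sumr; apply: eq_bigr => q _.
    rewrite [in LHS]mulr_sumr [in LHS]mulr_sumr [in RHS]mulr_sumr; apply: eq_bigr => j _; rewrite /D; field; by rewrite !gt_eqF.
  have -> : \sum_a \sum_b n%:R^-1 * \sum_(j < n) Ri j (a, b) * D n w j a b =
     n%:R^-1 * \sum_(j < n) \sum_a \sum_b Ri j (a, b) * D n w j a b.
    rewrite [in RHS]exchange_big /= [RHS]mulr_sumr; apply: eq_bigr => a _.
    by rewrite [in RHS]exchange_big /= [RHS]mulr_sumr; apply: eq_bigr => b _.
  rewrite -!mulrDr -!big_split /= -sumrB; congr (_ * _); apply: eq_bigr => j _.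
  by rewrite Ej; ring.
have ni : 0 <= n%:R^-1 :> R by rewrite invr_ge0 ltW.
have hi : 0 <= (h n)^-1 by rewrite invr_ge0 ltW.
have nh : 0 <= (T_ n)^-1 by rewrite invr_ge0 mulr_ge0// ltW.
have i2 : 0 <= 2^-1 :> R by rewrite invr_ge0.
rewrite E normrM normrN (ger0_norm i2).
apply: (le_via (1 * (L n w * gau v + cc n w * gau v ^+ 3))); last by rewrite mul1r.
apply: ler_pM; rewrite ?invr_ge0//; first by rewrite invf_le1// ler1n.
have g3 : 0 <= gau v ^+ 3 by rewrite exprn_ge0// gau_ge0.
rewrite [X in `|X + _|]addrC -addrA; apply: le_trans (ler_normD _ _) _; apply: lerD.
  apply: norm_suml_le => a _.
  apply: norm_suml_le => b _.
  apply: norm_suml_le => q _.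
  by rewrite normrM mulrC ler_wpM2l// coord_gau.
apply: le_trans (ler_normD _ _) _; rewrite mulrDl; apply: lerD.
  rewrite normrM (ger0_norm ni) -mulrA ler_wpM2l//.
  by apply: le_trans (ler_norm_sum _ _ _) _; rewrite mulr_suml; apply: ler_sum.
apply: norm_suml_le => a _.
apply: norm_suml_le => b _.
rewrite normrM (ger0_norm ni).
have -> : (T_ n)^-1 * (\sum_(j < n) (Bw (a, b) (x n j w) * y a n j w) ^+ 2) +
    ((T_ n)^-1 * (\sum_(j < n) (1 * y b n j w) ^+ 2) +
     n%:R^-1 * (\sum_(j < n) `|Bw (a, b) (x n j w) * gram (C (x n j w)) a b|)) =
   n%:R^-1 * \sum_(j < n) ((h n)^-1 * ((Bw (a, b) (x n j w) * y a n j w) ^+ 2 + (1 * y b n j w) ^+ 2) +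
     `|Bw (a, b) (x n j w) * gram (C (x n j w)) a b|).
  by rewrite big_split /= -mulr_sumr big_split /=; field; rewrite !gt_eqF.
rewrite -mulrA ler_wpM2l//; apply: norm_suml_le => j _.
have B0 : 0 <= Bw (a, b) (x n j w).
  by apply: mulr_ge0; [exact: (HBi (a, b)).1|rewrite exprn_ge0// (le_trans ler01 (w1 _))].
rewrite normrM; apply: le_trans (ler_wpM2r (normr_ge0 _) (hRi j (a, b))) _; rewrite mulrAC ler_wpM2r//.
rewrite -{1}(ger0_norm B0) -normrM /D mulrBr; apply: le_trans (ler_normB _ _) _; rewrite lerD2r.
rewrite mulrCA normrM (ger0_norm hi) ler_wpM2l// mulrA normrM mul1r.
set u := Bw _ _ * _; set z := y b n j w; clearbody u z.
rewrite -(real_normK (num_real u)) -(real_normK (num_real z)).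
have := sqr_ge0 (`|u| - `|z|); have := mulr_ge0 (normr_ge0 u) (normr_ge0 z); rewrite !expr2; lra.
Unshelve. all: end_near. Qed.

End scale_contrast.

(** * The drift contrast *)
Lemma pder_sum (R : realType) p (e : R) (I : Type) (s : seq I) (f : I -> 'cV[R]_p -> R) f' :
  (forall i, pder e (f i) (f' i)) -> pder e (fun v => \sum_(i <- s) f i v) (fun q v => \sum_(i <- s) f' i q v).
Proof.
move=> H v bv q; elim: s => [|i s [IH1 IH2]].
  have -> : (fun v => \sum_(i <- [::]) f i v) = cst 0 by apply/funext => u; rewrite big_nil.
  by rewrite big_nil; split; [exact: derivable_cst|rewrite derive_cst].
have -> : (fun v => \sum_(i <- i :: s) f i v) = f i + (fun v => \sum_(i <- s) f i v).
  by apply/funext => u; rewrite big_cons.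
have [d1 d2] := H i v bv q; rewrite big_cons; split; first exact: derivableD.
by rewrite deriveD// d2 IH2.
Qed.

Lemma pderZ (R : realType) p (e a : R) (f : 'cV[R]_p -> R) f' : pder e f f' ->
  pder e (fun v => a * f v) (fun q v => a * f' q v).
Proof.
move=> H v bv q; have [d1 d2] := H v bv q.
have -> : (fun v => a * f v) = a \*: f by [].
by split; [exact: derivableZ|rewrite deriveZ// d2].
Qed.

Lemma norm_product3 (R : realDomainType) (a b y A B g : R) : 0 <= B -> 0 <= g -> `|a| <= A -> `|b| <= B * g ->
  `|a * (b * y)| <= `|(A * B) * y| * g.
Proof.
move=> B0 g0 aA bB; have A0 := le_trans (normr_ge0 _) aA.
rewrite !normrM (ger0_norm A0) (ger0_norm B0); apply: (le_via (A * ((B * g) * `|y|))).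
  by rewrite ler_pM ?mulr_ge0 ?ler_wpM2r.
by apply: eq_ler; ring.
Qed.

Section drift_contrast.
Context d0 (Omega : measurableType d0) (R : realType) (P : probability Omega R).
Context (d r p q : nat) (d_gt0 : (0 < d)%N).
Variables (h : nat -> R) (x : nat -> nat -> Omega -> 'cV[R]_d)
  (z : 'I_r -> nat -> nat -> Omega -> R) (dl mu : 'I_d -> nat -> nat -> Omega -> R)
  (A : 'cV[R]_d -> 'cV[R]_d) (C : 'cV[R]_d -> 'M[R]_(d, r)).
Hypotheses (h_gt0 : forall n, 0 < h n) (Toy : n%:R * h n @[n --> \oo] --> +oo).
Local Notation T n := (n%:R * h n).
Hypotheses (pC : forall i c, pw (fun s => C s i c))
  (Hstate : forall f, pw f -> bip P (fun n w => n%:R^-1 * \sum_(j < n) `|f (x n j w)|))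
  (Hmu : forall f i, pw f -> bip P (fun n w => (T n)^-1 * \sum_(j < n) `|f (x n j w) * mu i n j w|))
  (Hdelta : forall f i, pw f -> bip P (fun n w => Num.sqrt (T n) * ((T n)^-1 * \sum_(j < n) `|f (x n j w) * dl i n j w|)))
  (Hmusum : forall f i, pw f -> bip P (fun n w => Num.sqrt (T n) * `|(T n)^-1 * \sum_(j < n) f (x n j w) * mu i n j w|))
  (Hfield : forall k (e : R) (U : 'I_r -> 'cV[R]_d -> 'cV[R]_k -> R), 0 < e -> (forall c, bL e (U c)) ->
     (forall c v, box e v -> meas (U c ^~ v)) ->
     exists Y : nat -> Omega -> R, [/\ bip P Y, forall n w, 0 <= Y n w &
       forall n w v, box e v -> Num.sqrt (T n) * `|(T n)^-1 *
         \sum_(j < n) \sum_c U c (x n j w) v * z c n j w| <= Y n w]).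
Variables (Th : set 'cV[R]_p) (c : 'cV[R]_d -> 'cV[R]_p -> 'M[R]_(d, r)) (C0 BC : R) (g0 : 'cV[R]_p) (e : R).
Hypotheses (Rc : forall i j, regular Th (fun s g => c s g i j)) (C00 : 0 <= C0)
  (lamc : forall s g, closure Th g -> 0 < lambda_min (gram (c s g)) /\
      (lambda_min (gram (c s g)))^-1 <= BC * (1 + enorm s `^ C0))
  (mc : forall g, closure Th g -> mmx (fun s => c s g))
  (e0 : 0 < e) (bTh : forall v, box e v -> Th (g0 + v)).
Variable gh : nat -> Omega -> 'cV[R]_p.
Hypotheses (cgh : forall n w, closure Th (gh n w))
  (gh_box : vanishes P (fun n => [set w | ~ box e (gh n w - g0)]))
  (gh_rate : bip P (fun n w => Num.sqrt (T n) * gau (gh n w - g0))).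
Variables (Tb : set 'cV[R]_q) (b : 'cV[R]_d -> 'cV[R]_q -> 'cV[R]_d) (a0 : 'cV[R]_q).
Hypotheses (Rb : forall i, regular Tb (fun s al => b s al i 0))
  (mb : forall al, closure Tb al -> mmx (fun s => b s al))
  (bTb : forall u, box (e + e) u -> Tb (a0 + u)) (ba0 : forall s, b s a0 = A s).
Local Notation iS s g := (invmx (gram (c s g))).
Local Notation be k s u := (b s (a0 + u) k 0 - A s k 0).
Local Notation xi i n j w := (\sum_c C (x n j w) i c * z c n j w + dl i n j w + mu i n j w).

Definition drift_ratio n w (u : 'cV[R]_q) := (T n)^-1 * \sum_(j < n) \sum_i \sum_k
  iS (x n j w) (gh n w) i k * (xi i n j w * be k (x n j w) u - h n / 2 * (be i (x n j w) u * be k (x n j w) u)).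

Let w1 := @wt_ge1 R d.
Let wt0 (s : 'cV[R]_d) n : 0 <= wt s ^+ n. Proof. by rewrite exprn_ge0// (le_trans ler01 (w1 s)). Qed.
Let bTb1 u : box e u -> Tb (a0 + u).
Proof. by move=> bu; apply: bTb => i; apply: le_trans (bu i) _; rewrite lerDl ltW. Qed.

(** The estimated scale parameter, which is not adapted, is treated as an additional coordinate of
    the field: chaining over the joint box makes the martingale term uniform in it. *)
Lemma drift_rate (ah : nat -> Omega -> 'cV[R]_q) chi : 0 < chi ->
  (forall n w, closure Tb (ah n w)) -> (forall n w, 0 <= drift_ratio n w (ah n w - a0)) ->
  (forall del, 0 < del -> vanishes P (fun n => [set w | exists2 u, closure Tb (a0 + u) &
     - chi * gau u ^+ 2 + del < drift_ratio n w u])) ->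
  bip P (fun n w => T n * drift_ratio n w (ah n w - a0)).
Proof.
move=> chi0 cah F0 HB.
have box_cl v : box e v -> closure Th (g0 + v) by move=> bv; apply: subset_closure; exact: bTh.
have cg0 : closure Th g0 by have := box_cl 0 (box0 (ltW e0)); rewrite addr0.
have mS v i k : closure Th v -> meas (fun s => iS s v i k).
  by move=> cv; have mcv := mc cv; exact: (mmx_invmx (mmxM mcv (mmx_trmx mcv))).
have [B0 [N0 [B00 HS]]] := iS_bound d_gt0 C00 lamc.
pose W0 (s : 'cV[R]_d) := B0 * wt s ^+ N0.
have W00 s : 0 <= W0 s by rewrite mulr_ge0.
have pW0 : pw W0 by apply: pwM; [exact: pw_cst|exact: pw_wt].
have /choice[lf Hlf] : forall k : 'I_d, exists l, exists qf, jets wt e (fun s u => b s (a0 + u) k 0) l qf.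
  by move=> k; exact: (regular_jet (Rb k) e0 bTb1).
have {Hlf}/choice[qf J] := Hlf.
have pl k m : pw (lf k m).
  have [_ Ol _ _ _] := J k; apply: (pw_bO e0) (Ol m).
  apply: (jets_measurable m e0 (J k)) => u bu; apply: (mb _ k 0); exact/subset_closure/bTb1.
have /choice[K1 HK1] : forall k : 'I_d, exists BN : R * nat, 0 <= BN.1 /\ forall s u, box e u ->
    `|be k s u| <= BN.1 * wt s ^+ BN.2 * gau u.
  move=> k; have [B [N [HB0 H]]] := jets_bO1 w1 e0 (J k); exists (B, N); split => // s u bu.
  by have := H s u bu; rewrite addr0 ba0 expr1.
have /choice[K3 HK3] : forall k : 'I_d, exists BN : R * nat, 0 <= BN.1 /\ forall s u, box e u ->
    `|be k s u - lin (lf k) s u - qf k s u| <= BN.1 * wt s ^+ BN.2 * gau u ^+ 3.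
  move=> k; have [_ _ _ _ [B [N [HB0 H]]]] := J k; exists (B, N); split => // s u bu.
  by have := H s u bu; rewrite addr0 ba0.
have /choice[K2 HK2] : forall ik : 'I_d * 'I_d, exists BN : R * nat, 0 <= BN.1 /\ forall s u, box e u ->
    `|be ik.1 s u * be ik.2 s u - lin (lf ik.1) s u * lin (lf ik.2) s u| <= BN.1 * wt s ^+ BN.2 * gau u ^+ 3.
  move=> [i k]; have O1 m := jets_bO1 w1 e0 (J m); have O2 m := jets_bO2 w1 e0 (J m).
  have Ol m : bO wt e 1 (lin (lf m)) by have [_ Hl _ _ _] := J m; exact: bO_lin.
  have [B [N [HB0 H]]] := bOD w1 (bOM (O2 i) (O1 k)) (bOM (Ol i) (O2 k) : bO wt e 3 _).
  exists (B, N); split => // s u bu; have := H s u bu; rewrite !addr0 !ba0 /=.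
  by congr (`|_| <= _); ring.
have /choice[KL HKL] : forall ik : 'I_d * 'I_d, exists BN : R * nat, 0 <= BN.1 /\ forall s v, box e v ->
    `|iS s (g0 + v) ik.1 ik.2 - iS s g0 ik.1 ik.2| <= BN.1 * wt s ^+ BN.2 * gau v.
  move=> [i k]; have [B [N [HB0 H]]] := iS_bL d_gt0 Rc C00 lamc e0 bTh i k; exists (B, N); split => // s v bv.
  by have := (H s).2 v 0 bv (box0 (ltW e0)); rewrite addr0 subr0.
pose Wf (K : R * nat) (s : 'cV[R]_d) := K.1 * wt s ^+ K.2.
have pWf K : pw (Wf K) by apply: pwM; [exact: pw_cst|exact: pw_wt].
pose U m cc (s : 'cV[R]_d) (v : 'cV[R]_(p + q)) := \sum_i \sum_k
   iS s (g0 + usubmx v) i k * (dpar Tb (fun s al => b s al k 0) a0 [:: m] s (dsubmx v) * C s i cc).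
have /choice[Y HY] : forall m, exists Y : nat -> Omega -> R, [/\ bip P Y, forall n w, 0 <= Y n w &
    forall n w v, box e v -> Num.sqrt (T n) * `|(T n)^-1 *
         \sum_(j < n) \sum_cc U m cc (x n j w) v * z cc n j w| <= Y n w].
  move=> m; apply: Hfield => // [cc|cc v bv].
    apply: bL_sum => i; apply: bL_sum => k; apply: bLM.
      exact: (bL_usub q (iS_bL d_gt0 Rc C00 lamc e0 bTh i k)).
    apply: bLM; last by apply: bL_fix; exact: (pC i cc).2.
    exact: (bL_dsub p (bL_dpar (Rb k) e0 bTb1 (jx := [:: m]) isT)).
  have bu : box e (usubmx v) by move=> i; rewrite mxE.
  have bd : box e (dsubmx v) by move=> i; rewrite mxE.
  apply: measurable_sum => i; apply: measurable_sum => k; apply: measurable_funM; first exact: (mS _ i k (box_cl _ bu)).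
  apply: measurable_funM; last exact: (pC i cc).1.
  have bTs v' : box e v' -> Tb (a0 + dsubmx v + v').
    move=> bv'; rewrite -addrA; apply: bTb => l; rewrite mxE; apply: le_trans (ler_normD _ _) _.
    by apply: lerD.
  have := jets_measurable m e0 (regular_jets (Rb k) e0 bTs).
  rewrite /dpar addr0; apply => v' bv'; apply: (mb _ k 0); exact/subset_closure/bTs.
pose L n w := \sum_m (Num.sqrt (T n))^-1 * Y m n w +
  (\sum_i \sum_k (T n)^-1 * (\sum_(j < n) `|(W0 (x n j w) * Wf (K1 k) (x n j w)) * dl i n j w|) +
   \sum_i \sum_k ((\sum_m `|(T n)^-1 * \sum_(j < n) (iS (x n j w) g0 i k * lf k m (x n j w)) * mu i n j w|) +
      gau (gh n w - g0) * ((T n)^-1 * (\sum_(j < n) `|(Wf (KL (i, k)) (x n j w) * Wf (K1 k) (x n j w)) * mu i n j w|)))).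
pose cn n w := \sum_i \sum_k (n%:R^-1 * (\sum_(j < n) `|W0 (x n j w) * Wf (K2 (i, k)) (x n j w)|) +
   (T n)^-1 * (\sum_(j < n) `|(W0 (x n j w) * Wf (K3 k) (x n j w)) * mu i n j w|)).
pose Q n w u := \sum_i \sum_k (- 2^-1 * (n%:R^-1 * \sum_(j < n) iS (x n j w) (gh n w) i k *
      (lin (lf i) (x n j w) u * lin (lf k) (x n j w) u)) +
   (T n)^-1 * \sum_(j < n) iS (x n j w) g0 i k * qf k (x n j w) u * mu i n j w).
have [] := @m_estimator_rate R q _ _ P (fun n => T n) drift_ratio Q (fun n w => ah n w - a0) L cn
  [set u | closure Tb (a0 + u)] chi e chi0 e0 Toy; last by [].
- move=> n w; have T0 : 0 <= T n by rewrite mulr_ge0// ltW.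
  have Ti0 : 0 <= (T n)^-1 by rewrite invr_ge0.
  rewrite addr_ge0//; first by apply: sumr_ge0 => m _; rewrite mulr_ge0 ?invr_ge0 ?sqrtr_ge0//; have [_ + _] := HY m; exact.
  rewrite addr_ge0//; apply: sumr_ge0 => i _; apply: sumr_ge0 => k _.
    by rewrite mulr_ge0// sumr_ge0.
  rewrite addr_ge0//; first exact: sumr_ge0.
  by rewrite mulr_ge0 ?gau_ge0// mulr_ge0// sumr_ge0.
- move=> n w v t; rewrite /Q mulr_sumr; apply: eq_bigr => i _; rewrite mulr_sumr; apply: eq_bigr => k _.
  have linZv (l : 'I_q -> 'cV[R]_d -> R) s : lin l s (t *: v) = t * lin l s v.
    by rewrite /lin mulr_sumr; apply: eq_bigr => m _; rewrite mxE mulrA.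
  rewrite [RHS]mulrDr; congr (_ + _).
    rewrite [RHS]mulrCA; congr (_ * _); rewrite [RHS]mulrCA; congr (_ * _).
    by rewrite mulr_sumr; apply: eq_bigr => j _; rewrite !linZv; ring.
  rewrite [RHS]mulrCA; congr (_ * _); rewrite mulr_sumr; apply: eq_bigr => j _.
  by have [_ _ _ -> _] := J k; ring.
- by move=> u bu /=; apply: subset_closure; exact: bTb1.
- by move=> n w /=; rewrite addrC subrK.
- exact: F0.
- have BL1 := bip_sum (index_enum 'I_q) (fun m => let: And3 H _ _ := HY m in H).
  have BL2 := bip_sum (index_enum 'I_d) (fun i => bip_sum (index_enum 'I_d) (fun k => Hdelta i (pwM pW0 (pWf (K1 k))))).
  have piS i k : pw (fun s => iS s g0 i k).
    by split; [exact: mS|exists B0, N0; split => // s; exact: HS].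
  have T0 n : 0 <= T n by rewrite mulr_ge0// ltW.
  have Ti0 n : 0 <= (T n)^-1 by rewrite invr_ge0.
  have BM i k : bip P (fun n w => (Num.sqrt (T n) * gau (gh n w - g0)) *
      ((T n)^-1 * (\sum_(j < n) `|(Wf (KL (i, k)) (x n j w) * Wf (K1 k) (x n j w)) * mu i n j w|))).
    apply: bipM => [n w|n w||]; [by rewrite mulr_ge0 ?sqrtr_ge0 ?gau_ge0|by rewrite mulr_ge0 ?sumr_ge0|by []|].
    exact: (Hmu i (pwM (pWf (KL (i, k))) (pWf (K1 k)))).
  have BL3 := bip_sum (index_enum 'I_d) (fun i => bip_sum (index_enum 'I_d) (fun k =>
     bipD (bip_sum (index_enum 'I_q) (fun m => Hmusum i (pwM (piS i k) (pl k m)))) (BM i k))).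
  apply: bip_le_all (bipD BL1 (bipD BL2 BL3)) => n w; have s0 := sqrtr_ge0 (T n).
  rewrite /L mulrDr mulrDr; apply: lerD; [|apply: lerD]; rewrite mulr_sumr; apply: ler_sum => i _.
  + have [_ Yi0 _] := HY i; rewrite mulrA -[leRHS]mul1r ler_wpM2r//.
    by have [->|sn] := eqVneq (Num.sqrt (T n)) 0; [rewrite mul0r|rewrite divff].
  + by rewrite mulr_sumr; apply: ler_sum.
  + rewrite mulr_sumr; apply: ler_sum => k _; rewrite mulrDr; apply: lerD; last by rewrite mulrA.
    by rewrite mulr_sumr; apply: ler_sum.
- have Bc := bip_sum (index_enum 'I_d) (fun i => bip_sum (index_enum 'I_d) (fun k =>
     bipD (Hstate (pwM pW0 (pWf (K2 (i, k))))) (Hmu i (pwM pW0 (pWf (K3 k)))))).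
  exact: (bip_le_all (fun n w => lexx (cn n w)) Bc).
- exact: HB.
- apply: vanishes_sub gh_box; near=> n => w /=; apply: contra_not => bv u bu.
  have n0 : 0 < n%:R :> R by rewrite ltr0n; near: n; exact: nbhs_infty_gt.
  have hn := h_gt0 n; have Tp : 0 < T n by rewrite mulr_gt0.
  have Ti : 0 <= (T n)^-1 by rewrite invr_ge0 ltW.
  have ni : 0 <= n%:R^-1 :> R by rewrite invr_ge0 ltW.
  set vg := gh n w - g0 in bv *.
  have ghE : gh n w = g0 + vg by rewrite /vg addrC subrK.
  have SiB j i k : `|iS (x n j w) (gh n w) i k| <= W0 (x n j w) by apply: HS; exact: cgh.
  have S0B j i k : `|iS (x n j w) g0 i k| <= W0 (x n j w) by exact: HS.
  have Wf0 K s : 0 <= K.1 -> 0 <= Wf K s by move=> K0; rewrite mulr_ge0.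
  pose P2 := (T n)^-1 * \sum_(j < n) \sum_i \sum_k iS (x n j w) (gh n w) i k *
     ((\sum_cc C (x n j w) i cc * z cc n j w) * be k (x n j w) u).
  have E : drift_ratio n w u - Q n w u = P2 + (
    \sum_i \sum_k (T n)^-1 * (\sum_(j < n) iS (x n j w) (gh n w) i k * (be k (x n j w) u * dl i n j w)) +
    \sum_i \sum_k ((T n)^-1 * (\sum_(j < n) iS (x n j w) g0 i k * lin (lf k) (x n j w) u * mu i n j w) +
      (T n)^-1 * (\sum_(j < n) (iS (x n j w) (gh n w) i k - iS (x n j w) g0 i k) * (be k (x n j w) u * mu i n j w)))) +
    \sum_i \sum_k (- 2^-1 * (n%:R^-1 * (\sum_(j < n) iS (x n j w) (gh n w) i k *
        (be i (x n j w) u * be k (x n j w) u - lin (lf i) (x n j w) u * lin (lf k) (x n j w) u))) +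
      (T n)^-1 * (\sum_(j < n) iS (x n j w) g0 i k * ((be k (x n j w) u - lin (lf k) (x n j w) u - qf k (x n j w) u) * mu i n j w))).
    rewrite /drift_ratio /P2 /Q.
    have X1 (G : 'I_n -> 'I_d -> 'I_d -> R) : (T n)^-1 * (\sum_j \sum_i \sum_k G j i k) = \sum_i \sum_k (T n)^-1 * \sum_j G j i k.
      rewrite exchange_big /= mulr_sumr; apply: eq_bigr => i _.
      by rewrite exchange_big /= mulr_sumr.
    rewrite !X1 -!big_split -sumrB /=; apply: eq_bigr => i _; rewrite -!big_split -sumrB /=; apply: eq_bigr => k _.
    rewrite !mulr_sumr -!big_split -sumrB /=; apply: eq_bigr => j _.
    field; by rewrite !gt_eqF.
  have hP2 : `|P2| <= (\sum_m (Num.sqrt (T n))^-1 * Y m n w) * gau u.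
    pose a (j : 'I_n) k := \sum_i iS (x n j w) (gh n w) i k * (\sum_cc C (x n j w) i cc * z cc n j w).
    pose dp k jx (j : 'I_n) := dpar Tb (fun s al => b s al k 0) a0 jx (x n j w).
    have dphi := pder_sum (index_enum 'I_n) (fun j => pder_sum (index_enum 'I_d) (fun k =>
      pderZ ((T n)^-1 * a j k) (@dpar_pder _ _ _ _ _ _ _ (Rb k) bTb1 [::] (x n j w) isT))).
    have [xi1 bxi] := mean_value dphi bu (box0 (ltW e0)).
    set lhs := (X in X = _); have -> : lhs = P2.
      rewrite /lhs -sumrB /P2 mulr_sumr; apply: eq_bigr => j _.
      rewrite -sumrB exchange_big /= mulr_sumr; apply: eq_bigr => k _.
      rewrite -mulrBr /dpar /= addr0 ba0 -mulrA; congr (_ * _); rewrite /a mulr_suml; apply: eq_bigr => i _.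
      by rewrite mulrA.
    move=> ->; apply: norm_suml_le => m _.
    rewrite mxE subr0 normrM mulrC; apply: ler_pM => //; last exact: coord_gau.
    have bxm : box e (xi1 m) by move=> i; apply: le_trans (bxi m i) _; rewrite ge_max bu mxE normr0 ltW.
    have bc : box e (col_mx vg (xi1 m)).
      by move=> i; rewrite mxE; case: splitP => k _; [exact: bv|exact: bxm].
    have [_ _ HYm] := HY m; have := HYm n w _ bc.
    rewrite mulrC -ler_pdivlMr ?sqrtr_gt0// [X in _ <= X]mulrC; congr (`|_| <= _).
    rewrite mulr_sumr; apply: eq_bigr => j _.
    rewrite /U col_mxKu col_mxKd -ghE.
    under eq_bigr do rewrite mulr_suml; rewrite exchange_big /=.
    under eq_bigr do under eq_bigr do rewrite mulr_suml.
    under eq_bigr do rewrite exchange_big /=.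
    rewrite exchange_big /= mulr_sumr; apply: eq_bigr => k _.
    rewrite -mulrA; congr (_ * _); rewrite /a mulr_suml; apply: eq_bigr => i _.
    rewrite mulr_sumr mulr_suml; apply: eq_bigr => cc _; rewrite /dpar; ring.
  have g0' := gau_ge0 u; have g3 : 0 <= gau u ^+ 3 by rewrite exprn_ge0.
  rewrite E; apply: le_trans (ler_normD _ _) _; apply: lerD.
    apply: le_trans (ler_normD _ _) _; rewrite /L mulrDl; apply: lerD => //.
    apply: le_trans (ler_normD _ _) _; rewrite mulrDl; apply: lerD.
      apply: norm_suml_le => i _.
      apply: norm_suml_le => k _.
      rewrite normrM (ger0_norm Ti) -mulrA ler_wpM2l//.
      apply: norm_suml_le => j _.
      apply: norm_product3 => //; [exact: Wf0 (HK1 k).1|exact: (HK1 k).2].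
    apply: norm_suml_le => i _.
    apply: norm_suml_le => k _.
    apply: le_trans (ler_normD _ _) _; rewrite mulrDl; apply: lerD.
      have -> : (T n)^-1 * (\sum_(j < n) iS (x n j w) g0 i k * lin (lf k) (x n j w) u * mu i n j w) =
        \sum_m u m 0 * ((T n)^-1 * \sum_(j < n) iS (x n j w) g0 i k * lf k m (x n j w) * mu i n j w).
        under [RHS]eq_bigr do rewrite mulrCA mulr_sumr; rewrite -mulr_sumr; congr (_ * _).
        rewrite exchange_big /=; apply: eq_bigr => j _; rewrite /lin mulr_sumr mulr_suml; apply: eq_bigr => m _; ring.
      apply: norm_suml_le => m _.
      by rewrite normrM mulrC ler_wpM2l// coord_gau.
    rewrite normrM (ger0_norm Ti) [X in _ <= X * _]mulrCA -mulrA ler_wpM2l//.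
    apply: le_trans (ler_norm_sum _ _ _) _; rewrite [X in _ <= X * _]mulr_sumr [leRHS]mulr_suml; apply: ler_sum => j _.
    have hA : `|iS (x n j w) (gh n w) i k - iS (x n j w) g0 i k| <= gau vg * Wf (KL (i, k)) (x n j w).
      by rewrite ghE mulrC; exact: (HKL (i, k)).2.
    have := norm_product3 (mu i n j w) (Wf0 _ (x n j w) (HK1 k).1) g0' hA ((HK1 k).2 (x n j w) u bu).
    have E4 (s1 s2 s3 s4 : R) : 0 <= s1 -> `|s1 * s2 * s3 * s4| = s1 * `|s2 * s3 * s4|.
      by move=> s10; rewrite -!mulrA normrM ger0_norm.
    by rewrite E4 ?gau_ge0.
  apply: norm_suml_le => i _.
  apply: norm_suml_le => k _.
  apply: le_trans (ler_normD _ _) _; rewrite mulrDl; apply: lerD.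
    rewrite !normrM normrN (ger0_norm ni) -[leRHS]mul1r; apply: ler_pM => //.
      by rewrite ger0_norm ?invr_ge0// invf_le1// ler1n.
    rewrite -mulrA ler_wpM2l//.
    apply: norm_suml_le => j _.
    have := norm_product3 1 (Wf0 _ (x n j w) (HK2 (i, k)).1) g3 (SiB j i k) ((HK2 (i, k)).2 (x n j w) u bu).
    by rewrite !mulr1.
  rewrite normrM (ger0_norm Ti) -mulrA ler_wpM2l//.
  apply: norm_suml_le => j _.
  apply: norm_product3 => //; [exact: Wf0 (HK3 k).1|exact: (HK3 k).2].
Unshelve. all: end_near. Qed.

End drift_contrast.

(** * Borel sets of the parameter spaces, moments of the invariant law *)
Section borel.
Context (R : realType) (p : nat).

Definition rat_box (ab : {ffun 'I_p -> rat * rat}) : set 'cV[R]_p :=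
  \bigcap_(i in [set: 'I_p]) [set v | (ratr (ab i).1 < v i 0 < ratr (ab i).2)%R].

Lemma rat_box_measurable ab : measurable (rat_box ab).
Proof.
apply: fin_bigcap_measurable => // i _.
have := @measurable_entry R p 1 setT i 0 measurableT `]ratr (ab i).1, ratr (ab i).2[%classic (measurable_itv _).
by rewrite setTI; congr measurable; apply/seteqP; split => v /=; rewrite in_itv.
Qed.

Lemma open_mx_measurable (U : set 'cV[R]_p) : open U -> measurable U.
Proof.
move=> oU; pose G (n : nat) : set 'cV[R]_p := if unpickle n is Some ab then
  (if `[< rat_box ab `<=` U >] then rat_box ab else set0) else set0.
have -> : U = \bigcup_n G n.
  apply/seteqP; split => v; last first.
    by move=> [n _]; rewrite /G; case: unpickle => // ab; case: asboolP => // H; exact: H.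
  move=> Uv; have /nbhs_ballP[e /= e0 He] : nbhs v U by apply: open_nbhs_nbhs.
  have /choice[a Ha] : forall i, exists a : rat * rat, v i 0 - e < ratr a.1 < v i 0 /\ v i 0 < ratr a.2 < v i 0 + e.
    move=> i; have [|a1 h1] := @rat_in_itvoo R (v i 0 - e) (v i 0); first by lra.
    have [|a2 h2] := @rat_in_itvoo R (v i 0) (v i 0 + e); first by lra.
    by exists (a1, a2).
  exists (pickle [ffun i => a i]) => //; rewrite /G pickleK asboolT.
    by move=> i _ /=; rewrite ffunE; have [/andP[_ ->] /andP[-> _]] := Ha i.
  move=> u /= Hu; apply: He; split => // i j; rewrite ord1 /ball /=.
  have := Hu i I; rewrite /= ffunE => /andP[h1 h2]; have [/andP[h3 h4] /andP[h5 h6]] := Ha i.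
  by rewrite ltr_norml; apply/andP; split; lra.
apply: bigcup_measurable => n _; rewrite /G; case: unpickle => // ab; case: asboolP => // _; exact: rat_box_measurable.
Qed.

Lemma closed_mx_measurable (D : set 'cV[R]_p) : closed D -> measurable D.
Proof. by move=> cD; rewrite -[D]setCK; apply: measurableC; apply: open_mx_measurable; exact: closed_openC. Qed.

End borel.

Lemma mmx_coef d1 (T : measurableType d1) (R : realType) d p k l (D : set 'cV[R]_p)
  (F : 'cV[R]_d -> 'cV[R]_p -> 'M[R]_(k, l)) (f : T -> 'cV[R]_d) (g : T -> 'cV[R]_p) :
  measurable_fun (setT `*` closure D) (fun z : 'cV[R]_d * 'cV[R]_p => F z.1 z.2) ->
  meas f -> meas g -> (forall w, closure D (g w)) ->
  mmx (fun w => F (f w) (g w)).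
Proof.
move=> mF mf mg cg i j.
have mD : measurable ((setT : set 'cV[R]_d) `*` closure D).
  by apply: measurableX => //; apply: closed_mx_measurable; exact: closed_closure.
have mFg : meas (fun w => F (f w) (g w)).
  apply: (measurable_comp mD _ mF (measurable_fun_pair mf mg)).
  by move=> _ [w _ <-]; split => //=.
exact: (measurableT_comp (@measurable_entry R k l setT i j) mFg).
Qed.

Lemma enorm_coord (R : realType) n (y : 'cV[R]_n) k : `|y k 0| <= enorm y.
Proof.
rewrite -sqrtr_sqr; apply: ler_wsqrtr; rewrite (bigD1 k)//= lerDl.
by apply: sumr_ge0 => i _; exact: sqr_ge0.
Qed.

Lemma gau_enorm (R : realType) n (y : 'cV[R]_n) : gau y <= n%:R * enorm y.
Proof.
rewrite mulr_natl -[X in _ *+ X]card_ord -sumr_const; apply: ler_sum => k _; exact: enorm_coord.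
Qed.

Lemma wt_enorm (R : realType) d N : exists2 K : R, 0 <= K & forall y : 'cV[R]_d, wt y ^+ N <= K * (1 + enorm y `^ N.+1%:R).
Proof.
exists (2 ^+ N * (1 + d%:R ^+ N) * 2); first by rewrite !mulr_ge0 ?addr_ge0 ?exprn_ge0.
move=> y; have e0 := enorm_ge0 y.
rewrite powR_mulrn//.
have h1 : wt y ^+ N <= 2 ^+ N * (1 + d%:R ^+ N * enorm y ^+ N).
  rewrite -exprMn; apply: (le_via ((1 + d%:R * enorm y) ^+ N)).
    rewrite lerXn2r ?nnegrE//; [exact: le_trans ler01 (wt_ge1 y)|by rewrite addr_ge0// mulr_ge0|].
    by rewrite lerD2l; exact: gau_enorm.
  by have := exprD_le N ler01 (mulr_ge0 (ler0n R d) e0); rewrite expr1n.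
have h2 : enorm y ^+ N <= 1 + enorm y ^+ N.+1.
  have [y1|y1] := leP (enorm y) 1.
    by apply: (le_via 1); [exact: exprn_ile1|rewrite lerDl exprn_ge0].
  apply: (le_via (enorm y ^+ N.+1)); last by rewrite lerDr.
  by apply: ler_weXn2l; [exact: ltW|].
apply: le_trans h1 _; rewrite -!mulrA ler_wpM2l ?exprn_ge0// mulrDl mul1r.
have d0 : 0 <= d%:R ^+ N :> R by rewrite exprn_ge0.
have e1 : 0 <= enorm y ^+ N.+1 by rewrite exprn_ge0.
apply: lerD; first by lra.
by apply: le_trans (ler_wpM2l d0 h2) _; rewrite ler_wpM2l//; lra.
Qed.

Lemma measurable_enorm (R : realType) d : meas (@enorm R d).
Proof.
have -> : @enorm R d = fun y => (\sum_(i < d) y i 0 ^+ 2) `^ 2^-1.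
  by apply/funext => y; rewrite /enorm powR12_sqrt// sumr_ge0// => i _; exact: sqr_ge0.
apply: (@measurableT_comp _ _ _ _ _ _ (fun y : R => y `^ 2^-1)); first exact: measurable_powR.
by apply: measurable_sum => i; apply: measurable_funX; exact: measurable_entry.
Qed.

(** Ergodicity, used at time 0 from the origin, bounds the distance between the integrals under the
    initial and the invariant law, which forces the latter to be finite. *)
Lemma invariant_moments d0 (Omega : measurableType d0) (R : realType) (P : probability Omega R) d r
  (X : R -> Omega -> 'cV[R]_d) (Z : R -> Omega -> 'cV[R]_r) A C (piX : probability 'cV[R]_d R) (f : 'cV[R]_d -> R) :
  cond_R3 P X Z A C piX -> pw f -> piX.-integrable setT (EFin \o f).
Proof.
move=> [[Pt [_ HPt]] _] [mf [B [N [B0 fB]]]].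
have [K K0 HK] := wt_enorm R d N.
have [a a0 [B' H]] := HPt N.+1%:R (ltr0Sn R N).
pose g (y : 'cV[R]_d) : R := 1 + enorm y `^ N.+1%:R.
have g0 y : 0 <= g y by rewrite addr_ge0// powR_ge0.
have mg : meas g.
  apply: measurable_funD => //; apply: (@measurableT_comp _ _ _ _ _ _ (fun y : R => y `^ N.+1%:R)).
    exact: measurable_powR.
  exact: measurable_enorm.
have := H 0 0 g (lexx _) mg; rewrite mulr0 expR0 mul1e => /(_ (fun y => eq_ind_r (fun t => is_true (t <= _)) (lexx _) (ger0_norm (g0 y)))) Hg.
have pig : (\int[piX]_y (g y)%:E < +oo)%E.
  have p0 : (0 <= \int[piX]_y (g y)%:E)%E by apply: integral_ge0 => y _; rewrite lee_fin.
  have q0 : (0 <= \int[Pt 0%R 0%R]_y (g y)%:E)%E by apply: integral_ge0 => y _; rewrite lee_fin.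
  move: Hg p0 q0; case: (\int[piX]_y (g y)%:E)%E => [s| |] //; first by move=> *; exact: ltry.
  by case: (\int[Pt 0%R 0%R]_y (g y)%:E)%E => [t| |].
have ig : piX.-integrable setT (EFin \o g).
  apply/integrableP; split; first exact/measurable_EFinP.
  by under eq_integral do rewrite /= ger0_norm//.
have := integrableZl measurableT (B * K) ig; apply: le_integrable => //; first exact/measurable_EFinP.
move=> y _; rewrite /= lee_fin [leRHS]ger0_norm ?mulr_ge0//.
by apply: le_trans (fB y) _; rewrite -mulrA ler_wpM2l.
Qed.

(** * The two criteria *)
Section criteria.
Context (R : realType) d0 (Omega : measurableType d0) (P : probability Omega R) (d r : nat) (d_gt0 : (0 < d)%N).
Context (X : R -> Omega -> 'cV[R]_d) (C : 'cV[R]_d -> 'M[R]_(d, r)) (A : 'cV[R]_d -> 'cV[R]_d).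
Context (h : nat -> R) (h_gt0 : forall n, 0 < h n).
Context (Sc : candidates R d d r) (Dr : candidates R d d 1).
Context (ghat : forall m1 : 'I_(ncand Sc), nat -> Omega -> 'cV[R]_(pdim m1)).
Local Notation st n j w := (X (j%:R * h n) w).
Local Notation iS m x g := (invmx (gram (coef m x g))).

Lemma mxdot_otimes2 (M : 'M[R]_d) u : mxdot M (otimes2 u) = \sum_a \sum_b M a b * (u a 0 * u b 0).
Proof.
rewrite /mxdot /mxtrace; apply: eq_bigr => a _; rewrite mxE; apply: eq_bigr => b _.
by rewrite !mxE big_ord1 !mxE.
Qed.

Lemma bilinE (M : 'M[R]_d) u v : bilin M u v = \sum_a \sum_b M a b * (u a 0 * v b 0).
Proof.
rewrite /bilin mxE exchange_big /=; apply: eq_bigr => b _; rewrite mxE mulr_suml.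
by apply: eq_bigr => a _; rewrite !mxE; ring.
Qed.

Lemma dobsE n j w i : dobs X h n j.+1 w i 0 = dX X i (j%:R * h n) (j.+1%:R * h n) w.
Proof. by rewrite /dobs /obs /dX !mxE. Qed.

Lemma H1_ratio (m : 'I_(ncand Sc)) (g0 g : 'cV[R]_(pdim m)) n w :
  (forall x, 0 < \det (Smx x g)) -> (forall x, 0 < \det (Smx x g0)) ->
  n%:R^-1 * (H1 X h n w g - H1 X h n w g0) =
  scale_ratio h (fun n j w => st n j w) (fun i n j w => dX X i (j%:R * h n) (j.+1%:R * h n) w) (coef m) g0 n w (g - g0).
Proof.
move=> dg dg0; rewrite /H1 /scale_ratio !big_add1 /= !big_mkord -mulrBr mulrCA; congr (_ * (_ * _)).
rewrite -sumrB; apply: eq_bigr => j _; rewrite /scale_term (_ : g0 + (g - g0) = g); last by rewrite addrC subrK.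
have k0 : 0 < 2 * pi * h n by rewrite !mulr_gt0// pi_gt0.
have ld g' : 0 < \det (Smx (obs X h n j w) g') ->
    ln (\det ((2 * pi * h n) *: Smx (obs X h n j w) g')) = ln ((2 * pi * h n) ^+ d) + ln (\det (Smx (obs X h n j w) g')).
  by move=> dt; rewrite detZ lnM// posrE ?exprn_gt0.
rewrite !ld// !mxdot_otimes2 /obs.
have E : \sum_a \sum_b (iS m (st n j w) g a b - iS m (st n j w) g0 a b) *
    (dX X a (j%:R * h n) (j.+1%:R * h n) w * dX X b (j%:R * h n) (j.+1%:R * h n) w) =
  \sum_a \sum_b iS m (st n j w) g a b * (dobs X h n j.+1 w a 0 * dobs X h n j.+1 w b 0) -
  \sum_a \sum_b iS m (st n j w) g0 a b * (dobs X h n j.+1 w a 0 * dobs X h n j.+1 w b 0).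
  rewrite -sumrB; apply: eq_bigr => a _; rewrite -sumrB; apply: eq_bigr => b _.
  by rewrite -!dobsE mulrBl.
by rewrite E /Smx; ring.
Qed.

Lemma H2_ratio (m1 : 'I_(ncand Sc)) (m2 : 'I_(ncand Dr)) (a0 al : 'cV[R]_(pdim m2)) Z n w :
  (forall x, coef m2 x a0 = A x) ->
  (n%:R * h n)^-1 * (H2 X h ghat m1 n w al - H2 X h ghat m1 n w a0) =
  drift_ratio h (fun n j w => st n j w) (fun a n j w => dZ Z a (j%:R * h n) (j.+1%:R * h n) w)
    (fun i n j w => ddelta X A i (j%:R * h n) (j.+1%:R * h n) w)
    (fun i n j w => dmu Z X A C i (j%:R * h n) (j.+1%:R * h n) w)
    A C (coef m1) (ghat m1) (coef m2) a0 n w (al - a0).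
Proof.
move=> ca0; rewrite /H2 /drift_ratio !big_add1 /= !big_mkord -sumrB; congr (_ * _).
apply: eq_bigr => j _; rewrite (_ : a0 + (al - a0) = al); last by rewrite addrC subrK.
rewrite ca0 !bilinE !mxdot_otimes2 /Smx /obs.
set M := invmx _; set x := st n j w; set b := coef m2 x al.
have xiE i : \sum_c C x i c * dZ Z c (j%:R * h n) (j.+1%:R * h n) w + ddelta X A i (j%:R * h n) (j.+1%:R * h n) w +
   dmu Z X A C i (j%:R * h n) (j.+1%:R * h n) w = dobs X h n j.+1 w i 0 - h n * A x i 0.
  have := rhoE Z X A C i (j%:R * h n) (j.+1%:R * h n) w; rewrite dobsE /rho -/x.
  have -> : j.+1%:R * h n - j%:R * h n = h n by rewrite -natr1; ring.
  by set s := \sum_c _; move=> H; rewrite -(subrK s (dX _ _ _ _ _)) H; ring.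
have Msym a c : M a c = M c a by rewrite /M -[in LHS]gram_sym -trmx_inv mxE.
have AB : \sum_i \sum_k M i k * (A x i 0 * b k 0) = \sum_i \sum_k M i k * (b i 0 * A x k 0).
  rewrite exchange_big /=; apply: eq_bigr => i _; apply: eq_bigr => k _; by rewrite Msym; ring.
transitivity (\sum_i \sum_k M i k * ((dobs X h n j.+1 w i 0 - h n * A x i 0) * (b k 0 - A x k 0) -
    h n / 2 * ((b i 0 - A x i 0) * (b k 0 - A x k 0))) + h n / 2 *
  (\sum_i \sum_k M i k * (A x i 0 * b k 0) - \sum_i \sum_k M i k * (b i 0 * A x k 0))).
  have sumZ (G : 'I_d -> 'I_d -> R) k : k * (\sum_i \sum_j G i j) = \sum_i \sum_j k * G i j.
    by rewrite mulr_sumr; apply: eq_bigr => i _; rewrite mulr_sumr.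
  have sumB (G G' : 'I_d -> 'I_d -> R) : (\sum_i \sum_j G i j) - (\sum_i \sum_j G' i j) = \sum_i \sum_j (G i j - G' i j).
    by rewrite -sumrB; apply: eq_bigr => i _; rewrite -sumrB.
  rewrite !(sumB, sumZ) -big_split; apply: eq_bigr => i _; rewrite -big_split; apply: eq_bigr => k _ /=.
  by field.
rewrite AB subrr mulr0 addr0; apply: eq_bigr => i _; apply: eq_bigr => k _; by rewrite xiE.
Qed.

End criteria.

(** * Consequences of uniform limits of criteria *)
Section uniform_limits.
Context d0 (Omega : measurableType d0) (R : realType) (P : probability Omega R).

Lemma sup_limit V (D : set V) (G : nat -> Omega -> V -> R) :
  cvg0_in_prob P (fun n w => ereal_sup [set (`|G n w g|)%:E | g in D]) ->
  forall del, 0 < del -> vanishes P (fun n => [set w | exists2 g, D g & del <= `|G n w g|]).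
Proof.
move=> /cvg0_vip H del del0; apply: vanishes_sub (H del del0); near=> n => w [g Dg dg] /=.
apply: (le_via (`|G n w g|)%:E); first by rewrite lee_fin.
by apply: ereal_sup_ubound; exists g.
Unshelve. all: end_near. Qed.

Section criterion.
Variables (V : Type) (D : set V) (H : nat -> Omega -> V -> R) (H0 : V -> R) (k c : nat -> R).
Hypotheses (k0 : forall n, 0 <= k n) (lim : forall del, 0 < del ->
  vanishes P (fun n => [set w | exists2 g, D g & del <= `|k n * H n w g + c n - H0 g|])).

Lemma estimator_value (est : nat -> Omega -> V) gs : (forall n w, argmax D (H n w) (est n w)) ->
  D gs -> (forall g, D g -> H0 g <= H0 gs) ->
  forall del, 0 < del -> vanishes P (fun n => [set w | del <= `|k n * H n w (est n w) + c n - H0 gs|]).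
Proof.
move=> He Dgs Hgs del del0; apply: vanishes_sub (lim del0); near=> n => w /=.
apply: contraPP => nex; apply/negP; rewrite -ltNge.
have B g : D g -> `|k n * H n w g + c n - H0 g| < del.
  by move=> Dg; rewrite ltNge; apply/negP => bad; apply: nex; exists g.
have [De mx] := He n w; have := B _ De; have := B _ Dgs; have h1 := Hgs _ De.
have h2 := ler_wpM2l (k0 n) (mx _ Dgs); move: h1 h2; rewrite !ltr_norml.
move=> h1 h2 /andP[h3 h4] /andP[h5 h6]; apply/andP; split; lra.
Unshelve. all: end_near. Qed.

End criterion.

Lemma ratio_bound p (D : set 'cV[R]_p) (H : nat -> Omega -> 'cV[R]_p -> R) H0 (k c : nat -> R) g0 chi : D g0 ->
  (forall del, 0 < del -> vanishes P (fun n => [set w | exists2 g, D g & del <= `|k n * H n w g + c n - H0 g|])) ->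
  (forall g, D g -> H0 g - H0 g0 <= - chi * gau (g - g0) ^+ 2) ->
  forall del, 0 < del -> vanishes P (fun n => [set w | exists2 v, D (g0 + v) &
     - chi * gau v ^+ 2 + del < k n * (H n w (g0 + v) - H n w g0)]).
Proof.
move=> Dg0 lim HB del del0; have d2 : 0 < del / 2 by rewrite divr_gt0.
apply: vanishes_sub (lim _ d2); near=> n => w [v Dv hv] /=.
apply: contraPP hv => nex; apply/negP; rewrite -leNgt.
have B g : D g -> `|k n * H n w g + c n - H0 g| < del / 2.
  by move=> Dg; rewrite ltNge; apply/negP => bad; apply: nex; exists g.
have := B _ Dv; have := B _ Dg0; have := HB _ Dv; rewrite addrAC subrr add0r.
rewrite !ltr_norml mulrBr; move=> h1 /andP[h3 h4] /andP[h5 h6]; lra.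
Unshelve. all: end_near. Qed.

(** Different limits decide the comparison at the leading order, where the penalty is negligible. *)
Lemma gap_selection (K1 K2 : nat -> Omega -> R) (c pen : nat -> R) v1 v2 : v2 < v1 ->
  (forall del, 0 < del -> vanishes P (fun n => [set w | del <= `|K1 n w + c n - v1|])) ->
  (forall del, 0 < del -> vanishes P (fun n => [set w | del <= `|K2 n w + c n - v2|])) ->
  (forall del, 0 < del -> \forall n \near \oo, `|pen n| <= del) ->
  vanishes P (fun n => [set w | ~ (- 2 * K1 n w + pen n < - 2 * K2 n w)]).
Proof.
move=> v12 L1 L2 Lp; have d0' : 0 < (v1 - v2) / 8 by rewrite divr_gt0// subr_gt0.
apply: vanishes_sub (vanishesU (L1 _ d0') (L2 _ d0')); near=> n => w /=.
apply: contra_notP => /not_orP[/negP + /negP]; rewrite -!ltNge => h1 h2.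
have h3 : `|pen n| <= (v1 - v2) / 8 by near: n; exact: Lp.
move: h1 h2 h3; rewrite !ltr_norml ler_norml.
move=> /andP[h1 h2] /andP[h3 h4] /andP[h5 h6]; lra.
Unshelve. all: end_near. Qed.

Lemma log_penalty (T : nat -> R) a : T n @[n --> \oo] --> +oo ->
  forall del, 0 < del -> \forall n \near \oo, `|a * (ln (T n) / T n)| <= del.
Proof.
move=> Toy del del0; pose b := `|a| + 1; have b0 : 0 < b by rewrite ltr_wpDl.
near=> n.
have T1 : 1 <= T n by near: n; move/cvgryPge : Toy; exact.
have T0 : 0 < T n := lt_le_trans ltr01 T1.
have s0 : 0 < Num.sqrt (T n) by rewrite sqrtr_gt0.
have Tb : (2 * b / del) ^+ 2 <= T n by near: n; move/cvgryPge : Toy; exact.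
have sb : 2 * b / del <= Num.sqrt (T n).
  have q0 : 0 <= 2 * b / del by rewrite divr_ge0 ?(ltW del0)// mulr_ge0// ltW.
  by rewrite -(ger0_norm q0) -sqrtr_sqr; apply: ler_wsqrtr.
have l0 : 0 <= ln (T n) by exact: ln_ge0.
have l2 : ln (T n) <= 2 * Num.sqrt (T n).
  rewrite -[in leLHS](sqr_sqrtr (ltW T0)) lnXn// -[leLHS]mulr_natl ler_wpM2l//.
  by apply: ltW; exact: ln_sublinear.
rewrite normrM (ger0_norm (divr_ge0 l0 (ltW T0))).
apply: (le_via (b * (2 * Num.sqrt (T n) / T n))).
  apply: ler_pM; rewrite ?divr_ge0 ?(ltW T0)//; first by rewrite lerDl.
  by rewrite ler_wpM2r// invr_ge0 ltW.
rewrite -[X in _ / X](sqr_sqrtr (ltW T0)).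
have -> : b * (2 * Num.sqrt (T n) / Num.sqrt (T n) ^+ 2) = 2 * b / Num.sqrt (T n).
  by field; rewrite gt_eqF.
by rewrite ler_pdivrMr// [leRHS]mulrC -ler_pdivrMr.
Unshelve. all: end_near. Qed.

End uniform_limits.

Lemma penalized_lt (R : realFieldType) (k u1 u2 p1 p2 l : R) :
  - 2 * (k * u1) + (p1 - p2) * l < - 2 * (k * u2) -> k * (- 2 * u1) + p1 * l < k * (- 2 * u2) + p2 * l.
Proof. by rewrite mulrBl !(mulrCA k); lra. Qed.

(** With c and a the values of the smaller model at the truth and at its estimator, b - c bounds the
    gain of the larger model; twice this gain is beaten by one unit of penalty. *)
Lemma nested_lt (R : realFieldType) (k l p1 p2 a b c : R) : 0 < k -> 0 <= l -> p1 + 1 <= p2 -> c <= a ->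
  k * (b - c) + k * (b - c) < l -> - 2 * a + p1 / k * l < - 2 * b + p2 / k * l.
Proof.
move=> k0 l0 pp ca H; rewrite -(ltr_pM2l k0) !mulrDr.
have E p : k * (p / k * l) = p * l by field; rewrite gt_eqF.
rewrite !E; have := ler_wpM2r l0 pp; have := ler_wpM2l (ltW k0) ca.
by move: H; rewrite mulrDl mul1r !mulrBr !(mulrCA k); lra.
Qed.

Lemma argmax_gap (R : realType) n (S : {set 'I_n}) (f : 'I_n -> R) i j :
  [set` S] = argmax setT f -> i \in S -> j \notin S -> f j < f i.
Proof.
move=> E iS jS; have [_ mx] : argmax setT f i by rewrite -E.
rewrite lt_neqAle mx// andbT; apply: contraNN jS => /eqP fji.
suff : [set` S] j by [].
by rewrite E; split => // y _; rewrite fji; exact: mx.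
Qed.

(** * Model selection *)
Section selection.
Context (R : realType) (d0 : measure_display) (Omega : measurableType d0)
  (P : probability Omega R) (d r : nat) (d_gt0 : (0 < d)%N).
Context (Z : R -> Omega -> 'cV[R]_r) (nu : {measure set 'cV[R]_r -> \bar R}) (X : R -> Omega -> 'cV[R]_d)
  (A : 'cV[R]_d -> 'cV[R]_d) (C : 'cV[R]_d -> 'M[R]_(d, r)).
Hypotheses (Z_levy : levy_process P Z) (X_sde : sde_solution P Z A C X).
Context (h : nat -> R) (Sc : candidates R d d r) (Dr : candidates R d d 1).
Hypotheses (h_gt0 : forall n, 0 < h n) (Tn_oo : horizon h n @[n --> \oo] --> +oo)
  (nh2_0 : n%:R * h n ^+ 2 @[n --> \oo] --> 0) (Sc_adm : admissible Sc) (Dr_adm : admissible Dr).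
Context (g0 : forall m1 : 'I_(ncand Sc), 'cV[R]_(pdim m1))
  (a0 : forall m2 : 'I_(ncand Dr), 'cV[R]_(pdim m2)).
Hypotheses (g0_true : forall m1, m1 \in specified Sc C -> true_value C m1 (g0 m1))
  (a0_true : forall m2, m2 \in specified Dr A -> true_value A m2 (a0 m2)).
Context (ghat : forall m1 : 'I_(ncand Sc), nat -> Omega -> 'cV[R]_(pdim m1))
  (ahat : forall (m2 : 'I_(ncand Dr)) (m1 : 'I_(ncand Sc)), nat -> Omega -> 'cV[R]_(pdim m2)).
Hypotheses (ghat_est : scale_estimator X h ghat) (ahat_est : drift_estimator X h ghat ahat).
Context (piX : probability 'cV[R]_d R).
Hypothesis HR : cond_R P X h ghat ahat Z nu A C piX g0 a0.
Context (gstar : forall m1 : 'I_(ncand Sc), 'cV[R]_(pdim m1))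
  (astar : forall (m2 : 'I_(ncand Dr)) (m1 : 'I_(ncand Sc)), 'cV[R]_(pdim m2)).
Hypotheses (H1_lim : scale_limits P X h C piX gstar)
  (H2_lim : drift_limits P X h ghat A piX gstar astar)
  (gstar_true : forall m1, m1 \in specified Sc C -> gstar m1 = g0 m1)
  (astar_true : forall m2 m1, m2 \in specified Dr A -> astar m2 m1 = a0 m2).
Context (m1s : 'I_(ncand Sc)) (m2s : 'I_(ncand Dr)).
Hypotheses (m1sM : m1s \in specified Sc C) (m2sM : m2s \in specified Dr A).
Local Notation st := (fun n j w => X (j%:R * h n) w).
Local Notation T n := (n%:R * h n).

Lemma T_oo : T n @[n --> \oo] --> +oo. Proof. exact: Tn_oo. Qed.

Lemma mmx_coef_at k l (K : candidates R d k l) (m : 'I_(ncand K)) th : admissible K -> closure (Theta m) th ->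
  mmx (fun x => coef m x th).
Proof.
move=> adm cth; have [_ _ _ _ mF] := adm m.
by apply: (mmx_coef mF).
Qed.

Lemma scale_regularity m1 : m1 \in specified Sc C -> cond_R2_scale m1 /\ cond_R4_scale piX g0 m1.
Proof. by move=> M; have [_ _ H] := HR; have [? _ ? _ _] := H m1 m2s M m2sM. Qed.

Lemma drift_regularity m1 m2 : m1 \in specified Sc C -> m2 \in specified Dr A ->
  cond_R2_drift m2 /\ cond_R4_drift piX g0 a0 m1 m2.
Proof. by move=> M M'; have [_ _ H] := HR; have [_ ? _ ? _] := H m1 m2 M M'. Qed.

Lemma Theta_box k l (K : candidates R d k l) (m : 'I_(ncand K)) th : admissible K -> Theta m th ->
  exists2 e : R, 0 < e & forall v, box e v -> Theta m (th + v).
Proof.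
move=> adm Tth; have [_ oT _ _ _] := adm m.
have /nbhs_ballP[e /= e0 He] : nbhs th (Theta m) by apply: open_nbhs_nbhs.
exists (e / 2); first by rewrite divr_gt0.
move=> v bv; apply: He; split => // i j; rewrite /ball /= !mxE opprD addNKr normrN ord1.
by apply: le_lt_trans (bv i) _; lra.
Qed.

Lemma XM N : exists B : R, forall t, 0 <= t -> (\int[P]_w (nX X t w ^+ N)%:E <= B%:E)%E.
Proof.
have [_ [_ H3] _] := HR.
case: N => [|N].
  by exists 1 => t t0; under eq_integral do rewrite expr0; rewrite integral_cstP.
have [B HB] := H3 N.+1%:R (ltr0Sn R N).
exists (d%:R ^+ N.+1 * B) => t t0.
apply: (le_via (\int[P]_w (d%:R ^+ N.+1 * (enorm (X t w) `^ N.+1%:R))%:E)%E).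
  apply: ge0_le_integral_nomeas => w _; first by rewrite lee_fin exprn_ge0// nX_ge0.
  rewrite lee_fin powR_mulrn ?enorm_ge0// -exprMn lerXn2r ?nnegrE ?nX_ge0 ?mulr_ge0 ?enorm_ge0//.
  exact: gau_enorm.
under eq_integral do rewrite EFinM.
have mX : meas (fun w => enorm (X t w) `^ N.+1%:R).
  have [F [Ffilt _ XF _ _]] := X_sde.
  apply: (X_measurable Ffilt XF t0 (f := fun y => enorm y `^ N.+1%:R)).
  by apply: (@measurableT_comp _ _ _ _ _ _ (fun y : R => y `^ N.+1%:R)); [exact: measurable_powR|exact: measurable_enorm].
rewrite ge0_integralZl//; try by move=> w _; rewrite lee_fin powR_ge0.
  2: exact/measurable_EFinP.
by rewrite EFinM; apply: lee_wpmul2l; [rewrite lee_fin exprn_ge0|have := HB t t0; rewrite unlock].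
Qed.

(** All that is used of the equation by the analysis of the two contrasts. *)
Lemma discretized :
  [/\ forall i c, pw (fun s => C s i c),
      forall f, pw f -> bip P (fun n w => n%:R^-1 * \sum_(j < n) `|f (st n j w)|),
      forall f i, pw f -> bip P (fun n w => (T n)^-1 * \sum_(j < n) (f (st n j w) * dX X i (j%:R * h n) (j.+1%:R * h n) w) ^+ 2) &
      forall f a b, pw f -> bip P (fun n w => Num.sqrt (T n) * `|(T n)^-1 * \sum_(j < n) f (st n j w) *
        (dX X a (j%:R * h n) (j.+1%:R * h n) w * dX X b (j%:R * h n) (j.+1%:R * h n) w - h n * gram (C (st n j w)) a b)|)] /\
  [/\ forall f i, pw f -> bip P (fun n w => (T n)^-1 * \sum_(j < n) `|f (st n j w) * dmu Z X A C i (j%:R * h n) (j.+1%:R * h n) w|),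
      forall f i, pw f -> bip P (fun n w => Num.sqrt (T n) * ((T n)^-1 * \sum_(j < n) `|f (st n j w) * ddelta X A i (j%:R * h n) (j.+1%:R * h n) w|)),
      forall f i, pw f -> bip P (fun n w => Num.sqrt (T n) * `|(T n)^-1 * \sum_(j < n) f (st n j w) * dmu Z X A C i (j%:R * h n) (j.+1%:R * h n) w|) &
      forall k (e : R) (U : 'I_r -> 'cV[R]_d -> 'cV[R]_k -> R), 0 < e -> (forall c, bL e (U c)) ->
     (forall c v, box e v -> meas (U c ^~ v)) ->
     exists Y : nat -> Omega -> R, [/\ bip P Y, forall n w, 0 <= Y n w &
       forall n w v, box e v -> Num.sqrt (T n) * `|(T n)^-1 *
         \sum_(j < n) \sum_c U c (st n j w) v * dZ Z c (j%:R * h n) (j.+1%:R * h n) w| <= Y n w]].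
Proof.
have [F [Ffilt [ZF Zind] XF Xc Xito]] := X_sde; have [ZR1 _ _] := HR.
have [[Rc _] _] := scale_regularity m1sM; have [Rb _] := drift_regularity m1sM m2sM.
have [Tg cg] := g0_true m1sM; have [Ta ca] := a0_true m2sM.
have cTg := subset_closure Tg; have cTa := subset_closure Ta.
have mC i a : meas (fun x : 'cV[R]_d => C x i a).
  by have := mmx_coef_at Sc_adm cTg i a; congr measurable_fun; apply/funext => s; rewrite cg.
have mA i : meas (fun x : 'cV[R]_d => A x i 0).
  by have := mmx_coef_at Dr_adm cTa i 0; congr measurable_fun; apply/funext => s; rewrite ca.
have /choice[Lc HLc] : forall ia : 'I_d * 'I_r, exists L, 0 <= L /\ forall x y : 'cV[R]_d,
    `|C x ia.1 ia.2 - C y ia.1 ia.2| <= L * \sum_k `|x k 0 - y k 0|.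
  move=> [i a]; have [L [L0 HL]] := regular_lip (Rc i a); exists L; split => // x y.
  by rewrite -!cg; exact: HL.
have /choice[La HLa] : forall i : 'I_d, exists L, 0 <= L /\ forall x y : 'cV[R]_d,
    `|A x i 0 - A y i 0| <= L * \sum_k `|x k 0 - y k 0|.
  move=> i; have [L [L0 HL]] := regular_lip (Rb i); exists L; split => // x y.
  by rewrite -!ca; exact: HL.
pose L := \sum_ia Lc ia + \sum_i La i.
have sc0 : 0 <= \sum_ia Lc ia by apply: sumr_ge0 => ia _; exact: (HLc ia).1.
have sa0 : 0 <= \sum_i La i by apply: sumr_ge0 => i _; exact: (HLa i).1.
have L0 : 0 <= L by rewrite addr_ge0.
have CL x y i a : `|C x i a - C y i a| <= L * \sum_k `|x k 0 - y k 0|.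
  apply: le_trans ((HLc (i, a)).2 x y) _; rewrite ler_wpM2r ?sumr_ge0//.
  rewrite /L (bigD1 (i, a))//= -addrA lerDl addr_ge0//; apply: sumr_ge0 => ia _; exact: (HLc ia).1.
have AL x y i : `|A x i 0 - A y i 0| <= L * \sum_k `|x k 0 - y k 0|.
  apply: le_trans ((HLa i).2 x y) _; rewrite ler_wpM2r ?sumr_ge0//.
  rewrite /L addrC (bigD1 i)//= -addrA lerDl addr_ge0//; apply: sumr_ge0 => j _; exact: (HLa j).1.
split; split.
- exact: (pw_C L0 CL mC).
- by move=> f pf; exact: (bip_state Ffilt XF XM h_gt0 pf).
- by move=> f i pf; exact: (bip_square_incr Ffilt ZF Zind Z_levy ZR1 XF Xc Xito L0 CL AL mC mA XM h_gt0 T_oo nh2_0 pf i).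
- by move=> f a b pf; exact: (bip_quadratic Ffilt ZF Zind Z_levy ZR1 XF Xc Xito L0 CL AL mC mA XM h_gt0 T_oo nh2_0 a b pf).
- by move=> f i pf; exact: (bip_mu Ffilt ZF Zind Z_levy ZR1 XF Xc Xito L0 CL AL mC mA XM h_gt0 T_oo nh2_0 pf i).
- by move=> f i pf; exact: (bip_delta Ffilt ZF Zind Z_levy ZR1 XF Xc Xito L0 CL AL mC mA XM h_gt0 T_oo nh2_0 pf i).
- by move=> f i pf; exact: (bip_mu_sum Ffilt ZF Zind Z_levy ZR1 XF Xc Xito L0 CL AL mC mA XM h_gt0 T_oo nh2_0 pf i).
- by move=> k e U e0 UL mU; exact: (bip_field Ffilt ZF Zind Z_levy ZR1 XF XM h_gt0 T_oo nh2_0 e0 UL mU).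
Qed.

Lemma ghat_cl m n w : closure (Theta m) (ghat m n w).
Proof. by have [_ H] := ghat_est m n; have [] := H w. Qed.

Lemma ahat_cl m1 m2 n w : closure (Theta m2) (ahat m2 m1 n w).
Proof. by have [_ H] := ahat_est m1 m2 n; have [] := H w. Qed.

Lemma argmax_set1 (V : Type) (D : set V) (H : V -> R) gs : argmax D H = [set gs] ->
  D gs /\ forall g, D g -> H g <= H gs.
Proof. by move=> E; have : argmax D H gs by rewrite E. Qed.

Lemma scale_value m del : 0 < del -> vanishes P (fun n => [set w | del <=
  `|n%:R^-1 * H1 X h n w (ghat m n w) + d%:R / 2 * ln (2 * pi * h n) - H10 C piX (gstar m)|]).
Proof.
have [Hs /(_ m)/sup_limit lim _] := H1_lim; have [Dgs mx] := argmax_set1 (Hs m).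
apply: (estimator_value (k := fun n => n%:R^-1) (c := fun n => d%:R / 2 * ln (2 * pi * h n))
  (H := fun n w => @H1 _ _ _ _ _ X h Sc m n w) _ lim _ Dgs mx) => [n|n w]; first by rewrite invr_ge0.
by have [_ H] := ghat_est m n; exact: H.
Qed.

Lemma drift_value m1 m2 del : 0 < del -> vanishes P (fun n => [set w | del <=
  `|(T n)^-1 * H2 X h ghat m1 n w (ahat m2 m1 n w) + - (2^-1 * \int[piX]_x mxdot (invmx (Smx x (gstar m1))) (otimes2 (A x)))
    - H20 A piX gstar m1 (astar m2 m1)|]).
Proof.
have [Hs /(_ m2)/sup_limit lim _] := H2_lim m1; have [Dgs mx] := argmax_set1 (Hs m2).
apply: (estimator_value (k := fun n => (T n)^-1)
  (c := fun _ => - (2^-1 * \int[piX]_x mxdot (invmx (Smx x (gstar m1))) (otimes2 (A x))))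
  (H := fun n w => @H2 _ _ _ _ _ X h Sc Dr ghat m1 m2 n w) _ lim _ Dgs mx) => [n|n w].
  by rewrite invr_ge0 mulr_ge0// ltW.
by have [_ H] := ahat_est m1 m2 n; exact: H.
Qed.

Lemma scale_misspecified m : m \notin specified Sc C ->
  vanishes P (fun n => [set w | ~ (GQBIC1 X h ghat m1s n w < GQBIC1 X h ghat m n w)]).
Proof.
move=> mM.
have [_ _ E0] := H1_lim; have gap := argmax_gap E0 m1sM mM.
have := gap_selection gap (@scale_value m1s) (@scale_value m)
  (log_penalty ((pdim m1s)%:R - (pdim m)%:R) T_oo).
apply: vanishes_sub; near=> n => w /=; apply: contra_not.
have n0 : 0 < n%:R :> R by rewrite ltr0n; near: n; exact: nbhs_infty_gt.
have hn := h_gt0 n.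
rewrite /GQBIC1 /horizon => H; rewrite -(ltr_pM2l (x := n%:R^-1)) ?invr_gt0// !mulrDr.
have E q : n%:R^-1 * (q / h n * ln (T n)) = q * (ln (T n) / T n) by field; rewrite !gt_eqF.
by rewrite !E; exact: penalized_lt.
Unshelve. all: end_near. Qed.

Lemma drift_misspecified m1 m2 : m2 \notin specified Dr A ->
  vanishes P (fun n => [set w | ~ (GQBIC2 X h ghat ahat m1 m2s n w < GQBIC2 X h ghat ahat m1 m2 n w)]).
Proof.
move=> mM; have [_ _ E] := H2_lim m1.
have gap := argmax_gap E m2sM mM.
have := gap_selection gap (@drift_value m1 m2s) (@drift_value m1 m2)
  (log_penalty ((pdim m2s)%:R - (pdim m2)%:R) T_oo).
apply: vanishes_sub; near=> n => w /=; apply: contra_not.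
have n0 : 0 < n%:R :> R by rewrite ltr0n; near: n; exact: nbhs_infty_gt.
have T0 : 0 < T n by rewrite mulr_gt0.
rewrite /GQBIC2 /horizon => H; rewrite -(ltr_pM2l (x := (T n)^-1)) ?invr_gt0// !mulrDr.
have E' q : (T n)^-1 * (q * ln (T n)) = q * (ln (T n) / T n) by rewrite mulrCA mulrC mulrA mulrC mulrA; ring.
by rewrite !E'; exact: penalized_lt.
Unshelve. all: end_near. Qed.

Lemma pw_le (f g : 'cV[R]_d -> R) : meas f -> (forall x, `|f x| <= `|g x|) -> pw g -> pw f.
Proof. by move=> mf fg [_ [B [N [B0 H]]]]; split => //; exists B, N; split => // x; exact: le_trans (fg x) (H x). Qed.

Lemma pw_det n (M : 'cV[R]_d -> 'M[R]_n) : (forall i j, pw (fun x => M x i j)) -> pw (fun x => \det (M x)).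
Proof.
move=> pM; apply: pw_sum => s; apply: pwM; first exact: pw_cst.
elim: (index_enum _) => [|i l IH]; first by under eq_fun do rewrite big_nil; exact: pw_cst.
by under eq_fun do rewrite big_cons; exact: pwM.
Qed.

Lemma ln_le_inv (y : R) : 0 < y -> `|ln y| <= y + y^-1.
Proof.
move=> y0; have i0 : 0 < y^-1 by rewrite invr_gt0.
have := ln_sublinear y0; have := ln_sublinear i0; rewrite lnV ?posrE// => h1 h2.
by rewrite ler_norml; apply/andP; split; lra.
Qed.

Lemma chi_gau p (chi : R) (v : 'cV[R]_p) : 0 <= chi -> - chi * enorm v ^+ 2 <= - (chi / (p%:R + 1) ^+ 2) * gau v ^+ 2.
Proof.
move=> chi0; rewrite !mulNr lerN2 mulrAC ler_pdivrMr ?exprn_gt0 ?ltr_wpDl// -mulrA ler_wpM2l//.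
rewrite -exprMn lerXn2r ?nnegrE ?gau_ge0 ?mulr_ge0 ?enorm_ge0 ?addr_ge0//.
by apply: le_trans (gau_enorm v) _; rewrite mulrDr mulr1 mulrC lerDl enorm_ge0.
Qed.

(** The identifiability hypothesis bounds a single integral, the gap is a difference of two.
    Splitting needs integrable log-determinants, which follows from |ln y| <= y + 1/y. *)
Lemma H10_gap m : m \in specified Sc C -> exists2 chi : R, 0 < chi & forall g, closure (Theta m) g ->
  H10 C piX g - H10 C piX (g0 m) <= - chi * gau (g - g0 m) ^+ 2.
Proof.
move=> M; have [[Rc [C0 C00 [BC lamc]]] [chi chi0 R4]] := scale_regularity M; have [_ H3 _] := HR.
have [Tg cg] := g0_true M; have cTg := subset_closure Tg.
exists (chi / ((pdim m)%:R + 1) ^+ 2); first by rewrite divr_gt0// exprn_gt0// ltr_wpDl.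
move=> g clg; apply: le_trans (chi_gau _ (ltW chi0)); apply: le_trans (R4 g clg).
have mS g' : closure (Theta m) g' -> mmx (fun x => gram (coef m x g')).
  by move=> c'; have mc := mmx_coef_at Sc_adm c'; exact: (mmxM mc (mmx_trmx mc)).
have pc g' : closure (Theta m) g' -> forall i j, pw (fun x => coef m x g' i j).
  move=> c' i j; split; first exact: (mmx_coef_at Sc_adm c').
  by have [B [N [B0 H]]] := regular_bound (Rc i j); exists B, N; split => // x; exact: H.
have pS g' : closure (Theta m) g' -> forall i j, pw (fun x => gram (coef m x g') i j).
  move=> c' i j; have := pw_sum (index_enum 'I_r) (fun l => pwM (pc g' c' i l) (pc g' c' j l)).
  by congr pw; apply/funext => x; rewrite mxE; apply: eq_bigr => l _; rewrite mxE.
have pI g' : closure (Theta m) g' -> forall i j, pw (fun x => invmx (gram (coef m x g')) i j).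
  move=> c' i j; split; first exact: (mmx_invmx (mS g' c')).
  by have [B [N [B0 H]]] := iS_bound d_gt0 C00 lamc; exists B, N; split => // x; exact: H.
have dpos g' : closure (Theta m) g' -> forall x, 0 < \det (gram (coef m x g')).
  by move=> c' x; exact: (S_det d_gt0 lamc).
have pJ g' : closure (Theta m) g' -> pw (fun x => \tr (invmx (Smx x g') *m gram (C x)) + ln (\det (Smx x g'))).
  move=> c'; apply: pwD.
    have := pw_sum (index_enum 'I_d) (fun i => pw_sum (index_enum 'I_d) (fun j => pwM (pI g' c' i j) (pS (g0 m) cTg j i))).
    by congr pw; apply/funext => x; apply: eq_bigr => i _; rewrite mxE; apply: eq_bigr => j _; rewrite cg.
  apply: (pw_le _ _ (pwD (pw_det (pS g' c')) (pw_det (pI g' c')))).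
    apply: (@measurableT_comp _ _ _ _ _ _ (@ln R)); first exact: measurable_ln.
    by apply: measurable_det; exact: mS.
  move=> x; apply: le_trans (ln_le_inv (dpos g' c' x)) _; rewrite det_inv; exact: ler_norm.
have iJ g' c' := invariant_moments H3 (pJ g' c').
rewrite /H10 -mulrBr -RintegralB//; [|exact: iJ|exact: iJ].
apply: eq_ler; congr (_ * _); apply: eq_Rintegral => x _ /=.
have -> : gram (C x) = Smx x (g0 m) by rewrite /Smx cg.
have dg := dpos _ clg x; have dg0 := dpos _ cTg x.
rewrite (mulVmx (S_unit d_gt0 lamc x cTg)) linearB /= ln_div ?posrE// /Smx; ring.
Qed.

Lemma H20_gap m1 m2 : m1 \in specified Sc C -> m2 \in specified Dr A -> exists2 chi : R, 0 < chi &
  forall al, closure (Theta m2) al -> H20 A piX gstar m1 al - H20 A piX gstar m1 (a0 m2) <= - chi * gau (al - a0 m2) ^+ 2.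
Proof.
move=> M M'; have [_ [chi chi0 R4]] := drift_regularity M M'; have [Ta ca] := a0_true M'.
exists (chi / ((pdim m2)%:R + 1) ^+ 2); first by rewrite divr_gt0// exprn_gt0// ltr_wpDl.
move=> al clal; apply: le_trans (chi_gau _ (ltW chi0)); apply: le_trans (R4 al clal).
have -> : H20 A piX gstar m1 (a0 m2) = 0.
  have E0 : (fun x => mxdot (invmx (Smx x (gstar m1))) (otimes2 (coef m2 x (a0 m2) - A x))) = cst 0.
    apply/funext => x; rewrite ca subrr mxdot_otimes2 big1// => i _; rewrite big1// => j _.
    by rewrite mxE mul0r mulr0.
  by rewrite /H20 E0 Rintegral_cst// mul0r mulr0.
have Aeq : A = fun x => coef m2 x (a0 m2) by apply/funext => x; rewrite ca.
rewrite subr0 /H20 (gstar_true M) Aeq; exact: lexx.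
Qed.

Lemma scale_specified m : m \in specified Sc C -> exists2 e : R, 0 < e &
  [/\ forall v, box e v -> Theta m (g0 m + v), vanishes P (fun n => [set w | ~ box e (ghat m n w - g0 m)]),
      bip P (fun n w => Num.sqrt (T n) * gau (ghat m n w - g0 m)) &
      bip P (fun n w => T n * (n%:R^-1 * (H1 X h n w (ghat m n w) - H1 X h n w (g0 m))))].
Proof.
move=> M; have [[Rc [C0 C00 [BC lamc]]] _] := scale_regularity M.
have [Tg cg] := g0_true M; have cTg := subset_closure Tg.
have [e e0 bTh] := Theta_box Sc_adm Tg; exists e => //.
have [[pC Hstate Hsquare Hquad] _] := discretized.
have pS a b : pw (fun z => gram (C z) a b).
  have := pw_sum (index_enum 'I_r) (fun l => pwM (pC a l) (pC b l)).
  by congr pw; apply/funext => x; rewrite mxE; apply: eq_bigr => l _; rewrite mxE.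
have dpos g' : closure (Theta m) g' -> forall x, 0 < \det (Smx x g') by move=> c' x; exact: (S_det d_gt0 lamc).
have RE n w g : closure (Theta m) g -> n%:R^-1 * (H1 X h n w g - H1 X h n w (g0 m)) =
  scale_ratio h st (fun i n j w => dX X i (j%:R * h n) (j.+1%:R * h n) w) (coef m) (g0 m) n w (g - g0 m).
  by move=> c'; apply: H1_ratio => //; exact: dpos.
have [chi chi0 gap] := H10_gap M.
have [Hs /(_ m)/sup_limit lim _] := H1_lim.
have RB := ratio_bound (H := fun n w => @H1 _ _ _ _ _ X h Sc m n w) (k := fun n => n%:R^-1) cTg lim gap.
set ratio := scale_ratio _ _ _ _ _ in RE.
have F0 n w : 0 <= ratio n w (ghat m n w - g0 m).
  rewrite -RE; last exact: ghat_cl.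
  have [_ He] := ghat_est m n; have [_ mx] := He w.
  by rewrite mulr_ge0 ?invr_ge0// subr_ge0; exact: mx.
have RB' del : 0 < del -> vanishes P (fun n => [set w | exists2 v, closure (Theta m) (g0 m + v) &
     - chi * gau v ^+ 2 + del < ratio n w v]).
  move=> del0; apply: vanishes_sub (RB _ del0); near=> n => w [v cv hv] /=; exists v => //.
  by rewrite RE// [g0 m + v]addrC addrK.
have [B1 B2 B3] := scale_rate d_gt0 h_gt0 T_oo pS Hstate Hsquare Hquad Rc C00 lamc
  (fun g c' => mmx_coef_at Sc_adm c') e0 bTh cg chi0 (@ghat_cl m) F0 RB'.
split => //; apply: bip_le_all B3 => n w; rewrite -/ratio RE//; exact: ghat_cl.
Unshelve. all: end_near. Qed.

Lemma drift_specified m1 m2 : m1 \in specified Sc C -> m2 \in specified Dr A ->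
  bip P (fun n w => T n * ((T n)^-1 * (H2 X h ghat m1 n w (ahat m2 m1 n w) - H2 X h ghat m1 n w (a0 m2)))).
Proof.
move=> M M'; have [[Rc [C0 C00 [BC lamc]]] _] := scale_regularity M; have [Rb _] := drift_regularity M M'.
have [e1 e10 [bTh1 gbox1 grate _]] := scale_specified M.
have [Ta ca] := a0_true M'; have cTa := subset_closure Ta.
have [e2 e20 bTb2] := Theta_box Dr_adm Ta.
have [[pC Hstate _ _] [Hmu Hdelta Hmusum Hfield]] := discretized.
pose ratio := drift_ratio h st (fun a n j w => dZ Z a (j%:R * h n) (j.+1%:R * h n) w)
    (fun i n j w => ddelta X A i (j%:R * h n) (j.+1%:R * h n) w)
    (fun i n j w => dmu Z X A C i (j%:R * h n) (j.+1%:R * h n) w)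
    A C (coef m1) (ghat m1) (coef m2) (a0 m2).
have RE n w al : (T n)^-1 * (H2 X h ghat m1 n w al - H2 X h ghat m1 n w (a0 m2)) = ratio n w (al - a0 m2).
  exact: H2_ratio.
have [chi chi0 gap] := H20_gap M M'.
have [_ /(_ m2)/sup_limit lim _] := H2_lim m1.
have RB := ratio_bound (H := fun n w => @H2 _ _ _ _ _ X h Sc Dr ghat m1 m2 n w) (k := fun n => (T n)^-1)
  (c := fun _ => - (2^-1 * \int[piX]_x mxdot (invmx (Smx x (gstar m1))) (otimes2 (A x)))) cTa lim gap.
have F0 n w : 0 <= ratio n w (ahat m2 m1 n w - a0 m2).
  rewrite -RE; have [_ He] := ahat_est m1 m2 n; have [_ mx] := He w.
  by rewrite mulr_ge0 ?invr_ge0 ?mulr_ge0 ?(ltW (h_gt0 n))// subr_ge0; exact: mx.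
have RB' del : 0 < del -> vanishes P (fun n => [set w | exists2 v, closure (Theta m2) (a0 m2 + v) &
     - chi * gau v ^+ 2 + del < ratio n w v]).
  move=> del0; apply: vanishes_sub (RB _ del0); near=> n => w [v cv hv] /=; exists v => //.
  by move: hv; rewrite RE [a0 m2 + v]addrC addrK.
pose e := Num.min e1 (e2 / 2).
have e0 : 0 < e by rewrite lt_min e10 divr_gt0.
have bsub p (v : 'cV[R]_p) u : box e v -> e <= u -> box u v by move=> bv eu i; exact: le_trans (bv i) eu.
have ee1 : e <= e1 by rewrite ge_min lexx.
have ee2 : e + e <= e2 by have : e <= e2 / 2 by [rewrite ge_min lexx orbT]; lra.
have gbox : vanishes P (fun n => [set w | ~ box e (ghat m1 n w - g0 m1)]).
  have Te : Num.sqrt (T n) * e @[n --> \oo] --> +oo.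
    apply/cvgryPge => B; near=> n; rewrite -ler_pdivrMr//; apply: le_trans (ler_norm _) _.
    rewrite -sqrtr_sqr; apply: ler_wsqrtr; near: n; move/cvgryPge : T_oo; exact.
  apply: vanishes_sub (bip_vanishes grate Te); near=> n => w /= nb.
  rewrite ler_wpM2l ?sqrtr_ge0// leNgt; apply/negP => lt; apply: nb; apply: box_gau; exact: ltW.
have bTh v : box e v -> Theta m1 (g0 m1 + v) by move=> bv; apply: bTh1; exact: bsub ee1.
have bTb u : box (e + e) u -> Theta m2 (a0 m2 + u).
  by move=> bu; apply: bTb2 => i; exact: le_trans (bu i) ee2.
have B := drift_rate d_gt0 h_gt0 T_oo pC Hstate Hmu Hdelta Hmusum Hfield Rc C00 lamc
  (fun g c' => mmx_coef_at Sc_adm c') e0 bTh (@ghat_cl m1) gbox grate Rb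
  (fun g c' => mmx_coef_at Dr_adm c') bTb ca chi0 (@ahat_cl m1 m2) F0 RB'.
by apply: bip_le_all B => n w; rewrite RE.
Unshelve. all: end_near. Qed.

Lemma lnT_oo : ln (T n) @[n --> \oo] --> +oo.
Proof.
apply/cvgryPge => B; near=> n; rewrite -[B]expRK ler_ln ?posrE ?expR_gt0//; last first.
  by near: n; move/cvgryPgt : T_oo; exact.
by near: n; move/cvgryPge : T_oo; exact.
Unshelve. all: end_near. Qed.

(** Both models evaluate to the same quasi-likelihood at their true values, since both coefficients
    are then C. So the larger model gains a bounded amount over the true value, after multiplication
    by h. *)
Lemma scale_nested m : m \in specified Sc C -> (pdim m1s < pdim m)%N ->
  vanishes P (fun n => [set w | ~ (GQBIC1 X h ghat m1s n w < GQBIC1 X h ghat m n w)]).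
Proof.
move=> M pp; have [e e0 [_ _ _ B]] := scale_specified M.
have [_ cg] := g0_true M; have [Ts cgs] := g0_true m1sM.
have B2 := bipD B B.
apply: vanishes_sub (bip_vanishes B2 lnT_oo); near=> n => w /=; apply: contra_notT; rewrite -ltNge => lt.
have hn := h_gt0 n.
have n0 : 0 < n%:R :> R by rewrite ltr0n; near: n; exact: nbhs_infty_gt.
have T1 : 1 <= T n by near: n; move/cvgryPge : T_oo; exact.
have l0 : 0 <= ln (T n) by exact: ln_ge0.
have Eq : H1 X h n w (g0 m1s) = H1 X h n w (g0 m).
  rewrite /H1; congr (_ * _); apply: eq_bigr => j _.
  by rewrite /Smx cg cgs.
have [_ He] := ghat_est m1s n; have [_ mx] := He w; have := mx _ (subset_closure Ts); rewrite Eq => h1.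
have E : T n * (n%:R^-1 * (H1 X h n w (ghat m n w) - H1 X h n w (g0 m))) =
   h n * (H1 X h n w (ghat m n w) - H1 X h n w (g0 m)) by field; rewrite gt_eqF.
rewrite !E in lt; rewrite /GQBIC1 /horizon.
have pd : (pdim m1s)%:R + 1 <= (pdim m)%:R :> R by rewrite natr1 ler_nat.
apply: nested_lt hn l0 pd h1 lt.
Unshelve. all: end_near. Qed.

Lemma drift_nested m1 m2 : m1 \in specified Sc C -> m2 \in specified Dr A -> (pdim m2s < pdim m2)%N ->
  vanishes P (fun n => [set w | ~ (GQBIC2 X h ghat ahat m1 m2s n w < GQBIC2 X h ghat ahat m1 m2 n w)]).
Proof.
move=> M M' pp; have B := drift_specified M M'.
have [_ ca] := a0_true M'; have [Ts cas] := a0_true m2sM.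
have B2 := bipD B B.
apply: vanishes_sub (bip_vanishes B2 lnT_oo); near=> n => w /=; apply: contra_notT; rewrite -ltNge => lt.
have T1 : 1 <= T n by near: n; move/cvgryPge : T_oo; exact.
have T0 : 0 < T n := lt_le_trans ltr01 T1.
have l0 : 0 <= ln (T n) by exact: ln_ge0.
have Eq : H2 X h ghat m1 n w (a0 m2s) = H2 X h ghat m1 n w (a0 m2).
  by rewrite /H2; apply: eq_bigr => j _; rewrite ca cas.
have [_ He] := ahat_est m1 m2s n; have [_ mx] := He w; have := mx _ (subset_closure Ts); rewrite Eq => h1.
rewrite !mulrA divff ?gt_eqF// !mul1r in lt; rewrite /GQBIC2 /horizon.
have pd : (pdim m2s)%:R + 1 <= (pdim m2)%:R :> R by rewrite natr1 ler_nat.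
have := nested_lt (k := 1) (b := H2 X h ghat m1 n w (ahat m2 m1 n w)) ltr01 l0 pd h1.
by rewrite !divr1 !mul1r; exact.
Unshelve. all: end_near. Qed.

Lemma obs_measurable n j : meas (obs X h n j).
Proof.
have [F [Ffilt _ XF _ _]] := X_sde.
have t0 : 0 <= j%:R * h n by rewrite mulr_ge0// ltW.
apply: measurable_mx => i k.
by apply: (X_measurable Ffilt XF t0 (f := fun y => y i k)); exact: measurable_entry.
Qed.

Lemma Smx_hat_mmx m n j : mmx (fun w => Smx (obs X h n j w) (ghat m n w)).
Proof.
have [_ _ _ _ mF] := Sc_adm m; have [mg _] := ghat_est m n.
have H := mmx_coef mF (obs_measurable n j) mg (@ghat_cl m n).
exact: (mmxM H (mmx_trmx H)).
Qed.

Lemma obs_entry n j i : meas (fun w => obs X h n j w i 0).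
Proof. exact: (measurableT_comp (@measurable_entry R d 1 setT i 0) (obs_measurable n j)). Qed.

Lemma dobs_entry n j i : meas (fun w => dobs X h n j w i 0).
Proof.
under eq_fun do rewrite /dobs entryB.
by apply: measurable_funB; exact: obs_entry.
Qed.

Lemma GQBIC1_measurable m n : meas (GQBIC1 X h ghat m n).
Proof.
apply: measurable_funD => //; apply: measurable_funM => //; apply: measurable_funM => //.
apply: measurable_sum => j; have mS := Smx_hat_mmx m n j.-1; apply: measurable_funD.
  apply: (@measurableT_comp _ _ _ _ _ _ (@ln R)); first exact: measurable_ln.
  by under eq_fun do rewrite detZ; apply: measurable_funM => //; exact: measurable_det.
apply: measurable_funM => //; under eq_fun do rewrite mxdot_otimes2.
apply: measurable_sum => a; apply: measurable_sum => b; apply: measurable_funM; first exact: mmx_invmx.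
by apply: measurable_funM; exact: dobs_entry.
Qed.

Lemma GQBIC2_measurable m1 m2 n : meas (GQBIC2 X h ghat ahat m1 m2 n).
Proof.
apply: measurable_funD => //; apply: measurable_funM => //.
apply: measurable_sum => j; have mS := mmx_invmx (Smx_hat_mmx m1 n j.-1).
have [_ _ _ _ mF] := Dr_adm m2; have [mg _] := ahat_est m1 m2 n.
have H := mmx_coef mF (obs_measurable n j.-1) mg (@ahat_cl m1 m2 n).
apply: measurable_funB.
  under eq_fun do rewrite bilinE; apply: measurable_sum => a; apply: measurable_sum => b.
  by apply: measurable_funM; [exact: mS|apply: measurable_funM; [exact: dobs_entry|exact: H]].
apply: measurable_funM => //; under eq_fun do rewrite mxdot_otimes2.
apply: measurable_sum => a; apply: measurable_sum => b.
by apply: measurable_funM; [exact: mS|apply: measurable_funM; exact: H].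
Qed.

Lemma measurable_lt (f g : Omega -> R) : meas f -> meas g ->
  measurable [set w | f w < g w].
Proof.
move=> mf mg; have := measurable_fun_ltr mf mg measurableT (I : measurable [set true]).
by rewrite setTI; congr measurable; apply/seteqP; split => w.
Qed.

Section selected_scale.
Variable m1hat : nat -> Omega -> 'I_(ncand Sc).
Hypotheses (m1hat_meas : forall n m1, measurable [set w | m1hat n w = m1])
  (m1hat_min : forall n w, argmin setT (fun m1 => GQBIC1 X h ghat m1 n w) (m1hat n w)).

Lemma selected_measurable m2 n :
  measurable [set w | GQBIC2 X h ghat ahat (m1hat n w) m2s n w < GQBIC2 X h ghat ahat (m1hat n w) m2 n w].
Proof.
rewrite (_ : [set w | _] = \bigcup_(m1 in [set: 'I_(ncand Sc)]) ([set w | m1hat n w = m1] `&`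
    [set w | GQBIC2 X h ghat ahat m1 m2s n w < GQBIC2 X h ghat ahat m1 m2 n w])).
  apply: fin_bigcup_measurable => // m1 _; apply: measurableI => //.
  by apply: measurable_lt; exact: GQBIC2_measurable.
apply/seteqP; split => w /=; first by move=> H; exists (m1hat n w).
by move=> [m1 _ [/= <-]].
Qed.

(** The selected scale is random, but it is one of finitely many and is correctly specified with
    probability tending to one; on this event one of the finitely many comparisons applies. *)
Lemma selected_drift m2 : (forall m1, m1 \in specified Sc C ->
    vanishes P (fun n => [set w | ~ (GQBIC2 X h ghat ahat m1 m2s n w < GQBIC2 X h ghat ahat m1 m2 n w)])) ->
  P [set w | GQBIC2 X h ghat ahat (m1hat n w) m2s n w < GQBIC2 X h ghat ahat (m1hat n w) m2 n w]
    @[n --> \oo] --> 1%E.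
Proof.
move=> H; apply: vanishes_cvg1; first by move=> n; exact: selected_measurable.
pose B1 m1 n := [set w | m1 \in specified Sc C /\
  ~ (GQBIC2 X h ghat ahat m1 m2s n w < GQBIC2 X h ghat ahat m1 m2 n w)].
pose B2 m1 n := [set w | m1 \notin specified Sc C /\ ~ (GQBIC1 X h ghat m1s n w < GQBIC1 X h ghat m1 n w)].
have V1 m1 : vanishes P (B1 m1).
  have [M|M] := boolP (m1 \in specified Sc C); last by apply: vanishes0; near=> n; rewrite -subset0 => w [/idP]; rewrite (negbTE M).
  by apply: vanishes_sub (H m1 M); near=> n => w [].
have V2 m1 : vanishes P (B2 m1).
  have [M|M] := boolP (m1 \in specified Sc C); first by apply: vanishes0; near=> n; rewrite -subset0 => w []; rewrite M.
  by apply: vanishes_sub (scale_misspecified M); near=> n => w [].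
apply: vanishes_sub (vanishesU (vanishes_bigU V1) (vanishes_bigU V2)); near=> n => w /= bad.
have [M|M] := boolP (m1hat n w \in specified Sc C); [left|right]; exists (m1hat n w); split => //.
have [_ mn] := m1hat_min n w; apply/negP; rewrite -leNgt; exact: mn.
Unshelve. all: end_near. Qed.

End selected_scale.
End selection.

Theorem theorem5p3
  (R : realType) (d0 : measure_display) (Omega : measurableType d0)
  (P : probability Omega R) (d r : nat) (d_gt0 : (0 < d)%N) (r_gt0 : (0 < r)%N)
  (Z : R -> Omega -> 'cV[R]_r) (nu : {measure set 'cV[R]_r -> \bar R})
  (X : R -> Omega -> 'cV[R]_d)
  (A : 'cV[R]_d -> 'cV[R]_d) (C : 'cV[R]_d -> 'M[R]_(d, r))
  (Z_levy : levy_process P Z) (Z_nu : levy_measure P Z nu)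
  (Z_X0 : process_independent_of P Z (X 0))
  (X_sde : sde_solution P Z A C X)
  (h : nat -> R) (h_gt0 : forall n, 0 < h n)
  (Tn_oo : horizon h n @[n --> \oo] --> +oo)
  (nh2_0 : n%:R * h n ^+ 2 @[n --> \oo] --> 0)
  (Sc : candidates R d d r) (Dr : candidates R d d 1)
  (Sc_adm : admissible Sc) (Dr_adm : admissible Dr)
  (M1_bounds : (0 < #|specified Sc C| < ncand Sc)%N)
  (M2_bounds : (0 < #|specified Dr A| < ncand Dr)%N)
  (g0 : forall m1 : 'I_(ncand Sc), 'cV[R]_(pdim m1))
  (a0 : forall m2 : 'I_(ncand Dr), 'cV[R]_(pdim m2))
  (g0_true : forall m1, m1 \in specified Sc C -> true_value C m1 (g0 m1))
  (a0_true : forall m2, m2 \in specified Dr A -> true_value A m2 (a0 m2))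
  (ghat : forall m1 : 'I_(ncand Sc), nat -> Omega -> 'cV[R]_(pdim m1))
  (ahat : forall (m2 : 'I_(ncand Dr)) (m1 : 'I_(ncand Sc)),
     nat -> Omega -> 'cV[R]_(pdim m2))
  (ghat_est : scale_estimator X h ghat)
  (ahat_est : drift_estimator X h ghat ahat)
  (piX : probability 'cV[R]_d R)
  (HR : cond_R P X h ghat ahat Z nu A C piX g0 a0)
  (gstar : forall m1 : 'I_(ncand Sc), 'cV[R]_(pdim m1))
  (astar : forall (m2 : 'I_(ncand Dr)) (m1 : 'I_(ncand Sc)), 'cV[R]_(pdim m2))
  (H1_lim : scale_limits P X h C piX gstar)
  (H2_lim : drift_limits P X h ghat A piX gstar astar)
  (gstar_true : forall m1, m1 \in specified Sc C -> gstar m1 = g0 m1)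
  (astar_true : forall m2 m1, m2 \in specified Dr A -> astar m2 m1 = a0 m2)
  (m1s : 'I_(ncand Sc)) (m1s_opt : specified_min Sc C m1s)
  (m2s : 'I_(ncand Dr)) (m2s_opt : specified_min Dr A m2s)
  (m1hat : nat -> Omega -> 'I_(ncand Sc))
  (m1hat_meas : forall n m1, measurable [set w | m1hat n w = m1])
  (m1hat_min : forall n w,
     argmin setT (fun m1 => GQBIC1 X h ghat m1 n w) (m1hat n w)) :
  [/\ forall m1 : 'I_(ncand Sc), m1 \in specified Sc C -> m1 <> m1s ->
        nested_scale P X h m1s m1 ->
        P [set w | GQBIC1 X h ghat m1s n w < GQBIC1 X h ghat m1 n w]
          @[n --> \oo] --> 1%E,
      forall m1 : 'I_(ncand Sc), m1 \notin specified Sc C ->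
        P [set w | GQBIC1 X h ghat m1s n w < GQBIC1 X h ghat m1 n w]
          @[n --> \oo] --> 1%E,
      forall m2 : 'I_(ncand Dr), m2 \in specified Dr A -> m2 <> m2s ->
        (forall m1 : 'I_(ncand Sc), nested_drift P X h ghat m1 m2s m2) ->
        P [set w | GQBIC2 X h ghat ahat (m1hat n w) m2s n w <
                   GQBIC2 X h ghat ahat (m1hat n w) m2 n w]
          @[n --> \oo] --> 1%E &
      forall m2 : 'I_(ncand Dr), m2 \notin specified Dr A ->
        P [set w | GQBIC2 X h ghat ahat (m1hat n w) m2s n w <
                   GQBIC2 X h ghat ahat (m1hat n w) m2 n w]
          @[n --> \oo] --> 1%E].
Proof.
have m1sM : m1s \in specified Sc C by have [] := m1s_opt.
have m2sM : m2s \in specified Dr A by have [] := m2s_opt.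
split.
- move=> m1 M _ [pp _]; apply: vanishes_cvg1.
    by move=> n; apply: measurable_lt; exact: (GQBIC1_measurable X_sde h_gt0 Sc_adm ghat_est).
  exact: (scale_nested d_gt0 Z_levy X_sde h_gt0 Tn_oo nh2_0 Sc_adm Dr_adm g0_true a0_true ghat_est HR H1_lim m1sM m2sM M pp).
- move=> m1 M; apply: vanishes_cvg1.
    by move=> n; apply: measurable_lt; exact: (GQBIC1_measurable X_sde h_gt0 Sc_adm ghat_est).
  exact: (scale_misspecified h_gt0 Tn_oo ghat_est H1_lim m1sM M).
- move=> m2 M _ nest; apply: (selected_drift X_sde h_gt0 Tn_oo Sc_adm Dr_adm ghat_est ahat_est H1_lim m1sM m1hat_meas m1hat_min) => m1 M1.
  have [pp _] := nest m1.
  exact: (drift_nested d_gt0 Z_levy X_sde h_gt0 Tn_oo nh2_0 Sc_adm Dr_adm g0_true a0_true ghat_est ahat_est HR H1_lim H2_lim gstar_true m1sM m2sM M1 M pp).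
- move=> m2 M; apply: (selected_drift X_sde h_gt0 Tn_oo Sc_adm Dr_adm ghat_est ahat_est H1_lim m1sM m1hat_meas m1hat_min) => m1 M1.
  by apply: (drift_misspecified h_gt0 Tn_oo ahat_est H2_lim m2sM).
Qed.
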